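(* Let $s,p,q$ satisfy one of the following: (i) $s\ge 0$, $2\le p\le 3$ and $1\le q\le\frac32$; (ii) $s>\frac23-\frac1q$, $2\le p\le3$ and $\frac32<q\le\frac{18}{11}$; (iii) $s>\frac23-\frac1q$, $2\le p<\frac{10q'}{q'+6}$ and $\frac{18}{11}<q\le 2$. Let $u_0\in M^s_{p,q}(\mathbb R)$ and let $u\in C([0,T],M^s_{p,q}(\mathbb R))$ be the constructed solution (described in the context) of $$ i u_t-u_{xx}\pm|u|^2u=0,\qquad u(0,x)=u_0(x). $$ Then $u$ is unique in $C([0,T],M^s_{p,q}(\mathbb R))$: every solution in $C([0,T],M^s_{p,q}(\mathbb R))$ of this Cauchy problem with initial condition $u_0$ coincides with $u$.
   Context: Here $q'$ is the conjugate exponent of $q$, $\frac1q+\frac1{q'}=1$. The sign $\pm$ is fixed and either choice is allowed; $x\in\mathbb R$. Modulation spaces. Let $\{\sigma_k=\sigma_0(\cdot-k)\}_{k\in\mathbb Z}\subset C^\infty(\mathbb R)$ be a partition of unity with $|\sigma_0|\ge c>0$ on $[-\frac12,\frac12)$ and $\mathrm{supp}\,\sigma_0\subseteq\{|\xi|<1\}$. Put $\Box_k=\mathcal F^{-1}\sigma_k\mathcal F$. $M^s_{p,q}(\mathbb R)$ is the space of tempered distributions $f$ with $\|f\|_{M^s_{p,q}}=\big(\sum_{k\in\mathbb Z}\langle k\rangle^{sq}\|\Box_kf\|_{L^p}^q\big)^{1/q}<\infty$, $\langle k\rangle=(1+|k|^2)^{1/2}$. Notion of solution. Under each of (i)–(iii)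 one has the continuous embedding $M^s_{p,q}(\mathbb R)\hookrightarrow L^3(\mathbb R)$, so for $u\in C([0,T],M^s_{p,q}(\mathbb R))$ the nonlinearity $|u|^2u$ is an element of $C([0,T],L^1(\mathbb R))$, and the equation is understood in the sense of distributions on $(0,T)\times\mathbb R$, together with $u(0)=u_0$. The constructed solution. For $s\ge0$, $1\le q\le2$, $2\le p<\frac{10q'}{q'+6}$ there is a time $T>0$ depending only on $\|u_0\|_{M^s_{p,q}}$ and a solution $u\in C([0,T],M^s_{p,q}(\mathbb R))$ obtained as follows: choose $u_0^{(m)}$ with compactly supported Fourier transforms, lying in $M^{\tilde s}_{p,q}(\mathbb R)$ for some large $\tilde s>\frac1{q'}$ (so that $M^{\tilde s}_{p,q}(\mathbb R)$ is a Banach algebra), with $u_0^{(m)}\to u_0$ in $M^s_{p,q}(\mathbb R)$; let $u^{(m)}$ be the corresponding smooth solutions of the equation; then for such $T$ the sequence $u^{(m)}$ converges in $C([0,T],M^s_{p,q}(\mathbb R))$, and $u$ is its limit. *)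

(* Defs.v *)
From HB Require Import structures.
From mathcomp Require Export all_boot all_order all_algebra.
From mathcomp Require Export complex.
From mathcomp Require Export all_classical all_reals all_analysis.

Set Implicit Arguments.
Unset Strict Implicit.
Unset Printing Implicit Defensive.

Export Order.TTheory GRing.Theory Num.Theory.
Export numFieldNormedType.Exports.

Local Open Scope classical_set_scope.
Local Open Scope complex_scope.
Local Open Scope ring_scope.

Definition cabs (R : realType) (z : R[i]) : R := Normc.normc z.

Definition expi (R : realType) (t : R) : R[i] := cos t +i* sin t.

Definition cmeasurable (R : realType) (g : R -> R[i]) : Prop :=
  measurable_fun setT (fun x => complex.Re (g x)) /\
  measurable_fun setT (fun x => complex.Im (g x)).

Definition cintegral (R : realType) (D : set R) (g : R -> R[i]) : R[i] :=
  (\int[lebesgue_measure]_(x in D) complex.Re (g x)) +i*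
  (\int[lebesgue_measure]_(x in D) complex.Im (g x)).

Definition cLnorm (R : realType) (p : R) (g : R -> R[i]) : \bar R :=
  Lnorm lebesgue_measure p%:E (fun x : R => (cabs (g x))%:E).

Definition cderive (R : realType) (V : normedModType R) (v : V)
    (g : V -> R[i]) : V -> R[i] :=
  fun x => ('D_v (fun y => complex.Re (g y)) x) +i*
           ('D_v (fun y => complex.Im (g y)) x).

(* All iterated directional derivatives exist and are continuous at every point
   of A; for A open in a finite-dimensional V this is C^oo on A. *)
Definition smooth_on (R : realType) (V : normedModType R) (A : set V)
    (g : V -> R[i]) : Prop :=
  forall (vs : seq V) (x : V), A x ->
    let h := foldr (@cderive R V) g vs in
    [/\ {for x, continuous (fun y => complex.Re (h y))},
        {for x, continuous (fun y => complex.Im (h y))},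
        (forall v : V, derivable (fun y => complex.Re (h y)) x v) &
        (forall v : V, derivable (fun y => complex.Im (h y)) x v)].

Definition csupp (R : realType) (V : normedModType R) (g : V -> R[i]) : set V :=
  closure [set x | g x != 0].

Definition seminorm (R : realType) (m n : nat) (phi : R -> R[i]) : \bar R :=
  ereal_sup
    [set (`|x| ^+ m * cabs (iter n (cderive (1 : R)) phi x))%:E | x in setT].

Definition schwartz (R : realType) (phi : R -> R[i]) : Prop :=
  smooth_on setT phi /\ forall m n : nat, (seminorm m n phi < +oo)%E.

(* A tempered distribution is represented by a functional on all functions of
   which only the values on Schwartz functions matter; accordingly equality of
   distributions is [dist_eq], not Leibniz equality. *)
Definition dist (R : realType) : Type := (R -> R[i]) -> R[i].

Definition dist_eq (R : realType) (f g : dist R) : Prop :=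
  forall phi, schwartz phi -> f phi = g phi.

(* Sequential continuity suffices, the Schwartz space being metrizable. *)
Definition tempered (R : realType) (f : dist R) : Prop :=
  (forall (a : R[i]) (phi psi : R -> R[i]), schwartz phi -> schwartz psi ->
     f (fun x => a * phi x + psi x) = a * f phi + f psi) /\
  (forall phi_ : nat -> R -> R[i], (forall j, schwartz (phi_ j)) ->
     (forall m n, seminorm m n (phi_ j) @[j --> \oo] --> 0%E) ->
     cabs (f (phi_ j)) @[j --> \oo] --> (0 : R)).

Definition dist_of (R : realType) (g : R -> R[i]) : dist R :=
  fun phi => cintegral setT (fun x => g x * phi x).

Definition represents (R : realType) (f : dist R) (g : R -> R[i]) : Prop :=
  cmeasurable g /\ dist_eq f (dist_of g).

(* +oo when f is not an L^p function, the infimum being then over an empty set or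
   over functions of infinite norm. *)
Definition dist_Lnorm (R : realType) (p : R) (f : dist R) : \bar R :=
  ereal_inf [set cLnorm p g | g in [set g | represents f g]].

Definition fourier (R : realType) (phi : R -> R[i]) : R -> R[i] :=
  fun xi => ((Num.sqrt (2 * pi))^-1)%:C *
            cintegral setT (fun x => expi (- (x * xi)) * phi x).

Definition ifourier (R : realType) (phi : R -> R[i]) : R -> R[i] :=
  fun x => ((Num.sqrt (2 * pi))^-1)%:C *
           cintegral setT (fun xi => expi (x * xi) * phi xi).

Definition dist_fourier (R : realType) (f : dist R) : dist R :=
  fun phi => f (fourier phi).

Definition dist_ifourier (R : realType) (f : dist R) : dist R :=
  fun phi => f (ifourier phi).

Definition dist_mul (R : realType) (a : R -> R[i]) (f : dist R) : dist R :=
  fun phi => f (fun x => a x * phi x).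

Definition dist_supp_in (R : realType) (K : set R) (f : dist R) : Prop :=
  forall phi, schwartz phi -> csupp phi `&` K = set0 -> f phi = 0.

Definition compact_spectrum (R : realType) (f : dist R) : Prop :=
  exists2 K : set R, compact K & dist_supp_in K (dist_fourier f).

Definition shift (R : realType) (sigma0 : R -> R[i]) (k : int) : R -> R[i] :=
  fun xi => sigma0 (xi - k%:~R).

(* By the support condition the sum over k is finite at every point. *)
Definition admissible_partition (R : realType) (sigma0 : R -> R[i]) : Prop :=
  [/\ smooth_on setT sigma0,
      (forall xi : R, \sum_(k \in [set: int]) shift sigma0 k xi = 1),
      (exists2 c : R, 0 < c &
         forall xi : R, - 2^-1 <= xi < 2^-1 -> c <= cabs (sigma0 xi)) &
      csupp sigma0 `<=` [set xi : R | `|xi| < 1]].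

Definition box (R : realType) (sigma0 : R -> R[i]) (k : int) (f : dist R) :
    dist R :=
  dist_ifourier (dist_mul (shift sigma0 k) (dist_fourier f)).

Definition bracket (R : realType) (k : int) : R :=
  Num.sqrt (1 + (k%:~R) ^+ 2).

Definition modnorm (R : realType) (sigma0 : R -> R[i]) (s p q : R)
    (f : dist R) : \bar R :=
  ((\esum_(k in [set: int])
     ((bracket R k `^ (s * q))%R%:E * (dist_Lnorm p (box sigma0 k f) `^ q)))
   `^ q^-1)%E.

Definition modulation (R : realType) (sigma0 : R -> R[i]) (s p q : R) :
    set (dist R) :=
  [set f | tempered f /\ (modnorm sigma0 s p q f < +oo)%E].

(* C([0,T], M^s_{p,q}); values outside [0,T] are irrelevant. *)
Definition Cmod (R : realType) (sigma0 : R -> R[i]) (s p q T : R) :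
    set (R -> dist R) :=
  [set u | forall t, t \in `[0, T] ->
     modulation sigma0 s p q (u t) /\
     modnorm sigma0 s p q (u t' \- u t) @[t' --> within `[0, T] (nbhs t)]
       --> 0%E].

Definition Cmod_cvg (R : realType) (sigma0 : R -> R[i]) (s p q T : R)
    (u_ : nat -> R -> dist R) (u : R -> dist R) : Prop :=
  ereal_sup [set modnorm sigma0 s p q (u_ m t \- u t) | t in `[0, T]]
    @[m --> \oo] --> 0%E.

Definition L3_density (R : realType) (f : dist R) : R -> R[i] :=
  xget (fun=> 0) [set g | represents f g /\ (cLnorm 3 g < +oo)%E].

(* |f|^2 f as a distribution, for f in L^3; independent of the choice of the
   representative in [L3_density]. *)
Definition cubic (R : realType) (f : dist R) : dist R :=
  let g := L3_density f in dist_of (fun x => (cabs (g x) ^+ 2)%:C * g x).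

Definition test_function (R : realType) (T : R) (psi : R * R -> R[i]) : Prop :=
  [/\ smooth_on setT psi, compact (csupp psi) &
      csupp psi `<=` [set z : R * R | 0 < z.1 < T]].

(* A time-dependent distribution, as a distribution on (0,T) x R. *)
Definition pairing (R : realType) (T : R) (f : R -> dist R)
    (psi : R * R -> R[i]) : R[i] :=
  cintegral `]0, T[ (fun t => f t (fun x => psi (t, x))).

Definition dt (R : realType) (psi : R * R -> R[i]) : R * R -> R[i] :=
  cderive ((1, 0) : R * R) psi.

Definition dx (R : realType) (psi : R * R -> R[i]) : R * R -> R[i] :=
  cderive ((0, 1) : R * R) psi.

(* u solves i u_t - u_xx + (-1)^b |u|^2 u = 0 in the sense of distributions on
   (0,T) x R, with u(0) = u0. *)
Definition nls_solution (R : realType) (b : bool) (T : R) (u0 : dist R)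
    (u : R -> dist R) : Prop :=
  dist_eq (u 0) u0 /\
  forall psi : R * R -> R[i], test_function T psi ->
    - ((0 +i* 1) * pairing T u (dt psi)) - pairing T u (dx (dx psi))
      + (-1) ^+ b * pairing T (fun t => cubic (u t)) psi = 0.

Definition smooth_in_spacetime (R : realType) (T : R) (u : R -> dist R) : Prop :=
  exists2 w : R * R -> R[i], smooth_on [set z : R * R | 0 < z.1 < T] w &
    forall t, 0 < t < T -> represents (u t) (fun x => w (t, x)).

(* [hoelder_conjugate q%:E] is +oo for q = 1; then [conj_exp q] is 0, and so
   [(conj_exp q)^-1] is 1/q' for every q >= 1. *)
Definition conj_exp (R : realType) (q : R) : R := fine (hoelder_conjugate q%:E).

Definition constructed_solution (R : realType) (sigma0 : R -> R[i]) (b : bool)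
    (s p q T : R) (u0 : dist R) (u : R -> dist R) : Prop :=
  [/\ Cmod sigma0 s p q T u,
      nls_solution b T u0 u &
      exists (s' : R) (u0_ : nat -> dist R) (u_ : nat -> R -> dist R),
        [/\ (conj_exp q)^-1 < s',
            (forall m, compact_spectrum (u0_ m) /\
                       modulation sigma0 s' p q (u0_ m)),
            modnorm sigma0 s p q (u0_ m \- u0) @[m --> \oo] --> 0%E,
            (forall m, [/\ Cmod sigma0 s' p q T (u_ m),
                           nls_solution b T (u0_ m) (u_ m) &
                           smooth_in_spacetime T (u_ m)]) &
            Cmod_cvg sigma0 s p q T u_ u]].

(* Main.v *)
(* In each of the three cases p <= 3 and the weighted l^q condition on the pieces box_k f implies
   that their L^p norms are summable to the power 3/2.  Bernstein's inequality replaces p by 3, and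
   the Hausdorff-Young inequality on the circle with exponents 3/2 and 3 then embeds M^s_{p,q} in
   L^3.  It suffices to show that C([0,T], L^3) contains at most one solution.

   Let g be the difference of two solutions and F the difference of their cubic terms, so that
   |F|_1 <= C |g|_3, and suppose that g vanishes at time a and |F|_1 <= A on [a, a + h].  Let w be
   the mollification of g by a heat kernel.  Pairing g with Gaussians transported by the free
   Schroedinger flow gives the dispersive bound |w| <= A sqrt h, independently of the mollification.
   The energy identity then gives |w|_2^2 <= 2 (A sqrt h) A h, hence |w|_3^3 <= 2 A^3 h^2, and so
   |g|_3^3 <= 16 A^3 h^2.  For a fixed small h this improves every bound |g|_3 <= y on the interval
   to |g|_3 <= y / 2, so g = 0 there, and one steps through [0, T]. *)

From HB Require Import structures.
Require Import Defs.
From mathcomp Require Import ring lra zify.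
From mathcomp Require Import measurable_realfun lebesgue_integral_under.

Set Implicit Arguments.
Unset Strict Implicit.
Unset Printing Implicit Defensive.

Local Open Scope classical_set_scope.
Local Open Scope ring_scope.

(** The circle enters a problem on the line because each frequency block is a convolution with exp(i
    k z) times one fixed Schwartz function: once the convolution variable x is frozen, the sum over
    k is a trigonometric polynomial in z = y - x, and the weight [kap] carries the estimate from one
    period to the whole line. The uniqueness argument has little regularity to work with: a
    difference of solutions is only a continuous path in L^3, not known to lie in L^2, and the
    equation reaches it only through pairings with test functions. Testing with tensor products
    shows that these pairings are differentiable in time, which suffices for the Gaussian pairing
    and, after convolution with a fixed kernel, for a localised energy. The final bounds are uniform
    in the mollification parameter, and returning to the function itself costs a factor 8. The time
    step depends only on a bound of both solutions in L^3 over [0, T], so finitely many steps reach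
    T. Integral inequalities appear in crude forms, obtained by splitting a value at a threshold:
    the exponents matter, the constants do not. *)

Notation mR R := (measurableTypeR R).
Notation lmeas f := (@measurable_fun _ _ (measurableTypeR _) _ setT f).
Notation CRe := complex.Re.
Notation CIm := complex.Im.

(** * Complex-valued integrals *)

Section Complex.
Variable R : realType.
Implicit Types (x y z : R[i]) (a b t : R).

Lemma cplxP x y : CRe x = CRe y -> CIm x = CIm y -> x = y.
Proof. by case: x y => [a b] [c d] /= -> ->. Qed.

Lemma CReD x y : CRe (x + y) = CRe x + CRe y. Proof. by case: x y => [? ?] []. Qed.
Lemma CImD x y : CIm (x + y) = CIm x + CIm y. Proof. by case: x y => [? ?] []. Qed.
Lemma CReN x : CRe (- x) = - CRe x. Proof. by case: x. Qed.
Lemma CImN x : CIm (- x) = - CIm x. Proof. by case: x. Qed.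
Lemma CReM x y : CRe (x * y) = CRe x * CRe y - CIm x * CIm y.
Proof. by case: x y => [? ?] []. Qed.
Lemma CImM x y : CIm (x * y) = CRe x * CIm y + CIm x * CRe y.
Proof. by case: x y => [? ?] []. Qed.
Definition CE := (CReD, CImD, CReN, CImN, CReM, CImM).

Lemma cabsE z : cabs z = Num.sqrt (CRe z ^+ 2 + CIm z ^+ 2).
Proof. by case: z. Qed.
Lemma sqr_cabs z : cabs z ^+ 2 = CRe z ^+ 2 + CIm z ^+ 2.
Proof. by rewrite cabsE sqr_sqrtr// addr_ge0// sqr_ge0. Qed.
Lemma cabs_ge0 z : 0 <= cabs z. Proof. by rewrite cabsE sqrtr_ge0. Qed.
Lemma cabsM x y : cabs (x * y) = cabs x * cabs y. Proof. exact: Normc.normcM. Qed.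
Lemma cabsD x y : cabs (x + y) <= cabs x + cabs y. Proof. exact: le_normcD. Qed.
Lemma cabsN x : cabs (- x) = cabs x. Proof. exact: normcN. Qed.
Lemma cabs0 : cabs (0 : R[i]) = 0. Proof. exact: Normc.normc0. Qed.
Lemma cabs1 : cabs (1 : R[i]) = 1. Proof. exact: Normc.normc1. Qed.
Lemma cabs_eq0 x : cabs x = 0 -> x = 0. Proof. exact: Normc.eq0_normc. Qed.
Lemma cabsBC x y : cabs (x - y) = cabs (y - x).
Proof. by rewrite -cabsN opprB. Qed.
Lemma cabsB x y : cabs (x - y) <= cabs x + cabs y.
Proof. by rewrite -(cabsN y) cabsD. Qed.
Lemma cabs_dist (x y : R[i]) : `|cabs x - cabs y| <= cabs (x - y).
Proof.
rewrite ler_norml; have h1 := cabsD (x - y) y; have h2 := cabsD (y - x) x.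
by move: h1 h2; rewrite !subrK (cabsBC y); lra.
Qed.
Lemma cabs_real a : cabs (a%:C)%C = `|a|.
Proof. by rewrite cabsE/= expr0n addr0 sqrtr_sqr. Qed.
Lemma CRe_le_cabs z : `|CRe z| <= cabs z.
Proof. by rewrite -sqrtr_sqr cabsE ler_sqrt ?addr_ge0 ?sqr_ge0// lerDl sqr_ge0. Qed.
Lemma CIm_le_cabs z : `|CIm z| <= cabs z.
Proof. by rewrite -sqrtr_sqr cabsE ler_sqrt ?addr_ge0 ?sqr_ge0// lerDr sqr_ge0. Qed.
Lemma cabs_le z : cabs z <= `|CRe z| + `|CIm z|.
Proof.
have -> : z = ((CRe z)%:C + (0 +i* CIm z))%C by apply: cplxP; rewrite /= ?addr0 ?add0r.
rewrite (le_trans (cabsD _ _))// lerD ?cabs_real//= ?addr0//.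
by rewrite expr0n !add0r sqrtr_sqr.
Qed.
Lemma cabs_i : cabs (0 +i* 1 : R[i])%C = 1.
Proof. by rewrite cabsE/= expr0n expr1n add0r sqrtr1. Qed.
Lemma cabs_expi t : cabs (expi t) = 1.
Proof. by rewrite cabsE/= cos2Dsin2 sqrtr1. Qed.
Lemma expiD s t : expi (s + t) = expi s * expi t :> R[i].
Proof. by apply: cplxP; rewrite !CE/= ?cosD ?sinD //; ring. Qed.
Lemma expi0 : expi 0 = 1 :> R[i].
Proof. by apply: cplxP; rewrite /= ?cos0 ?sin0. Qed.
Lemma cabsX z n : cabs (z ^+ n) = cabs z ^+ n.
Proof. by elim: n => [|n IH]; rewrite ?expr0 ?cabs1// !exprS cabsM IH. Qed.
Lemma cabs_sum I (r : seq I) P (F : I -> R[i]) :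
  cabs (\sum_(i <- r | P i) F i) <= \sum_(i <- r | P i) cabs (F i).
Proof.
elim/big_ind2 : _ => [|? ? ? ? h1 h2|//]; first by rewrite cabs0.
by rewrite (le_trans (cabsD _ _))// lerD.
Qed.

(** A unimodular factor that rotates z onto its modulus; the value 1 at z = 0 keeps [cabs_phase]
    unconditional. *)
Definition phase z : R[i] := if z == 0 then 1 else (CRe z / cabs z +i* - (CIm z / cabs z))%C.
Lemma phaseP z : phase z * z = ((cabs z)%:C)%C.
Proof.
rewrite /phase; case: eqP => [->|z0]; first by rewrite mulr0 cabs0.
have c0 : cabs z != 0 by apply/eqP => /cabs_eq0.
apply: cplxP; rewrite !CE/=; last by field.
by apply: (mulIf c0); rewrite -expr2 sqr_cabs; field.
Qed.
Lemma cabs_phase z : cabs (phase z) = 1.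
Proof.
rewrite /phase; case: eqP => [_|z0]; first by rewrite cabs1.
have c0 : cabs z != 0 by apply/eqP => /cabs_eq0.
have := phaseP z; rewrite /phase; case: eqP => // _ /(congr1 (@cabs R)).
by rewrite cabsM cabs_real ger0_norm ?cabs_ge0// => h; apply: (mulIf c0); rewrite h mul1r.
Qed.
End Complex.

(** * Measurability of complex-valued functions *)

Section Measurability.
Context d (T : measurableType d) (R : realType).
Implicit Types (g h : T -> R[i]).

(** The analogue of [cmeasurable] on an arbitrary measurable space: the Fubini arguments need it on
    the product of two lines. *)
Definition cmeas g := measurable_fun setT (fun x => CRe (g x)) /\
  measurable_fun setT (fun x => CIm (g x)).

Lemma cmeasD g h : cmeas g -> cmeas h -> cmeas (fun x => g x + h x).
Proof.
move=> [g1 g2] [h1 h2]; split.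
- under eq_fun do rewrite CReD; exact: measurable_funD.
- under eq_fun do rewrite CImD; exact: measurable_funD.
Qed.
Lemma cmeasN g : cmeas g -> cmeas (fun x => - g x).
Proof.
move=> [g1 g2]; split.
- under eq_fun do rewrite CReN; exact: measurableT_comp g1.
- under eq_fun do rewrite CImN; exact: measurableT_comp g2.
Qed.
Lemma cmeasB g h : cmeas g -> cmeas h -> cmeas (fun x => g x - h x).
Proof. by move=> mg mh; apply: cmeasD => //; exact: cmeasN. Qed.
Lemma cmeasM g h : cmeas g -> cmeas h -> cmeas (fun x => g x * h x).
Proof.
move=> [g1 g2] [h1 h2]; split.
- under eq_fun do rewrite CReM; apply: measurable_funB; exact: measurable_funM.
- under eq_fun do rewrite CImM; apply: measurable_funD; exact: measurable_funM.
Qed.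
Lemma cmeas_cst (c : R[i]) : cmeas (fun _ => c).
Proof. by split; exact: measurable_cst. Qed.
Lemma cmeas_sum I (r : seq I) (F : I -> T -> R[i]) :
  (forall i, cmeas (F i)) -> cmeas (fun x => \sum_(i <- r) F i x).
Proof.
move=> mF; elim: r => [|i r IH].
  by under [X in cmeas X]eq_fun do rewrite big_nil; exact: cmeas_cst.
by under [X in cmeas X]eq_fun do rewrite big_cons; exact: cmeasD.
Qed.
Lemma measurable_cabs g : cmeas g -> measurable_fun setT (fun x => cabs (g x)).
Proof.
move=> [g1 g2]; under eq_fun do rewrite cabsE.
apply: (measurableT_comp (continuous_measurable_fun (@sqrt_continuous R))).
by apply: measurable_funD; apply: measurable_funX.
Qed.
Lemma cmeas_real (f : T -> R) :
  measurable_fun setT f -> cmeas (fun x => (f x)%:C)%C.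
Proof. by move=> mf; split => //=; exact: measurable_cst. Qed.
Lemma cmeas_expi (f : T -> R) :
  measurable_fun setT f -> cmeas (fun x => expi (f x)).
Proof.
move=> mf; split => /=.
- exact: (measurableT_comp (continuous_measurable_fun (@continuous_cos R))).
- exact: (measurableT_comp (continuous_measurable_fun (@continuous_sin R))).
Qed.
End Measurability.

Notation lcmeas g := (@cmeas _ (measurableTypeR _) _ g).

Lemma cmeas_comp d1 d2 (T1 : measurableType d1) (T2 : measurableType d2) (R : realType)
  (g : T2 -> R[i]) (f : T1 -> T2) :
  measurable_fun setT f -> cmeas g -> cmeas (fun x => g (f x)).
Proof.
move=> mf [g1 g2]; split.
- by apply: (measurableT_comp g1).
- by apply: (measurableT_comp g2).
Qed.

(** * Complex integrals, domination and dominated convergence *)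

Section Integrals.
Variable R : realType.
Notation mu := (@lebesgue_measure R).
Implicit Types (g h : R -> R[i]) (D : set (mR R)).

Lemma integrable_dom d (T : measurableType d) (nu : {measure set T -> \bar R}) (D : set T) (f h : T -> R) :
  measurable D -> measurable_fun D f -> (forall x, D x -> `|f x| <= h x) ->
  nu.-integrable D (EFin \o h) -> nu.-integrable D (EFin \o f).
Proof.
move=> mD mf fh ih; apply: (le_integrable mD _ _ ih).
  exact/measurable_EFinP.
by move=> x Dx /=; rewrite lee_fin (le_trans (fh x Dx))// ler_norm.
Qed.

Definition cintegrable D g := mu.-integrable D (EFin \o (fun x => CRe (g x))) /\
  mu.-integrable D (EFin \o (fun x => CIm (g x))).

Lemma cintegrable_dom D g (h : R -> R) : measurable D -> lcmeas g ->
  (forall x, D x -> cabs (g x) <= h x) -> mu.-integrable D (EFin \o h) -> cintegrable D g.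
Proof.
move=> mD [g1 g2] gh ih; split; apply: (integrable_dom mD _ _ ih).
- exact: measurable_funTS g1.
- by move=> x Dx; rewrite (le_trans (CRe_le_cabs _))// gh.
- exact: measurable_funTS g2.
- by move=> x Dx; rewrite (le_trans (CIm_le_cabs _))// gh.
Qed.

Lemma integrable_cabs D g : measurable D -> cintegrable D g ->
  mu.-integrable D (EFin \o (fun x => cabs (g x))).
Proof.
move=> mD [g1 g2].
have := integrableD mD (integrable_abse g1) (integrable_abse g2) => ih.
have m1 : @measurable_fun _ _ (mR R) _ D (fun x => CRe (g x)).
  by apply/measurable_EFinP; exact: (measurable_int mu g1).
have m2 : @measurable_fun _ _ (mR R) _ D (fun x => CIm (g x)).
  by apply/measurable_EFinP; exact: (measurable_int mu g2).
apply: (@integrable_dom _ (mR R) mu D (fun x => cabs (g x)) (fun x => `|CRe (g x)| + `|CIm (g x)|)) => //.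
- under eq_fun do rewrite cabsE.
  apply: (measurableT_comp (continuous_measurable_fun (@sqrt_continuous R))).
  by apply: measurable_funD; apply: measurable_funX.
- by move=> x _; rewrite ger0_norm ?cabs_ge0// cabs_le.
Qed.

Lemma cintegrableD D g h : measurable D -> cintegrable D g -> cintegrable D h ->
  cintegrable D (fun x => g x + h x).
Proof.
move=> mD [g1 g2] [h1 h2]; split.
- by have := integrableD mD g1 h1; congr (_.-integrable _ _); apply/funext => x /=; rewrite CReD.
- by have := integrableD mD g2 h2; congr (_.-integrable _ _); apply/funext => x /=; rewrite CImD.
Qed.
Lemma cintegrableZ D (c : R[i]) g : measurable D -> cintegrable D g ->
  cintegrable D (fun x => c * g x).
Proof.
move=> mD [g1 g2]; split.
- have := integrableB mD (integrableZl mD (CRe c) g1) (integrableZl mD (CIm c) g2).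
  by congr (_.-integrable _ _); apply/funext => x /=; rewrite CReM.
- have := integrableD mD (integrableZl mD (CRe c) g2) (integrableZl mD (CIm c) g1).
  by congr (_.-integrable _ _); apply/funext => x /=; rewrite CImM.
Qed.
Lemma cintegrable_sum D I (r : seq I) (F : I -> R -> R[i]) : measurable D ->
  (forall i, cintegrable D (F i)) -> cintegrable D (fun x => \sum_(i <- r) F i x).
Proof.
move=> mD mF; elim: r => [|i r IH].
  under [X in cintegrable _ X]eq_fun do rewrite big_nil.
  by split; exact: integrable0.
by under [X in cintegrable _ X]eq_fun do rewrite big_cons; exact: cintegrableD.
Qed.

Lemma integrable_rZl D (c : R) (f : R -> R) : measurable D -> mu.-integrable D (EFin \o f) ->
  mu.-integrable D (EFin \o (fun x => c * f x)).
Proof. by move=> mD fi; exact: (integrableZl mD c fi). Qed.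

Lemma eq_cintegral D g h : {in D, g =1 h} -> cintegral D g = cintegral D h.
Proof. by move=> gh; apply: cplxP => /=; apply: eq_Rintegral => x xD; rewrite gh. Qed.
Lemma cintegralD D g h : measurable D -> cintegrable D g -> cintegrable D h ->
  cintegral D (fun x => g x + h x) = cintegral D g + cintegral D h.
Proof.
move=> mD [g1 g2] [h1 h2]; apply: cplxP; rewrite CE/=.
- by under eq_Rintegral do rewrite CReD; rewrite RintegralD.
- by under eq_Rintegral do rewrite CImD; rewrite RintegralD.
Qed.
Lemma cintegralZ D (c : R[i]) g : measurable D -> cintegrable D g ->
  cintegral D (fun x => c * g x) = c * cintegral D g.
Proof.
move=> mD [g1 g2]; apply: cplxP; rewrite CE/=.
- under eq_Rintegral do rewrite CReM.
  by rewrite RintegralB ?RintegralZl//; exact: integrable_rZl.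
- under eq_Rintegral do rewrite CImM.
  by rewrite RintegralD ?RintegralZl//; exact: integrable_rZl.
Qed.
Lemma cintegralB D g h : measurable D -> cintegrable D g -> cintegrable D h ->
  cintegral D (fun x => g x - h x) = cintegral D g - cintegral D h.
Proof.
move=> mD ig ih; under eq_cintegral do rewrite -mulN1r.
by rewrite cintegralD ?cintegralZ ?mulN1r//; exact: cintegrableZ.
Qed.
Lemma cintegrableB D g h : measurable D -> cintegrable D g -> cintegrable D h ->
  cintegrable D (fun x => g x - h x).
Proof.
move=> mD ig ih; have := cintegrableD mD ig (cintegrableZ (-1) mD ih).
by congr cintegrable; apply/funext => x; rewrite mulN1r.
Qed.
Lemma cintegral_sum D I (r : seq I) (F : I -> R -> R[i]) : measurable D ->
  (forall i, cintegrable D (F i)) ->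
  cintegral D (fun x => \sum_(i <- r) F i x) = \sum_(i <- r) cintegral D (F i).
Proof.
move=> mD mF; elim: r => [|i r IH].
  rewrite big_nil; under eq_cintegral do rewrite big_nil.
  by apply: cplxP; rewrite /= Rintegral_cst// mul0r.
rewrite big_cons -IH; under eq_cintegral do rewrite big_cons.
by rewrite cintegralD//; exact: cintegrable_sum.
Qed.

(** Multiplying by the phase of the integral makes it real and nonnegative, and the real part of the
    rotated integrand is at most its modulus. *)
Lemma cabs_cintegral D g : measurable D -> cintegrable D g ->
  cabs (cintegral D g) <= \int[mu]_(x in D) cabs (g x).
Proof.
move=> mD ig; have iz := cintegrableZ (phase (cintegral D g)) mD ig.
have -> : cabs (cintegral D g) = CRe (phase (cintegral D g) * cintegral D g).
  by rewrite phaseP.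
rewrite -cintegralZ//=; apply: le_Rintegral => //; first by case: iz.
  exact: integrable_cabs.
by move=> x _; rewrite (le_trans (ler_norm _))// (le_trans (CRe_le_cabs _))// cabsM cabs_phase mul1r.
Qed.

Lemma cabs_cintegral_le D g (h : R -> R) : measurable D -> lcmeas g ->
  (forall x, D x -> cabs (g x) <= h x) -> mu.-integrable D (EFin \o h) ->
  cabs (cintegral D g) <= \int[mu]_(x in D) h x.
Proof.
move=> mD mg gh ih; have ig := cintegrable_dom mD mg gh ih.
by rewrite (le_trans (cabs_cintegral mD ig))// le_Rintegral//; exact: integrable_cabs.
Qed.

Lemma Rintegral_dct D (f_ : nat -> R -> R) (f h : R -> R) : measurable D ->
  (forall n, @measurable_fun _ _ (mR R) _ D (f_ n)) -> @measurable_fun _ _ (mR R) _ D f ->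
  (forall x, D x -> f_ n x @[n --> \oo] --> f x) ->
  mu.-integrable D (EFin \o h) -> (forall n x, D x -> `|f_ n x| <= h x) ->
  \int[mu]_(x in D) f_ n x @[n --> \oo] --> \int[mu]_(x in D) f x.
Proof.
move=> mD mf_ mf cf ih fh.
have mE n : measurable_fun D (EFin \o f_ n) by exact/measurable_EFinP.
have mE' : measurable_fun D (EFin \o f) by exact/measurable_EFinP.
have cE : {ae mu, forall x, D x -> (EFin \o f_ n) x @[n --> \oo] --> (EFin \o f) x}.
  apply: aeW => x Dx; apply: cvg_EFin; first exact: nearW.
  exact: cf.
have dE : {ae mu, forall x n, D x -> (`|(EFin \o f_ n) x| <= (EFin \o h) x)%E}.
  by apply: aeW => x n Dx; rewrite lee_fin fh.
have [if_ _ c] := dominated_convergence mD mE mE' cE ih dE.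
apply: fine_cvg; rewrite fineK//.
exact: integrable_fin_num.
Qed.

Lemma cvg_cabs (u : nat -> R[i]) (l : R[i]) :
  CRe (u n) @[n --> \oo] --> CRe l -> CIm (u n) @[n --> \oo] --> CIm l ->
  cabs (u n - l) @[n --> \oo] --> (0 : R).
Proof.
move=> c1 c2; apply: (@squeeze_cvgr _ _ _ _ (cst 0) (fun n => `|CRe (u n) - CRe l| + `|CIm (u n) - CIm l|)).
- by apply: nearW => n; rewrite cabs_ge0 (le_trans (cabs_le _))// !CE.
- exact: cvg_cst.
- rewrite -[X in _ --> X]addr0; apply: cvgD.
  + by apply/norm_cvg0P/subr_cvg0.
  + by apply/norm_cvg0P/subr_cvg0.
Qed.
Lemma cabs_cvg (u : nat -> R[i]) (l : R[i]) : cabs (u n - l) @[n --> \oo] --> (0 : R) ->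
  (CRe (u n) @[n --> \oo] --> CRe l) /\ (CIm (u n) @[n --> \oo] --> CIm l).
Proof.
move=> c; split; apply/subr_cvg0/norm_cvg0P.
- apply: (@squeeze_cvgr _ _ _ _ (cst 0) (fun n => cabs (u n - l))) => //; last exact: cvg_cst.
  by apply: nearW => n; rewrite normr_ge0 (le_trans _ (CRe_le_cabs _))// !CE.
- apply: (@squeeze_cvgr _ _ _ _ (cst 0) (fun n => cabs (u n - l))) => //; last exact: cvg_cst.
  by apply: nearW => n; rewrite normr_ge0 (le_trans _ (CIm_le_cabs _))// !CE.
Qed.

Lemma cintegral_dct D (f_ : nat -> R -> R[i]) (f : R -> R[i]) (h : R -> R) : measurable D ->
  (forall n, lcmeas (f_ n)) -> lcmeas f ->
  (forall x, D x -> cabs (f_ n x - f x) @[n --> \oo] --> (0 : R)) ->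
  mu.-integrable D (EFin \o h) -> (forall n x, D x -> cabs (f_ n x) <= h x) ->
  cabs (cintegral D (f_ n) - cintegral D f) @[n --> \oo] --> (0 : R).
Proof.
move=> mD mf_ [mf1 mf2] cf ih fh; apply: cvg_cabs => /=.
- apply: (Rintegral_dct mD _ _ _ ih).
  + by move=> n; apply: measurable_funTS; case: (mf_ n).
  + exact: measurable_funTS.
  + by move=> x Dx; case: (cabs_cvg (cf x Dx)).
  + by move=> n x Dx; rewrite (le_trans (CRe_le_cabs _))// fh.
- apply: (Rintegral_dct mD _ _ _ ih).
  + by move=> n; apply: measurable_funTS; case: (mf_ n).
  + exact: measurable_funTS.
  + by move=> x Dx; case: (cabs_cvg (cf x Dx)).
  + by move=> n x Dx; rewrite (le_trans (CIm_le_cabs _))// fh.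
Qed.
End Integrals.

(** * Affine changes of variables *)

Section Affine.
Variable R : realType.
Notation mu := (@lebesgue_measure R).

Definition aff (l c : R) (x : mR R) : mR R := l * x + c.
Lemma measurable_aff l c : measurable_fun setT (aff l c).
Proof.
apply: (@measurable_funD _ (mR R)); last exact: measurable_cst.
by apply: (@measurable_funM _ (mR R)) => //; exact: measurable_cst.
Qed.
HB.instance Definition _ l c := isMeasurableFun.Build _ _ _ _ (aff l c) (measurable_aff l c).

Definition lebesgue_image (l c : R) : {measure set (mR R) -> \bar R} :=
  measure_function_pushforward__canonical__measure_function_Measure mu (measurable_aff l c).

(** Both sides are measures that agree on half-open intervals, and Lebesgue measure is determined by
    its values there. *)
Lemma lebesgue_aff (l c : R) (l0 : 0 < l) (A : set (mR R)) : measurable A ->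
  mu A = mscale (NngNum (ltW l0)) (lebesgue_image l c) A.
Proof.
move=> mA; apply: lebesgue_measure_unique => // _ [[a b] _ <-].
change (mu `]a, b]%classic = (l%:E * mu (aff l c @^-1` `]a, b]%classic))%E).
have -> : aff l c @^-1` `]a, b]%classic = `](a - c) / l, (b - c) / l]%classic.
  apply/seteqP; split => x /=; rewrite !in_itv/= /aff ltr_pdivrMr// ler_pdivlMr//.
    by rewrite (mulrC x) ltrBlDr lerBrDr.
  by rewrite (mulrC x) ltrBlDr lerBrDr.
rewrite !lebesgue_measure_itv/= !lte_fin ltr_pM2r ?invr_gt0// ltrD2r.
case: ifP => _; last by rewrite mule0.
rewrite -!EFinD -EFinM; congr EFin; field.
by rewrite gt_eqF.
Qed.

Lemma ge0_integral_aff (l c : R) (f : R -> \bar R) : 0 < l ->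
  @measurable_fun _ _ (mR R) _ setT f -> (forall x, 0 <= f x)%E ->
  (\int[mu]_x f x = l%:E * \int[mu]_x f (l * x + c)%R)%E.
Proof.
move=> l0 mf f0.
transitivity (\int[mscale (NngNum (ltW l0)) (lebesgue_image l c)]_x f x)%E.
  by apply: eq_measure_integral => A mA _; exact: lebesgue_aff.
rewrite ge0_integral_mscale//=; congr (_ * _)%E.
exact: (ge0_integral_pushforward (measurable_aff l c)).
Qed.

Lemma ge0_integral_neg (f : R -> \bar R) :
  @measurable_fun _ _ (mR R) _ setT f -> (forall x, 0 <= f x)%E ->
  (\int[mu]_x f x = \int[mu]_x f (- x)%R)%E.
Proof.
move=> mf f0.
transitivity (\int[pushforward mu (-%R : mR R -> mR R)]_x f x)%E.
  by apply: eq_measure_integral => A mA _; apply/esym/lebesgue_measureN.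
by rewrite ge0_integral_pushforward.
Qed.

Lemma Rintegral_posneg d (T : measurableType d) (nu : {measure set T -> \bar R}) D (f : T -> R) :
  \int[nu]_(x in D) f x = fine (\int[nu]_(x in D) (Num.max (f x) 0)%:E - \int[nu]_(x in D) (Num.max (- f x) 0)%:E)%E.
Proof.
rewrite /Rintegral integralE; congr (fine (_ - _)%E); apply: eq_integral => x _.
  by rewrite funeposE EFin_max.
by rewrite funenegE EFin_max.
Qed.

(** No integrability is assumed: the identity is applied to the positive and negative parts, and
    when one of them has infinite integral [fine] gives 0 on both sides. *)
Lemma Rintegral_aff (l c : R) (f : R -> R) : 0 < l -> lmeas f ->
  \int[mu]_x f x = l * \int[mu]_x f (l * x + c).
Proof.
move=> l0 mf; rewrite !Rintegral_posneg.
have m1 : @measurable_fun _ _ (mR R) _ setT (fun x => (Num.max (f x) 0)%:E).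
  by apply/measurable_EFinP; apply: (@measurable_maxr _ (mR R)).
have m2 : @measurable_fun _ _ (mR R) _ setT (fun x => (Num.max (- f x) 0)%:E).
  by apply/measurable_EFinP; apply: (@measurable_maxr _ (mR R)) => //; exact: (@measurable_funN _ (mR R)).
rewrite (ge0_integral_aff c l0 m1); last by move=> x; rewrite lee_fin le_max lexx orbT.
rewrite (ge0_integral_aff c l0 m2); last by move=> x; rewrite lee_fin le_max lexx orbT.
set a := (\int[mu]_x _)%E; set b := (\int[mu]_x _)%E.
have a0 : (0 <= a)%E by apply: integral_ge0 => x _; rewrite lee_fin le_max lexx orbT.
have b0 : (0 <= b)%E by apply: integral_ge0 => x _; rewrite lee_fin le_max lexx orbT.
have fB (x y : \bar R) : (0 <= x)%E -> (0 <= y)%E -> fine (l%:E * x - l%:E * y)%E = l * fine (x - y)%E.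
  case: x => [x| |]; case: y => [y| |] // _ _; rewrite ?gt0_muley ?lte_fin//=.
  - by rewrite mulrBr.
  - by rewrite mulr0.
  - by rewrite mulr0.
  - by rewrite mulr0.
exact: fB.
Qed.

Lemma Rintegral_neg (f : R -> R) : lmeas f -> \int[mu]_x f x = \int[mu]_x f (- x).
Proof.
move=> mf; rewrite !Rintegral_posneg.
rewrite (@ge0_integral_neg (fun x => (Num.max (f x) 0)%:E)); first last.
- by move=> x; rewrite lee_fin le_max lexx orbT.
- by apply/measurable_EFinP; apply: (@measurable_maxr _ (mR R)).
rewrite (@ge0_integral_neg (fun x => (Num.max (- f x) 0)%:E))//; first last.
- by move=> x; rewrite lee_fin le_max lexx orbT.
- by apply/measurable_EFinP; apply: (@measurable_maxr _ (mR R)) => //; exact: (@measurable_funN _ (mR R)).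
Qed.

Lemma integrable_aff (l c : R) (f : R -> R) : 0 < l -> mu.-integrable setT (EFin \o f) ->
  mu.-integrable setT (EFin \o (fun x => f (l * x + c))).
Proof.
move=> l0 /integrableP[mf fi]; have mf' : lmeas f by exact/measurable_EFinP.
have maf : lmeas (fun x : mR R => f (l * x + c)) by apply: (measurableT_comp mf' (measurable_aff l c)).
apply/integrableP; split; first exact/measurable_EFinP.
move: fi; rewrite (ge0_integral_aff c l0)//=; last first.
  by apply/measurable_EFinP; apply: (@measurableT_comp _ _ _ _ (mR R)).
set X := integral _ _ _ => h; rewrite ltNge leye_eq; apply/negP => /eqP XE.
by move: h; rewrite XE mulry gtr0_sg// mul1e.
Qed.
Lemma cintegral_shift (c : R) (g : R -> R[i]) : lcmeas g ->
  cintegral setT g = cintegral setT (fun x => g (x + c)).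
Proof.
move=> [m1 m2]; apply: cplxP => /=.
  by rewrite (Rintegral_aff c ltr01 m1) mul1r; apply: eq_Rintegral => x _; rewrite mul1r.
by rewrite (Rintegral_aff c ltr01 m2) mul1r; apply: eq_Rintegral => x _; rewrite mul1r.
Qed.
Lemma cintegral_neg (g : R -> R[i]) : lcmeas g ->
  cintegral setT g = cintegral setT (fun x => g (- x)).
Proof. by move=> [m1 m2]; apply: cplxP => /=; rewrite Rintegral_neg. Qed.
Lemma cintegral_scale (l : R) (g : R -> R[i]) : 0 < l -> lcmeas g ->
  cintegral setT g = (l%:C)%C * cintegral setT (fun x => g (l * x)).
Proof.
move=> l0 [m1 m2]; apply: cplxP; rewrite CE/= mul0r ?subr0 ?addr0.
  by rewrite (Rintegral_aff 0 l0 m1); congr (_ * _); apply: eq_Rintegral => x _; rewrite addr0.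
by rewrite (Rintegral_aff 0 l0 m2); congr (_ * _); apply: eq_Rintegral => x _; rewrite addr0.
Qed.
End Affine.

(** * Integrals with a parameter, Fubini's theorem, and the weight [kap] *)

Section Param.
Variable R : realType.
Notation mu := (@lebesgue_measure R).

(** Tonelli gives measurability for the positive and negative parts, and [fine] of their difference
    remains measurable whether or not the integrals are finite. *)
Lemma measurable_param (f : mR R * mR R -> R) :
  measurable_fun setT f -> lmeas (fun y => \int[mu]_x f (x, y)).
Proof.
move=> mf; under eq_fun do rewrite Rintegral_posneg.
apply: (measurableT_comp (@fine_measurable _ setT measurableT)) => //.
apply: emeasurable_funB.
- apply: (@measurable_fun_fubini_tonelli_G _ _ _ _ _ mu (fun xy => (Num.max (f xy) 0)%:E)) => //.
  + by apply/measurable_EFinP; apply: measurable_maxr.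
  + by move=> x; rewrite lee_fin le_max lexx orbT.
- apply: (@measurable_fun_fubini_tonelli_G _ _ _ _ _ mu (fun xy => (Num.max (- f xy) 0)%:E)) => //.
  + by apply/measurable_EFinP; apply: measurable_maxr => //; exact: measurable_funN.
  + by move=> x; rewrite lee_fin le_max lexx orbT.
Qed.

Lemma measurable_param2 (f : mR R * mR R -> R) :
  measurable_fun setT f -> lmeas (fun x => \int[mu]_y f (x, y)).
Proof.
move=> mf; under eq_fun do rewrite Rintegral_posneg.
apply: (measurableT_comp (@fine_measurable _ setT measurableT)) => //.
apply: emeasurable_funB.
- apply: (@measurable_fun_fubini_tonelli_F _ _ _ _ _ mu (fun xy => (Num.max (f xy) 0)%:E)) => //.
  + by apply/measurable_EFinP; apply: measurable_maxr.
  + by move=> x; rewrite lee_fin le_max lexx orbT.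
- apply: (@measurable_fun_fubini_tonelli_F _ _ _ _ _ mu (fun xy => (Num.max (- f xy) 0)%:E)) => //.
  + by apply/measurable_EFinP; apply: measurable_maxr => //; exact: measurable_funN.
  + by move=> x; rewrite lee_fin le_max lexx orbT.
Qed.

Lemma cmeas_param (f : mR R * mR R -> R[i]) :
  cmeas f -> lcmeas (fun y => cintegral setT (fun x => f (x, y))).
Proof.
by move=> [m1 m2]; split => /=; [exact: (measurable_param m1)|exact: (measurable_param m2)].
Qed.

(** Every signed double integral below comes with a majorant that is a product of two integrable
    functions of one variable; such a majorant yields integrability for the product measure at
    once. *)
Lemma Rfubini (f : mR R * mR R -> R) (a b : R -> R) : measurable_fun setT f ->
  mu.-integrable setT (EFin \o a) -> mu.-integrable setT (EFin \o b) ->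
  (forall x y, `|f (x, y)| <= a x * b y) ->
  \int[mu]_x \int[mu]_y f (x, y) = \int[mu]_y \int[mu]_x f (x, y).
Proof.
move=> mf ia ib fab.
have [a1|a1] := pselect (exists x, a x != 0); last first.
  have f0 x y : f (x, y) = 0.
    apply/eqP; rewrite -normr_le0 (le_trans (fab x y))//.
    have [->|] := eqVneq (a x) 0; first by rewrite mul0r.
    by move=> ax; exfalso; apply: a1; exists x.
  have Z : \int[mu]_x (0 : R) = 0 by rewrite Rintegral_cst// mul0r.
  under eq_Rintegral => x _ do under eq_Rintegral do rewrite f0.
  under [RHS]eq_Rintegral => x _ do under eq_Rintegral do rewrite f0.
  by [].
have imf : (mu \x mu)%E.-integrable setT (EFin \o f).
  apply/integrable12ltyP => //; first exact/measurable_EFinP.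
  apply: (@le_lt_trans _ _ (\int[mu]_x (`|a x|%:E * \int[mu]_y `|b y|%:E))%E).
    apply: ge0_le_integral => //=.
    - by move=> x _; apply: integral_ge0.
    - apply: (@measurable_fun_fubini_tonelli_F _ _ _ _ _ mu (fun xy => `|f xy|%:E)) => //.
      by apply/measurable_EFinP; exact: measurableT_comp.
    - apply: emeasurable_funM; last exact: measurable_cst.
      apply/measurable_EFinP; apply: (@measurableT_comp _ _ _ _ (mR R)) => //.
      by apply/measurable_EFinP; exact: (measurable_int mu ia).
    - move=> x _; rewrite -ge0_integralZl//=; last first.
        apply/measurable_EFinP; apply: (@measurableT_comp _ _ _ _ (mR R)) => //.
        by apply/measurable_EFinP; exact: (measurable_int mu ib).
      apply: ge0_le_integral => //=.
      + apply/measurable_EFinP; apply: (@measurableT_comp _ _ _ _ (mR R)) => //.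
        exact: (measurableT_comp mf (pair1_measurable x)).
      + apply: emeasurable_funM; first exact: measurable_cst.
        apply/measurable_EFinP; apply: (@measurableT_comp _ _ _ _ (mR R)) => //.
        by apply/measurable_EFinP; exact: (measurable_int mu ib).
      + by move=> y _; rewrite lee_fin -normrM (le_trans (fab x y))// ler_norm.
  rewrite ge0_integralZr//=; last 2 first.
  - apply/measurable_EFinP; apply: (@measurableT_comp _ _ _ _ (mR R)) => //.
    by apply/measurable_EFinP; exact: (measurable_int mu ia).
  - exact: integral_ge0.
  move/integrableP : ia => [_ ia]; move/integrableP : ib => [_ ib].
  rewrite lte_mul_pinfty//; first exact: integral_ge0.
  by rewrite ge0_fin_numE//; exact: integral_ge0.
have h := Fubini imf.
(* The inner integrals are known to be finite only almost everywhere, so extended and real inner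
   integrals are compared through an almost-everywhere equality. *)
have F1 : (\int[mu]_x \int[mu]_y (f (x, y))%:E = \int[mu]_x (\int[mu]_y f (x, y))%:E)%E.
  apply: ae_eq_integral => //.
  - exact: (measurable_fubini_F imf).
  - apply/measurable_EFinP.
    exact: (measurable_param2 mf).
  - have := ae_integrable1 imf; apply: filterS => x ix _ /=.
    rewrite /Rintegral fineK//; exact: integrable_fin_num.
have F2 : (\int[mu]_y \int[mu]_x (f (x, y))%:E = \int[mu]_y (\int[mu]_x f (x, y))%:E)%E.
  apply: ae_eq_integral => //.
  - exact: (measurable_fubini_G imf).
  - apply/measurable_EFinP.
    exact: (measurable_param mf).
  - have := ae_integrable2 imf; apply: filterS => x ix _ /=.
    rewrite /Rintegral fineK//; exact: integrable_fin_num.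
by rewrite /Rintegral; congr fine; rewrite -F1 -F2.
Qed.

Lemma cfubini (f : mR R * mR R -> R[i]) (a b : R -> R) : cmeas f ->
  mu.-integrable setT (EFin \o a) -> mu.-integrable setT (EFin \o b) ->
  (forall x y, cabs (f (x, y)) <= a x * b y) ->
  cintegral setT (fun x => cintegral setT (fun y => f (x, y))) =
  cintegral setT (fun y => cintegral setT (fun x => f (x, y))).
Proof.
move=> [m1 m2] ia ib fab; apply: cplxP => /=.
- apply: (@Rfubini (fun z => CRe (f z)) a b) => // x y.
  by rewrite (le_trans (CRe_le_cabs _)).
- apply: (@Rfubini (fun z => CIm (f z)) a b) => // x y.
  by rewrite (le_trans (CIm_le_cabs _)).
Qed.

Lemma cintegrable_param (f : mR R * mR R -> R[i]) (a b : R -> R) : cmeas f ->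
  mu.-integrable setT (EFin \o a) -> mu.-integrable setT (EFin \o b) ->
  (forall x y, cabs (f (x, y)) <= a x * b y) ->
  cintegrable setT (fun x => cintegral setT (fun y => f (x, y))).
Proof.
move=> mf ia ib fab.
have ms : cmeas (fun z : mR R * mR R => f (z.2, z.1)).
  by apply: (cmeas_comp _ mf); exact: measurable_swap.
apply: (@cintegrable_dom _ _ _ (fun x => (\int[mu]_y b y) * a x)) => //.
- exact: (cmeas_param ms).
- move=> x _; rewrite mulrC -RintegralZl//; apply: cabs_cintegral_le => //.
    exact: (cmeas_comp (pair1_measurable x) mf).
  exact: integrable_rZl.
- exact: integrable_rZl.
Qed.

(** The common majorant of the development: Schwartz functions are at most a multiple of it, L^p
    functions are integrable against it, and by [kap_peetre] a translation over a bounded distance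
    costs a bounded factor. Its mass pi is the origin of the factors pi + 1 in later constants. *)
Definition kap (x : R) : R := (1 + x ^+ 2)^-1.
Lemma kap_gt0 x : 0 < kap x.
Proof. by rewrite invr_gt0 ltr_wpDr// sqr_ge0. Qed.
Lemma kap_ge0 x : 0 <= kap x. Proof. exact/ltW/kap_gt0. Qed.
Lemma kap_le1 x : kap x <= 1.
Proof. by rewrite invf_le1 ?lerDl ?sqr_ge0// ltr_wpDr// sqr_ge0. Qed.
Lemma continuous_kap : continuous kap.
Proof.
move=> x; apply: cvgV; first by rewrite gt_eqF// ltr_wpDr// sqr_ge0.
by apply: cvgD; [exact: cvg_cst|exact: exprn_continuous].
Qed.
Lemma measurable_kap : lmeas kap.
Proof. exact: continuous_measurable_fun continuous_kap. Qed.
Lemma integral_kap : (\int[mu]_x (kap x)%:E = pi%:E)%E.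
Proof.
rewrite ge0_symfun_integralT//=; first last.
- by move=> x; rewrite /kap/= sqrrN.
- exact: continuous_kap.
- exact: kap_ge0.
rewrite -set_itvcy (@ge0_continuous_FTC2y _ _ atan 0 (pi / 2))//=.
- by rewrite atan0 sube0 -EFinM mulrC divfK.
- by move=> x _; exact: kap_ge0.
- by apply: continuous_subspaceT; exact: continuous_kap.
- exact: cvgy_atan.
- by apply: cvg_at_right_filter; exact: continuous_atan.
- by move=> x _; rewrite derive1_atan.
Qed.
Lemma integrable_kap : mu.-integrable setT (EFin \o kap).
Proof.
apply/integrableP; split; first by apply/measurable_EFinP; exact: measurable_kap.
by under eq_integral do rewrite /= ger0_norm ?kap_ge0//; rewrite integral_kap ltry.
Qed.
Lemma Rintegral_kap : \int[mu]_x kap x = pi.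
Proof. by rewrite /Rintegral integral_kap. Qed.
Lemma integrable_kap_shift c : mu.-integrable setT (EFin \o (fun x => kap (x - c))).
Proof.
have := integrable_aff (- c) ltr01 integrable_kap.
by congr (_.-integrable _ _); apply/funext => x /=; rewrite mul1r.
Qed.
End Param.

(** * Jensen's inequality with a crude constant *)

Section Jensen.
Context d (T : measurableType d) (R : realType) (nu : {measure set T -> \bar R}).

(** If a exceeds l then (a / l)^(p - 1) is at least 1 and the second term alone dominates a. This
    replaces Hoelder's inequality: integrated, with a suitable threshold l, it gives the right
    powers up to a constant. *)
Lemma powR_split (a l p : R) : 0 <= a -> 0 < l -> 1 <= p -> a <= l + a `^ p * l `^ (1 - p).
Proof.
move=> a0 l0 p1; have [al|la] := leP a l.
  by rewrite (le_trans al)// lerDl mulr_ge0// powR_ge0.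
have a_gt0 : 0 < a by exact: lt_trans la.
rewrite (@le_trans _ _ (a `^ p * l `^ (1 - p)))//; last by rewrite lerDr ltW.
have -> : a `^ p = a * a `^ (p - 1).
  by rewrite mulr_powRB1// (lt_le_trans ltr01 p1).
rewrite -mulrA ler_peMr//; have -> : 1 - p = - (p - 1) by rewrite opprB.
rewrite powRN -[X in _ <= X / _](divfK (_ : l `^ (p - 1) != 0)) ?gt_eqF ?powR_gt0// mulfK ?gt_eqF ?powR_gt0//.
by rewrite ler_pdivlMr ?powR_gt0// mul1r ge0_ler_powR ?nnegrE ?subr_ge0// ?ltW.
Qed.

(** The sharp factor I^(1 - 1/p) is relaxed to I + 1, which is what the threshold l = Y^(1/p) of
    [powR_split] yields: l I from the first term and Y l^(1 - p) = l from the second. *)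
Lemma jensen_int (h a : T -> R) (p I Y : R) :
  measurable_fun setT h -> measurable_fun setT a -> (forall x, 0 <= h x) -> (forall x, 0 <= a x) ->
  1 <= p -> 0 <= Y ->
  (\int[nu]_x (h x)%:E <= I%:E)%E -> (\int[nu]_x (h x * a x `^ p)%:E <= Y%:E)%E ->
  (\int[nu]_x (h x * a x)%:E <= ((I + 1) * Y `^ p^-1)%:E)%E.
Proof.
move=> mh ma h0 a0 p1 Y0 hI hY.
have I0 : 0 <= I by rewrite -lee_fin (le_trans _ hI)// integral_ge0// => x _; rewrite lee_fin.
have p0 : 0 < p by apply: lt_le_trans p1.
have map : measurable_fun setT (fun x => a x `^ p).
  by apply: (measurableT_comp (measurable_powR p)).
have key y : 0 < y -> Y <= y -> (\int[nu]_x (h x * a x)%:E <= ((I + 1) * y `^ p^-1)%:E)%E.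
  move=> y0 Yy; set l := y `^ p^-1; have l0 : 0 < l by rewrite powR_gt0.
  apply: (@le_trans _ _ (\int[nu]_x (l%:E * (h x)%:E + (l `^ (1 - p))%:E * (h x * a x `^ p)%:E))%E).
    apply: ge0_le_integral => //.
    - by move=> x _; rewrite lee_fin mulr_ge0.
    - by apply/measurable_EFinP; exact: measurable_funM.
    - apply: emeasurable_funD; apply: emeasurable_funM; try exact: measurable_cst.
        exact/measurable_EFinP.
      by apply/measurable_EFinP; exact: measurable_funM.
    - move=> x _; rewrite -!EFinM -EFinD lee_fin [l * _]mulrC mulrCA -mulrDr ler_wpM2l//.
      by rewrite (mulrC (l `^ _)) powR_split.
  rewrite ge0_integralD//; first last.
  - by apply: emeasurable_funM; [exact: measurable_cst|apply/measurable_EFinP; exact: measurable_funM].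
  - by move=> x _; rewrite -EFinM lee_fin !mulr_ge0 ?powR_ge0.
  - by apply: emeasurable_funM; [exact: measurable_cst|exact/measurable_EFinP].
  - by move=> x _; rewrite -EFinM lee_fin mulr_ge0// ltW.
  rewrite ge0_integralZl_EFin//; first last.
  - exact: ltW.
  - exact/measurable_EFinP.
  - by move=> x _; rewrite lee_fin.
  rewrite ge0_integralZl_EFin//; first last.
  - exact: powR_ge0.
  - by apply/measurable_EFinP; exact: measurable_funM.
  - by move=> x _; rewrite lee_fin mulr_ge0 ?powR_ge0.
  apply: (@le_trans _ _ (l%:E * I%:E + (l `^ (1 - p))%:E * y%:E)%E).
    apply: leeD; rewrite lee_pmul2l// ?lte_fin ?powR_gt0//.
    by rewrite (le_trans hY)// lee_fin.
  rewrite -!EFinM -EFinD lee_fin mulrDl mul1r mulrC lerD2l.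
  rewrite -[X in _ * X](powRr1 (ltW y0)) /l -powRrM -powRD ?gt_eqF ?implybT// mulrBr mulVf ?gt_eqF// mulr1 subrK ?invr_gt0//.
have [Y_gt0|] := ltP 0 Y; first exact: key.
move=> Yle0; have Ye : Y = 0 by apply/eqP; rewrite eq_le Yle0.
rewrite Ye powR0 ?invr_eq0 ?gt_eqF// mulr0.
(* For Y = 0 the threshold would vanish. The bound is applied instead with y = (e / (I + 1))^p > 0,
   which leaves exactly the error e. *)
apply/lee_addgt0Pr => e e0; rewrite add0e.
have ey : 0 < (e / (I + 1)) `^ p by rewrite powR_gt0 ?divr_gt0 ?ltr_wpDl.
rewrite (le_trans (key _ ey _))//; first by rewrite Ye ltW.
have I1 : 0 < I + 1 by rewrite ltr_wpDl.
have eI : 0 <= e / (I + 1) by rewrite divr_ge0 ?ltW.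
by rewrite -powRrM mulfV ?gt_eqF// powRr1// mulrC divfK ?gt_eqF.
Qed.

Lemma jensen_cube (h a : T -> R) (I Y : R) :
  measurable_fun setT h -> measurable_fun setT a -> (forall x, 0 <= h x) -> (forall x, 0 <= a x) ->
  0 <= Y ->
  (\int[nu]_x (h x)%:E <= I%:E)%E -> (\int[nu]_x (h x * a x ^+ 3)%:E <= Y%:E)%E ->
  (\int[nu]_x (h x * a x))^+ 3 <= (I + 1) ^+ 3 * Y.
Proof.
move=> mh ma h0 a0 Y0 hI hY.
have I0 : 0 <= I by rewrite -lee_fin (le_trans _ hI)// integral_ge0// => x _; rewrite lee_fin.
have := @jensen_int h a 3%:R I Y mh ma h0 a0 _ Y0 hI.
under eq_integral do rewrite powR_mulrn//.
move=> /(_ _ hY) J; have {}J : (\int[nu]_x (h x * a x)%:E <= ((I + 1) * Y `^ 3%:R^-1)%:E)%E.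
  by apply: J; rewrite ler1n.
have J' : \int[nu]_x (h x * a x) <= (I + 1) * Y `^ 3%:R^-1.
  rewrite -lee_fin /Rintegral fineK// ge0_fin_numE ?(le_lt_trans J) ?ltry//.
  by apply: integral_ge0 => x _; rewrite lee_fin mulr_ge0.
apply: (@le_trans _ _ (((I + 1) * Y `^ 3%:R^-1) ^+ 3)).
  by rewrite lerXn2r ?nnegrE ?mulr_ge0 ?addr_ge0 ?powR_ge0//; apply: Rintegral_ge0 => x _; rewrite mulr_ge0.
rewrite exprMn -(powR_mulrn _ (powR_ge0 Y _)) -powRrM mulVf ?powRr1//.
Qed.
End Jensen.

(** * Schwartz functions and the Fourier transform *)

Section Cder.
Variable R : realType.
Notation mu := (@lebesgue_measure R).
Implicit Types (f g : R -> R[i]) (x : R) (l : R[i]).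

(** Derivability and the value of the derivative travel together, so that computations with [cder]
    have no side conditions; [cderE] returns to the operator [cderive]. *)
Definition cder f x l := is_derive x (1 : R) (fun y => CRe (f y)) (CRe l) /\
  is_derive x (1 : R) (fun y => CIm (f y)) (CIm l).

Lemma is_derive_ext (h k : R -> R) x (a b : R) : is_derive x (1 : R) h a -> h = k -> a = b ->
  is_derive x (1 : R) k b.
Proof. by move=> ? <- <-. Qed.

Lemma cderE f x l : cder f x l -> cderive (1 : R) f x = l.
Proof. by move=> [h1 h2]; apply: cplxP; rewrite /cderive/= derive_val. Qed.

Lemma cder_ext f g x l l' : cder f x l -> f = g -> l = l' -> cder g x l'.
Proof. by move=> ? <- <-. Qed.

Lemma cderP f x : derivable (fun y => CRe (f y)) x (1 : R) -> derivable (fun y => CIm (f y)) x (1 : R) ->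
  cder f x (cderive (1 : R) f x).
Proof. by move=> h1 h2; split; apply/derivableP. Qed.

Lemma cder_cst (c : R[i]) x : cder (fun=> c) x 0.
Proof. by split; apply: is_derive_cst. Qed.

Lemma cderD f g x l k : cder f x l -> cder g x k -> cder (fun y => f y + g y) x (l + k).
Proof.
move=> [f1 f2] [g1 g2]; split.
- by apply: (is_derive_ext (is_deriveD f1 g1)); rewrite ?CE//; apply/funext => y; rewrite /= CE.
- by apply: (is_derive_ext (is_deriveD f2 g2)); rewrite ?CE//; apply/funext => y; rewrite /= CE.
Qed.

Lemma cderM f g x l k : cder f x l -> cder g x k -> cder (fun y => f y * g y) x (l * g x + f x * k).
Proof.
move=> [f1 f2] [g1 g2]; split.
- apply: (is_derive_ext (is_deriveB (is_deriveM f1 g1) (is_deriveM f2 g2))).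
    by apply/funext => y; rewrite /= CE.
  by rewrite !CE /GRing.scale/=; ring.
- apply: (is_derive_ext (is_deriveD (is_deriveM f1 g2) (is_deriveM f2 g1))).
    by apply/funext => y; rewrite /= CE.
  by rewrite !CE /GRing.scale/=; ring.
Qed.

Lemma cderZ (c : R[i]) f x l : cder f x l -> cder (fun y => c * f y) x (c * l).
Proof.
move=> h; apply: (cder_ext (cderM (cder_cst c x) h)) => //.
by rewrite mul0r add0r.
Qed.

Lemma cderN f x l : cder f x l -> cder (fun y => - f y) x (- l).
Proof.
move=> h; apply: (cder_ext (cderZ (-1) h)); rewrite ?mulN1r//.
by apply/funext => y; rewrite mulN1r.
Qed.

Lemma cder_real (h : R -> R) x a : is_derive x (1 : R) h a -> cder (fun y => (h y)%:C)%C x (a%:C)%C.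
Proof. by move=> hd; split => //=; exact: is_derive_cst. Qed.

Lemma cder_id x : cder (fun y => (y%:C)%C) x 1.
Proof. by apply: (cder_real (is_derive_id x 1)). Qed.

Lemma cder_expi (h : R -> R) x a : is_derive x (1 : R) h a ->
  cder (fun y => expi (h y)) x ((0 +i* a)%C * expi (h x)).
Proof.
move=> hd; split.
- apply: (is_derive_ext (is_derive1_comp (is_derive_cos (h x)) hd)) => //.
  by rewrite !CE/=; ring.
- apply: (is_derive_ext (is_derive1_comp (is_derive_sin (h x)) hd)) => //.
  by rewrite !CE/=; ring.
Qed.

Lemma cder_comp f (h : R -> R) x a l : cder f (h x) l -> is_derive x (1 : R) h a ->
  cder (fun y => f (h y)) x ((a%:C)%C * l).
Proof.
move=> [f1 f2] hd; split.
- apply: (is_derive_ext (is_derive1_comp f1 hd)) => //.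
  by rewrite !CE/=; ring.
- apply: (is_derive_ext (is_derive1_comp f2 hd)) => //.
  by rewrite !CE/=; ring.
Qed.

Lemma is_derive_aff (a b : R) x : is_derive x (1 : R) (fun y => a * y + b) a.
Proof.
have := is_deriveD (is_deriveM (is_derive_cst a x (1 : R)) (is_derive_id x (1 : R))) (is_derive_cst b x (1 : R)).
move=> h; apply: (is_derive_ext h) => //.
by rewrite /GRing.scale/=; ring.
Qed.

Lemma cder_sum I (r : seq I) (F : I -> R -> R[i]) (F' : I -> R[i]) x :
  (forall i, cder (F i) x (F' i)) -> cder (fun y => \sum_(i <- r) F i y) x (\sum_(i <- r) F' i).
Proof.
move=> h; elim: r => [|i r IH].
  apply: (cder_ext (cder_cst 0 x)); last by rewrite big_nil.
  by apply/funext => y; rewrite big_nil.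
apply: (cder_ext (cderD (h i) IH)); last by rewrite big_cons.
by apply/funext => y; rewrite big_cons.
Qed.

Lemma is_derive_cont (h : R -> R) x (a : R) : is_derive x (1 : R) h a -> {for x, continuous h}.
Proof. by move=> [hd _]; exact/differentiable_continuous/derivable1_diffP. Qed.

Lemma cder_cmeas f (f' : R -> R[i]) : (forall x, cder f x (f' x)) -> lcmeas f.
Proof.
move=> h; split; apply: continuous_measurable_fun => x.
- by case: (h x) => /is_derive_cont.
- by case: (h x) => _ /is_derive_cont.
Qed.

End Cder.

(** * Differentiation under the integral sign *)

Section DiffUnder.
Variable R : realType.
Notation mu := (@lebesgue_measure R).

Lemma is_derive_under (f f' : R -> R -> R) (G : R -> R) (u v a : R) :
  u < a < v ->
  (forall t, u < t < v -> mu.-integrable setT (EFin \o f t)) ->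
  (forall t x, u < t < v -> is_derive t (1 : R) (f ^~ x) (f' t x)) ->
  mu.-integrable setT (EFin \o G) ->
  (forall t x, u < t < v -> `|f' t x| <= G x) ->
  is_derive a (1 : R) (fun t => \int[mu]_x f t x) (\int[mu]_x f' a x).
Proof.
move=> auv fi fd Gi fG.
have E t x : u < t < v -> partial1of2 f t x = f' t x.
  by move=> tuv; rewrite partial1of2E; have := fd t x tuv => ?; rewrite derive_val.
have ain : `]u, v[%classic a by rewrite /= in_itv.
have G0 y : 0 <= G y by rewrite (le_trans _ (fG a y auv)).
have dom : forall t x, `]u, v[%classic t -> setT x -> `|partial1of2 f t x| <= G x.
  by move=> t x; rewrite /= in_itv/= => tuv _; rewrite E//; exact: fG.
have der : forall t x, `]u, v[%classic t -> setT x -> derivable (f ^~ x) t 1.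
  by move=> t x; rewrite /= in_itv/= => tuv _; case: (fd t x tuv).
have fi' t : `]u, v[%classic t -> mu.-integrable setT (EFin \o f t).
  by rewrite /= in_itv/=; exact: fi.
have D := derivable_under_integral measurableT ain fi' der G0 Gi dom.
have DE := differentiation_under_integral measurableT ain fi' der G0 Gi dom.
apply: DeriveDef => //; rewrite -derive1E DE.
by apply: eq_Rintegral => x _; rewrite E.
Qed.

Lemma cder_under (f f' : R -> R -> R[i]) (G : R -> R) (u v a : R) :
  u < a < v ->
  (forall t, u < t < v -> cintegrable setT (f t)) ->
  (forall t x, u < t < v -> cder (f ^~ x) t (f' t x)) ->
  mu.-integrable setT (EFin \o G) ->
  (forall t x, u < t < v -> cabs (f' t x) <= G x) ->
  cder (fun t => cintegral setT (f t)) a (cintegral setT (f' a)).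
Proof.
move=> auv fi fd Gi fG; split => /=.
- apply: (@is_derive_under (fun t x => CRe (f t x)) (fun t x => CRe (f' t x)) G u v a) => //.
  + by move=> t tuv; case: (fi t tuv).
  + by move=> t x tuv; case: (fd t x tuv).
  + by move=> t x tuv; rewrite (le_trans (CRe_le_cabs _))// fG.
- apply: (@is_derive_under (fun t x => CIm (f t x)) (fun t x => CIm (f' t x)) G u v a) => //.
  + by move=> t tuv; case: (fi t tuv).
  + by move=> t x tuv; case: (fd t x tuv).
  + by move=> t x tuv; rewrite (le_trans (CIm_le_cabs _))// fG.
Qed.

(** The integral over [-n - 1, n + 1] is a difference of two boundary values, each at most C / (n +
    1) by the decay of [kap]. *)
Lemma Rintegral_derive0 (h h' : R -> R) (C : R) : (forall x, is_derive x (1 : R) h (h' x)) ->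
  continuous h' -> mu.-integrable setT (EFin \o h') -> (forall x, `|h x| <= C * kap x) ->
  \int[mu]_x h' x = 0.
Proof.
move=> hd ch' ih' hC.
have mh' : lmeas h' by exact: continuous_measurable_fun.
pose f_ (n : nat) x := \1_(`[- n.+1%:R, n.+1%:R]%classic : set (mR R)) x * h' x.
have cv : \int[mu]_x f_ n x @[n --> \oo] --> \int[mu]_x h' x.
  apply: (@Rintegral_dct _ setT f_ h' (fun x => `|h' x|)) => //.
  - move=> n; apply: (@measurable_funM _ (mR R)) => //.
  - move=> x _; apply: cvg_near_cst.
    near=> n; rewrite /f_ indicE mem_set ?mul1r//= in_itv/= -ler_norml.
    rewrite (@le_trans _ _ n%:R) ?ler_nat//; near: n; exact: nbhs_infty_ger.
  - exact: integrable_norm.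
  - by move=> n x _; rewrite normrM ler_piMl// indicE; case: (_ \in _); rewrite ?normr1 ?normr0.
have fE n : \int[mu]_x f_ n x = h n.+1%:R - h (- n.+1%:R).
  have lt : - n.+1%:R < n.+1%:R :> R by rewrite gtrN.
  have -> : \int[mu]_x f_ n x = \int[mu]_(x in `[- n.+1%:R, n.+1%:R]) h' x.
    rewrite [RHS]Rintegral_mkcond; apply: eq_Rintegral => x _.
    by rewrite /f_ patchE indicE; case: ifP => _; rewrite ?mul1r ?mul0r.
  rewrite /Rintegral (@continuous_FTC2 _ h' h) //.
  - exact: continuous_subspaceT.
  - split.
    + by move=> x _; case: (hd x).
    + by apply: cvg_at_right_filter; exact: (is_derive_cont (hd _)).
    + by apply: cvg_at_left_filter; exact: (is_derive_cont (hd _)).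
  - by move=> x _; rewrite derive1E; have := hd x => ?; rewrite derive_val.
have C0 : 0 <= C by rewrite -(pmulr_lge0 _ (kap_gt0 (0 : R))) (le_trans _ (hC 0)).
have cv0 : \int[mu]_x f_ n x @[n --> \oo] --> (0 : R).
  apply: norm_cvg0; apply: (@squeeze_cvgr _ _ _ _ (cst 0) (fun n => (2 * C) * n.+1%:R^-1)).
  - apply: nearW => n; rewrite normr_ge0/= fE (le_trans (ler_normB _ _))//.
    have kn (y : R) : y ^+ 2 = n.+1%:R ^+ 2 -> `|h y| <= C * n.+1%:R^-1.
      move=> ye; rewrite (le_trans (hC y))// ler_wpM2l// /kap ye lef_pV2 ?posrE//.
        by rewrite (@le_trans _ _ (n.+1%:R ^+ 2)) ?lerDr// -[leLHS]mulr1 expr2 ler_wpM2l// ler1n.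
    have -> : 2 * C / n.+1%:R = C / n.+1%:R + C / n.+1%:R by rewrite -mulrA mulrDl !mul1r.
    by rewrite lerD ?kn ?sqrrN.
  - exact: cvg_cst.
  - rewrite -[X in _ --> X](mulr0 (2 * C)); apply: cvgMr; exact: cvg_harmonic.
exact: (cvg_unique _ cv cv0).
Unshelve. all: by end_near. Qed.

End DiffUnder.

(** * The Schwartz space and its multipliers *)

Section Schwartz.
Variable R : realType.
Notation mu := (@lebesgue_measure R).
Notation D := (cderive (1 : R)).
Implicit Types (f g phi psi : R -> R[i]) (x : R).

Definition csmooth f := forall n x, exists l, cder (iter n D f) x l.

Lemma cder_D f x l : cder f x l -> cder f x (D f x).
Proof. by move=> h; rewrite (cderE h). Qed.

Lemma csmooth_cder f n x : csmooth f -> cder (iter n D f) x (iter n.+1 D f x).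
Proof. by move=> /(_ n x)[l] /cder_D. Qed.

Lemma derive_dir (h : R -> R) x (v : R) : derivable h x 1 ->
  derivable h x v /\ 'D_v h x = v * 'D_1 h x.
Proof.
move=> /derivable1_diffP hd; split; first exact: diff_derivable.
by rewrite !deriveE// -[in LHS](mulr1 v) -[v * 1]/(v *: (1 : R)) linearZ.
Qed.

(** On the line a directional derivative along v is v times the ordinary one, so the iterated
    derivative along vs is the ordinary derivative of order [size vs] times the product of vs. *)
Lemma smooth_onP f : smooth_on setT f <-> csmooth f.
Proof.
split=> [sf n x|sf vs x _].
  have E : foldr (@cderive R R) f (nseq n 1) = iter n D f by elim: n => //= n ->.
  by have [_ _ d1 d2] := sf (nseq n 1) x I; rewrite E in d1 d2; exists (D (iter n D f) x); exact: cderP.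
have E : foldr (@cderive R R) f vs = fun x => ((\prod_(v <- vs) v)%:C)%C * iter (size vs) D f x.
  elim: vs => [|v vs IH /=]; first by apply/funext => y; rewrite big_nil mul1r.
  rewrite IH; apply/funext => y; rewrite big_cons.
  have [l /(cderZ ((\prod_(v <- vs) v)%:C)%C) [h1 h2]] := sf (size vs) y.
  have [l' /cderE] := sf (size vs) y => El.
  have hc := cderE (conj h1 h2).
  have [l2 hl2] : exists l2, cder (iter (size vs) D f) y l2 by exact: sf.
  apply: cplxP; rewrite /cderive/=.
    have [h1d _] := h1; have [_ ->] := derive_dir v h1d.
    have -> : 'D_1 (fun y0 => CRe (((\prod_(v <- vs) v)%:C)%C * iter (size vs) D f y0)) y = CRe (((\prod_(v <- vs) v)%:C)%C * D (iter (size vs) D f) y).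
      have [q1 q2] := cderZ ((\prod_(v <- vs) v)%:C)%C (cder_D hl2).
      by rewrite derive_val.
    by rewrite !CE/=; ring.
  have [h2d _] := h2; have [_ ->] := derive_dir v h2d.
  have -> : 'D_1 (fun y0 => CIm (((\prod_(v <- vs) v)%:C)%C * iter (size vs) D f y0)) y = CIm (((\prod_(v <- vs) v)%:C)%C * D (iter (size vs) D f) y).
    have [q1 q2] := cderZ ((\prod_(v <- vs) v)%:C)%C (cder_D hl2).
    by rewrite derive_val.
  by rewrite !CE/=; ring.
rewrite /= E.
have [h1 h2] := cderZ ((\prod_(v <- vs) v)%:C)%C (csmooth_cder (size vs) x sf).
split.
- exact: (is_derive_cont h1).
- exact: (is_derive_cont h2).
- by move=> v; case: h1 => h1 _; case: (derive_dir v h1).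
- by move=> v; case: h2 => h2 _; case: (derive_dir v h2).
Qed.

Lemma seminorm_le m n phi (C : R) : (seminorm m n phi <= C%:E)%E <->
  (forall x, `|x| ^+ m * cabs (iter n D phi x) <= C).
Proof.
split=> [h x|h].
  rewrite -lee_fin (le_trans _ h)//; apply: ereal_sup_ubound; by exists x.
by apply: ge_ereal_sup => _ [x _ <-]; rewrite lee_fin.
Qed.

Lemma seminorm_ge0 m n phi : (0 <= seminorm m n phi)%E.
Proof.
apply: (@le_trans _ _ (`|0 : R| ^+ m * cabs (iter n D phi 0))%:E).
  by rewrite lee_fin mulr_ge0 ?cabs_ge0// exprn_ge0.
by apply: ereal_sup_ubound; exists 0.
Qed.

Lemma schwartzP phi : schwartz phi <-> csmooth phi /\
  forall m n, exists C, forall x, `|x| ^+ m * cabs (iter n D phi x) <= C.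
Proof.
split=> [[sm h]|[sm h]]; split; try exact/smooth_onP.
  move=> m n; exists (fine (seminorm m n phi)); apply/seminorm_le.
  by rewrite fineK// ge0_fin_numE ?seminorm_ge0.
by move=> m n; have [C /seminorm_le hC] := h m n; rewrite (le_lt_trans hC)// ltry.
Qed.

Lemma csmooth_coind (F : (R -> R[i]) -> Prop) :
  (forall f, F f -> exists2 f', F f' & forall x, cder f x (f' x)) ->
  forall f, F f -> csmooth f /\ forall n, F (iter n D f).
Proof.
move=> H f Ff.
have K n : F (iter n D f).
  elim: n => // n /H[f' Ff' h].
  by have -> : iter n.+1 D f = f' by apply/funext => x /=; rewrite (cderE (h x)).
by split=> // n x; have [f' _ h] := H _ (K n); exists (f' x).
Qed.

Lemma schwartz_coind (F : (R -> R[i]) -> Prop) :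
  (forall f, F f -> exists2 f', F f' & forall x, cder f x (f' x)) ->
  (forall f, F f -> forall m, exists C, forall x, `|x| ^+ m * cabs (f x) <= C) ->
  forall f, F f -> schwartz f.
Proof.
move=> H1 H2 f Ff; have [sf K] := csmooth_coind H1 Ff.
by apply/schwartzP; split => // m n; exact: H2.
Qed.

Lemma schwartz_cder phi x : schwartz phi -> cder phi x (D phi x).
Proof. by move=> /schwartzP[sm _]; exact: (csmooth_cder 0 x sm). Qed.

Lemma schwartz_D phi : schwartz phi -> schwartz (D phi).
Proof.
move=> /schwartzP[sm h]; apply/schwartzP; split.
  by move=> n x; rewrite -iterSr; exact: sm.
by move=> m n; rewrite -iterSr; exact: h.
Qed.

Lemma schwartz_iterD n phi : schwartz phi -> schwartz (iter n D phi).
Proof. by move=> h; elim: n => //= n; exact: schwartz_D. Qed.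

Lemma schwartz_bound phi : schwartz phi -> forall m, exists C, forall x, `|x| ^+ m * cabs (phi x) <= C.
Proof. by move=> /schwartzP[_ h] m; exact: (h m 0). Qed.

Lemma schwartz_kap phi : schwartz phi -> exists2 C, 0 <= C & forall x, cabs (phi x) <= C * kap x.
Proof.
move=> h; have [C0 h0] := schwartz_bound h 0; have [C2 h2] := schwartz_bound h 2.
have C0p : 0 <= C0 by rewrite (le_trans _ (h0 0))// mulr_ge0 ?cabs_ge0// exprn_ge0.
have C2p : 0 <= C2 by rewrite (le_trans _ (h2 0))// mulr_ge0 ?cabs_ge0// exprn_ge0.
exists (C0 + C2); first exact: addr_ge0.
move=> x; rewrite /kap ler_pdivlMr; last by rewrite ltr_wpDr// sqr_ge0.
rewrite mulrDr mulr1 lerD//; first by have := h0 x; rewrite expr0 mul1r.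
by have := h2 x; rewrite real_normK ?num_real// mulrC.
Qed.

Lemma schwartz_cmeas phi : schwartz phi -> lcmeas phi.
Proof. by move=> h; apply: (@cder_cmeas _ phi (D phi)) => x; exact: schwartz_cder. Qed.

Lemma integrable_Ckap (C : R) : mu.-integrable setT (EFin \o (fun x => C * kap x)).
Proof. by apply: integrable_rZl => //; exact: integrable_kap. Qed.

Lemma schwartz_cintegrable phi : schwartz phi -> cintegrable setT phi.
Proof.
move=> h; have [C _ hC] := schwartz_kap h.
apply: (cintegrable_dom measurableT (schwartz_cmeas h) (h := fun x => C * kap x)) => //.
exact: integrable_Ckap.
Qed.

Lemma schwartz_int_D phi : schwartz phi -> cintegral setT (D phi) = 0.
Proof.
move=> h; have [C _ hC] := schwartz_kap h.
have [i1 i2] := schwartz_cintegrable (schwartz_D h).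
have c1 : continuous (fun x => CRe (D phi x)).
  by move=> x; have [/is_derive_cont] := schwartz_cder x (schwartz_D h).
have c2 : continuous (fun x => CIm (D phi x)).
  by move=> x; have [_ /is_derive_cont] := schwartz_cder x (schwartz_D h).
apply: cplxP => /=.
- apply: (@Rintegral_derive0 _ (fun x => CRe (phi x)) _ C) => //.
  + by move=> x; case: (schwartz_cder x h).
  + by move=> x; rewrite (le_trans (CRe_le_cabs _)).
- apply: (@Rintegral_derive0 _ (fun x => CIm (phi x)) _ C) => //.
  + by move=> x; case: (schwartz_cder x h).
  + by move=> x; rewrite (le_trans (CIm_le_cabs _)).
Qed.

(** The multipliers of the Schwartz space: smooth functions all of whose derivatives grow at most
    polynomially. *)
Definition slow f := csmooth f /\ forall n, exists C m, forall x, cabs (iter n D f x) <= C * (1 + `|x|) ^+ m.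

Lemma slow_coind (F : (R -> R[i]) -> Prop) :
  (forall f, F f -> exists2 f', F f' & forall x, cder f x (f' x)) ->
  (forall f, F f -> exists C m, forall x, cabs (f x) <= C * (1 + `|x|) ^+ m) ->
  forall f, F f -> slow f.
Proof.
move=> H1 H2 f Ff; have [sf K] := csmooth_coind H1 Ff.
by split => // n; exact: H2.
Qed.

Lemma slow_D f : slow f -> slow (D f).
Proof.
move=> [sf h]; split=> [n x|n]; first by rewrite -iterSr; exact: sf.
by rewrite -iterSr; exact: h.
Qed.

(** By the product rule this class is closed under differentiation, which is what [schwartz_coind]
    asks for; it stands in for the Leibniz formula of order n. *)
Inductive schwartz_span : (R -> R[i]) -> Prop :=
| SSM f g : schwartz f -> slow g -> schwartz_span (fun x => f x * g x)
| SSD f g : schwartz_span f -> schwartz_span g -> schwartz_span (fun x => f x + g x).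

Lemma ler_1Dn (x : R) m : (1 + `|x|) ^+ m <= 2 ^+ m * (1 + `|x| ^+ m).
Proof.
have [x1|x1] := leP `|x| 1.
  rewrite (@le_trans _ _ (2 ^+ m))//; first by rewrite lerXn2r ?nnegrE ?addr_ge0// -[2]/(1 + 1) lerD2l.
  by rewrite ler_peMr ?exprn_ge0// lerDl exprn_ge0.
rewrite (@le_trans _ _ ((2 * `|x|) ^+ m))//.
  by rewrite lerXn2r ?nnegrE ?addr_ge0 ?mulr_ge0// mulr2n mulrDl !mul1r lerD2r ltW.
by rewrite exprMn ler_wpM2l ?exprn_ge0// lerDr.
Qed.

Lemma schwartz_span_schwartz f : schwartz_span f -> schwartz f.
Proof.
move: f; apply: schwartz_coind.
- move=> f; elim=> {f} [f g sf [sg hg]|f g _ [f' Ff' hf'] _ [g' Fg' hg']].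
  + exists (fun x => D f x * g x + f x * D g x).
      apply: SSD; first by apply: SSM => //; exact: schwartz_D.
      by apply: SSM => //; exact: slow_D.
    by move=> x; apply: cderM; [exact: schwartz_cder|exact: (csmooth_cder 0)].
  + exists (fun x => f' x + g' x); first exact: SSD.
    by move=> x; exact: cderD.
- move=> f; elim=> {f} [f g sf [sg hg] m|f g _ IHf _ IHg m].
  + have [C [k hC]] := hg 0%N.
    have [A hA] := schwartz_bound sf m; have [B hB] := schwartz_bound sf (m + k).
    have C0 : 0 <= C by have := hC 0; rewrite normr0 addr0 expr1n mulr1; apply: le_trans; exact: cabs_ge0.
    exists (C * 2 ^+ k * (A + B)) => x.
    rewrite cabsM mulrA (@le_trans _ _ (`|x| ^+ m * cabs (f x) * (C * (2 ^+ k * (1 + `|x| ^+ k)))))//.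
      rewrite ler_wpM2l ?mulr_ge0 ?cabs_ge0// (le_trans (hC x))//.
      by rewrite ler_wpM2l// ler_1Dn.
    rewrite (_ : _ * _ = C * 2 ^+ k * (`|x| ^+ m * cabs (f x) + `|x| ^+ (m + k) * cabs (f x))); last first.
      by rewrite exprD; ring.
    by rewrite ler_wpM2l ?mulr_ge0 ?exprn_ge0// lerD.
  + have [A hA] := IHf m; have [B hB] := IHg m; exists (A + B) => x.
    rewrite (@le_trans _ _ (`|x| ^+ m * (cabs (f x) + cabs (g x))))//.
      by rewrite ler_wpM2l ?exprn_ge0// cabsD.
    by rewrite mulrDr lerD.
Qed.

Lemma schwartzM f g : schwartz f -> slow g -> schwartz (fun x => f x * g x).
Proof. by move=> sf sg; apply: schwartz_span_schwartz; exact: SSM. Qed.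

Lemma slow_cst (c : R[i]) : slow (fun=> c).
Proof.
apply: (@slow_coind (fun f => exists c, f = fun=> c)); last by exists c.
- by move=> _ [a ->]; exists (fun=> 0); [by exists 0|move=> x; exact: cder_cst].
- by move=> _ [a ->]; exists (cabs a), 0%N => x; rewrite mulr1.
Qed.

Lemma schwartzD f g : schwartz f -> schwartz g -> schwartz (fun x => f x + g x).
Proof.
move=> sf sg; apply: schwartz_span_schwartz.
have := SSD (SSM sf (slow_cst 1)) (SSM sg (slow_cst 1)).
by congr schwartz_span; apply/funext => x; rewrite !mulr1.
Qed.
Lemma schwartzZ (c : R[i]) f : schwartz f -> schwartz (fun x => c * f x).
Proof.
move=> sf; have := schwartzM sf (slow_cst c).
by congr schwartz; apply/funext => x; rewrite mulrC.
Qed.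
Lemma schwartzB f g : schwartz f -> schwartz g -> schwartz (fun x => f x - g x).
Proof.
move=> sf sg; have := schwartzD sf (schwartzZ (-1) sg).
by congr schwartz; apply/funext => x; rewrite mulN1r.
Qed.
Lemma schwartz0 : schwartz (fun _ : R => 0 : R[i]).
Proof.
apply: (@schwartz_coind (fun f => f = fun=> 0)) => // [_ ->|_ -> m].
  by exists (fun=> 0) => // x; exact: cder_cst.
by exists 0 => x; rewrite cabs0 mulr0.
Qed.
Lemma schwartz_sum I (r : seq I) (F : I -> R -> R[i]) : (forall i, schwartz (F i)) ->
  schwartz (fun x => \sum_(i <- r) F i x).
Proof.
move=> h; elim: r => [|i r IH].
  by under [X in schwartz X]eq_fun do rewrite big_nil; exact: schwartz0.
by under [X in schwartz X]eq_fun do rewrite big_cons; exact: schwartzD.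
Qed.

Lemma slow_id : slow (fun x => (x%:C)%C : R[i]).
Proof.
apply: (@slow_coind (fun f => f = (fun x => (x%:C)%C) \/ exists c, f = fun=> c)); last by left.
- move=> f [->|[c ->]].
  + by exists (fun=> 1); [by right; exists 1|move=> x; exact: cder_id].
  + by exists (fun=> 0); [by right; exists 0|move=> x; exact: cder_cst].
- move=> f [->|[c ->]].
  + by exists 1, 1%N => x; rewrite mul1r expr1 cabs_real lerDr.
  + by exists (cabs c), 0%N => x; rewrite mulr1.
Qed.

Lemma slow_expi (a : R) : slow (fun x => expi (a * x)).
Proof.
apply: (@slow_coind (fun f => exists c : R[i], f = fun x => c * expi (a * x))).
- move=> _ [c ->]; exists (fun x => (c * (0 +i* a)%C) * expi (a * x)).
    by exists (c * (0 +i* a)%C).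
  move=> x; rewrite -mulrA; apply: cderZ; apply: cder_expi.
  apply: (is_derive_ext (is_derive_aff a 0 x)) => //.
  by apply/funext => y; rewrite addr0.
- by move=> _ [c ->]; exists (cabs c), 0%N => x; rewrite mulr1 cabsM cabs_expi mulr1.
- by exists 1; apply/funext => x; rewrite mul1r.
Qed.

Lemma schwartz_neg f : schwartz f -> schwartz (fun x => f (- x)).
Proof.
move=> sf; apply: (@schwartz_coind (fun g => exists2 f, schwartz f & g = fun x => f (- x))); last by exists f.
- move=> _ [h sh ->]; exists (fun x => - D h (- x)).
    exists (fun x => (-1) * D h x); first by apply: schwartzZ; exact: schwartz_D.
    by apply/funext => x; rewrite mulN1r.
  move=> x; have hx := schwartz_cder (- x) sh.
  have hd : is_derive x (1 : R) (fun y => - y) (-1).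
    apply: (is_derive_ext (is_derive_aff (-1) 0 x)) => //.
    by apply/funext => y; rewrite addr0 mulN1r.
  apply: (cder_ext (cder_comp hx hd)) => //.
  by apply: cplxP; rewrite !CE/=; ring.
- move=> _ [h sh ->] m; have [C hC] := schwartz_bound sh m.
  by exists C => x; rewrite -normrN.
Qed.

End Schwartz.

(** * Gaussians with complex exponent *)

Section Gaussian.
Variable R : realType.
Notation mu := (@lebesgue_measure R).
Notation D := (cderive (1 : R)).

Lemma is_derive_expR_comp (h : R -> R) x a : is_derive x (1 : R) h a ->
  is_derive x (1 : R) (fun y => expR (h y)) (expR (h x) * a).
Proof. by move=> hd; apply: (is_derive_ext (is_derive1_comp (is_derive_expR (h x)) hd)). Qed.

(** The function exp(-(b1 + i b2) x^2); a nonzero b2 occurs in the free Schroedinger evolution. *)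
Definition cgauss (b1 b2 : R) (x : R) : R[i] := ((expR (- (b1 * x ^+ 2)))%:C)%C * expi (- (b2 * x ^+ 2)).

Lemma is_derive_quad (b x : R) : is_derive x (1 : R) (fun y => - (b * y ^+ 2)) (- (2 * b * x)).
Proof.
have h := is_deriveM (is_derive_cst (- b) x (1 : R)) (is_deriveX 2 (is_derive_id x (1 : R))).
apply: (is_derive_ext h).
  by apply/funext => y; rewrite -mulNr.
by rewrite /GRing.scale/=; ring.
Qed.

Lemma cder_cgauss b1 b2 x : cder (cgauss b1 b2) x (((-2)%:C)%C * ((b1 +i* b2)%C * ((x%:C)%C * cgauss b1 b2 x))).
Proof.
have h1 := cder_real (is_derive_expR_comp (is_derive_quad b1 x)).
have h2 := cder_expi (is_derive_quad b2 x).
apply: (cder_ext (cderM h1 h2)) => //.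
by rewrite /cgauss; apply: cplxP; rewrite !CE/=; ring.
Qed.

Lemma cabs_cgauss b1 b2 x : cabs (cgauss b1 b2 x) = expR (- (b1 * x ^+ 2)).
Proof. by rewrite cabsM cabs_expi mulr1 cabs_real ger0_norm ?expR_ge0. Qed.

Lemma pow_expR_bound (b : R) m : 0 < b -> exists C, forall x : R, `|x| ^+ m * expR (- (b * x ^+ 2)) <= C.
Proof.
move=> b0; case: m => [|m].
  by exists 1 => x; rewrite expr0 mul1r -expR0 ler_expR oppr_le0 mulr_ge0 ?sqr_ge0// ltW.
(* Chosen so that K (1 + b x^2 / (m + 1)) contains 1 + x^2, which exceeds |x|. The inequality 1 + t
   <= exp t and the power m + 1 then give the bound. *)
set K := 1 + m.+1%:R / b.
have K0 : 0 <= K by rewrite addr_ge0// divr_ge0// ltW.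
exists (K ^+ m.+1) => x.
have h : `|x| <= K * expR (b * x ^+ 2 / m.+1%:R).
  apply: (@le_trans _ _ (K * (1 + b * x ^+ 2 / m.+1%:R))); last by rewrite ler_wpM2l// expR_ge1Dx.
  have -> : K * (1 + b * x ^+ 2 / m.+1%:R) = 1 + x ^+ 2 + m.+1%:R / b + b * x ^+ 2 / m.+1%:R.
    have M0 : m.+1%:R != 0 :> R by rewrite pnatr_eq0.
    have b0' : b != 0 by rewrite gt_eqF.
    by rewrite /K; move: (m.+1%:R) M0 => M M0; field; rewrite M0 b0'.
  have A1 : `|x| <= 1 + x ^+ 2.
    rewrite -(real_normK (num_real x)).
    have : 0 <= (`|x| - 1) ^+ 2 by exact: sqr_ge0.
    have := normr_ge0 x; nra.
  have A2 : 0 <= m.+1%:R / b by rewrite divr_ge0// ltW.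
  have A3 : 0 <= b * x ^+ 2 / m.+1%:R by rewrite divr_ge0// mulr_ge0 ?sqr_ge0// ltW.
  by rewrite -addrA ler_wpDr// addr_ge0.
rewrite expRN ler_pdivrMr ?expR_gt0//.
have -> : expR (b * x ^+ 2) = expR (b * x ^+ 2 / m.+1%:R) ^+ m.+1.
  by rewrite -expRM_natr divfK// pnatr_eq0.
by rewrite -exprMn lerXn2r ?nnegrE ?mulr_ge0 ?expR_ge0.
Qed.

(** Polynomials times one Gaussian, generated so that closure under differentiation is visible. *)
Inductive gauss_span b1 b2 : (R -> R[i]) -> Prop :=
| GSg : gauss_span b1 b2 (cgauss b1 b2)
| GSx f : gauss_span b1 b2 f -> gauss_span b1 b2 (fun x => (x%:C)%C * f x)
| GSc c f : gauss_span b1 b2 f -> gauss_span b1 b2 (fun x => c * f x)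
| GSD f g : gauss_span b1 b2 f -> gauss_span b1 b2 g -> gauss_span b1 b2 (fun x => f x + g x).

Lemma schwartz_gauss b1 b2 : 0 < b1 -> schwartz (cgauss b1 b2).
Proof.
move=> b0; apply: (@schwartz_coind _ (gauss_span b1 b2)); last exact: GSg.
- move=> f; elim=> {f} [|f Ff [f' Ff' hf]|c f Ff [f' Ff' hf]|f g Ff [f' Ff' hf] Fg [g' Fg' hg]].
  + exists (fun x => ((-2)%:C)%C * ((b1 +i* b2)%C * ((x%:C)%C * cgauss b1 b2 x))).
      by do 3 constructor; exact: GSg.
    exact: cder_cgauss.
  + exists (fun x => 1 * f x + (x%:C)%C * f' x); first by apply: GSD; [exact: GSc|exact: GSx].
    by move=> x; apply: cderM => //; exact: cder_id.
  + by exists (fun x => c * f' x); [exact: GSc|move=> x; exact: cderZ].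
  + by exists (fun x => f' x + g' x); [exact: GSD|move=> x; exact: cderD].
- move=> f; elim=> {f} [|f Ff IH|c f Ff IH|f g Ff IHf Fg IHg] m.
  + have [C hC] := pow_expR_bound m b0; exists C => x; by rewrite cabs_cgauss.
  + have [C hC] := IH m.+1; exists C => x; by rewrite cabsM cabs_real mulrA -exprSr.
  + have [C hC] := IH m; exists (cabs c * C) => x.
    by rewrite cabsM mulrCA ler_wpM2l ?cabs_ge0.
  + have [A hA] := IHf m; have [B hB] := IHg m; exists (A + B) => x.
    rewrite (@le_trans _ _ (`|x| ^+ m * (cabs (f x) + cabs (g x))))//.
      by rewrite ler_wpM2l ?exprn_ge0// cabsD.
    by rewrite mulrDr lerD.
Qed.

Lemma Rintegral_gauss (b : R) : 0 < b -> \int[mu]_x expR (- (b * x ^+ 2)) = Num.sqrt (pi / b).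
Proof.
move=> b0; have sb : 0 < (Num.sqrt b)^-1 by rewrite invr_gt0 sqrtr_gt0.
have mg : lmeas (fun x : mR R => expR (- (b * x ^+ 2))).
  apply: (measurableT_comp (@measurable_expR R)).
  apply: (@measurableT_comp _ _ _ _ (mR R)) => //.
  by apply: (@measurable_funM _ (mR R)) => //; exact: measurable_funX.
rewrite (Rintegral_aff 0 sb mg).
have -> : \int[mu]_x expR (- (b * ((Num.sqrt b)^-1 * x + 0) ^+ 2)) = \int[mu]_x gauss_fun x.
  apply: eq_Rintegral => x _; rewrite /gauss_fun addr0 exprMn exprVn sqr_sqrtr ?ltW// mulrA mulfV ?gt_eqF// mul1r//.
by rewrite /Rintegral integralT_gauss/= sqrtrM ?pi_ge0// sqrtrV ?ltW// mulrC.
Qed.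
End Gaussian.

Section Limits.
Variable R : realType.

Lemma realCM (a b : R) : ((a * b)%:C)%C = (a%:C)%C * (b%:C)%C :> R[i].
Proof. by apply: cplxP; rewrite !CE/=; ring. Qed.
Lemma realCVK (a : R) : a != 0 -> ((a^-1)%:C)%C * (a%:C)%C = 1 :> R[i].
Proof. by move=> a0; rewrite -realCM mulVf. Qed.

Lemma cder_cvg_seq (f : R -> R[i]) x l (u : nat -> R) : cder f x l -> u n @[n --> \oo] --> x ->
  cabs (f (u n) - f x) @[n --> \oo] --> (0 : R).
Proof.
move=> [/is_derive_cont f1 /is_derive_cont f2] ux; apply: cvg_cabs.
- exact: (cvg_comp _ _ ux f1).
- exact: (cvg_comp _ _ ux f2).
Qed.

Lemma cabs_lim_uniq (u : nat -> R[i]) (l k : R[i]) : cabs (u n - l) @[n --> \oo] --> (0 : R) ->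
  cabs (u n - k) @[n --> \oo] --> (0 : R) -> l = k.
Proof.
move=> /cabs_cvg[l1 l2] /cabs_cvg[k1 k2]; apply: cplxP.
- exact: (cvg_unique _ l1 k1).
- exact: (cvg_unique _ l2 k2).
Qed.
End Limits.

(** * Fourier transform and inversion on Schwartz functions *)

Section Fourier.
Variable R : realType.
Notation mu := (@lebesgue_measure R).
Notation D := (cderive (1 : R)).
Implicit Types (phi psi : R -> R[i]).

Let c : R := (Num.sqrt (2 * pi))^-1.

Lemma fourier_c_gt0 : 0 < c.
Proof. by rewrite invr_gt0 sqrtr_gt0 mulr_gt0// pi_gt0. Qed.

Lemma schwartz_expiM (t : R) phi : schwartz phi -> schwartz (fun x => expi (- (x * t)) * phi x).
Proof.
move=> h; have := schwartzM h (slow_expi (- t)).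
by congr schwartz; apply/funext => x; rewrite mulrC mulNr (mulrC t).
Qed.

Lemma schwartz_mulx phi : schwartz phi -> schwartz (fun x => (x%:C)%C * phi x).
Proof.
move=> h; have := schwartzM h (@slow_id R).
by congr schwartz; apply/funext => x; rewrite mulrC.
Qed.

Lemma fourier_cder phi t : schwartz phi ->
  cder (fourier phi) t (fourier (fun x => (0 +i* (-1))%C * ((x%:C)%C * phi x)) t).
Proof.
move=> h; have [C C0 hC] := schwartz_kap (schwartz_mulx h).
rewrite /fourier; apply: cderZ.
apply: (@cder_under R (fun t x => expi (- (x * t)) * phi x)
  (fun t x => expi (- (x * t)) * ((0 +i* (-1))%C * ((x%:C)%C * phi x))) (fun x => C * kap x) (t - 1) (t + 1)).
- by rewrite ltrBlDr ltrDl ltr01.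
- by move=> y _; apply: schwartz_cintegrable; exact: schwartz_expiM.
- move=> y x _.
  have hd : is_derive y (1 : R) (fun z => - (x * z)) (- x).
    by apply: (is_derive_ext (is_derive_aff (- x) 0 y)) => //; apply/funext => z; rewrite addr0 mulNr.
  apply: (cder_ext (cderM (cder_expi hd) (cder_cst (phi x) y))) => //.
  by apply: cplxP; rewrite !CE/=; ring.
- exact: integrable_Ckap.
- move=> y x _; rewrite cabsM cabs_expi mul1r cabsM.
  have -> : cabs (0 +i* (-1) : R[i])%C = 1 by rewrite cabsE/= expr0n sqrrN expr1n add0r sqrtr1.
  by rewrite mul1r.
Qed.

Lemma fourier_D phi t : schwartz phi -> fourier (D phi) t = (0 +i* t)%C * fourier phi t.
Proof.
move=> h; rewrite /fourier mulrCA; congr (_ * _).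
have hs := schwartz_expiM t h.
have E : D (fun x => expi (- (x * t)) * phi x) =
    fun x => (- (0 +i* t)%C) * (expi (- (x * t)) * phi x) + expi (- (x * t)) * D phi x.
  apply/funext => x; apply: cderE.
  have hd : is_derive x (1 : R) (fun z => - (z * t)) (- t).
    by apply: (is_derive_ext (is_derive_aff (- t) 0 x)) => //; apply/funext => z; rewrite addr0 mulNr mulrC.
  apply: (cder_ext (cderM (cder_expi hd) (schwartz_cder x h))) => //.
  by apply: cplxP; rewrite !CE/=; ring.
have := schwartz_int_D hs; rewrite E cintegralD//; last 2 first.
- by apply: cintegrableZ => //; exact: schwartz_cintegrable.
- by apply: schwartz_cintegrable; apply: schwartz_expiM; exact: schwartz_D.
rewrite cintegralZ//; last exact: schwartz_cintegrable.
by move/eqP; rewrite mulNr addrC subr_eq0 => /eqP.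
Qed.

Lemma fourier_bound phi (C : R) t : lcmeas phi -> (forall x, cabs (phi x) <= C * kap x) ->
  cabs (fourier phi t) <= c * (C * pi).
Proof.
move=> mphi hC; rewrite /fourier cabsM cabs_real ger0_norm ?(ltW fourier_c_gt0)//.
rewrite ler_wpM2l ?(ltW fourier_c_gt0)//.
rewrite (@le_trans _ _ (\int[mu]_x (C * kap x)))//.
  apply: cabs_cintegral_le => //; last exact: integrable_Ckap.
    apply: cmeasM => //; apply: cmeas_expi.
    apply: (@measurableT_comp _ _ _ _ (mR R)) => //.
    by apply: (@measurable_funM _ (mR R)) => //; exact: measurable_cst.
  by move=> x _; rewrite cabsM cabs_expi mul1r.
by rewrite RintegralZl ?Rintegral_kap//; exact: integrable_kap.
Qed.

Lemma fourier_iterD m phi t : schwartz phi ->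
  fourier (iter m D phi) t = (0 +i* t)%C ^+ m * fourier phi t.
Proof.
move=> h; elim: m => [|m IH]; first by rewrite mul1r.
by rewrite iterS fourier_D ?IH ?mulrA -?exprS//; exact: schwartz_iterD.
Qed.

Lemma fourier_schwartz phi : schwartz phi -> schwartz (fourier phi).
Proof.
move=> h; apply: (@schwartz_coind _ (fun g => exists2 f, schwartz f & g = fourier f)); last by exists phi.
- move=> _ [f sf ->]; exists (fourier (fun x => (0 +i* (-1))%C * ((x%:C)%C * f x))).
    by exists (fun x => (0 +i* (-1))%C * ((x%:C)%C * f x)) => //; apply: schwartzZ; exact: schwartz_mulx.
  by move=> t; exact: fourier_cder.
- move=> _ [f sf ->] m; have sd := schwartz_iterD m sf.
  have [C C0 hC] := schwartz_kap sd; exists (c * (C * pi)) => t.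
  rewrite (le_trans _ (fourier_bound t (schwartz_cmeas sd) hC))// fourier_iterD// cabsM cabsX.
  by rewrite cabsE/= expr0n add0r sqrtr_sqr.
Qed.

Lemma ifourierE phi t : ifourier phi t = fourier phi (- t).
Proof. by rewrite /ifourier /fourier; congr (_ * _); apply: eq_cintegral => x _; congr (expi _ * _); ring. Qed.

Lemma ifourier_schwartz phi : schwartz phi -> schwartz (ifourier phi).
Proof.
move=> h; have := schwartz_neg (fourier_schwartz h).
by congr schwartz; apply/funext => t; rewrite ifourierE.
Qed.

(** The transform y of the Gaussian satisfies y' = -t y and y(0) = 1, as does the Gaussian itself:
    its product with exp(t^2 / 2) is constant. *)
Lemma fourier_gauss t : fourier (cgauss 2^-1 (0 : R)) t = cgauss 2^-1 0 t.
Proof.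
have h : (0 : R) < 2^-1 by [].
have sg := schwartz_gauss (0 : R) h.
set g := cgauss 2^-1 0; set y := fourier g.
have yd t' : cder y t' (- (t'%:C)%C * y t').
  have := fourier_cder t' sg.
  have E : (fun x => (0 +i* (-1))%C * ((x%:C)%C * g x)) = fun x => (0 +i* 1)%C * D g x.
    apply/funext => x; rewrite (cderE (cder_cgauss 2^-1 0 x)).
    by apply: cplxP; rewrite !CE/=; field.
  rewrite -/g E; have -> : fourier (fun x => (0 +i* 1)%C * D g x) t' = (0 +i* 1)%C * fourier (D g) t'.
    rewrite /fourier mulrCA; congr (_ * _); rewrite -cintegralZ//.
      by apply: eq_cintegral => x _; rewrite mulrCA.
    by apply: schwartz_cintegrable; apply: schwartz_expiM; exact: schwartz_D.
  rewrite fourier_D// mulrA => hh; apply: (cder_ext hh) => //.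
  by congr (_ * _); apply: cplxP; rewrite !CE/=; ring.
pose e (x : R) : R[i] := ((expR (x ^+ 2 / 2))%:C)%C.
have ed x : cder e x ((x%:C)%C * e x).
  have := cder_real (is_derive_expR_comp (is_derive_quad (- 2^-1) x)).
  move=> hh; apply: (cder_ext hh).
    by apply/funext => z; rewrite /e /=; congr (((expR _)%:C)%C); field.
  rewrite /e; apply: cplxP; rewrite !CE/= ?mul0r ?mulr0 ?subr0 ?addr0// mulrC; congr (_ * expR _); by field.
have zd x : cder (fun x => y x * e x) x 0.
  by apply: (cder_ext (cderM (yd x) (ed x))) => //; ring.
have zc x : y x * e x = y 0 * e 0.
  have rc (k : R -> R) : (forall x, is_derive x (1 : R) k 0) -> k x = k 0.
    by move=> hd; apply: is_derive_0_is_cst.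
  by apply: cplxP; [apply: (rc (fun x => CRe (y x * e x))) => z; case: (zd z)
    |apply: (rc (fun x => CIm (y x * e x))) => z; case: (zd z)].
have y0 : y 0 = 1.
  rewrite /y /fourier.
  have -> : cintegral setT (fun x => expi (- (x * 0)) * g x) = ((Num.sqrt (2 * pi))%:C)%C.
    apply: cplxP => /=.
      rewrite -[RHS](_ : Num.sqrt (pi / 2^-1) = _); last by rewrite invrK mulrC.
      rewrite -(Rintegral_gauss h); apply: eq_Rintegral => x _.
      by rewrite ?CE/= !mulr0 !mul0r !oppr0 cos0 sin0; ring.
    transitivity (\int[mu]_x (0 : R)); last by rewrite Rintegral_cst// mul0r.
    apply: eq_Rintegral => x _.
    by rewrite ?CE/= !mulr0 !mul0r !oppr0 cos0 sin0; ring.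
  apply: cplxP; rewrite !CE/= ?mulr0 ?mul0r ?subr0 ?addr0//.
  by rewrite mulVf// sqrtr_eq0 -ltNge mulr_gt0// pi_gt0.
have e0 : e 0 = 1 by rewrite /e expr0n mul0r expR0.
have := zc t; rewrite y0 e0 mulr1 => ht.
have gt : g t * e t = 1.
  rewrite /g /cgauss /e; apply: cplxP; rewrite !CE/= mul0r oppr0 cos0 sin0.
    by rewrite !mulr0 !mulr1 !subr0 -expRD mulrC addNr expR0.
  by ring.
have e1 : e t != 0 by apply/eqP => et; move: gt; rewrite et mulr0 => /eqP; rewrite eq_sym oner_eq0.
by apply: (mulIf e1); rewrite ht gt.
Qed.

Lemma fourier_gauss_int t : cintegral setT (fun x => expi (- (x * t)) * cgauss 2^-1 (0 : R) x) =
  ((Num.sqrt (2 * pi))%:C)%C * cgauss 2^-1 0 t.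
Proof.
rewrite -fourier_gauss /fourier mulrA.
have -> : ((Num.sqrt (2 * pi))%:C)%C * (((Num.sqrt (2 * pi))^-1)%:C)%C = 1 :> R[i]; last by rewrite mul1r.
apply: cplxP; rewrite !CE/= ?mulr0 ?mul0r ?subr0 ?addr0//.
by rewrite mulfV// sqrtr_eq0 -ltNge mulr_gt0// pi_gt0.
Qed.

(** The inversion integral is regularised by a factor g(d xi), with g a Gaussian and d tending to 0.
    Fubini and the known transform of g turn the regularised integral into the integral of g(s)
    phi(d s + x), which tends to phi x times the mass of g. *)
Lemma ifourierK phi : schwartz phi -> ifourier (fourier phi) = phi.
Proof.
move=> h; apply/funext => x.
set g := cgauss 2^-1 (0 : R); have sg : schwartz g by exact: schwartz_gauss.
have [C C0 hC] := schwartz_kap h.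
have [A A0 hA] := schwartz_kap (fourier_schwartz h).
have [B B0 hB] := schwartz_kap sg.
have mphi := schwartz_cmeas h; have mg := schwartz_cmeas sg.
have mF := schwartz_cmeas (fourier_schwartz h).
pose d (n : nat) : R := n.+1%:R^-1.
have d0 n : 0 < d n by rewrite invr_gt0.
have dc : d n @[n --> \oo] --> (0 : R) by exact: cvg_harmonic.
clearbody d.
have dcy y : d n * y @[n --> \oo] --> (0 : R) by rewrite -[X in _ --> X](mul0r y); exact: cvgMl.
have g1 y : cabs (g y) <= 1.
  by rewrite cabs_cgauss -expR0 ler_expR oppr_le0 mulr_ge0 ?sqr_ge0// invr_ge0.
have g0 : g 0 = 1 by rewrite /g /cgauss expr0n !mulr0 oppr0 expR0 expi0 mulr1.
have gder := cder_cgauss 2^-1 (0 : R) 0; rewrite -/g in gder.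
have gint := fourier_gauss_int; rewrite -/g in gint.
clearbody g.
have mlin (l : R) : measurable_fun setT (fun x : mR R => l * x).
  by apply: (@measurable_funM _ (mR R)) => //; exact: measurable_cst.
have mexp (l : R) : lcmeas (fun y : mR R => expi (l * y) : R[i]) by apply: cmeas_expi; exact: mlin.
have mgd (l : R) : lcmeas (fun y : mR R => g (l * y)) by apply: (cmeas_comp (mlin l)).
pose P n := cintegral setT (fun xi => g (d n * xi) * (expi (x * xi) * fourier phi xi)).
pose L1 := cintegral setT (fun xi => expi (x * xi) * fourier phi xi).
have c1 : cabs (P n - L1) @[n --> \oo] --> (0 : R).
  apply: (@cintegral_dct _ setT _ _ (fun xi => A * kap xi)) => //.
  - by move=> n; apply: cmeasM => //; apply: cmeasM.
  - exact: cmeasM.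
  - move=> y _; have := cder_cvg_seq gder (dcy y); rewrite g0 => cg.
    have -> : (fun n => cabs (g (d n * y) * (expi (x * y) * fourier phi y) - expi (x * y) * fourier phi y)) =
       (fun n => cabs (g (d n * y) - 1) * cabs (expi (x * y) * fourier phi y)).
      by apply/funext => n; rewrite -cabsM mulrBl mul1r.
    by rewrite -[X in _ --> X](mul0r (cabs (expi (x * y) * fourier phi y))); exact: cvgMl.
  - exact: integrable_Ckap.
  - by move=> n y _; rewrite cabsM (cabsM (expi _)) cabs_expi mul1r (le_trans _ (hA y))// ler_piMl ?cabs_ge0.
have PE n : P n = cintegral setT (fun s => g s * phi (d n * s + x)).
  pose f (z : mR R * mR R) : R[i] := (g (d n * z.1) * expi (x * z.1)) * (expi (- (z.2 * z.1)) * phi z.2).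
  have mf : cmeas f.
    apply: cmeasM; first apply: cmeasM.
    - exact: (cmeas_comp (measurable_fst) (mgd (d n))).
    - exact: (cmeas_comp (measurable_fst) (mexp x)).
    apply: cmeasM; last exact: (cmeas_comp (measurable_snd) mphi).
    apply: cmeas_expi.
    have mm : measurable_fun setT (fun z : mR R * mR R => z.2 * z.1).
      by apply: measurable_funM; [exact: measurable_snd|exact: measurable_fst].
    exact: (measurable_funN mm).
  have igd : mu.-integrable setT (EFin \o (fun xi => B * kap (d n * xi + 0))).
    by apply: integrable_rZl => //; apply: integrable_aff => //; exact: integrable_kap.
  have := cfubini mf igd (integrable_Ckap C).
  have dom : forall xi y, cabs (f (xi, y)) <= B * kap (d n * xi + 0) * (C * kap y).
    by move=> xi y; rewrite /f/= !cabsM !cabs_expi mulr1 mul1r addr0 ler_pM// ?cabs_ge0.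
  move=> /(_ dom) E.
  have -> : P n = (c%:C)%C * cintegral setT (fun xi => cintegral setT (fun y => f (xi, y))).
    have II := cintegrable_param mf igd (integrable_Ckap C) dom.
    rewrite -(cintegralZ (c%:C)%C measurableT II).
    apply: eq_cintegral => xi _; rewrite /f/= /fourier -/c.
    have ie := schwartz_cintegrable (schwartz_expiM xi h).
    by rewrite (cintegralZ _ measurableT ie); ring.
  rewrite E.
  have inner y : cintegral setT (fun xi => f (xi, y)) =
      phi y * (((d n)^-1 * Num.sqrt (2 * pi))%:C)%C * g ((y - x) / d n).
    rewrite /f/=.
    have -> : cintegral setT (fun xi => g (d n * xi) * expi (x * xi) * (expi (- (y * xi)) * phi y)) =
        phi y * cintegral setT (fun xi => expi (- ((d n * xi) * ((y - x) / d n))) * g (d n * xi)).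
      have II : cintegrable setT (fun xi => expi (- ((d n * xi) * ((y - x) / d n))) * g (d n * xi)).
        apply: (@cintegrable_dom R setT _ (fun xi => B * kap (d n * xi + 0)) measurableT _ _ igd).
          apply: cmeasM; last exact: mgd.
          apply: cmeas_expi; apply: (@measurable_funN _ (mR R)).
          by apply: (@measurable_funM _ (mR R)); [exact: mlin|exact: measurable_cst].
        by move=> xi _; rewrite cabsM cabs_expi mul1r addr0.
      rewrite -(cintegralZ (phi y) measurableT II); apply: eq_cintegral => xi _.
      have -> : - (d n * xi * ((y - x) / d n)) = x * xi + - (y * xi) by field; rewrite gt_eqF.
      by rewrite expiD; ring.
    have := @cintegral_scale _ (d n) (fun eta => expi (- (eta * ((y - x) / d n))) * g eta) (d0 n).
    rewrite gint => H.
    have {}H := H (schwartz_cmeas (schwartz_expiM _ sg)).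
    rewrite -!mulrA; apply: (congr1 (fun w => phi y * w)).
    have dC : ((d n)^-1%:C)%C * ((d n)%:C)%C = 1 :> R[i].
      by apply: realCVK; rewrite gt_eqF.
    have -> : (((d n)^-1 * Num.sqrt (2 * pi))%:C)%C = ((d n)^-1%:C)%C * ((Num.sqrt (2 * pi))%:C)%C :> R[i].
      exact: realCM.
    by rewrite -mulrA H mulrA dC mul1r.
  have -> : cintegral setT (fun y => cintegral setT (fun xi => f (xi, y))) =
      cintegral setT (fun y => phi y * (((d n)^-1 * Num.sqrt (2 * pi))%:C)%C * g ((y - x) / d n)).
    by apply: eq_cintegral => y _; exact: inner.
  clear mf dom igd E inner f.
  have I2 : cintegrable setT (fun y => phi y * (((d n)^-1 * Num.sqrt (2 * pi))%:C)%C * g ((y - x) / d n)).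
    apply: (@cintegrable_dom R setT _ (fun y => (C * ((d n)^-1 * Num.sqrt (2 * pi))) * kap y) measurableT _ _ (integrable_Ckap _)).
    - apply: cmeasM; first by apply: cmeasM => //; exact: cmeas_cst.
      apply: (cmeas_comp _ mg); apply: (@measurable_funM _ (mR R)); last exact: measurable_cst.
      by apply: (@measurable_funB _ (mR R)) => //; exact: measurable_cst.
    - move=> y _; rewrite !cabsM cabs_real ger0_norm; last by rewrite mulr_ge0 ?sqrtr_ge0// ltW// invr_gt0.
      rewrite (@le_trans _ _ (cabs (phi y) * ((d n)^-1 * Num.sqrt (2 * pi))))//.
        by rewrite ler_piMr// mulr_ge0 ?cabs_ge0// mulr_ge0 ?sqrtr_ge0// ltW// invr_gt0.
      by rewrite mulrAC ler_wpM2r// mulr_ge0 ?sqrtr_ge0// ltW// invr_gt0.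
  rewrite -(cintegralZ (c%:C)%C measurableT I2).
  have mH : lcmeas (fun y : mR R => phi y * g ((y - x) / d n)).
    apply: cmeasM => //; apply: (cmeas_comp _ mg); apply: (@measurable_funM _ (mR R)); last exact: measurable_cst.
    by apply: (@measurable_funB _ (mR R)) => //; exact: measurable_cst.
  transitivity (((d n)^-1%:C)%C * cintegral setT (fun y => phi y * g ((y - x) / d n))).
    have I3 : cintegrable setT (fun y => phi y * g ((y - x) / d n)).
      apply: (@cintegrable_dom R setT _ (fun y => C * kap y) measurableT mH _ (integrable_Ckap _)).
      by move=> y _; rewrite cabsM (le_trans _ (hC y))// ler_piMr ?cabs_ge0.
    rewrite -(cintegralZ ((d n)^-1%:C)%C measurableT I3); apply: eq_cintegral => y _.
    have cs : (c%:C)%C * ((Num.sqrt (2 * pi))%:C)%C = 1 :> R[i].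
      by apply: realCVK; rewrite sqrtr_eq0 -ltNge mulr_gt0// pi_gt0.
    have -> : (((d n)^-1 * Num.sqrt (2 * pi))%:C)%C = ((d n)^-1%:C)%C * ((Num.sqrt (2 * pi))%:C)%C :> R[i].
      exact: realCM.
    by rewrite -[RHS]mul1r -cs; ring.
  rewrite (cintegral_shift x mH) (cintegral_scale (d0 n)); last first.
    by apply: (cmeas_comp _ mH); apply: (@measurable_funD _ (mR R)) => //; exact: measurable_cst.
  have dC : ((d n)^-1%:C)%C * ((d n)%:C)%C = 1 :> R[i].
    by apply: realCVK; rewrite gt_eqF.
  rewrite mulrA dC mul1r; apply: eq_cintegral => s _.
  by rewrite addrK mulrAC mulfV ?gt_eqF// mul1r mulrC.
have c2 : cabs (P n - cintegral setT (fun s => g s * phi x)) @[n --> \oo] --> (0 : R).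
  under eq_fun do rewrite PE.
  apply: (@cintegral_dct _ setT _ _ (fun s => (C * B) * kap s)) => //.
  - move=> n; apply: cmeasM => //; apply: (cmeas_comp _ mphi).
    by apply: (@measurable_funD _ (mR R)); [exact: mlin|exact: measurable_cst].
  - by apply: cmeasM => //; exact: cmeas_cst.
  - move=> s _.
    have cx : d n * s + x @[n --> \oo] --> x by rewrite -[X in _ --> X](add0r x); apply: cvgD => //; exact: cvg_cst.
    have cg := cder_cvg_seq (schwartz_cder x h) cx.
    have -> : (fun n => cabs (g s * phi (d n * s + x) - g s * phi x)) =
       (fun n => cabs (g s) * cabs (phi (d n * s + x) - phi x)).
      by apply/funext => n; rewrite -cabsM mulrBr.
    by rewrite -[X in _ --> X](mulr0 (cabs (g s))); exact: cvgMr.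
  - exact: integrable_Ckap.
  - move=> n s _; rewrite cabsM mulrC -mulrA ler_pM// ?cabs_ge0//.
    by rewrite (le_trans (hC _))// ler_piMr// kap_le1.
have E := cabs_lim_uniq c1 c2.
rewrite /ifourier -/L1 E.
have -> : cintegral setT (fun s => g s * phi x) = phi x * ((Num.sqrt (2 * pi))%:C)%C.
  under eq_cintegral do rewrite mulrC.
  rewrite (cintegralZ _ measurableT (schwartz_cintegrable sg)).
  congr (_ * _); have := gint 0; rewrite g0 mulr1 => <-.
  by apply: eq_cintegral => s _; rewrite mulr0 oppr0 expi0 mul1r.
rewrite mulrCA; have -> : (((Num.sqrt (2 * pi))^-1)%:C)%C * ((Num.sqrt (2 * pi))%:C)%C = 1 :> R[i]; last by rewrite mulr1.
by apply: realCVK; rewrite sqrtr_eq0 -ltNge mulr_gt0// pi_gt0.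
Qed.

(** [ifourier] is [fourier] followed by a reflection, so the two compositions are the same integral
    after the substitution of -t for t. *)
Lemma fourierK phi : schwartz phi -> fourier (ifourier phi) = phi.
Proof.
move=> h; transitivity (ifourier (fourier phi)); last exact: ifourierK.
apply/funext => x; apply: (congr1 (fun z => (c%:C)%C * z)).
rewrite cintegral_neg; last first.
  by apply: schwartz_cmeas; apply: schwartz_expiM; exact: ifourier_schwartz.
apply: eq_cintegral => t _; have := ifourierE phi (- t); rewrite opprK => ->.
by congr (expi _ * _); ring.
Qed.
Lemma fourier_linear (a : R[i]) phi psi : schwartz phi -> schwartz psi ->
  fourier (fun x => a * phi x + psi x) = fun t => a * fourier phi t + fourier psi t.
Proof.
move=> s1 s2; apply/funext => t; rewrite /fourier mulrCA -mulrDr; congr (_ * _).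
have i1 := schwartz_cintegrable (schwartz_expiM t s1).
have i2 := schwartz_cintegrable (schwartz_expiM t s2).
rewrite -(cintegralZ a measurableT i1) -(cintegralD measurableT (cintegrableZ a measurableT i1) i2).
by apply: eq_cintegral => x _; ring.
Qed.

Lemma fourier_sum (I : Type) (r : seq I) (F : I -> R -> R[i]) : (forall i, schwartz (F i)) ->
  fourier (fun x => \sum_(i <- r) F i x) = fun t => \sum_(i <- r) fourier (F i) t.
Proof.
move=> sF; elim: r => [|i r IH].
  apply/funext => t; rewrite big_nil /fourier (_ : cintegral _ _ = 0) ?mulr0//.
  rewrite (_ : (fun x => _) = fun=> 0); last by apply/funext => x; rewrite big_nil mulr0.
  by apply: cplxP; rewrite /= Rintegral_cst// mul0r.
have E : (fun x => \sum_(j <- i :: r) F j x) = fun x => 1 * F i x + \sum_(j <- r) F j x.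
  by apply/funext => x; rewrite big_cons mul1r.
rewrite E (fourier_linear 1 (sF i) (schwartz_sum r sF)) IH.
by apply/funext => t; rewrite big_cons mul1r.
Qed.

End Fourier.

(** * Frequency-uniform decomposition *)

Section Tails.
Variable R : realType.
Notation mu := (@lebesgue_measure R).
Notation D := (cderive (1 : R)).

Lemma iterD_add n (f g : R -> R[i]) : csmooth f -> csmooth g ->
  iter n D (fun x => f x + g x) = fun x => iter n D f x + iter n D g x.
Proof.
move=> sf sg; elim: n => // n IH; apply/funext => x; rewrite iterS IH.
by apply: cderE; apply: cderD; exact: csmooth_cder.
Qed.

Lemma D_M (f g : R -> R[i]) : csmooth f -> csmooth g ->
  D (fun x => f x * g x) = fun x => D f x * g x + f x * D g x.
Proof.
move=> sf sg; apply/funext => x; apply: cderE.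
by apply: cderM; [exact: (csmooth_cder 0)|exact: (csmooth_cder 0)].
Qed.

Lemma schwartz_csmooth (f : R -> R[i]) : schwartz f -> csmooth f.
Proof. by move=> /schwartzP[]. Qed.

Lemma iterD_vanish (U : set R) (f : R -> R[i]) : open U -> (forall x, U x -> f x = 0) ->
  forall n x, U x -> iter n D f x = 0.
Proof.
move=> oU; elim: (@idP true) => // _ f0 n; elim: n => // n IH x Ux.
have nx : \near x, iter n D f x = 0.
  by apply: filterS (open_nbhs_nbhs (conj oU Ux)) => y; exact: IH.
apply: cplxP; rewrite /= /cderive/=.
- rewrite (@near_eq_derive _ _ _ _ (cst 0)) ?derive_cst//.
  by apply: filterS nx => y ->.
- rewrite (@near_eq_derive _ _ _ _ (cst 0)) ?derive_cst//.
  by apply: filterS nx => y ->.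
Qed.

(** Models an expanding cutoff minus 1: the derivatives of each order are bounded uniformly in N and
    vanish on a ball of radius N - 1. *)
Definition escaping (eta : nat -> R -> R[i]) := (forall N, csmooth (eta N)) /\
  forall n, exists2 C, 0 <= C & forall N x, cabs (iter n D (eta N) x) <= C /\
    (`|x| + 1 < N%:R -> iter n D (eta N) x = 0).

Lemma escaping_D eta : escaping eta -> escaping (fun N => D (eta N)).
Proof.
move=> [s h]; split=> [N n x|n]; first by rewrite -iterSr; exact: s.
by have [C C0 hC] := h n.+1; exists C => // N x; rewrite -iterSr.
Qed.

Lemma escaping_slow eta N : escaping eta -> slow (eta N).
Proof.
move=> [s h]; split=> // n; have [C C0 hC] := h n; exists C, 0%N => x.
by rewrite mulr1; case: (hC N x).
Qed.

(** Where [eta N] does not vanish one has N + 1 <= |x| + 2, so one more power of |x| in the decay of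
    psi is traded for the factor 1 / (N + 1). Derivatives are handled by the product rule. *)
Lemma escaping_decay eta psi : escaping eta -> schwartz psi -> forall n m,
  exists2 C, 0 <= C & forall N x, `|x| ^+ m * cabs (iter n D (fun y => psi y * eta N y) x) <= C / N.+1%:R.
Proof.
move=> he hp n; elim: n eta psi he hp => [|n IH] eta psi he hp m.
  have [C C0 hC] := he.2 0%N.
  have [A hA] := schwartz_bound hp m; have [B hB] := schwartz_bound hp m.+1.
  have A0 : 0 <= A by rewrite (le_trans _ (hA 0))// mulr_ge0 ?cabs_ge0// exprn_ge0.
  have B0 : 0 <= B by rewrite (le_trans _ (hB 0))// mulr_ge0 ?cabs_ge0// exprn_ge0.
  exists (C * (2 * A + B)); first by rewrite mulr_ge0// addr_ge0// mulr_ge0.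
  move=> N x /=; have [c1 c2] := hC N x; rewrite ler_pdivlMr// cabsM.
  have [xN|xN] := ltP (`|x| + 1) N%:R.
    by have /= -> := c2 xN; rewrite cabs0 !mulr0 mul0r mulr_ge0// addr_ge0// mulr_ge0.
  have xN' : N.+1%:R <= `|x| + 2 by rewrite -natr1 -[2]/(1 + 1) addrA lerD2r.
  apply: (@le_trans _ _ (C * (`|x| ^+ m * cabs (psi x) * (`|x| + 2)))).
    rewrite mulrA (mulrC C) -!mulrA; do 2 (rewrite ler_wpM2l ?exprn_ge0 ?cabs_ge0//).
    by rewrite mulrC ler_pM ?cabs_ge0.
  rewrite ler_wpM2l// mulrDr addrC lerD//; first by rewrite mulrC ler_wpM2l.
  by rewrite mulrAC -exprSr.
have [C1 C10 h1] := IH (fun N => D (eta N)) psi (escaping_D he) hp m.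
have [C2 C20 h2] := IH eta (D psi) he (schwartz_D hp) m.
exists (C1 + C2); first exact: addr_ge0.
move=> N x; rewrite iterSr D_M; last 2 first.
- exact: schwartz_csmooth.
- exact: he.1.
rewrite iterD_add; last 2 first.
- by apply: schwartz_csmooth; apply: schwartzM; [exact: schwartz_D|exact: escaping_slow].
- apply: schwartz_csmooth; apply: schwartzM => //.
  by apply: slow_D; exact: escaping_slow.
rewrite (@le_trans _ _ (`|x| ^+ m * (cabs (iter n D (fun y => D psi y * eta N y) x) + cabs (iter n D (fun y => psi y * D (eta N) y) x))))//.
  by rewrite ler_wpM2l ?exprn_ge0// cabsD.
by rewrite mulrDr mulrDl addrC lerD.
Qed.

(** Convergence to 0 in the Schwartz space with the explicit rate 1 / (N + 1), a form that passes
    through the Fourier transform by estimates alone. *)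
Definition scvg0 (phi_ : nat -> R -> R[i]) :=
  forall m n, exists2 C, 0 <= C & forall N x, `|x| ^+ m * cabs (iter n D (phi_ N) x) <= C / N.+1%:R.

Lemma scvg0_seminorm phi_ m n : scvg0 phi_ -> seminorm m n (phi_ j) @[j --> \oo] --> (0 : \bar R).
Proof.
move=> /(_ m n)[C C0 hC].
apply: (@squeeze_cvge _ _ _ _ (cst 0%E) _ (fun N => (C / N.+1%:R)%:E)).
- apply: nearW => N; rewrite seminorm_ge0/=; exact/seminorm_le.
- exact: cvg_cst.
- apply: cvg_EFin; first exact: nearW.
  by rewrite -[X in _ --> X](mulr0 C); apply: cvgMr; exact: cvg_harmonic.
Qed.

Lemma schwartz_pow n phi : schwartz phi ->
  schwartz (fun x : R => ((0 +i* (-1))%C * (x%:C)%C : R[i]) ^+ n * phi x).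
Proof.
move=> h; elim: n => [|n IH]; first by under [X in schwartz X]eq_fun do rewrite mul1r.
have := schwartzZ (0 +i* (-1))%C (schwartz_mulx IH).
by congr schwartz; apply/funext => x; rewrite exprS !mulrA.
Qed.

Lemma fourier_iterE n phi : schwartz phi ->
  iter n D (fourier phi) = fourier (fun x => ((0 +i* (-1))%C * (x%:C)%C : R[i]) ^+ n * phi x).
Proof.
move=> h; elim: n => [|n IH].
  by rewrite (_ : (fun x => _) = phi)//; apply/funext => x; rewrite mul1r.
have sn := schwartz_pow n h.
rewrite iterS IH (_ : (fun x => _ ^+ n.+1 * phi x) =
  fun x => (0 +i* (-1))%C * ((x%:C)%C * (((0 +i* (-1))%C * (x%:C)%C) ^+ n * phi x))); last first.
  by apply/funext => x; rewrite exprS !mulrA.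
by apply/funext => t; rewrite (cderE (fourier_cder t sn)).
Qed.

Lemma fourier_scvg0 eta psi : escaping eta -> schwartz psi ->
  scvg0 (fun N => fourier (fun x => psi x * eta N x)).
Proof.
move=> he hp m n.
pose psi' := fun x : R => ((0 +i* (-1))%C * (x%:C)%C : R[i]) ^+ n * psi x.
have hp' : schwartz psi' by exact: schwartz_pow.
have [A A0 hA] := escaping_decay he hp' m 0; have [B B0 hB] := escaping_decay he hp' m 2.
have c0 := ltW (fourier_c_gt0 R).
exists ((Num.sqrt (2 * pi))^-1 * ((A + B) * pi)).
  by rewrite mulr_ge0// mulr_ge0 ?pi_ge0// addr_ge0.
move=> N x.
have sN (p : R -> R[i]) : schwartz p -> schwartz (fun y => p y * eta N y).
  by move=> sp; apply: schwartzM => //; exact: escaping_slow.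
rewrite fourier_iterE; last exact: sN.
have -> : (fun x0 => ((0 +i* (-1))%C * (x0%:C)%C) ^+ n * (psi x0 * eta N x0)) = fun y => psi' y * eta N y.
  by apply/funext => y; rewrite mulrA.
have -> : `|x| ^+ m * cabs (fourier (fun y => psi' y * eta N y) x) = cabs (fourier (iter m D (fun y => psi' y * eta N y)) x).
  by rewrite fourier_iterD ?cabsM ?cabsX; [rewrite [cabs (0 +i* x)%C]cabsE/= expr0n add0r sqrtr_sqr|exact: sN].
have sD := schwartz_iterD m (sN _ hp').
rewrite (le_trans (@fourier_bound _ _ ((A + B) / N.+1%:R) x (schwartz_cmeas sD) _))//.
  move=> y; rewrite /kap ler_pdivlMr; last by rewrite ltr_wpDr// sqr_ge0.
  rewrite mulrDr mulr1 mulrDl lerD//; first by have := hA N y; rewrite expr0 mul1r.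
  by have := hB N y; rewrite real_normK ?num_real// mulrC.
by rewrite le_eqVlt; apply/orP; left; apply/eqP; ring.
Qed.
End Tails.

Opaque fourier ifourier.

(** * The partition of unity and its partial sums *)

Section Partition.
Variable R : realType.
Variable sigma0 : R -> R[i].
Hypothesis adm : admissible_partition sigma0.
Notation D := (cderive (1 : R)).

Lemma sigma_csmooth : csmooth sigma0.
Proof. by apply/smooth_onP; case: adm. Qed.

Lemma sigma_vanish n x : 1 <= `|x| -> iter n D sigma0 x = 0.
Proof.
move=> x1; apply: (@iterD_vanish R (~` csupp sigma0)).
- by apply: closed_openC; exact: closed_closure.
- move=> y ny; apply/eqP; apply: contra_notT ny => ny.
  by apply: subset_closure.
- by move=> /(let: And4 _ _ _ h := adm in h)/=; rewrite ltNge x1.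
Qed.

Lemma sigma_bounded n : exists2 C, 0 <= C & forall x, cabs (iter n D sigma0 x) <= C.
Proof.
have c1 : {within `[-1, 1], continuous (fun x => `|CRe (iter n D sigma0 x)| + `|CIm (iter n D sigma0 x)|)}.
  apply: continuous_subspaceT => x.
  have [/is_derive_cont h1 /is_derive_cont h2] := csmooth_cder n x sigma_csmooth.
  by apply: cvgD; apply: cvg_norm.
have [c _ hc] := EVT_max (ltW (gtrN (@ltr01 R))) c1.
exists (`|CRe (iter n D sigma0 c)| + `|CIm (iter n D sigma0 c)|); first exact: addr_ge0.
move=> x; have [x1|x1] := leP 1 `|x|.
  by rewrite sigma_vanish// cabs0 addr_ge0.
by rewrite (le_trans (cabs_le _))// hc// in_itv/= -ler_norml ltW.
Qed.

Lemma iterD_shift n (f : R -> R[i]) (k : int) : csmooth f ->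
  iter n D (shift f k) = shift (iter n D f) k.
Proof.
move=> sf; elim: n => // n IH; apply/funext => x; rewrite iterS IH.
apply: cderE; rewrite /shift.
have hd : is_derive x (1 : R) (fun y => y - k%:~R) 1.
  by apply: (is_derive_ext (is_derive_aff 1 (- k%:~R) x)) => //; apply/funext => y; rewrite mul1r.
by have := @cder_comp _ _ (fun y => y - k%:~R) x _ _ (csmooth_cder n (x - k%:~R) sf) hd; rewrite mul1r.
Qed.

Lemma shift_csmooth (f : R -> R[i]) k : csmooth f -> csmooth (shift f k).
Proof.
move=> sf n x; exists (iter n.+1 D (shift f k) x); rewrite !iterD_shift//.
have hd : is_derive x (1 : R) (fun y => y - k%:~R) 1.
  by apply: (is_derive_ext (is_derive_aff 1 (- k%:~R) x)) => //; apply/funext => y; rewrite mul1r.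
by have := @cder_comp _ _ (fun y => y - k%:~R) x _ _ (csmooth_cder n (x - k%:~R) sf) hd; rewrite mul1r.
Qed.

Lemma shift_slow k : slow (shift sigma0 k).
Proof.
split; first exact: shift_csmooth sigma_csmooth.
move=> n; have [C _ hC] := sigma_bounded n; exists C, 0%N => x.
by rewrite mulr1 iterD_shift ?hC//; exact: sigma_csmooth.
Qed.

Lemma shift_schwartz k : schwartz (shift sigma0 k).
Proof.
apply/schwartzP; split; first exact: shift_csmooth sigma_csmooth.
move=> m n; have [C C0 hC] := sigma_bounded n; exists ((1 + `|k%:~R|) ^+ m * C) => x.
rewrite iterD_shift; last exact: sigma_csmooth.
rewrite /shift; have [x1|x1] := leP 1 `|x - k%:~R|.
  by rewrite sigma_vanish// cabs0 mulr0 mulr_ge0// exprn_ge0// addr_ge0.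
rewrite ler_pM ?exprn_ge0 ?cabs_ge0// lerXn2r ?nnegrE ?addr_ge0//.
by have := ler_normD (x - k%:~R) k%:~R; rewrite subrK; lra.
Qed.

Definition zint N : seq int := [seq i%:Z - N%:Z | i <- iota 0 (N.*2.+1)].

Lemma zint_uniq N : uniq (zint N).
Proof. by rewrite map_inj_uniq ?iota_uniq// => i j; lia. Qed.

Lemma mem_zint N (k : int) : (k \in zint N) = (`|k| <= N%:Z).
Proof.
apply/mapP/idP => [ [j] | kN].
  by rewrite mem_iota => h ->; lia.
exists (absz (k + N%:Z)); last by lia.
by rewrite mem_iota; lia.
Qed.

Definition cutoff N x : R[i] := \sum_(k <- zint N) shift sigma0 k x.

Lemma cutoff1 N x : `|x| + 1 < N%:R -> cutoff N x = 1.
Proof.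
move=> xN; have [_ pu _ _] := adm; rewrite -[RHS](pu x) /cutoff fsbig_seq ?zint_uniq//.
apply: fsbig_widen => // k [_ /=]; rewrite mem_zint => /negP; rewrite -ltNge => kN.
rewrite /shift; apply: (sigma_vanish 0).
have h1 : N%:R + 1 <= `|k%:~R| :> R.
  by rewrite -intr_norm natr1 -[N.+1%:R]/((N.+1%:Z)%:~R) ler_int; lia.
have := ler_normB x (x - k%:~R); rewrite opprB addrC subrK; lra.
Qed.

(** Only the integers floor x and floor x + 1 can lie at distance less than 1 from x, whence a bound
    independent of the length of r. It makes the derivatives of [cutoff N] bounded uniformly in
    N. *)
Lemma sum_local (r : seq int) (x C : R) (F : int -> R) : uniq r -> 0 <= C ->
  (forall k, F k <= C) -> (forall k, 1 <= `|x - k%:~R| -> F k = 0) ->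
  \sum_(k <- r) F k <= 2 * C.
Proof.
move=> ur C0 FC F0; set j := Num.floor x.
have := floor_itv x; rewrite -/j intrD => /andP[j1 j2].
apply: (@le_trans _ _ (\sum_(k <- r) (C * (k == j)%:R + C * (k == j + 1)%:R))).
  apply: ler_sum => k _.
  have [->|kj] := eqVneq k j; first by rewrite mulr1 ler_wpDr// mulr_ge0.
  have [->|kj'] := eqVneq k (j + 1); first by rewrite mulr1 mulr0 add0r.
  rewrite !mulr0 addr0 F0//.
  have [h|h] := leP k (j - 1).
    have : (k%:~R : R) <= j%:~R - 1 by rewrite -[1]/(1%:~R) -intrB ler_int.
    move=> h'; rewrite ger0_norm; lra.
  have : j%:~R + 2 <= (k%:~R : R) by rewrite -[2]/(2%:~R) -intrD ler_int; lia.
  move=> h'; rewrite ler0_norm; lra.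
have cnt (a : int) : \sum_(k <- r) (C * (k == a)%:R) <= C.
  rewrite -big_distrr/= ler_piMr//.
  rewrite (_ : \sum_(k <- r) _ = (count_mem a r)%:R); last first.
    by rewrite -sum1_count natr_sum [RHS]big_mkcond/=; apply: eq_bigr => k _; case: (k == a).
  by rewrite lern1 count_uniq_mem// leq_b1.
by rewrite big_split/= mulrDl mul1r lerD.
Qed.

Lemma cutoff_iterD n N : iter n D (cutoff N) = fun x => \sum_(k <- zint N) shift (iter n D sigma0) k x.
Proof.
elim: n => // n IH; apply/funext => x; rewrite iterS IH.
apply: cderE; apply: cder_sum => k.
rewrite -(@iterD_shift n)//; last exact: sigma_csmooth.
by rewrite -(@iterD_shift n.+1); [apply: csmooth_cder; apply: shift_csmooth|]; exact: sigma_csmooth.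
Qed.

Lemma cutoff_csmooth N : csmooth (cutoff N).
Proof.
move=> n x; exists (iter n.+1 D (cutoff N) x).
rewrite (cutoff_iterD n N) (cutoff_iterD n.+1 N); apply: cder_sum => k.
rewrite -(@iterD_shift n)//; last exact: sigma_csmooth.
by rewrite -(@iterD_shift n.+1); [apply: csmooth_cder; apply: shift_csmooth|]; exact: sigma_csmooth.
Qed.

Lemma cutoff_bounded n : exists2 C, 0 <= C & forall N x, cabs (iter n D (cutoff N) x) <= C.
Proof.
have [C C0 hC] := sigma_bounded n; exists (2 * C); first by rewrite mulr_ge0.
move=> N x; rewrite cutoff_iterD (le_trans (cabs_sum _ _ _))//.
apply: (@sum_local _ x C) => //; first exact: zint_uniq.
  by move=> k; exact: hC.
by move=> k x1; rewrite /shift sigma_vanish// cabs0.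
Qed.

Lemma escaping_cutoff : escaping (fun N x => cutoff N x - 1).
Proof.
have sN N : csmooth (fun x => cutoff N x - 1).
  move=> n x; rewrite (@iterD_add _ n _ (fun=> -1)); [|exact: cutoff_csmooth|by case: (slow_cst (R := R) (-1))].
  have [s1 _] := slow_cst (R := R) (-1); have [l1 h1] := cutoff_csmooth N n x; have [l2 h2] := s1 n x.
  by exists (l1 + l2); exact: cderD.
split=> // n; have [C C0 hC] := cutoff_bounded n; exists (C + 1); first exact: addr_ge0.
move=> N x; split.
  case: n hC => [|n] hC; first by rewrite /= (le_trans (cabsB _ _))// cabs1 lerD2r; exact: (hC N x).
  rewrite (@iterD_add _ n.+1 _ (fun=> -1)); [|exact: cutoff_csmooth|by case: (slow_cst (R := R) (-1))].
  have -> : iter n.+1 D (fun=> -1) x = 0 :> R[i].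
    rewrite iterSr (_ : D (fun=> -1) = fun=> 0); last by apply/funext => y; apply: cderE; exact: cder_cst.
    by elim: n {hC} => // n IH; rewrite iterSr (_ : D (fun=> 0) = fun=> 0)//; apply/funext => y; apply: cderE; exact: cder_cst.
  by rewrite addr0 (le_trans (hC N x))// lerDl.
move=> xN; apply: (@iterD_vanish R [set y | `|y| < N%:R - 1]).
- rewrite (_ : [set y | _] = (fun y : R => `|y|) @^-1` [set z | z < N%:R - 1])//.
  by apply: open_comp; [move=> y _; exact: norm_continuous|exact: open_lt].
- by move=> y /=; rewrite ltrBrDr => /cutoff1 ->; rewrite subrr.
- by rewrite /= ltrBrDr.
Qed.

Lemma dist_lin (f : dist R) (a : R[i]) phi psi : tempered f -> schwartz phi -> schwartz psi ->
  f (fun x => a * phi x + psi x) = a * f phi + f psi.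
Proof. by move=> [h _]; exact: h. Qed.

Lemma dist_B (f : dist R) phi psi : tempered f -> schwartz phi -> schwartz psi ->
  f (fun x => phi x - psi x) = f phi - f psi.
Proof.
move=> tf s1 s2; have := dist_lin (-1) tf s2 s1.
by rewrite mulN1r addrC => <-; congr f; apply/funext => x; rewrite mulN1r addrC.
Qed.

Lemma dist_0 (f : dist R) : tempered f -> f (fun=> 0) = 0.
Proof.
move=> tf; have H : f (fun x => 0 - 0) = 0 by rewrite dist_B// ?subrr//; exact: schwartz0.
by rewrite -[RHS]H; congr f; apply/funext => x; rewrite subrr.
Qed.

Lemma dist_sum (f : dist R) (I : Type) (r : seq I) (F : I -> R -> R[i]) : tempered f ->
  (forall i, schwartz (F i)) -> f (fun x => \sum_(i <- r) F i x) = \sum_(i <- r) f (F i).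
Proof.
move=> tf sF; elim: r => [|i r IH].
  by rewrite big_nil -[RHS](dist_0 tf); congr f; apply/funext => x; rewrite big_nil.
rewrite big_cons -IH -[f (F i)]mul1r -dist_lin//; last exact: schwartz_sum.
by congr f; apply/funext => x; rewrite big_cons mul1r.
Qed.

Lemma boxE k (f : dist R) phi : box sigma0 k f phi = f (fourier (fun x => shift sigma0 k x * ifourier phi x)).
Proof. by []. Qed.

Lemma schwartz_box k phi : schwartz phi -> schwartz (fun x => shift sigma0 k x * ifourier phi x).
Proof.
move=> h; have := schwartzM (ifourier_schwartz h) (shift_slow k).
by congr schwartz; apply/funext => x; rewrite mulrC.
Qed.

(** The error is f tested against the Fourier transform of [ifourier phi] times [cutoff N] minus 1.
    These functions tend to 0 in the Schwartz space, so temperedness concludes. *)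
Lemma sum_box (f : dist R) phi : tempered f -> schwartz phi ->
  cabs (\sum_(k <- zint N) box sigma0 k f phi - f phi) @[N --> \oo] --> (0 : R).
Proof.
move=> tf h; have hi := ifourier_schwartz h.
have sc N : schwartz (fun x => cutoff N x * ifourier phi x).
  have := schwartz_sum (zint N) (fun k => schwartz_box k h).
  by congr schwartz; apply/funext => x; rewrite -big_distrl.
have sb N : schwartz (fun x => \sum_(k <- zint N) shift sigma0 k x * ifourier phi x).
  exact: (schwartz_sum (zint N) (fun k => schwartz_box k h)).
have E N : \sum_(k <- zint N) box sigma0 k f phi - f phi = f (fourier (fun x => ifourier phi x * (cutoff N x - 1))).
  have sF k : schwartz (fourier (fun x => shift sigma0 k x * ifourier phi x)).
    by apply: fourier_schwartz; exact: schwartz_box.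
  have E1 : \sum_(k <- zint N) box sigma0 k f phi = f (fourier (fun x => \sum_(k <- zint N) shift sigma0 k x * ifourier phi x)).
    by rewrite (fourier_sum (zint N) (fun k => schwartz_box k h)) (dist_sum (zint N) tf sF).
  have E2 : f phi = f (fourier (ifourier phi)) by rewrite fourierK.
  rewrite E1 E2 -(dist_B tf (fourier_schwartz (sb N)) (fourier_schwartz hi)).
  have L := fourier_linear (-1) hi (sb N).
  have -> : (fun x => ifourier phi x * (cutoff N x - 1)) =
      (fun x => -1 * ifourier phi x + \sum_(k <- zint N) shift sigma0 k x * ifourier phi x).
    by apply/funext => y; rewrite -big_distrl/= -/(cutoff N y); ring.
  by rewrite L; apply: (congr1 f); apply/funext => x; rewrite mulN1r addrC.
under eq_fun do rewrite E.
apply: tf.2 => [N|m n].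
  apply: fourier_schwartz; apply: schwartzM => //; exact: (escaping_slow N escaping_cutoff).
exact: (scvg0_seminorm m n (fourier_scvg0 escaping_cutoff hi)).
Qed.

(** Equal to 1 where |x| < 1, hence wherever [sigma0] lives: multiplying by it does not change a
    block, but realises the block as a convolution with a Schwartz kernel. *)
Definition fatsigma x : R[i] := shift sigma0 (-1) x + shift sigma0 0 x + shift sigma0 1 x.

Lemma fat_schwartz : schwartz fatsigma.
Proof. by do 2 (apply: schwartzD; last exact: shift_schwartz); exact: shift_schwartz. Qed.

Lemma sigma_fat k x : shift sigma0 k x * shift fatsigma k x = shift sigma0 k x.
Proof.
have [h|h] := leP 1 `|x - k%:~R|; first by have /= e := sigma_vanish 0 h; rewrite {1 3}/shift e mul0r.
suff -> : shift fatsigma k x = 1 by rewrite mulr1.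
rewrite /shift /fatsigma /shift; set y := x - k%:~R.
have [_ pu _ _] := adm; rewrite -[RHS](pu y).
move: h; rewrite -/y => h.
transitivity (\sum_(j <- [:: -1; 0; 1]) shift sigma0 j y).
  by rewrite !big_cons big_nil addr0 addrA.
rewrite fsbig_seq//; apply: fsbig_widen => // j [_ /=]; rewrite !inE => nj.
rewrite /shift; apply: (sigma_vanish 0).
have h1 : 2 <= `|j%:~R| :> R by rewrite -intr_norm -[2]/(2%:~R) ler_int; lia.
have := ler_normB y (y - j%:~R); rewrite opprB addrC subrK; lra.
Qed.
End Partition.
Transparent fourier ifourier.

(** * Frequency blocks as convolutions *)

Section Kernel.
Variable R : realType.
Notation mu := (@lebesgue_measure R).
Variable sigma0 : R -> R[i].
Hypothesis adm : admissible_partition sigma0.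

Notation fat := (fatsigma sigma0).
Let c : R := (Num.sqrt (2 * pi))^-1.

Lemma fat_shiftE k x : shift fat k x = shift sigma0 (k - 1) x + shift sigma0 k x + shift sigma0 (k + 1) x.
Proof.
rewrite /shift /fatsigma /shift.
by congr (sigma0 _ + sigma0 _ + sigma0 _); rewrite ?rmorphB ?rmorphD ?rmorphN /=; ring.
Qed.

Lemma schwartz_fat_box k phi : schwartz phi -> schwartz (fun x => shift fat k x * ifourier phi x).
Proof.
move=> h.
have := schwartzD (schwartzD (schwartz_box adm (k - 1) h) (schwartz_box adm k h)) (schwartz_box adm (k + 1) h).
by congr schwartz; apply/funext => x; rewrite fat_shiftE -!mulrDl.
Qed.

(** The extra factor c = 1 / sqrt(2 pi) is the normalisation under which a product of Fourier
    transforms corresponds to a convolution. *)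
Definition fatker (z : R) : R[i] := (c%:C)%C * ifourier fat z.

Lemma schwartz_fatker : schwartz fatker.
Proof. by apply: schwartzZ; apply: ifourier_schwartz; exact: fat_schwartz. Qed.

Lemma box_fat k (f : dist R) phi : schwartz phi ->
  box sigma0 k f phi = box sigma0 k f (fourier (fun x => shift fat k x * ifourier phi x)).
Proof.
move=> h; rewrite !boxE; apply: (congr1 f); apply: congr1; apply/funext => x.
by rewrite ifourierK ?mulrA ?(sigma_fat adm)//; exact: schwartz_fat_box.
Qed.

(** Shifting the multiplier by k only modulates the kernel. Its modulus is that of [fatker], so all
    bounds are uniform in k. *)
Definition bandker k (z : R) : R[i] := expi (k%:~R * z) * fatker z.

Lemma cabs_bandker k z : cabs (bandker k z) = cabs (fatker z).
Proof. by rewrite /bandker cabsM cabs_expi mul1r. Qed.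

Lemma schwartz_bandker k : schwartz (bandker k).
Proof.
have := schwartzM schwartz_fatker (slow_expi (k%:~R : R)).
by congr schwartz; apply/funext => x; rewrite mulrC.
Qed.

Lemma measurable_subr2 : measurable_fun setT (fun z : mR R * mR R => z.2 - z.1).
Proof. by apply: measurable_funB; [exact: measurable_snd|exact: measurable_fst]. Qed.

Lemma fat_conv k phi x : schwartz phi ->
  fourier (fun t => shift fat k t * ifourier phi t) x = cintegral setT (fun y => bandker k (y - x) * phi y).
Proof.
move=> h; have sf := fat_schwartz adm.
have msf : lcmeas (shift fat k).
  by apply: (cmeas_comp _ (schwartz_cmeas sf)); apply: (@measurable_funB _ (mR R)) => //; exact: measurable_cst.
have [A A0 hA] := schwartz_kap sf; have [B B0 hB] := schwartz_kap h.
have iA : mu.-integrable setT (EFin \o (fun t => A * kap (t - k%:~R))).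
  by apply: integrable_rZl => //; exact: integrable_kap_shift.
have ml (a : R) : lcmeas (fun t => expi (a * t)).
  by apply: cmeas_expi; apply: (@measurable_funM _ (mR R)); [exact: measurable_cst|exact: measurable_id].
have m1 y : lcmeas (fun t => expi ((y - x) * t) * shift fat k t) by apply: cmeasM; [exact: ml|exact: msf].
have i1 y : cintegrable setT (fun t => expi ((y - x) * t) * shift fat k t).
  apply: (@cintegrable_dom R setT _ (fun t => A * kap (t - k%:~R)) measurableT (m1 y) _ iA).
  by move=> t _; rewrite cabsM cabs_expi mul1r hA.
have i2 y : cintegrable setT (fun t => expi ((y - x) * t) * fat t).
  apply: (@cintegrable_dom R setT _ (fun t => A * kap t) measurableT _ _ (integrable_Ckap A)).
    by apply: cmeasM; [exact: ml|exact: (schwartz_cmeas sf)].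
  by move=> t _; rewrite cabsM cabs_expi mul1r hA.
pose F (z : mR R * mR R) : R[i] := (expi (- (z.1 * x)) * shift fat k z.1) * (expi (z.2 * z.1) * phi z.2).
have FE t y : F (t, y) = (expi (- (t * x)) * shift fat k t) * (expi (y * t) * phi y) by [].
have mF : cmeas F.
  apply: cmeasM; apply: cmeasM.
  - apply: cmeas_expi; apply: measurable_funN; apply: measurable_funM; [exact: measurable_fst|exact: measurable_cst].
  - exact: (cmeas_comp measurable_fst msf).
  - by apply: cmeas_expi; apply: measurable_funM; [exact: measurable_snd|exact: measurable_fst].
  - exact: (cmeas_comp measurable_snd (schwartz_cmeas h)).
have dom t y : cabs (F (t, y)) <= A * kap (t - k%:~R) * (B * kap y).
  by rewrite FE cabsM (cabsM (expi _)) (cabsM (expi _)) !cabs_expi !mul1r ler_pM ?cabs_ge0// hA.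
have FF := cfubini mF iA (integrable_Ckap B) dom.
have IF := cintegrable_param mF iA (integrable_Ckap B) dom.
clearbody F.
have step1 : fourier (fun t => shift fat k t * ifourier phi t) x =
    (c%:C)%C * ((c%:C)%C * cintegral setT (fun t => cintegral setT (fun y => F (t, y)))).
  rewrite -(cintegralZ (c%:C)%C measurableT IF); apply: (congr1 (fun w => (c%:C)%C * w)).
  apply: eq_cintegral => t _.
  have iph : cintegrable setT (fun y => expi (y * t) * phi y).
    have := schwartz_cintegrable (schwartz_expiM (- t) h).
    by congr cintegrable; apply/funext => y; rewrite mulrN opprK.
  have -> : cintegral setT (fun y => F (t, y)) = expi (- (t * x)) * shift fat k t * cintegral setT (fun y => expi (y * t) * phi y).
    by rewrite -(cintegralZ _ measurableT iph); apply: eq_cintegral => y _; rewrite FE; ring.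
  have -> : ifourier phi t = (c%:C)%C * cintegral setT (fun y => expi (y * t) * phi y).
    by apply: (congr1 (fun w => (c%:C)%C * w)); apply: eq_cintegral => y _; rewrite (mulrC t y).
  by ring.
rewrite step1 FF.
have inner y : (c%:C)%C * ((c%:C)%C * cintegral setT (fun t => F (t, y))) = bandker k (y - x) * phi y.
  have -> : cintegral setT (fun t => F (t, y)) = phi y * cintegral setT (fun t => expi ((y - x) * t) * shift fat k t).
    rewrite -(cintegralZ (phi y) measurableT (i1 y)); apply: eq_cintegral => t _; rewrite FE.
    have -> : (y - x) * t = - (t * x) + y * t by ring.
    by rewrite expiD; ring.
  rewrite (cintegral_shift k%:~R (m1 y)).
  have -> : cintegral setT (fun t => expi ((y - x) * (t + k%:~R)) * shift fat k (t + k%:~R)) =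
      expi (k%:~R * (y - x)) * cintegral setT (fun t => expi ((y - x) * t) * fat t).
    rewrite -(cintegralZ _ measurableT (i2 y)); apply: eq_cintegral => t _.
    rewrite /shift addrK.
    have -> : (y - x) * (t + k%:~R) = k%:~R * (y - x) + (y - x) * t by ring.
    by rewrite expiD mulrA.
  rewrite /bandker /fatker /ifourier; ring.
have IG : cintegrable setT (fun y => cintegral setT (fun t => F (t, y))).
  apply: (cintegrable_param (f := fun z => F (z.2, z.1)) _ (integrable_Ckap B) iA).
    by apply: (cmeas_comp _ mF); exact: measurable_swap.
  by move=> y t /=; rewrite mulrC.
rewrite -(cintegralZ (c%:C)%C measurableT IG) -(cintegralZ (c%:C)%C measurableT (cintegrableZ _ measurableT IG)).
by apply: eq_cintegral => y _; exact: inner.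
Qed.

Definition bandconv k (g : R -> R[i]) (y : R) : R[i] := cintegral setT (fun x => bandker k (y - x) * g x).

Lemma lcmeas_bandconv k g : lcmeas g -> lcmeas (bandconv k g).
Proof.
move=> mg; apply: (cmeas_param (f := fun z => bandker k (z.2 - z.1) * g z.1)).
apply: cmeasM; last exact: (cmeas_comp measurable_fst mg).
exact: (cmeas_comp measurable_subr2 (schwartz_cmeas (schwartz_bandker k))).
Qed.

(** Peetre's inequality 1 + x^2 <= 2 (1 + (y - x)^2) (1 + y^2): the difference of the two sides is 1
    + (2 y - x)^2 + 2 (y - x)^2 y^2. *)
Lemma kap_peetre (x y : R) : kap (y - x) <= 2 * kap x / kap y.
Proof.
have h1 : 0 <= (y - x) ^+ 2 * y ^+ 2 by rewrite mulr_ge0 ?sqr_ge0.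
have h2 : 0 <= (2 * y - x) ^+ 2 by exact: sqr_ge0.
have p (z : R) : 0 < 1 + z ^+ 2 by rewrite ltr_wpDr// sqr_ge0.
have [p1 p2] := (p (y - x), p x).
rewrite /kap invrK -subr_ge0.
have -> : 2 / (1 + x ^+ 2) * (1 + y ^+ 2) - (1 + (y - x) ^+ 2)^-1 =
    (2 * (1 + (y - x) ^+ 2) * (1 + y ^+ 2) - (1 + x ^+ 2)) / ((1 + (y - x) ^+ 2) * (1 + x ^+ 2)).
  by field; rewrite !gt_eqF.
rewrite divr_ge0//; last by rewrite mulr_ge0// ltW.
nra.
Qed.

Lemma schwartz_kap2 (phi : R -> R[i]) : schwartz phi -> exists2 C, 0 <= C & forall x, cabs (phi x) <= C * kap x ^+ 2.
Proof.
move=> h; have [A A0 hA] := schwartz_kap h.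
have [B B0 hB] := schwartz_kap (schwartz_mulx (schwartz_mulx h)).
exists (A + B); first exact: addr_ge0.
move=> x; rewrite expr2 mulrA /kap ler_pdivlMr; last by rewrite ltr_wpDr// sqr_ge0.
rewrite -/(kap x) mulrDr mulr1 mulrDl lerD//.
have := hB x; rewrite !cabsM !cabs_real mulrA -expr2 real_normK ?num_real// mulrC; exact.
Qed.

(** A representative of a block may be replaced by its convolution with the band kernel. Fubini
    moves the convolution from the test function to g; of the two factors [kap y] that bound the
    test function, one pays for Peetre's inequality and the other keeps the majorant integrable. *)
Lemma box_bandconv k (f : dist R) g phi : represents (box sigma0 k f) g ->
  mu.-integrable setT (EFin \o (fun x => cabs (g x) * kap x)) -> schwartz phi ->
  box sigma0 k f phi = cintegral setT (fun y => bandconv k g y * phi y).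
Proof.
move=> [mg hg] ig h; rewrite box_fat// hg; last by apply: fourier_schwartz; exact: schwartz_fat_box.
rewrite /dist_of.
under eq_cintegral do rewrite fat_conv//.
have [A A0 hA] := schwartz_kap (schwartz_bandker k); have [B B0 hB] := schwartz_kap2 h.
have mb z : lcmeas (fun x => bandker k (z - x)).
  apply: (cmeas_comp _ (schwartz_cmeas (schwartz_bandker k))).
  by apply: (@measurable_funB _ (mR R)); [exact: measurable_cst|exact: measurable_id].
have mb' z : lcmeas (fun y => bandker k (y - z)).
  apply: (cmeas_comp _ (schwartz_cmeas (schwartz_bandker k))).
  by apply: (@measurable_funB _ (mR R)); [exact: measurable_id|exact: measurable_cst].
have i1 x : cintegrable setT (fun y => bandker k (y - x) * phi y).
  apply: (@cintegrable_dom R setT _ (fun y => (A * B) * kap y) measurableT _ _ (integrable_Ckap _)).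
    by apply: cmeasM; [exact: mb'|exact: (schwartz_cmeas h)].
  move=> y _; rewrite cabsM (@le_trans _ _ (A * (B * kap y ^+ 2)))//.
    by rewrite ler_pM ?cabs_ge0// (le_trans (hA _))// ler_piMr// kap_le1.
  by rewrite mulrA ler_wpM2l ?mulr_ge0// expr2 ler_piMr ?kap_ge0// kap_le1.
have i2 y : cintegrable setT (fun x => bandker k (y - x) * g x).
  apply: (@cintegrable_dom R setT _ (fun x => (2 * A / kap y) * (cabs (g x) * kap x)) measurableT).
  - by apply: cmeasM; [exact: mb|exact: mg].
  - move=> x _; rewrite cabsM [leRHS]mulrCA [leLHS]mulrC ler_wpM2l ?cabs_ge0//.
    rewrite (le_trans (hA _))// (le_trans (ler_wpM2l A0 (kap_peetre x y)))//.
    by rewrite le_eqVlt; apply/orP; left; apply/eqP; ring.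
  - exact: integrable_rZl.
pose F (z : mR R * mR R) : R[i] := g z.1 * (bandker k (z.2 - z.1) * phi z.2).
have FE x y : F (x, y) = g x * (bandker k (y - x) * phi y) by [].
have mF : cmeas F.
  apply: cmeasM; first exact: (cmeas_comp measurable_fst mg).
  apply: cmeasM; last exact: (cmeas_comp measurable_snd (schwartz_cmeas h)).
  exact: (cmeas_comp measurable_subr2 (schwartz_cmeas (schwartz_bandker k))).
have dom x y : cabs (F (x, y)) <= (cabs (g x) * kap x) * ((2 * A * B) * kap y).
  rewrite FE cabsM (cabsM (bandker _ _)) -mulrA ler_wpM2l ?cabs_ge0//.
  rewrite (@le_trans _ _ ((A * (2 * kap x / kap y)) * (B * kap y ^+ 2)))//.
    rewrite ler_pM ?cabs_ge0// (le_trans (hA _))// ler_wpM2l//; exact: kap_peetre.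
  rewrite le_eqVlt; apply/orP; left; apply/eqP; field.
  by rewrite gt_eqF// kap_gt0.
have FF := cfubini mF ig (integrable_Ckap (2 * A * B)) dom.
clearbody F.
transitivity (cintegral setT (fun x => cintegral setT (fun y => F (x, y)))).
  apply: eq_cintegral => x _; under [RHS]eq_cintegral do rewrite FE.
  by rewrite (cintegralZ (g x) measurableT (i1 x)).
rewrite FF; apply: eq_cintegral => y _; under eq_cintegral do rewrite FE; rewrite mulrC.
by rewrite -(cintegralZ (phi y) measurableT (i2 y)); apply: eq_cintegral => x _; ring.
Qed.

End Kernel.

(** * Embedding of modulation spaces in L^3 *)

Section Torus.
Variable R : realType.
Notation mu := (@lebesgue_measure R).
Let I2 : set (mR R) := `[0, 2 * pi]%classic.

Definition cj (z : R[i]) : R[i] := (CRe z +i* - CIm z)%C.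
Lemma cjD x y : cj (x + y) = cj x + cj y.
Proof. by apply: cplxP; rewrite ?CE/= ?CE/=; ring. Qed.
Lemma cjM x y : cj (x * y) = cj x * cj y.
Proof. by apply: cplxP; rewrite ?CE/= ?CE/=; ring. Qed.
Lemma cj_mul z : z * cj z = ((cabs z ^+ 2)%:C)%C.
Proof. by apply: cplxP; rewrite !CE/=; [rewrite sqr_cabs|]; ring. Qed.
Lemma cj_expi t : cj (expi t) = expi (- t).
Proof. by apply: cplxP; rewrite /= ?cosN ?sinN. Qed.

Lemma measurable_I2 : measurable I2. Proof. exact: measurable_itv. Qed.

Lemma mu_I2 : mu I2 = (2 * pi)%:E.
Proof.
rewrite /I2 lebesgue_measure_itv/= lte_fin mulr_gt0 ?pi_gt0//=.
by rewrite oppr0 adde0.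
Qed.

Lemma integrable_addR d (T : measurableType d) (m : {measure set T -> \bar R}) (D : set T) (f g : T -> R) :
  measurable D -> m.-integrable D (EFin \o f) -> m.-integrable D (EFin \o g) ->
  m.-integrable D (EFin \o (fun x => f x + g x)).
Proof. by move=> mD fi gi; exact: (integrableD mD fi gi). Qed.

Lemma integrable_cst_itv (a b k : R) : mu.-integrable `[a, b] (EFin \o (fun=> k)).
Proof.
apply: continuous_compact_integrable; first exact: segment_compact.
by apply: continuous_subspaceT => x; exact: cvg_cst.
Qed.

Lemma expi_2pi_int (n : int) : expi (n%:~R * (2 * pi)) = 1 :> R[i].
Proof.
have nat (m : nat) : expi (m%:R * (2 * pi)) = 1 :> R[i].
  elim: m => [|m IH]; first by rewrite mul0r expi0.
  rewrite -natr1 mulrDl expiD IH mul1r mul1r.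
  by apply: cplxP; rewrite /= -mulr_natl ?mulr_natl ?cos2pi ?sin2pi// mulr2n ?cosDpi ?sinDpi ?cospi ?sinpi ?opprK ?oppr0.
case: n => m; first exact: nat.
rewrite NegzE rmorphN/= mulNr -cj_expi -[m.+1%:~R]/(m.+1%:R) nat.
by apply: cplxP; rewrite /= ?oppr0.
Qed.

Lemma cintegral_expi (n : int) : n != 0 -> cintegral I2 (fun z => expi (n%:~R * z)) = 0.
Proof.
move=> n0; have n0' : n%:~R != 0 :> R by rewrite intr_eq0.
have p2 : 0 < 2 * pi :> R by rewrite mulr_gt0// pi_gt0.
have [/= e1 e2] : cos (n%:~R * (2 * pi)) = 1 :> R /\ sin (n%:~R * (2 * pi)) = 0 :> R.
  by have := expi_2pi_int n => h; split; [have := congr1 (fun z : R[i] => CRe z) h|have := congr1 (fun z : R[i] => CIm z) h].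
have hd x : is_derive x (1 : R) (fun z => n%:~R * z) n%:~R.
  by apply: (is_derive_ext (is_derive_aff n%:~R 0 x)) => //; apply/funext => y; rewrite addr0.
have FTC (F f : R -> R) : (forall x, is_derive x (1 : R) F (f x)) -> continuous f -> F (2 * pi) = F 0 ->
    \int[mu]_(x in I2) f x = 0.
  move=> dF cf FF; rewrite /Rintegral (@continuous_FTC2 _ f F)//= ?FF ?subrr//.
  - exact: continuous_subspaceT.
  - split.
    + by move=> x _; case: (dF x).
    + by apply: cvg_at_right_filter; exact: (is_derive_cont (dF _)).
    + by apply: cvg_at_left_filter; exact: (is_derive_cont (dF _)).
  - by move=> x _; rewrite derive1E; have := dF x => ?; rewrite derive_val.
have dsin x : is_derive x (1 : R) (fun z => n%:~R^-1 * sin (n%:~R * z)) (cos (n%:~R * x)).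
  have := is_deriveM (is_derive_cst (n%:~R^-1 : R) x (1 : R)) (is_derive1_comp (is_derive_sin (n%:~R * x)) (hd x)).
  by move=> h; apply: (is_derive_ext h) => //; rewrite /GRing.scale/=; field.
have dcos x : is_derive x (1 : R) (fun z => - n%:~R^-1 * cos (n%:~R * z)) (sin (n%:~R * x)).
  have := is_deriveM (is_derive_cst (- n%:~R^-1 : R) x (1 : R)) (is_derive1_comp (is_derive_cos (n%:~R * x)) (hd x)).
  by move=> h; apply: (is_derive_ext h) => //; rewrite /GRing.scale/=; field.
apply: cplxP => /=.
- apply: (FTC _ _ dsin); last by rewrite e2 !mulr0 sin0 mulr0.
  move=> x; have h := is_derive1_comp (is_derive_cos (n%:~R * x)) (hd x).
  exact: (is_derive_cont h).
- apply: (FTC _ _ dcos); last by rewrite e1 mulr0 cos0.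
  move=> x; have h := is_derive1_comp (is_derive_sin (n%:~R * x)) (hd x).
  exact: (is_derive_cont h).
Qed.

Definition trig (a : int -> R[i]) (r : seq int) (z : R) : R[i] := \sum_(k <- r) a k * expi (k%:~R * z).

Lemma lcmeas_expilin (b : R) : lcmeas (fun z => expi (b * z)).
Proof. by apply: cmeas_expi; apply: (@measurable_funM _ (mR R)); [exact: measurable_cst|exact: measurable_id]. Qed.

Lemma trig_meas a r : lcmeas (trig a r).
Proof. by apply: cmeas_sum => k; apply: cmeasM; [exact: cmeas_cst|exact: lcmeas_expilin]. Qed.

Lemma trig_bound a r z : cabs (trig a r z) <= \sum_(k <- r) cabs (a k).
Proof.
rewrite (le_trans (cabs_sum _ _ _))// le_eqVlt; apply/orP; left; apply/eqP.
by apply: eq_bigr => k _; rewrite cabsM cabs_expi mulr1.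
Qed.

Lemma integrable_I2 (f : R -> R) C : lmeas f -> (forall x, `|f x| <= C) -> mu.-integrable I2 (EFin \o f).
Proof.
move=> mf fC; apply: (@integrable_dom R _ (mR R) mu I2 f (fun=> C)).
- exact: measurable_I2.
- exact: measurable_funTS.
- by move=> x _.
- exact: integrable_cst_itv.
Qed.

Lemma lmeas_trigX a r n : lmeas (fun z => cabs (trig a r z) ^+ n).
Proof. by apply: measurable_funX; apply: measurable_cabs; exact: trig_meas. Qed.

Lemma integrable_trigX a r n : mu.-integrable I2 (EFin \o (fun z => cabs (trig a r z) ^+ n)).
Proof.
apply: (@integrable_I2 _ ((\sum_(k <- r) cabs (a k)) ^+ n)); first exact: lmeas_trigX.
move=> x; rewrite ger0_norm ?exprn_ge0 ?cabs_ge0// lerXn2r ?nnegrE ?cabs_ge0 ?trig_bound//.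
by apply: sumr_ge0 => k _; exact: cabs_ge0.
Qed.

Lemma cintegrable_trig (b : R[i]) a r (n : int) :
  cintegrable I2 (fun z => b * expi (n%:~R * z) * cj (trig a r z)).
Proof.
apply: (@cintegrable_dom _ _ _ (fun=> cabs b * \sum_(k <- r) cabs (a k))).
- exact: measurable_I2.
- apply: cmeasM; first by apply: cmeasM; [exact: cmeas_cst|exact: lcmeas_expilin].
  by have [m1 m2] := trig_meas a r; split => //=; apply: (@measurable_funN _ (mR R)).
- move=> z _; rewrite cabsM cabsM cabs_expi mulr1 ler_wpM2l ?cabs_ge0//.
  by rewrite (le_trans _ (trig_bound a r z))// !cabsE/= sqrrN.
- exact: integrable_cst_itv.
Qed.

Lemma trig_orth (b : R[i]) a r (n : int) : n \notin r ->
  cintegral I2 (fun z => b * expi (n%:~R * z) * cj (trig a r z)) = 0.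
Proof.
elim: r => [|k r IH] nr.
  rewrite (_ : (fun z => _) = fun=> 0); last first.
    by apply/funext => z; rewrite /trig big_nil; apply: cplxP; rewrite !CE/=; ring.
  by apply: cplxP; rewrite /= Rintegral_cst ?mul0r//; exact: measurable_I2.
move: nr; rewrite inE negb_or => /andP[nk nr].
have ie : cintegrable I2 (fun z => expi ((n - k)%:~R * z)).
  apply: (@cintegrable_dom _ _ _ (fun=> 1)).
  - exact: measurable_I2.
  - exact: lcmeas_expilin.
  - by move=> z _; rewrite cabs_expi.
  - exact: integrable_cst_itv.
have -> : (fun z => b * expi (n%:~R * z) * cj (trig a (k :: r) z)) =
   fun z => (b * cj (a k)) * expi ((n - k)%:~R * z) + b * expi (n%:~R * z) * cj (trig a r z).
  apply/funext => z; rewrite /trig big_cons cjD mulrDr; congr (_ + _).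
  by rewrite cjM cj_expi rmorphB/= mulrBl expiD; ring.
rewrite (cintegralD measurable_I2 (cintegrableZ _ measurable_I2 ie) (cintegrable_trig b a r n)).
rewrite (cintegralZ _ measurable_I2 ie) IH// addr0 cintegral_expi ?mulr0//.
by rewrite subr_eq0.
Qed.

(** Frequencies are added one at a time; the cross term between the new exponential and the rest
    integrates to 0 by [trig_orth]. *)
Lemma trig_L2 a r : uniq r ->
  \int[mu]_(z in I2) (cabs (trig a r z) ^+ 2) = 2 * pi * \sum_(k <- r) cabs (a k) ^+ 2.
Proof.
elim: r => [_|k r IH /=/andP[kr ur]].
  rewrite big_nil mulr0 (_ : (fun z => _) = fun=> 0); last first.
    by apply/funext => z; rewrite /trig big_nil cabs0 expr0n.
  by rewrite Rintegral_cst ?mul0r//; exact: measurable_I2.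
have ic := cintegrable_trig (a k) a r k; have oc := trig_orth (a k) a kr.
have E z : cabs (trig a (k :: r) z) ^+ 2 =
    (cabs (a k) ^+ 2 + cabs (trig a r z) ^+ 2) + 2 * CRe (a k * expi (k%:~R * z) * cj (trig a r z)).
  rewrite /trig big_cons -/(trig a r z) !sqr_cabs !CE/=.
  have : cos (k%:~R * z) ^+ 2 + sin (k%:~R * z) ^+ 2 = 1 :> R by exact: cos2Dsin2.
  set C := cos _; set S := sin _ => CS.
  have -> : CRe (a k) ^+ 2 + CIm (a k) ^+ 2 = (CRe (a k) ^+ 2 + CIm (a k) ^+ 2) * (C ^+ 2 + S ^+ 2) by rewrite CS mulr1.
  ring.
under eq_Rintegral do rewrite E.
have i0 := integrable_trigX a r 2.
have i1 : mu.-integrable I2 (EFin \o (fun z => cabs (a k) ^+ 2)) by exact: integrable_cst_itv.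
rewrite RintegralD; last 3 first.
- exact: measurable_I2.
- exact: (integrableD measurable_I2 i1 i0).
- by apply: integrable_rZl; [exact: measurable_I2|case: ic].
rewrite RintegralD//; last exact: measurable_I2.
rewrite (@RintegralZl _ (mR R) R mu I2 (fun z => CRe (a k * expi (k%:~R * z) * cj (trig a r z))) 2 measurable_I2); last by case: ic.
have -> : \int[mu]_(z in I2) CRe (a k * expi (k%:~R * z) * cj (trig a r z)) = 0.
  by have := congr1 (fun z : R[i] => CRe z) oc.
have -> : 2 * pi * \sum_(j <- k :: r) cabs (a j) ^+ 2 = cabs (a k) ^+ 2 * (2 * pi) + 2 * pi * \sum_(j <- r) cabs (a j) ^+ 2.
  by rewrite big_cons; ring.
rewrite -(IH ur) mulr0 addr0 Rintegral_cst; last exact: measurable_I2.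
exact: (congr1 (fun w => cabs (a k) ^+ 2 * fine w + _) mu_I2).
Qed.

(** Its square is the cube, by [p32_sqr], so the exponents 3/2 and 3 of Hausdorff-Young are handled
    with ordinary squares. *)
Definition p32 (x : R) : R := x `^ (3 / 2).
Lemma p32_ge0 x : 0 <= p32 x. Proof. exact: powR_ge0. Qed.
Lemma p32_sqr x : 0 <= x -> p32 x ^+ 2 = x ^+ 3.
Proof.
move=> x0; rewrite /p32 -powR_mulrn ?powR_ge0// -powRrM -powR_mulrn//.
by congr powR; field.
Qed.
Lemma p32_le x y : 0 <= x -> x <= y -> p32 x <= p32 y.
Proof. by move=> x0 xy; rewrite /p32 ge0_ler_powR ?nnegrE ?(le_trans x0 xy)// divr_ge0. Qed.

(** For x <= y a factor x^(1/2) may be exchanged for y^(1/2). This is where the ordering of the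
    coefficients is used. *)
Lemma p32_mix x y : 0 <= x -> x <= y -> y * x ^+ 2 <= p32 y * p32 x.
Proof.
move=> x0 xy; have y0 := le_trans x0 xy.
rewrite -(@ler_pXn2r _ 2)// ?nnegrE ?mulr_ge0 ?p32_ge0 ?sqr_ge0//.
rewrite [leRHS]exprMn !p32_sqr// (_ : (y * x ^+ 2) ^+ 2 = y ^+ 2 * x ^+ 3 * x); last by ring.
by rewrite (_ : y ^+ 3 * x ^+ 3 = y ^+ 2 * x ^+ 3 * y); [rewrite ler_wpM2l// mulr_ge0// exprn_ge0|ring].
Qed.

(* Adding the coefficients in increasing order of modulus, the cube of the modulus grows at each step by at
   most the new modulus times the L2-masses, which are computed exactly by orthogonality. *)
Lemma hausdorff_young_sorted a r : uniq r -> sorted (fun i j => cabs (a j) <= cabs (a i)) r ->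
  \int[mu]_(z in I2) (cabs (trig a r z) ^+ 3) <= 6 * pi * (\sum_(k <- r) p32 (cabs (a k))) ^+ 2.
Proof.
have pp : 0 <= pi :> R by exact: pi_ge0.
elim: r => [_ _|k r IH ukr skr].
  rewrite (_ : (fun z => _) = fun=> 0); last first.
    by apply/funext => z; rewrite /trig big_nil cabs0 expr0n.
  rewrite Rintegral_cst; last exact: measurable_I2.
  by rewrite mul0r mulr_ge0 ?sqr_ge0// mulr_ge0.
have /andP[kr ur] : (k \notin r) && uniq r by [].
have sr : sorted (fun i j => cabs (a j) <= cabs (a i)) r by exact: path_sorted skr.
have kmax : forall j, j \in r -> cabs (a j) <= cabs (a k).
  by apply/allP; apply: order_path_min skr => i j l h1 h2; exact: le_trans h2 h1.
set A := \sum_(j <- r) p32 (cabs (a j)) in IH *.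
have A0 : 0 <= A by apply: sumr_ge0 => j _; exact: p32_ge0.
set al := p32 (cabs (a k)); have al0 : 0 <= al by exact: p32_ge0.
have i3 := integrable_trigX a r 3.
have i2 := integrable_trigX a r 2; have i2' := integrable_trigX a (k :: r) 2.
have mI := measurable_I2.
(* For y <= x <= y + w one has x^3 - y^3 = (x - y) (x^2 + x y + y^2), at most w times 3/2 (x^2 +
   y^2); for x <= y the bound is immediate. *)
apply: (@le_trans _ _ (\int[mu]_(z in I2) (cabs (trig a r z) ^+ 3 +
    (3 / 2 * cabs (a k)) * (cabs (trig a (k :: r) z) ^+ 2 + cabs (trig a r z) ^+ 2)))).
  apply: le_Rintegral => //.
  - exact: integrable_trigX.
  - apply: (integrable_addR mI i3); apply: (integrable_rZl _ mI); exact: (integrable_addR mI i2' i2).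
  - move=> z _.
    have h : cabs (trig a (k :: r) z) <= cabs (a k) + cabs (trig a r z).
      by rewrite /trig big_cons (le_trans (cabsD _ _))// cabsM cabs_expi mulr1.
    move: (cabs_ge0 (trig a (k :: r) z)) (cabs_ge0 (trig a r z)) (cabs_ge0 (a k)) h.
    move: (cabs (trig a (k :: r) z)) (cabs (trig a r z)) (cabs (a k)) => x y w x0 y0 w0 h.
    have [xy|yx] := leP x y.
      by rewrite ler_wpDr ?mulr_ge0 ?addr_ge0 ?sqr_ge0// lerXn2r.
    have := sqr_ge0 (x - y); have xy0 : 0 <= x * y by rewrite mulr_ge0.
    have s0 : 0 <= x ^+ 2 + y ^+ 2 by rewrite addr_ge0 ?sqr_ge0.
    have : 0 <= (w - (x - y)) * (x ^+ 2 + y ^+ 2) by rewrite mulr_ge0//; lra.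
    have : 0 <= (x - y) * (x - y) ^+ 2 by rewrite mulr_ge0 ?sqr_ge0// subr_ge0 ltW.
    nra.
rewrite RintegralD//; last by apply: (integrable_rZl _ mI); exact: (integrable_addR mI i2' i2).
rewrite RintegralZl//; last exact: (integrableD mI i2' i2).
rewrite RintegralD// !trig_L2// big_cons.
set S := \sum_(j <- r) cabs (a j) ^+ 2.
have kS : cabs (a k) * S <= al * A.
  rewrite !big_distrr/= big_seq [leRHS]big_seq; apply: ler_sum => j jr.
  by apply: p32_mix; [exact: cabs_ge0|exact: kmax].
have kk : cabs (a k) * cabs (a k) ^+ 2 <= al * al by apply: p32_mix => //; exact: cabs_ge0.
have S0 : 0 <= S by apply: sumr_ge0 => j _; exact: sqr_ge0.
rewrite big_cons -/al -/A.
have := IH ur sr.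
set J := \int[mu]_(x in _) _ => hJ.
apply: (@le_trans _ _ (6 * pi * A ^+ 2 + 3 / 2 * (2 * pi) * (2 * (al * A + al * al)))).
  apply: lerD => //.
  have c0 := cabs_ge0 (a k).
  have h : cabs (a k) * (2 * S + cabs (a k) ^+ 2) <= 2 * (al * A + al * al).
    have : 0 <= cabs (a k) * cabs (a k) ^+ 2 by rewrite mulr_ge0// sqr_ge0.
    lra.
  have -> : 3 / 2 * cabs (a k) * (2 * pi * (cabs (a k) ^+ 2 + S) + 2 * pi * S) =
     3 / 2 * (2 * pi) * (cabs (a k) * (2 * S + cabs (a k) ^+ 2)) by ring.
  by rewrite ler_wpM2l// !mulr_ge0.
rewrite -subr_ge0 (_ : _ - _ = 6 * pi * (al * A)); last by field.
by rewrite !mulr_ge0.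
Qed.

Lemma trig_perm a r s : perm_eq r s -> trig a r = trig a s.
Proof. by move=> rs; apply/funext => z; rewrite /trig (perm_big _ rs). Qed.

Lemma hausdorff_young a r : uniq r ->
  \int[mu]_(z in I2) (cabs (trig a r z) ^+ 3) <= 6 * pi * (\sum_(k <- r) p32 (cabs (a k))) ^+ 2.
Proof.
move=> ur; set le := fun i j : int => cabs (a j) <= cabs (a i).
have pr : perm_eq (sort le r) r by rewrite perm_sort.
rewrite -(trig_perm a pr) -(perm_big _ pr)/=; apply: hausdorff_young_sorted.
  by rewrite sort_uniq.
by apply: sort_sorted => i j; rewrite /le le_total.
Qed.

(** For y in one period, [kap z] is at most a constant times [kap (z - y)]. Averaging over y and
    translating turns the left side into a [kap]-weighted integral over w of integrals over one
    period of the polynomial translated by w, whose coefficients keep their moduli. *)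
Lemma hausdorff_young_kap a r : uniq r ->
  (\int[mu]_z (kap z * cabs (trig a r z) ^+ 3)%:E <=
   (6 * pi * (1 + 4 * pi ^+ 2) * (\sum_(k <- r) p32 (cabs (a k))) ^+ 2)%:E)%E.
Proof.
move=> ur; set A := \sum_(k <- r) _.
have p0 : 0 < pi :> R by exact: pi_gt0.
have mI := measurable_I2.
have mk2 : measurable_fun setT (fun z : mR R * mR R => kap (z.2 - z.1)).
  by apply: (measurableT_comp (@measurable_kap R)); exact: measurable_subr2.
(* Peetre's constant for 0 <= y <= 2 pi, divided by the length of the period over which the average
   is taken. *)
pose c := 2 * (1 + 4 * pi ^+ 2) / (2 * pi) : R.
have c0 : 0 <= c.
  by rewrite /c divr_ge0// mulr_ge0 ?(ltW p0)// addr_ge0// mulr_ge0// sqr_ge0.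
pose H (z : mR R * mR R) := \1_I2 z.1 * (kap (z.2 - z.1) * cabs (trig a r z.2) ^+ 3).
have mH : measurable_fun setT H.
  apply: measurable_funM.
    by apply: (measurableT_comp (measurable_indic measurable_I2)); exact: measurable_fst.
  apply: measurable_funM => //.
  by apply: (measurableT_comp (lmeas_trigX a r 3)); exact: measurable_snd.
have H0 z : 0 <= H z.
  by rewrite mulr_ge0 ?mulr_ge0 ?kap_ge0 ?exprn_ge0 ?cabs_ge0// indicE.
have step1 z : ((kap z * cabs (trig a r z) ^+ 3)%:E <= c%:E * \int[mu]_y (H (y, z))%:E)%E.
  have m1 : measurable_fun setT (fun y : mR R => (H (y, z))%:E).
    by apply/measurable_EFinP; exact: (measurableT_comp mH (pair2_measurable z)).
  rewrite -ge0_integralZl_EFin//; last by move=> y _; rewrite lee_fin.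
  apply: (@le_trans _ _ (\int[mu]_y ((kap z * cabs (trig a r z) ^+ 3 / (2 * pi)) * \1_I2 y)%:E)%E).
    under eq_integral do rewrite EFinM.
    rewrite ge0_integralZl_EFin//; last 2 first.
    - by apply/measurable_EFinP; exact: measurable_indic.
    - by rewrite divr_ge0 ?mulr_ge0 ?kap_ge0 ?exprn_ge0 ?cabs_ge0// ltW.
    have e : (\int[mu]_y (\1_I2 y)%:E = (2 * pi)%:E)%E.
      by rewrite (integral_indic mu measurableT mI) setIT; exact: mu_I2.
    rewrite -[X in (_ <= _ * X)%E]/(\int[mu]_y (\1_I2 y)%:E)%E e -EFinM lee_fin.
    by rewrite divfK// gt_eqF// mulr_gt0.
  apply: ge0_le_integral => //.
  - move=> y _; rewrite lee_fin mulr_ge0 ?divr_ge0 ?mulr_ge0 ?kap_ge0 ?exprn_ge0 ?cabs_ge0// ?ltW//.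
  - apply/measurable_EFinP; apply: (@measurable_funM _ (mR R)); first exact: measurable_cst.
    exact: measurable_indic.
  - by apply: emeasurable_funM => //; exact: measurable_cst.
  - move=> y _; rewrite lee_fin /H/= indicE; case: (boolP (y \in I2)) => [|_]; last by rewrite !mulr0 mul0r mulr0.
    move=> /set_mem; rewrite /I2/= in_itv/= => /andP[y0 y2]; rewrite mulr1 mul1r /c.
    have pe := kap_peetre y z.
    have : kap z <= 2 * (1 + 4 * pi ^+ 2) * kap (z - y).
      have := kap_peetre (z - y) (- y); rewrite (_ : - y - (z - y) = - z); last by ring.
      rewrite {1}/kap sqrrN -/(kap z) => /le_trans; apply.
      rewrite mulrAC ler_wpM2r ?kap_ge0// ler_wpM2l// /kap invrK lerD2l sqrrN.
      rewrite -subr_ge0 (_ : _ - _ = (2 * pi - y) * (2 * pi + y)); last by ring.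
      by rewrite mulr_ge0 ?subr_ge0// addr_ge0// mulr_ge0// ltW.
    move=> hk; rewrite -mulrA.
    have q0 : 0 <= cabs (trig a r z) ^+ 3 / (2 * pi) by rewrite divr_ge0 ?exprn_ge0 ?cabs_ge0 ?mulr_ge0// ltW.
    apply: (@le_trans _ _ (2 * (1 + 4 * pi ^+ 2) * kap (z - y) * (cabs (trig a r z) ^+ 3 / (2 * pi)))).
      by rewrite ler_wpM2r.
    by rewrite le_eqVlt; apply/orP; left; apply/eqP; ring.
apply: (@le_trans _ _ (c%:E * \int[mu]_z \int[mu]_y (H (y, z))%:E)%E).
  rewrite -ge0_integralZl_EFin//; last 2 first.
  - by move=> z _; apply: integral_ge0 => y _; rewrite lee_fin.
  - apply: (@measurable_fun_fubini_tonelli_G _ _ _ _ _ mu (fun xy => (H xy)%:E)).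
      exact/measurable_EFinP.
    by move=> x; rewrite lee_fin.
  apply: ge0_le_integral => //.
  - by move=> z _; rewrite lee_fin mulr_ge0 ?kap_ge0 ?exprn_ge0 ?cabs_ge0.
  - apply/measurable_EFinP; apply: (@measurable_funM _ (mR R)); first exact: measurable_kap.
    exact: lmeas_trigX.
  - apply: emeasurable_funM; first exact: measurable_cst.
    apply: (@measurable_fun_fubini_tonelli_G _ _ _ _ _ mu (fun xy => (H xy)%:E)).
      exact/measurable_EFinP.
    by move=> x; rewrite lee_fin.
have -> : (\int[mu]_z \int[mu]_y (H (y, z))%:E = \int[mu]_w \int[mu]_y (H (y, w + y))%:E)%E.
  rewrite -(@fubini_tonelli _ _ _ _ _ mu mu (fun xy => (H xy)%:E))/=; last 2 first.
  - exact/measurable_EFinP.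
  - by move=> z; rewrite lee_fin.
  rewrite -(@fubini_tonelli _ _ _ _ _ mu mu (fun xy => (H (xy.1, xy.2 + xy.1))%:E))/=; last 2 first.
  - apply/measurable_EFinP; apply: (measurableT_comp mH).
    apply/measurable_fun_pairP; split => //=; first exact: measurable_fst.
    by apply: measurable_funD; [exact: measurable_snd|exact: measurable_fst].
  - by move=> z; rewrite lee_fin.
  apply: eq_integral => y _.
  rewrite (ge0_integral_aff y ltr01) ?mul1e; last 2 first.
  - by apply/measurable_EFinP; exact: (measurableT_comp mH (pair1_measurable y)).
  - by move=> z; rewrite lee_fin.
  by apply: eq_integral => w _; rewrite mul1r.
have inner w : (\int[mu]_y (H (y, w + y))%:E <= (kap w * (6 * pi * A ^+ 2))%:E)%E.
  pose b k := a k * expi (k%:~R * w).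
  have tE y : trig a r (w + y) = trig b r y.
    by rewrite /trig; apply: eq_bigr => k _; rewrite mulrDr expiD mulrA.
  have bA : \sum_(k <- r) p32 (cabs (b k)) = A.
    by apply: eq_bigr => k _; rewrite /b cabsM cabs_expi mulr1.
  have -> : (\int[mu]_y (H (y, w + y))%:E = (kap w)%:E * \int[mu]_(y in I2) (cabs (trig b r y) ^+ 3)%:E)%E.
    rewrite [X in (_ * X)%E]integral_mkcond -ge0_integralZl_EFin//; last 3 first.
    - by move=> y _; rewrite patchE; case: ifP => // _; rewrite lee_fin exprn_ge0 ?cabs_ge0.
    - apply: (measurable_restrictT _ mI).1; apply: measurable_funTS; apply/measurable_EFinP; exact: lmeas_trigX.
    - exact: kap_ge0.
    apply: eq_integral => y _; rewrite /H/= patchE indicE; case: (boolP (y \in I2)) => _.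
      by rewrite mul1r addrK tE EFinM.
    by rewrite mul0r mule0.
  rewrite EFinM lee_wpmul2l ?lee_fin ?kap_ge0//.
  have := hausdorff_young b ur; rewrite bA -lee_fin /Rintegral fineK//.
  exact: (integrable_fin_num mI (integrable_trigX b r 3)).
apply: (@le_trans _ _ (c%:E * \int[mu]_w (kap w * (6 * pi * A ^+ 2))%:E)%E).
  rewrite lee_wpmul2l ?lee_fin//; apply: ge0_le_integral => //.
  - by move=> z _; apply: integral_ge0 => y _; rewrite lee_fin.
  - pose H' (xy : mR R * mR R) := (H (xy.1, (xy.2 : R) + (xy.1 : R)))%:E.
    have mH' : measurable_fun setT H'.
      apply/measurable_EFinP; apply: (measurableT_comp mH).
      apply/measurable_fun_pairP; split => //=; first exact: measurable_fst.
      by apply: measurable_funD; [exact: measurable_snd|exact: measurable_fst].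
    have H'0 x : (0 <= H' x)%E by rewrite lee_fin.
    exact: (@measurable_fun_fubini_tonelli_G _ _ _ _ _ mu H' mH' H'0).
  - apply/measurable_EFinP; apply: (@measurable_funM _ (mR R)); [exact: measurable_kap|exact: measurable_cst].
under eq_integral do rewrite EFinM.
rewrite ge0_integralZr//; last 3 first.
- by apply/measurable_EFinP; exact: measurable_kap.
- by move=> z _; rewrite lee_fin kap_ge0.
- by rewrite lee_fin mulr_ge0 ?sqr_ge0// mulr_ge0// ltW.
rewrite integral_kap -!EFinM lee_fin /c le_eqVlt; apply/orP; left; apply/eqP.
have : pi != 0 :> R by rewrite gt_eqF.
by generalize (pi : R) => P P0; field.
Qed.
End Torus.

(** * Bernstein's inequality and the summation of blocks *)

Section Conv.
Variable R : realType.
Notation mu := (@lebesgue_measure R).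

(** The cube of the L^3 norm: no root is taken, and Jensen's inequality and Fatou's lemma apply to
    it directly. *)
Definition int3 (g : R -> R[i]) : \bar R := (\int[mu]_x (cabs (g x) ^+ 3)%:E)%E.

Lemma ler_cube (x y : R) : 0 <= x -> x <= y -> x ^+ 3 <= y ^+ 3.
Proof. by move=> x0 xy; rewrite lerXn2r ?nnegrE ?(le_trans x0 xy). Qed.

Lemma tonelli_swap (H : mR R * mR R -> R) : measurable_fun setT H -> (forall z, 0 <= H z) ->
  (\int[mu]_y \int[mu]_x (H (x, y))%:E = \int[mu]_x \int[mu]_y (H (x, y))%:E)%E.
Proof.
move=> mH H0; have mH' : measurable_fun setT (EFin \o H) by exact/measurable_EFinP.
by rewrite -(@fubini_tonelli _ _ _ _ _ mu mu _ mH')//= => z; rewrite lee_fin.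
Qed.

Lemma tonelli_conv (H : mR R * mR R -> R) : measurable_fun setT H -> (forall z, 0 <= H z) ->
  (\int[mu]_y \int[mu]_x (H (x, (y : R) - (x : R)))%:E = \int[mu]_x \int[mu]_y (H (x, y))%:E)%E.
Proof.
move=> mH H0.
have mK : measurable_fun setT (fun z : mR R * mR R => H (z.1, (z.2 : R) - (z.1 : R))).
  apply: (measurableT_comp mH); apply/measurable_fun_pairP; split => //=; first exact: measurable_fst.
  exact: measurable_subr2.
rewrite (tonelli_swap mK)//; apply: eq_integral => x _.
rewrite (ge0_integral_aff x ltr01) ?mul1e/=; last 2 first.
- by apply/measurable_EFinP; exact: (measurableT_comp mK (pair1_measurable x)).
- by move=> z; rewrite lee_fin.
by apply: eq_integral => y _ /=; rewrite mul1r addrK.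
Qed.

Lemma kapC (x y : R) : kap (y - x) = kap (x - y).
Proof. by rewrite /kap -sqrrN opprB. Qed.

Lemma measurable_kap_sub (y : R) : lmeas (fun x => kap (y - x)).
Proof.
apply: (measurableT_comp (@measurable_kap R)).
by apply: (@measurable_funB _ (mR R)); [exact: measurable_cst|exact: measurable_id].
Qed.

Lemma integral_kap_sub (y : R) : (\int[mu]_x (kap (y - x))%:E = pi%:E)%E.
Proof.
rewrite -integral_kap (ge0_integral_aff y ltr01) ?mul1e//=; last 2 first.
- by apply/measurable_EFinP; exact: measurable_kap_sub.
- by move=> x; rewrite lee_fin kap_ge0.
apply: eq_integral => x _; rewrite mul1r /kap; congr (_%:E).
by rewrite opprD addrCA subrr addr0 sqrrN.
Qed.

Lemma tonelli_kap (f : R -> R) : lmeas f -> (forall x, 0 <= f x) ->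
  (\int[mu]_y \int[mu]_x (kap (y - x) * f x)%:E = pi%:E * \int[mu]_x (f x)%:E)%E.
Proof.
move=> mf f0.
have mH : measurable_fun setT (fun z : mR R * mR R => kap z.2 * f z.1).
  apply: measurable_funM.
    by apply: (measurableT_comp (@measurable_kap R)); exact: measurable_snd.
  by apply: (measurableT_comp mf); exact: measurable_fst.
rewrite (tonelli_conv mH)/=; last by move=> z; rewrite mulr_ge0// kap_ge0.
rewrite -ge0_integralZl_EFin//; last 3 first.
- by move=> x _; rewrite lee_fin.
- exact/measurable_EFinP.
- exact: pi_ge0.
apply: eq_integral => x _; under eq_integral do rewrite EFinM.
rewrite ge0_integralZr ?integral_kap//.
- by apply/measurable_EFinP; exact: measurable_kap.
- by move=> z _; rewrite lee_fin kap_ge0.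
by rewrite lee_fin.
Qed.

Lemma integrable_le_fin (f : R -> R) (Y : R) : lmeas f -> (forall x, 0 <= f x) ->
  (\int[mu]_x (f x)%:E <= Y%:E)%E -> mu.-integrable setT (EFin \o f).
Proof.
move=> mf f0 h; apply/integrableP; split; first exact/measurable_EFinP.
by under eq_integral do rewrite /= ger0_norm//; rewrite (le_lt_trans h)// ltry.
Qed.

Lemma lmeas_powcabs (p : R) (g : R -> R[i]) : lcmeas g -> lmeas (fun x => cabs (g x) `^ p).
Proof. by move=> mg; apply: (measurableT_comp (measurable_powR p)); exact: (measurable_cabs mg). Qed.

Lemma lmeas_cabs3 (g : R -> R[i]) : lcmeas g -> lmeas (fun x => cabs (g x) ^+ 3).
Proof. by move=> mg; apply: (@measurable_funX _ (mR R)); exact: (measurable_cabs mg). Qed.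

(** With threshold 1, [powR_split] gives |g| <= 1 + |g|^p, so [kap] times |g| is at most [kap] plus
    |g|^p. *)
Lemma integrable_kap_powR (p : R) g (Y : R) : 1 <= p -> lcmeas g ->
  (\int[mu]_x (cabs (g x) `^ p)%:E <= Y%:E)%E ->
  mu.-integrable setT (EFin \o (fun x => cabs (g x) * kap x)).
Proof.
move=> p1 mg h.
have ip := integrable_le_fin (lmeas_powcabs p mg) (fun x => powR_ge0 _ _) h.
apply: (@integrable_dom R _ (mR R) mu setT _ (fun x => kap x + cabs (g x) `^ p)) => //.
- by apply: (@measurable_funM _ (mR R)); [exact: (measurable_cabs mg)|exact: measurable_kap].
- move=> x _; rewrite ger0_norm ?mulr_ge0 ?cabs_ge0 ?kap_ge0//.
  have := @powR_split R (cabs (g x)) 1 p (cabs_ge0 _) ltr01 p1; rewrite powR1 mulr1 => k.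
  rewrite (le_trans (ler_wpM2r (kap_ge0 x) k))// mulrDl mul1r lerD2l.
  by rewrite ler_piMr ?powR_ge0// kap_le1.
- by apply: integrable_addR => //; exact: integrable_kap.
Qed.

Lemma integrable_kap_int3 g (Y : R) : lcmeas g -> (int3 g <= Y%:E)%E ->
  mu.-integrable setT (EFin \o (fun x => cabs (g x) * kap x)).
Proof.
move=> mg h; apply: (@integrable_kap_powR 3%:R g Y) => //; first by rewrite ler1n.
by under eq_integral do rewrite powR_mulrn ?cabs_ge0//.
Qed.

(** Cauchy-Schwarz with free weights. It takes the place of Minkowski's inequality: the right side
    is linear in the squares of the h k and can be integrated term by term. *)
Lemma weighted_cauchy (I : Type) (r : seq I) (h n : I -> R) : (forall k, 0 <= h k) -> (forall k, 0 < n k) ->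
  (\sum_(k <- r) h k) ^+ 2 <= (\sum_(k <- r) n k) * \sum_(k <- r) h k ^+ 2 / n k.
Proof.
move=> h0 n0; elim: r => [|k r IH]; first by rewrite !big_nil mul0r expr0n.
rewrite !big_cons; set S := \sum_(j <- r) h j; set N := \sum_(j <- r) n j; set Q := \sum_(j <- r) _.
have S0 : 0 <= S by exact: sumr_ge0.
have N0 : 0 <= N by apply: sumr_ge0 => j _; exact: ltW.
have Q0 : 0 <= Q by apply: sumr_ge0 => j _; rewrite divr_ge0 ?sqr_ge0// ltW.
have [hk nk] := (h0 k, n0 k); set x := h k; set m := n k.
have xm : 0 <= x ^+ 2 / m by rewrite divr_ge0 ?sqr_ge0// ltW.
suff : 2 * x * S <= m * Q + N * (x ^+ 2 / m).
  move=> c; rewrite sqrrD mulrDl !mulrDr.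
  have -> : m * (x ^+ 2 / m) = x ^+ 2 by field; rewrite gt_eqF.
  have -> : x * S *+ 2 = 2 * x * S by rewrite -mulr_natl mulrA.
  move: IH; rewrite -/S -/N -/Q; lra.
rewrite -(@ler_pXn2r _ 2)// ?nnegrE ?addr_ge0 ?mulr_ge0 ?(ltW nk) ?invr_ge0 ?(ltW nk)//.
have : x ^+ 2 * S ^+ 2 <= x ^+ 2 * (N * Q) by rewrite ler_wpM2l ?sqr_ge0.
have := sqr_ge0 (m * Q - N * (x ^+ 2 / m)).
have -> : (m * Q - N * (x ^+ 2 / m)) ^+ 2 = (m * Q + N * (x ^+ 2 / m)) ^+ 2 - 4 * (x ^+ 2 * (N * Q)).
  by field; rewrite gt_eqF.
have -> : (2 * x * S) ^+ 2 = 4 * (x ^+ 2 * S ^+ 2) by ring.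
lra.
Qed.

Variable sigma0 : R -> R[i].
Hypothesis adm : admissible_partition sigma0.

Lemma integrable_bandker k g y : lcmeas g ->
  mu.-integrable setT (EFin \o (fun x => cabs (g x) * kap x)) ->
  cintegrable setT (fun x => bandker sigma0 k (y - x) * g x).
Proof.
move=> mg ig.
have [A A0 hA] := schwartz_kap (schwartz_bandker adm k).
have mb z : lcmeas (fun x => bandker sigma0 k (z - x)).
  apply: (cmeas_comp _ (schwartz_cmeas (schwartz_bandker adm k))).
  by apply: (@measurable_funB _ (mR R)); [exact: measurable_cst|exact: measurable_id].
apply: (@cintegrable_dom R setT _ (fun x => (2 * A / kap y) * (cabs (g x) * kap x)) measurableT).
- by apply: cmeasM; [exact: mb|exact: mg].
- move=> x _; rewrite cabsM [leRHS]mulrCA [leLHS]mulrC ler_wpM2l ?cabs_ge0//.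
  rewrite (le_trans (hA _))// (le_trans (ler_wpM2l A0 (kap_peetre x y)))//.
  by rewrite le_eqVlt; apply/orP; left; apply/eqP; ring.
- exact: integrable_rZl.
Qed.

Lemma integrable_kap_sub_mul (f : R -> R) y : lmeas f -> (forall x, 0 <= f x) ->
  mu.-integrable setT (EFin \o (fun x => f x * kap x)) ->
  mu.-integrable setT (EFin \o (fun x => kap (y - x) * f x)).
Proof.
move=> mf f0 ig.
apply: (@integrable_dom R _ (mR R) mu setT _ (fun x => (2 / kap y) * (f x * kap x))) => //.
- by apply: (@measurable_funM _ (mR R)); [exact: measurable_kap_sub|].
- move=> x _; rewrite ger0_norm ?mulr_ge0 ?kap_ge0// [leRHS]mulrCA mulrC ler_wpM2l//.
  by rewrite (le_trans (kap_peetre x y))// le_eqVlt; apply/orP; left; apply/eqP; ring.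
- exact: integrable_rZl.
Qed.

Lemma fatker_kap : exists2 A, 0 < A & forall z, cabs (fatker sigma0 z) <= A * kap z.
Proof.
have [A A0 hA] := schwartz_kap (schwartz_fatker adm).
exists (A + 1); first by rewrite ltr_wpDl.
by move=> z; rewrite (le_trans (hA z))// ler_wpM2r ?kap_ge0// lerDl.
Qed.

(** Let Y(y) be the integral of kap(y - x) |g x|^p. Jensen bounds the convolution by a constant
    times Y^(1/p). Since Y <= lam^p and p <= 3, its cube is at most a constant times lam^(3 - p) Y,
    and the integral of Y is pi times that of |g|^p. *)
Lemma bernstein : exists2 C : R, 0 < C & forall k (p lam : R) g, 1 <= p <= 3 -> 0 < lam -> lcmeas g ->
  (\int[mu]_x (cabs (g x) `^ p)%:E <= (lam `^ p)%:E)%E ->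
  (int3 (bandconv sigma0 k g) <= (C * lam ^+ 3)%:E)%E.
Proof.
have [A A0 hA] := fatker_kap.
have p0 : 0 < pi :> R by exact: pi_gt0.
exists ((A * (pi + 1)) ^+ 3 * pi); first by rewrite mulr_gt0// exprn_gt0// mulr_gt0// addr_gt0.
move=> k p lam g /andP[p1 p3] l0 mg h.
have pp : 0 < p by exact: lt_le_trans p1.
have ig := integrable_kap_powR p1 mg h.
have mp := lmeas_powcabs p mg.
have mkp y : lmeas (fun x => kap (y - x) * cabs (g x) `^ p).
  by apply: (@measurable_funM _ (mR R)); [exact: measurable_kap_sub|].
have Yle y : (\int[mu]_x (kap (y - x) * cabs (g x) `^ p)%:E <= (lam `^ p)%:E)%E.
  rewrite (le_trans _ h)//; apply: ge0_le_integral => //.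
  - by move=> x _; rewrite lee_fin mulr_ge0 ?kap_ge0 ?powR_ge0.
  - exact/measurable_EFinP.
  - exact/measurable_EFinP.
  - by move=> x _; rewrite lee_fin ler_piMl ?powR_ge0// kap_le1.
pose Y y := fine (\int[mu]_x (kap (y - x) * cabs (g x) `^ p)%:E)%E.
have YE y : (\int[mu]_x (kap (y - x) * cabs (g x) `^ p)%:E = (Y y)%:E)%E.
  rewrite /Y fineK// ge0_fin_numE ?(le_lt_trans (Yle y)) ?ltry//.
  by apply: integral_ge0 => x _; rewrite lee_fin mulr_ge0 ?kap_ge0 ?powR_ge0.
have Y0 y : 0 <= Y y.
  by rewrite fine_ge0// integral_ge0// => x _; rewrite lee_fin mulr_ge0 ?kap_ge0 ?powR_ge0.
have Yl y : Y y <= lam `^ p by rewrite -lee_fin -YE.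
have mgc : lmeas (fun x => cabs (g x)) by exact: (measurable_cabs mg).
have ikg y := integrable_kap_sub_mul y mgc (fun x => cabs_ge0 (g x)) ig.
have pt y : cabs (bandconv sigma0 k g y) ^+ 3 <= (A * (pi + 1)) ^+ 3 * lam `^ (3 - p) * Y y.
  have b1 : cabs (bandconv sigma0 k g y) <= A * ((pi + 1) * Y y `^ p^-1).
    apply: (@le_trans _ _ (\int[mu]_x (A * (kap (y - x) * cabs (g x))))).
      apply: cabs_cintegral_le => //.
      - apply: cmeasM => //; apply: (cmeas_comp _ (schwartz_cmeas (schwartz_bandker adm k))).
        by apply: (@measurable_funB _ (mR R)); [exact: measurable_cst|exact: measurable_id].
      - by move=> x _; rewrite cabsM cabs_bandker mulrA ler_wpM2r ?cabs_ge0.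
      - by apply: integrable_rZl => //; exact: ikg.
    rewrite (RintegralZl _ measurableT (ikg y)).
    rewrite ler_pM2l// -lee_fin /Rintegral fineK; last exact: (integrable_fin_num _ (ikg y)).
    apply: (@jensen_int _ _ _ mu (fun x => kap (y - x)) (fun x => cabs (g x)) p pi (Y y)) => //.
    - exact: measurable_kap_sub.
    - by move=> x; exact: kap_ge0.
    - by move=> x; exact: cabs_ge0.
    - by rewrite integral_kap_sub.
    - by rewrite YE.
  apply: (@le_trans _ _ ((A * ((pi + 1) * Y y `^ p^-1)) ^+ 3)).
    by apply: ler_cube => //; exact: cabs_ge0.
  have c0 : 0 <= A * (pi + 1) by rewrite ltW// mulr_gt0// addr_gt0.
  rewrite mulrA [leLHS]exprMn -[leRHS]mulrA ler_wpM2l ?exprn_ge0//.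
  have [->|Yn] := eqVneq (Y y) 0.
    by rewrite powR0 ?invr_eq0 ?gt_eqF// expr0n mulr0.
  have Yp : 0 < Y y by rewrite lt_def Yn Y0.
  rewrite -powR_mulrn ?powR_ge0// -powRrM.
  have -> : p^-1 * 3 = 1 + (3 - p) / p by field; rewrite gt_eqF.
  have -> : Y y `^ (1 + (3 - p) / p) = Y y * Y y `^ ((3 - p) / p).
    have yq : (1 + (3 - p) / p == 0) ==> (Y y != 0) by rewrite Yn implybT.
    by rewrite (powRD yq) (powRr1 (Y0 y)).
  rewrite mulrC ler_wpM2r ?Y0//.
  have -> : lam `^ (3 - p) = (lam `^ p) `^ ((3 - p) / p).
    by rewrite -powRrM; congr (_ `^ _); field; rewrite gt_eqF.
  by rewrite ge0_ler_powR ?nnegrE ?powR_ge0 ?Y0// divr_ge0 ?subr_ge0// ltW.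
have mY : lmeas Y.
  apply: (measurable_param (f := fun z => kap (z.2 - z.1) * cabs (g z.1) `^ p)).
  apply: measurable_funM.
    by apply: (measurableT_comp (@measurable_kap R)); exact: measurable_subr2.
  by apply: (measurableT_comp mp); exact: measurable_fst.
set c := (A * (pi + 1)) ^+ 3 in pt *.
have c0 : 0 <= c by rewrite /c exprn_ge0// ltW// mulr_gt0// addr_gt0.
apply: (@le_trans _ _ (\int[mu]_y ((c * lam `^ (3 - p)) * Y y)%:E)%E).
  apply: ge0_le_integral => //.
  - by move=> x _; rewrite lee_fin exprn_ge0 ?cabs_ge0.
  - by apply/measurable_EFinP; apply: lmeas_cabs3; exact: lcmeas_bandconv.
  - by apply/measurable_EFinP; apply: (@measurable_funM _ (mR R)); [exact: measurable_cst|].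
  - by move=> y _; rewrite lee_fin.
under eq_integral do rewrite EFinM.
rewrite ge0_integralZl_EFin//; last 3 first.
- by move=> y _; rewrite lee_fin.
- exact/measurable_EFinP.
- by rewrite mulr_ge0 ?powR_ge0.
have -> : (\int[mu]_y (Y y)%:E = pi%:E * \int[mu]_x (cabs (g x) `^ p)%:E)%E.
  by rewrite -tonelli_kap//; [apply: eq_integral => y _; rewrite -YE|move=> x; exact: powR_ge0].
apply: (@le_trans _ _ ((c * lam `^ (3 - p))%:E * (pi%:E * (lam `^ p)%:E))%E).
  apply: lee_wpmul2l; first by rewrite lee_fin mulr_ge0// powR_ge0.
  by apply: lee_wpmul2l => //; rewrite lee_fin ltW.
rewrite -!EFinM lee_fin le_eqVlt; apply/orP; left; apply/eqP.
have -> : lam ^+ 3 = lam `^ (3 - p) * lam `^ p.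
  have ll : (3 - p + p == 0) ==> (lam != 0) by rewrite (gt_eqF l0) implybT.
  by rewrite -(powRD ll) subrK (powR_mulrn 3 (ltW l0)).
by ring.
Qed.

(** The sum is the integral over x of fatker(y - x) P(x, y - x), where P(x, z) is the trigonometric
    polynomial in z with coefficients [g k x]. Jensen, a shift in y, and [hausdorff_young_kap] at
    fixed x reduce the claim to the integral of the squared sum of the |g k x|^(3/2); there
    [weighted_cauchy] with the weights n k applies. *)
Lemma band_sum : exists2 C : R, 0 < C & forall (r : seq int) (g : int -> R -> R[i]) (n : int -> R),
  uniq r -> (forall k, lcmeas (g k)) -> (forall k, 0 < n k) ->
  (forall k, int3 (g k) <= (n k ^+ 2)%:E)%E ->
  (int3 (fun y => (\sum_(k <- r) bandconv sigma0 k (g k) y)%R) <= (C * (\sum_(k <- r) n k) ^+ 2)%:E)%E.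
Proof.
have [A A0 hA] := fatker_kap.
have p0 : 0 < pi :> R by exact: pi_gt0.
pose c1 := (A * (pi + 1)) ^+ 3 : R.
pose c2 := 6 * pi * (1 + 4 * pi ^+ 2) : R.
have c10 : 0 < c1 by rewrite exprn_gt0// mulr_gt0// addr_gt0.
have c20 : 0 < c2.
  by rewrite mulr_gt0 ?mulr_gt0// ltr_wpDr// mulr_ge0// sqr_ge0.
exists (c1 * c2); first by rewrite mulr_gt0.
move=> r g n ur mg n0 gn.
have ig k := integrable_kap_int3 (mg k) (gn k).
pose P (z : mR R * mR R) : R[i] := trig (fun k => g k z.1) r z.2.
have mP : cmeas P.
  apply: cmeas_sum => k; apply: cmeasM; first exact: (cmeas_comp measurable_fst (mg k)).
  exact: (cmeas_comp measurable_snd (lcmeas_expilin k%:~R)).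
have mPc : measurable_fun setT (fun z => cabs (P z)) by exact: measurable_cabs.
pose H (z : mR R * mR R) := kap z.2 * cabs (P z) ^+ 3.
have mH : measurable_fun setT H.
  apply: measurable_funM; last exact: measurable_funX.
  by apply: (measurableT_comp (@measurable_kap R)); exact: measurable_snd.
have H0 z : 0 <= H z by rewrite mulr_ge0 ?kap_ge0// exprn_ge0 ?cabs_ge0.
have mdiag y : measurable_fun setT (fun x : mR R => (x, (y : R) - (x : R)) : mR R * mR R).
  apply/measurable_fun_pairP; split; first exact: measurable_id.
  by apply: (@measurable_funB _ (mR R)); [exact: measurable_cst|exact: measurable_id].
have mPy y : lmeas (fun x => cabs (P (x, y - x))) by exact: (measurableT_comp mPc (mdiag y)).
have Pb x z : cabs (P (x, z)) <= \sum_(k <- r) cabs (g k x) by exact: trig_bound.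
have iP y : mu.-integrable setT (EFin \o (fun x => kap (y - x) * cabs (P (x, y - x)))).
  apply: (@integrable_dom R _ (mR R) mu setT _ (fun x => kap (y - x) * \sum_(k <- r) cabs (g k x))) => //.
  - by apply: (@measurable_funM _ (mR R)); [exact: measurable_kap_sub|exact: mPy].
  - by move=> x _; rewrite ger0_norm ?mulr_ge0 ?kap_ge0 ?cabs_ge0// ler_wpM2l ?kap_ge0.
  - apply: integrable_kap_sub_mul.
    + by apply: (@measurable_sum _ (mR R)) => k; exact: (measurable_cabs (mg k)).
    + by move=> x; apply: sumr_ge0 => k _; exact: cabs_ge0.
    + rewrite (_ : _ \o _ = fun x => (\sum_(k <- r) (cabs (g k x) * kap x)%:E)%E); last first.
        by apply/funext => x; rewrite /= mulr_suml sumEFin.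
      by apply: (@integrable_sum _ (mR R)) => // k _; exact: ig.
have pt y : ((cabs (\sum_(k <- r) bandconv sigma0 k (g k) y) ^+ 3)%:E <=
    c1%:E * \int[mu]_x (H (x, y - x))%:E)%E.
  have mHy : measurable_fun setT (fun x : mR R => H (x, y - x)) by exact: (measurableT_comp mH (mdiag y)).
  have b1 : cabs (\sum_(k <- r) bandconv sigma0 k (g k) y) <= A * \int[mu]_x (kap (y - x) * cabs (P (x, y - x))).
    rewrite /bandconv -cintegral_sum//; last by move=> k; exact: integrable_bandker.
    rewrite -RintegralZl//; apply: cabs_cintegral_le => //.
    - apply: cmeas_sum => k; apply: cmeasM => //; apply: (cmeas_comp _ (schwartz_cmeas (schwartz_bandker adm k))).
      by apply: (@measurable_funB _ (mR R)); [exact: measurable_cst|exact: measurable_id].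
    - move=> x _; rewrite (_ : \sum_(k <- r) _ = fatker sigma0 (y - x) * P (x, y - x)).
        by rewrite cabsM mulrA ler_wpM2r ?cabs_ge0.
      by rewrite /P /trig mulr_sumr; apply: eq_bigr => k _; rewrite /bandker/=; ring.
    - by apply: integrable_rZl.
  have E0 : (0 <= \int[mu]_x (H (x, (y - x)%R))%:E)%E by apply: integral_ge0 => x _; rewrite lee_fin.
  have [fy|] := boolP (\int[mu]_x (H (x, (y - x)%R))%:E \is a fin_num)%E; last first.
    rewrite ge0_fin_numE// -leNgt leye_eq => /eqP ->.
    by rewrite gt0_muley ?lte_fin// leey.
  rewrite -(fineK fy) -EFinM lee_fin.
  set Y := fine _; have Y0 : 0 <= Y by rewrite fine_ge0.
  have J : (\int[mu]_x (kap (y - x) * cabs (P (x, y - x)))) ^+ 3 <= (pi + 1) ^+ 3 * Y.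
    apply: jensen_cube => //.
    - exact: measurable_kap_sub.
    - by move=> x; exact: kap_ge0.
    - by move=> x; exact: cabs_ge0.
    - by rewrite integral_kap_sub.
    - by rewrite /Y fineK.
  have I0 : 0 <= \int[mu]_x (kap (y - x) * cabs (P (x, y - x))).
    by apply: Rintegral_ge0 => x _; rewrite mulr_ge0 ?kap_ge0 ?cabs_ge0.
  apply: (@le_trans _ _ ((A * \int[mu]_x (kap (y - x) * cabs (P (x, y - x)))) ^+ 3)).
    by apply: ler_cube => //; exact: cabs_ge0.
  by rewrite exprMn /c1 [in leRHS]exprMn -[leRHS]mulrA ler_wpM2l// exprn_ge0// ltW.
pose S2 x := (\sum_(k <- r) p32 (cabs (g k x))) ^+ 2.
have inner x : (\int[mu]_y (H (x, y))%:E <= (c2 * S2 x)%:E)%E.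
  exact: (hausdorff_young_kap (fun k => g k x) ur).
pose N := \sum_(k <- r) n k.
have N0 : 0 <= N by apply: sumr_ge0 => k _; exact: ltW.
have S2le x : S2 x <= N * \sum_(k <- r) (n k)^-1 * cabs (g k x) ^+ 3.
  rewrite (le_trans (weighted_cauchy r (h := fun k => p32 (cabs (g k x))) _ n0))//.
    by move=> k; exact: p32_ge0.
  have E k : p32 (cabs (g k x)) ^+ 2 / n k = (n k)^-1 * cabs (g k x) ^+ 3.
    by rewrite p32_sqr ?cabs_ge0// mulrC.
  by rewrite (eq_bigr _ (fun k _ => E k)).
have mHk : measurable_fun setT (fun y : mR R => (\int[mu]_x (H (x, (y - x)%R))%:E)%E).
  apply: (@measurable_fun_fubini_tonelli_G _ _ _ _ _ mu (fun z : mR R * mR R => (H (z.1, (z.2 : R) - (z.1 : R)))%:E)).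
    apply/measurable_EFinP; apply: (measurableT_comp mH); apply/measurable_fun_pairP; split => //=; first exact: measurable_fst.
    exact: measurable_subr2.
  by move=> z; rewrite lee_fin.
have mG : lcmeas (fun y => \sum_(k <- r) bandconv sigma0 k (g k) y).
  by apply: cmeas_sum => k; exact: lcmeas_bandconv.
have m3 k : lmeas (fun x => cabs (g k x) ^+ 3) by exact: lmeas_cabs3.
clear ig; clearbody H c1 c2.
apply: (@le_trans _ _ (c1%:E * \int[mu]_y \int[mu]_x (H (x, (y - x)%R))%:E)%E).
  rewrite -ge0_integralZl_EFin//; last 2 first.
  - by move=> y _; apply: integral_ge0 => x _; rewrite lee_fin.
  - exact: ltW.
  apply: ge0_le_integral => //.
  - by move=> x _; rewrite lee_fin exprn_ge0 ?cabs_ge0.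
  - by apply/measurable_EFinP; exact: lmeas_cabs3.
  - by apply: emeasurable_funM; [exact: measurable_cst|].
rewrite (tonelli_conv mH H0) -[c1 * c2 * _]mulrA EFinM; apply: lee_wpmul2l; first by rewrite lee_fin ltW.
apply: (@le_trans _ _ (\int[mu]_x ((c2 * N) * \sum_(k <- r) (n k)^-1 * cabs (g k x) ^+ 3)%:E)%E).
  apply: ge0_le_integral => //.
  - by move=> x _; apply: integral_ge0 => y _; rewrite lee_fin.
  - apply: (@measurable_fun_fubini_tonelli_F _ _ _ _ _ mu (fun z => (H z)%:E)).
      exact/measurable_EFinP.
    by move=> z; rewrite lee_fin.
  - apply/measurable_EFinP; apply: (@measurable_funM _ (mR R)); first exact: measurable_cst.
    apply: (@measurable_sum _ (mR R)) => k; apply: (@measurable_funM _ (mR R)) => //; exact: measurable_cst.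
  - move=> x _; rewrite (le_trans (inner x))// lee_fin -mulrA ler_wpM2l//; exact: ltW.
under eq_integral do rewrite EFinM -sumEFin.
have t0 k x : (0 <= ((n k)^-1 * cabs (g k x) ^+ 3)%:E)%E.
  by rewrite lee_fin mulr_ge0 ?invr_ge0 ?(ltW (n0 k))// exprn_ge0 ?cabs_ge0.
have tm k : measurable_fun setT (fun x : mR R => ((n k)^-1 * cabs (g k x) ^+ 3)%:E).
  by apply/measurable_EFinP; apply: (@measurable_funM _ (mR R)) => //; exact: measurable_cst.
rewrite ge0_integralZl_EFin//; last 3 first.
- by move=> x _; apply: sume_ge0 => k _; exact: t0.
- by apply: emeasurable_sum.
- by rewrite mulr_ge0// ltW.
rewrite ge0_integral_sum//.
apply: (@le_trans _ _ ((c2 * N)%:E * \sum_(k <- r) (n k)%:E)%E).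
  rewrite lee_wpmul2l ?lee_fin ?mulr_ge0 ?(ltW c20)//; apply: lee_sum => k _.
  under eq_integral do rewrite EFinM.
  rewrite ge0_integralZl_EFin//; last 3 first.
  - by move=> x _; rewrite lee_fin exprn_ge0 ?cabs_ge0.
  - exact/measurable_EFinP.
  - by rewrite invr_ge0 ltW.
  have i0 : 0 <= (n k)^-1 by rewrite invr_ge0 ltW.
  rewrite (le_trans (lee_wpmul2l _ (gn k))) ?lee_fin// expr2 mulrA mulVf ?mul1r// gt_eqF//.
by rewrite sumEFin -EFinM lee_fin -/N expr2 mulrA.
Qed.
End Conv.

(** * Completeness of L^3 *)

Section Complete.
Variable R : realType.
Notation mu := (@lebesgue_measure R).

Lemma fatou_le (f_ : nat -> R -> R) (f : R -> R) (c : \bar R) :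
  (forall j, lmeas (f_ j)) -> lmeas f -> (forall j x, 0 <= f_ j x) -> (forall x, 0 <= f x) ->
  {ae mu, forall x, f_ ^~ x @ \oo --> f x} ->
  (forall j, (\int[mu]_x (f_ j x)%:E <= c)%E) -> (\int[mu]_x (f x)%:E <= c)%E.
Proof.
move=> m_ m f_0 f0 cv h.
have mE j : measurable_fun setT (fun x : mR R => (f_ j x)%:E) by exact/measurable_EFinP.
apply: (@le_trans _ _ (\int[mu]_x limn_einf (fun j => (f_ j x)%:E))%E).
  apply: ae_ge0_le_integral => //.
  - by move=> x _; rewrite lee_fin.
  - exact/measurable_EFinP.
  - move=> x _; rewrite limn_einf_lim; apply: lime_ge; first exact: is_cvg_einfs.
    apply: nearW => n; apply: le_ereal_inf_tmp => _ [k _ <-]; by rewrite lee_fin.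
  - apply: (measurableT_comp (f := -%E)) => //.
    by apply: measurable_fun_limn_esup => j; exact: (measurableT_comp (f := -%E)).
  - have FF := ae_filter_ringOfSetsType mu; apply: filterS cv => x cx _.
    have : (fun j => (f_ j x)%:E) @ \oo --> (f x)%:E by apply: cvg_EFin => //; exact: nearW.
    by move=> c'; rewrite (is_cvg_limn_einfE (cvgP _ c')) (cvg_lim _ c').
apply: (le_trans (fatou mu measurableT mE _)); first by move=> j x _; rewrite lee_fin.
rewrite limn_einf_lim; apply: lime_le; first exact: is_cvg_einfs.
apply: nearW => n; apply: le_trans (h n); apply: ereal_inf_lbound; by exists n => /=.
Qed.

Lemma cvg_cabsE (u : nat -> R[i]) (l : R[i]) :
  CRe (u n) @[n --> \oo] --> CRe l -> CIm (u n) @[n --> \oo] --> CIm l ->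
  cabs (u n) @[n --> \oo] --> cabs l.
Proof.
move=> c1 c2; rewrite cabsE; under eq_fun do rewrite cabsE.
apply: (@cvg_comp _ _ _ (fun n => CRe (u n) ^+ 2 + CIm (u n) ^+ 2) Num.sqrt); last exact: sqrt_continuous.
by apply: cvgD; [exact: (cvg_comp _ _ c1 (@exprn_continuous _ 2 _))|exact: (cvg_comp _ _ c2 (@exprn_continuous _ 2 _))].
Qed.

Lemma cvg_step (u d : nat -> R) : (forall j, `|u j.+1 - u j| <= d j) -> cvgn (series d) -> cvgn u.
Proof.
move=> ud sd; have t : cvgn (series (telescope u)).
  apply: normed_cvg; apply: (series_le_cvg _ _ ud sd) => // n.
  exact: le_trans (ud n).
move: t; rewrite telescopeK => t.
rewrite (_ : u = fun n => (u n - u 0%N) + u 0%N); last by apply/funext => n; rewrite subrK.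
by apply: is_cvgD => //; exact: is_cvg_cst.
Qed.

(** The splitting at a threshold with exponent 3: a value below t is at most t, a value above t
    gains the factor (a / t)^2. *)
Lemma le_add_cube (a t : R) : 0 <= a -> 0 < t -> a <= t + a ^+ 3 / t ^+ 2.
Proof.
move=> a0 t0; have [h|h] := leP a t; first by rewrite ler_wpDr// divr_ge0 ?exprn_ge0// ltW.
rewrite ler_wpDl ?(ltW t0)// ler_pdivlMr ?exprn_gt0// [leRHS]exprS ler_wpM2l//.
by rewrite lerXn2r ?nnegrE// ltW.
Qed.

Lemma sum_half_le (n : nat) : \sum_(0 <= j < n) (2^-1 : R) ^+ j <= 2.
Proof.
have -> : \sum_(0 <= j < n) (2^-1 : R) ^+ j = 2 - 2 * 2^-1 ^+ n.
  elim: n => [|n IH]; first by rewrite big_geq// expr0 mulr1 subrr.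
  by rewrite big_nat_recr//= IH exprS; field.
by rewrite gerBl mulr_ge0// exprn_ge0.
Qed.

(** Along a subsequence with errors at most 8^(-j), the increments D_j make the sum of 4^j D_j^3
    integrable, hence finite almost everywhere. There D_j is dominated by convergent geometric
    series, so the subsequence converges pointwise, and Fatou's lemma returns the same errors e
    n. *)
Lemma L3_complete (G_ : nat -> R -> R[i]) (e : nat -> R) :
  (forall n, lcmeas (G_ n)) -> e @ \oo --> (0 : R) ->
  (forall n m, (n <= m)%N -> int3 (fun x => (G_ m x - G_ n x)%R) <= (e n)%:E)%E ->
  exists2 G, lcmeas G & forall n, (int3 (fun x => (G x - G_ n x)%R) <= (e n)%:E)%E.
Proof.
move=> mG e0 hG.
have [K hK] : {K : nat -> nat & forall j n, (K j <= n)%N -> e n <= 8^-1 ^+ j}.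
  suff : forall j, exists K, forall n, (K <= n)%N -> e n <= 8^-1 ^+ j.
    by move=> h; apply: (choice (P := fun j K => forall n, (K <= n)%N -> e n <= 8^-1 ^+ j)).
  move=> j; have p : 0 < (8^-1 : R) ^+ j by rewrite exprn_gt0.
  have /cvgrPdist_lt/(_ _ p)[N _ hN] := e0; exists N => n /hN /=.
  by rewrite sub0r normrN => /ltW; apply: le_trans; exact: ler_norm.
(* Summing the K i and adding j makes k strictly increasing and at least K j at the same time. *)
pose k j := (\sum_(0 <= i < j.+1) K i + j)%N.
have kK j : (K j <= k j)%N by rewrite /k big_nat_recr//= -addnA; lia.
have kS j : (k j < k j.+1)%N by rewrite /k [in X in (_ < X)%N]big_nat_recr//=; lia.
have kj j : (j <= k j)%N by rewrite /k leq_addl.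
have kmono i j : (i <= j)%N -> (k i <= k j)%N.
  by move=> ij; apply: (@homo_leq _ k leq) => // [? ? ?|n]; [exact: leq_trans|exact: ltnW].
pose D j x := cabs (G_ (k j.+1) x - G_ (k j) x).
have D0 j x : 0 <= D j x by exact: cabs_ge0.
have mD j : lmeas (D j) by apply: measurable_cabs; exact: cmeasB.
pose t j x := 4 ^+ j * D j x ^+ 3.
have t0 j x : 0 <= t j x by rewrite mulr_ge0 ?exprn_ge0.
have mt j : lmeas (t j).
  by apply: (@measurable_funM _ (mR R)); [exact: measurable_cst|exact: (@measurable_funX _ (mR R))].
have mtE j : measurable_fun setT (fun x : mR R => (t j x)%:E) by exact/measurable_EFinP.
have tE0 j x : (0 <= (t j x)%:E)%E by rewrite lee_fin.
have it j : (\int[mu]_x (t j x)%:E <= (2^-1 ^+ j)%:E)%E.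
  under eq_integral do rewrite EFinM.
  rewrite ge0_integralZl_EFin ?exprn_ge0//; last 2 first.
  - by move=> x _; rewrite lee_fin exprn_ge0.
  - by apply/measurable_EFinP; exact: (@measurable_funX _ (mR R)).
  apply: (@le_trans _ _ ((4 ^+ j)%:E * (8^-1 ^+ j)%:E)%E).
    apply: lee_wpmul2l; first by rewrite lee_fin exprn_ge0.
    apply: (le_trans (hG _ _ (ltnW (kS j)))); rewrite lee_fin; exact: hK.
  by rewrite -EFinM lee_fin -exprMn le_eqVlt; apply/orP; left; apply/eqP; congr (_ ^+ _); field.
pose S x := (\sum_(0 <= j <oo) (t j x)%:E)%E.
have mS : measurable_fun setT (S : mR R -> \bar R).
  by apply: ge0_emeasurable_sum.
have S0 x : (0 <= S x)%E by apply: nneseries_ge0.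
have iS : (\int[mu]_x S x <= 2%:E)%E.
  rewrite integral_nneseries//; apply: lime_le.
    by apply: is_cvg_nneseries => n _ _; exact: integral_ge0.
  apply: nearW => n; apply: (@le_trans _ _ (\sum_(0 <= j < n) (2^-1 ^+ j)%:E)%E).
    by apply: lee_sum => j _.
  by rewrite sumEFin lee_fin sum_half_le.
have aS : {ae mu, forall x, (S x < +oo)%E}.
  have : mu.-integrable setT (S : mR R -> \bar R).
    apply/integrableP; split => //; under eq_integral do rewrite gee0_abs//.
    exact: (le_lt_trans iS (ltry _)).
  move=> h; have := integrable_ae measurableT h; have FF := ae_filter_ringOfSetsType mu.
  apply: filterS => x /(_ I).
  by rewrite ge0_fin_numE.
pose E : set (mR R) := [set x | (S x < +oo)%E].
have mE : measurable E.
  rewrite (_ : E = setT `&` S @^-1` [set` `]-oo%E, +oo%E[]).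
    by apply: mS => //; exact: emeasurable_itv.
  by apply/seteqP; split => x; rewrite /E/= in_itv/= ?andbT; [move=> h; split => //; rewrite (lt_le_trans _ (S0 x))|case=> _ /andP[]].
(* Off the set where the series is finite the sequence is replaced by 0, so that its limit exists
   everywhere and is measurable. *)
pose g j x := ((\1_E x)%:C)%C * G_ (k j) x.
have mg j : lcmeas (g j).
  by apply: cmeasM => //; apply: cmeas_real; exact: measurable_indic.
(* The threshold (3/4)^j in [le_add_cube] leaves the second term D_j^3 (16/9)^j, at most S (4/9)^j
   because 4^j D_j^3 <= S. *)
have step x j : (S x < +oo)%E -> D j x <= (3 / 4) ^+ j + fine (S x) * (4 / 9) ^+ j.
  move=> Sx; have fS : S x \is a fin_num by rewrite ge0_fin_numE.
  have tS : t j x <= fine (S x).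
    rewrite -lee_fin fineK//; apply: le_trans (nneseries_lim_ge j.+1 _) => //.
    by rewrite big_nat_recr//= leeDr// sume_ge0.
  have p : 0 < (3 / 4 : R) ^+ j by rewrite exprn_gt0// divr_gt0.
  rewrite (le_trans (le_add_cube (D0 j x) p))// lerD2l.
  have -> : D j x ^+ 3 / ((3 / 4) ^+ j) ^+ 2 = t j x * (4 / 9) ^+ j.
    have -> : ((3 / 4 : R) ^+ j ^+ 2)^-1 = 4 ^+ j * (4 / 9) ^+ j.
      by rewrite -exprMn -exprM mulnC exprM -exprVn; congr (_ ^+ _); field.
    by rewrite /t mulrCA mulrA.
  by rewrite ler_wpM2r// exprn_ge0// divr_ge0.
have dsum x : cvgn (series (fun j => (3 / 4 : R) ^+ j + fine (S x) * (4 / 9) ^+ j)).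
  rewrite (_ : series _ = series (geometric 1 (3 / 4)) \+ series (geometric (fine (S x)) (4 / 9))).
    by apply: is_cvgD; apply: is_cvg_geometric_series; rewrite ger0_norm ?divr_ge0//; lra.
  apply/funext => n; rewrite /series/= -big_split/=; apply: eq_bigr => j _.
  by rewrite mul1r.
have cvr x : cvgn (fun j => CRe (g j x)) /\ cvgn (fun j => CIm (g j x)).
  have [Sx|Sx] := boolP (S x < +oo)%E; last first.
    have z j : g j x = 0.
      by rewrite /g indicE; rewrite (_ : x \in E = false) ?mul0r//; apply/negbTE; rewrite notin_setE => h; rewrite h in Sx.
    have z1 : (fun j => CRe (g j x)) = fun=> 0 by apply/funext => j; rewrite z.
    have z2 : (fun j => CIm (g j x)) = fun=> 0 by apply/funext => j; rewrite z.
    by rewrite z1 z2; split; exact: is_cvg_cst.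
  have gE j : g j x = G_ (k j) x by rewrite /g indicE mem_set ?mul1r.
  split; apply: (cvg_step _ (dsum x)) => j; rewrite !gE.
  - rewrite -CReN -CReD (le_trans (CRe_le_cabs _))//; exact: step.
  - rewrite -CImN -CImD (le_trans (CIm_le_cabs _))//; exact: step.
pose G x : R[i] := (limn (fun j => CRe (g j x)) +i* limn (fun j => CIm (g j x)))%C.
have mGl : lcmeas G.
  split.
  - by apply: (@measurable_fun_cvg _ (mR R) _ _ (fun j x => CRe (g j x))) => [j|x _]; [case: (mg j)|case: (cvr x)].
  - by apply: (@measurable_fun_cvg _ (mR R) _ _ (fun j x => CIm (g j x))) => [j|x _]; [case: (mg j)|case: (cvr x)].
exists G => // n.
apply: (@fatou_le (fun j x => cabs (G_ (k (j + n)%N) x - G_ n x) ^+ 3)).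
- by move=> j; apply: lmeas_cabs3; exact: cmeasB.
- by apply: lmeas_cabs3; exact: cmeasB.
- by move=> j x; rewrite exprn_ge0// cabs_ge0.
- by move=> x; rewrite exprn_ge0// cabs_ge0.
- have FF := ae_filter_ringOfSetsType mu; apply: filterS aS => x Sx.
  have gE j : g j x = G_ (k j) x by rewrite /g indicE mem_set ?mul1r.
  apply: (@cvg_comp _ _ _ (fun j => cabs (G_ (k (j + n)%N) x - G_ n x)) (fun z => z ^+ 3)); last exact: exprn_continuous.
  apply: cvg_cabsE.
  + rewrite (_ : (fun j => _) = fun j => CRe (g (j + n)%N x) - CRe (G_ n x)); last first.
      by apply/funext => j; rewrite gE CReD CReN.
    rewrite CReD CReN; apply: cvgB; last exact: cvg_cst.
    by rewrite (cvg_shiftn n (fun j => CRe (g j x))); case: (cvr x).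
  + rewrite (_ : (fun j => _) = fun j => CIm (g (j + n)%N x) - CIm (G_ n x)); last first.
      by apply/funext => j; rewrite gE CImD CImN.
    rewrite CImD CImN; apply: cvgB; last exact: cvg_cst.
    by rewrite (cvg_shiftn n (fun j => CIm (g j x))); case: (cvr x).
- move=> j; apply: hG; rewrite (leq_trans _ (kj _))// leq_addl//.
Qed.
End Complete.

(** * Summability of the block norms *)

Section Summability.
Variable R : realType.
Notation mu := (@lebesgue_measure R).

Definition br (k : int) : R := 1 + `|k%:~R|.
Lemma br_ge1 k : 1 <= br k. Proof. by rewrite lerDl. Qed.
Lemma br_gt0 k : 0 < br k. Proof. exact: lt_le_trans (br_ge1 k). Qed.
Lemma bracket_ge1 k : 1 <= bracket R k.
Proof. by rewrite -[X in X <= _]sqrtr1 ler_sqrt ?lerDl ?sqr_ge0// addr_ge0// sqr_ge0. Qed.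
Lemma bracket_gt0 k : 0 < bracket R k. Proof. exact: lt_le_trans (bracket_ge1 k). Qed.
Lemma br_bracket k : br k <= 2 * bracket R k.
Proof.
rewrite -(@ler_pXn2r _ 2)// ?nnegrE ?mulr_ge0 ?(ltW (br_gt0 k)) ?(ltW (bracket_gt0 k))//.
rewrite exprMn sqr_sqrtr ?addr_ge0 ?sqr_ge0// /br -[(k%:~R) ^+ 2]real_normK ?num_real//.
set y := `| _ |; have : 0 <= (y - 1) ^+ 2 by exact: sqr_ge0.
have : 0 <= y ^+ 2 by exact: sqr_ge0.
nra.
Qed.

(** A discrete form of the derivative of x^(-r), which makes the sum of the (j + 1)^(-(r + 1))
    telescope. *)
Lemma powRN_decr (x r : R) : 1 < x -> 0 < r -> r * x `^ (- (r + 1)) <= (x - 1) `^ (- r) - x `^ (- r).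
Proof.
move=> x1 r0; have x0 : 0 < x by exact: lt_trans x1.
have y0 : 0 < 1 - x^-1 by rewrite subr_gt0 invf_lt1.
have E : x - 1 = x * (1 - x^-1) by rewrite mulrBr mulr1 mulfV ?gt_eqF.
have ln1 : ln (1 - x^-1) <= - x^-1.
  rewrite -[leRHS]expRK ler_ln ?posrE ?expR_gt0//; exact: expR_ge1Dx.
have h : 1 + r * x^-1 <= (1 - x^-1) `^ (- r).
  rewrite /powR gt_eqF// (le_trans (expR_ge1Dx _))// ler_expR mulNr -mulrN ler_wpM2l ?(ltW r0)//; lra.
have -> : x `^ (- (r + 1)) = x `^ (- r) * x^-1.
  rewrite opprD powRD; last by rewrite (gt_eqF x0) implybT.
  by rewrite powR_inv1 ?ltW.
rewrite E powRM ?(ltW x0) ?(ltW y0)// -[X in _ - X]mulr1 -mulrBr mulrCA.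
by apply: ler_wpM2l; [exact: powR_ge0|lra].
Qed.

Lemma sum_powRN (r : R) n : 0 < r -> \sum_(0 <= j < n) (j.+1%:R : R) `^ (- (r + 1)) <= 1 + r^-1.
Proof.
move=> r0; have r1 : 0 < r^-1 by rewrite invr_gt0.
case: n => [|n]; first by rewrite big_geq// addr_ge0// ltW.
suff : \sum_(0 <= j < n.+1) (j.+1%:R : R) `^ (- (r + 1)) <= 1 + r^-1 * (1 - n.+1%:R `^ (- r)).
  move=> /le_trans; apply; rewrite lerD2l ler_piMr ?(ltW r1)// gerBl powR_ge0//.
elim: n => [|n IH]; first by rewrite big_nat1 !powR1 subrr mulr0 addr0.
rewrite big_nat_recr//= (le_trans (lerD IH (lexx _)))// -addrA lerD2l.
have := @powRN_decr n.+2%:R r; rewrite ltr1n => /(_ isT r0).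
have -> : n.+2%:R - 1 = n.+1%:R :> R by rewrite -[n.+2%:R]natr1 addrK.
move=> h; have : r^-1 * (r * n.+2%:R `^ (- (r + 1))) <= r^-1 * (n.+1%:R `^ (- r) - n.+2%:R `^ (- r)).
  by rewrite ler_wpM2l// ltW.
rewrite mulrA mulVf ?gt_eqF// mul1r; lra.
Qed.

Lemma le_sum_sub (I : eqType) (r r' : seq I) (F : I -> R) : uniq r -> {subset r <= r'} -> (forall i, 0 <= F i) ->
  \sum_(i <- r) F i <= \sum_(i <- r') F i.
Proof.
move=> ur sr F0; have : {subset r <= undup r'} by move=> i /sr; rewrite mem_undup.
move=> sr'; apply: (@le_trans _ _ (\sum_(i <- undup r') F i)).
  rewrite [leRHS](bigID (mem r))/= ler_wpDr ?sumr_ge0// -[leRHS]big_filter le_eqVlt; apply/orP; left; apply/eqP.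
  apply: perm_big; apply: uniq_perm => //; first by rewrite filter_uniq// undup_uniq.
  by move=> i; rewrite mem_filter andbC; case: (boolP (i \in r)) => [/sr' ->|_]; rewrite ?andbF.
elim: r' {sr sr'} => //= i r' IH; case: ifP => _; rewrite !big_cons ?lerD2l//.
by rewrite (le_trans IH)// lerDr.
Qed.

Lemma sub_zint (r : seq int) : exists N, {subset r <= zint N}.
Proof.
elim: r => [|k r [N h]]; first by exists 0%N.
exists (maxn N (absz k)) => j; rewrite inE mem_zint => /orP[/eqP ->|/h]; last rewrite mem_zint; lia.
Qed.

Lemma sum_br (r : R) (l : seq int) : 0 < r -> uniq l -> \sum_(k <- l) br k `^ (- (r + 1)) <= 2 * (1 + r^-1).
Proof.
move=> r0 ul; have [N hN] := sub_zint l.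
apply: (le_trans (le_sum_sub (r' := [seq i%:Z | i <- iota 0 N.+1] ++ [seq - i%:Z | i <- iota 0 N.+1]) ul _ (fun k => powR_ge0 _ _))).
  move=> k /hN; rewrite mem_zint mem_cat => h.
  case: (lerP 0 k) => k0; apply/orP; [left|right]; apply/mapP; exists (absz k); rewrite ?mem_iota; lia.
rewrite big_cat !big_map/= mulr_natl mulr2n; have := sum_powRN N.+1 r0; rewrite /index_iota subn0 => h.
apply: lerD; apply: le_trans h; rewrite le_eqVlt; apply/orP; left; apply/eqP; apply: eq_bigr => j _; congr (_ `^ _).
  by rewrite /br ger0_norm ?ler0n// -[j.+1%:R]natr1 addrC.
by rewrite /br rmorphN/= normrN ger0_norm ?ler0n// -[j.+1%:R]natr1 addrC.
Qed.

(** Young's inequality without its numerical weights: either y <= x^(al - 1), or x <= y^(1 / (al -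
    1)). *)
Lemma young_le (x y al be : R) : 0 <= x -> 0 <= y -> 1 < al -> be = al / (al - 1) -> x * y <= x `^ al + y `^ be.
Proof.
move=> x0 y0 a1 ->; have am : 0 < al - 1 by rewrite subr_gt0.
have al0 : 0 < al by exact: lt_trans a1.
have [h|h] := leP y (x `^ (al - 1)).
  by rewrite ler_wpDr ?powR_ge0// (le_trans (ler_wpM2l x0 h))// mulr_powRB1.
rewrite ler_wpDl ?powR_ge0//.
have xy : x <= y `^ (al - 1)^-1.
  rewrite -[x](@powRr1 _ x x0) -[X in x `^ X](@mulfV _ (al - 1)) ?gt_eqF// powRrM.
  by rewrite ge0_ler_powR ?nnegrE ?powR_ge0 ?invr_ge0 ?(ltW am) ?(ltW h).
rewrite (le_trans (ler_wpM2r y0 xy))// mulrC.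
have {1}-> : (al - 1)^-1 = al / (al - 1) - 1 by field; rewrite gt_eqF.
by rewrite mulr_powRB1// divr_gt0.
Qed.

(* All that the proof uses of the conditions on (s, q). *)
Definition summing (s q : R) := exists2 C : R, 0 < C & forall (lam : R) (a : int -> R), 0 < lam -> (forall k, 0 <= a k) ->
  (forall l : seq int, uniq l -> \sum_(k <- l) bracket R k `^ (s * q) * a k `^ q <= lam `^ q) ->
  forall l : seq int, uniq l -> \sum_(k <- l) p32 (a k) <= C * p32 lam.

Lemma p32M (x y : R) : 0 <= x -> 0 <= y -> p32 (x * y) = p32 x * p32 y.
Proof. exact: powRM. Qed.

Lemma p32_gt0 (x : R) : 0 < x -> 0 < p32 x. Proof. exact: powR_gt0. Qed.

(** The hypothesis of [summing] is homogeneous of degree q and its conclusion of degree 3/2, so lam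
    may be taken to be 1. *)
Lemma summing_norm (s q : R) : (exists2 C : R, 0 < C & forall b : int -> R, (forall k, 0 <= b k) ->
  (forall l : seq int, uniq l -> \sum_(k <- l) bracket R k `^ (s * q) * b k `^ q <= 1) ->
  forall l : seq int, uniq l -> \sum_(k <- l) p32 (b k) <= C) -> summing s q.
Proof.
move=> [C C0 H]; exists C => // lam a lam0 a0 h l ul.
have l0 := ltW lam0; have b0 k : 0 <= a k / lam by rewrite divr_ge0.
have hb : forall l : seq int, uniq l -> \sum_(k <- l) bracket R k `^ (s * q) * (a k / lam) `^ q <= 1.
  move=> l' ul'; have lq : 0 < lam `^ q by rewrite powR_gt0.
  rewrite (eq_bigr (fun k => (lam `^ q)^-1 * (bracket R k `^ (s * q) * a k `^ q))).
    by rewrite -mulr_sumr mulrC ler_pdivrMr// mul1r h.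
  by move=> k _; rewrite powRM ?invr_ge0// -powR_inv1// powRAC powR_inv1 ?powR_ge0//; ring.
have := H (fun k => a k / lam) b0 hb l ul.
rewrite (eq_bigr (fun k => (p32 lam)^-1 * p32 (a k))).
  by rewrite -mulr_sumr mulrC ler_pdivrMr// p32_gt0.
move=> k _; rewrite p32M ?invr_ge0// mulrC; congr (_ * _).
by rewrite /p32 -powR_inv1// powRAC powR_inv1 ?powR_ge0.
Qed.

Lemma le1_of_powR (b q : R) : 0 <= b -> 0 < q -> b `^ q <= 1 -> b <= 1.
Proof.
move=> b0 q0; apply: contraTT; rewrite -!ltNge => b1.
have := gt0_ltr_powR q0; move=> /(_ 1 b); rewrite powR1; apply=> //; by rewrite nnegrE.
Qed.

(** After normalisation every b k is at most 1, so lowering the exponent from 3/2 to q can only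
    increase its power; for s >= 0 the weights are at least 1. *)
Lemma summing_low (s q : R) : 0 <= s -> 1 <= q <= 3 / 2 -> summing s q.
Proof.
move=> s0 /andP[q1 q2]; apply: summing_norm; exists 1 => // b b0 h l ul.
have q0 : 0 < q by exact: lt_le_trans q1.
have bh k : b k `^ q <= bracket R k `^ (s * q) * b k `^ q.
  rewrite ler_peMl ?powR_ge0// -(powRr0 (bracket R k)) ler_powR ?bracket_ge1// mulr_ge0//.
  exact: ltW.
have b1 k : b k <= 1.
  apply: (le1_of_powR (b0 k) q0); apply: (le_trans (bh k)).
  by have := h [:: k] isT; rewrite big_seq1.
apply: le_trans (h l ul); apply: ler_sum => k _; apply: le_trans (bh k).
have [->|n0] := eqVneq (b k) 0; first by rewrite /p32 !powR0// gt_eqF// divr_gt0.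
by apply: ger_powR => //; rewrite b1 lt_def n0 b0.
Qed.

(** Young's inequality with exponent al = 2 q / 3 is applied to b^(3/2) = (<k>^s b)^(3/2) <k>^(-3 s
    / 2). The first factor produces the summands of the hypothesis, the second the power <k>^(-(r +
    1)). The condition s > 2/3 - 1/q is exactly r > 0, the convergence of the resulting series. *)
Lemma summing_high (s q : R) : 2 / 3 - q^-1 < s -> 3 / 2 < q -> summing s q.
Proof.
move=> hs hq; have q0 : 0 < q by lra.
have qq : 0 < 2 * q - 3 by lra.
pose al := 2 * q / 3 : R; pose be := 2 * q / (2 * q - 3) : R.
have al1 : 1 < al by rewrite /al; lra.
have beE : be = al / (al - 1) by rewrite /be /al; field; rewrite !gt_eqF//; lra.
pose r := 3 * s * q / (2 * q - 3) - 1.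
have r0 : 0 < r.
  rewrite /r subr_gt0 ltr_pdivlMr// mul1r.
  have : (2 / 3 - q^-1) * q < s * q by rewrite ltr_pM2r.
  by rewrite mulrBl mulVf ?gt_eqF//; lra.
have r1 : 0 < r^-1 by rewrite invr_gt0.
have c0 : 0 <= 2 `^ (r + 1) * (2 * (1 + r^-1)) by rewrite mulr_ge0 ?powR_ge0// mulr_ge0// addr_ge0// ltW.
apply: summing_norm; exists (1 + 2 `^ (r + 1) * (2 * (1 + r^-1))).
  by rewrite ltr_wpDr.
move=> b b0 h l ul.
have term k : p32 (b k) <= bracket R k `^ (s * q) * b k `^ q + 2 `^ (r + 1) * br k `^ (- (r + 1)).
  have K0 := ltW (bracket_gt0 k); have K1 := bracket_gt0 k.
  set x := p32 (bracket R k `^ s * b k); set y := bracket R k `^ (- (3 / 2 * s)).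
  have E1 : p32 (b k) = x * y.
    rewrite /x p32M ?powR_ge0// /p32 -powRrM /y mulrAC -powRD; last by rewrite (gt_eqF K1) implybT.
    by rewrite (_ : s * (3 / 2) + _ = 0) ?powRr0 ?mul1r//; ring.
  have E2 : x `^ al = bracket R k `^ (s * q) * b k `^ q.
    rewrite /x /p32 -powRrM (_ : 3 / 2 * al = q); last by rewrite /al; field.
    by rewrite powRM ?powR_ge0// -powRrM.
  have E3 : y `^ be <= 2 `^ (r + 1) * br k `^ (- (r + 1)).
    rewrite /y -powRrM (_ : - (3 / 2 * s) * be = - (r + 1)); last by rewrite /be /r; field; rewrite gt_eqF.
    rewrite !powRN ler_pdivlMr ?powR_gt0 ?br_gt0// mulrC ler_pdivrMr ?powR_gt0//.
    rewrite -powRM// ge0_ler_powR ?nnegrE ?mulr_ge0 ?(ltW (br_gt0 k))//; first by rewrite addr_ge0// ltW.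
    exact: br_bracket.
  rewrite E1 -E2; apply: (le_trans (young_le _ _ al1 beE)); rewrite ?powR_ge0//.
  by rewrite lerD2l.
apply: (le_trans (ler_sum _ (fun k _ => term k))); rewrite big_split/= -mulr_sumr.
by apply: lerD; [exact: h|apply: ler_wpM2l; [exact: powR_ge0|exact: sum_br]].
Qed.

Lemma conj_expE (q : R) : 1 < q -> conj_exp q = q / (q - 1).
Proof.
move=> q1; have q0 : 0 < q by exact: lt_trans q1.
have qm : 0 < q - 1 by rewrite subr_gt0.
rewrite /conj_exp /hoelder_conjugate /= eqe gt_eqF// -EFinB inver gt_eqF// -EFinM//.
Qed.

(** 10 q' / (q' + 6) <= 3 holds exactly for q' <= 18/7, that is, for q >= 18/11: the threshold in
    the third case is the value at which the admissible range of p shrinks below 3. *)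
Lemma p_le3 (p q : R) : 18 / 11 < q -> p < 10 * conj_exp q / (conj_exp q + 6) -> p <= 3.
Proof.
move=> h; have q1 : 1 < q by lra.
have qm : 0 < q - 1 by rewrite subr_gt0.
rewrite conj_expE// => /ltW/le_trans; apply.
have c0 : 0 < q / (q - 1) by rewrite divr_gt0//; lra.
rewrite ler_pdivrMr; last by rewrite addr_gt0.
have : q / (q - 1) <= 18 / 7 by rewrite ler_pdivrMr//; lra.
lra.
Qed.

Lemma exponents (s p q : R) :
  [\/ [/\ 0 <= s, 2 <= p <= 3 & 1 <= q <= 3 / 2],
      [/\ 2 / 3 - q^-1 < s, 2 <= p <= 3 & 3 / 2 < q <= 18 / 11] |
      [/\ 2 / 3 - q^-1 < s,
          2 <= p < 10 * conj_exp q / (conj_exp q + 6) & 18 / 11 < q <= 2]] ->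
  [/\ 1 <= p <= 3, 1 <= q & summing s q].
Proof.
case=> [[s0 /andP[p2 p3] /andP[q1 q2]]|[s0 /andP[p2 p3] /andP[q1 q2]]|[s0 /andP[p2 p3] /andP[q1 q2]]].
- split=> //; [by apply/andP; split => //; lra|by apply: summing_low => //; apply/andP].
- by split; [apply/andP; split => //; lra|lra|exact: summing_high].
- split; [|lra|by apply: summing_high => //; lra].
  by apply/andP; split; [lra|exact: p_le3 p3].
Qed.
End Summability.

(** * The embedding into L^3 *)

Section Embedding.
Variable R : realType.
Notation mu := (@lebesgue_measure R).

Lemma int3_ge0 (g : R -> R[i]) : (0 <= int3 g)%E.
Proof. by apply: integral_ge0 => x _; rewrite lee_fin exprn_ge0// cabs_ge0. Qed.

Lemma cintegrable_pair (phi : R -> R[i]) B g (Y : R) : lcmeas phi -> (forall x, cabs (phi x) <= B * kap x) ->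
  lcmeas g -> (int3 g <= Y%:E)%E -> cintegrable setT (fun x => g x * phi x).
Proof.
move=> mp hB mg hY; have ig := integrable_kap_int3 mg hY.
apply: (@cintegrable_dom R setT _ (fun x => B * (cabs (g x) * kap x)) measurableT).
- exact: cmeasM.
- by move=> x _; rewrite cabsM [leRHS]mulrCA ler_wpM2l ?cabs_ge0.
- exact: integrable_rZl.
Qed.

Lemma pair_bound (phi : R -> R[i]) B g (Y : R) : 0 <= B -> lcmeas phi -> (forall x, cabs (phi x) <= B * kap x) ->
  lcmeas g -> (int3 g <= Y%:E)%E -> cabs (cintegral setT (fun x => g x * phi x)) ^+ 3 <= (B * (pi + 1)) ^+ 3 * Y.
Proof.
move=> B0 mp hB mg hY; have ig := integrable_kap_int3 mg hY.
have Y0 : 0 <= Y by rewrite -lee_fin (le_trans (int3_ge0 g)).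
have ikg : mu.-integrable setT (EFin \o (fun x => kap x * cabs (g x))).
  by move: ig; congr (_.-integrable _ _); apply/funext => x /=; rewrite mulrC.
have mc : lmeas (fun x => cabs (g x)) by exact: (measurable_cabs mg).
apply: (@le_trans _ _ ((B * \int[mu]_x (kap x * cabs (g x))) ^+ 3)).
  apply: ler_cube; first exact: cabs_ge0.
  rewrite -(RintegralZl _ measurableT ikg); apply: cabs_cintegral_le => //.
  - exact: cmeasM.
  - by move=> x _; rewrite cabsM mulrA mulrC ler_wpM2r ?cabs_ge0.
  - exact: integrable_rZl.
rewrite [leLHS]exprMn [(B * (pi + 1)) ^+ 3]exprMn -[leRHS]mulrA; apply: ler_wpM2l; first exact: exprn_ge0.
apply: jensen_cube => //.
- exact: measurable_kap.
- by move=> x; exact: kap_ge0.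
- by move=> x; exact: cabs_ge0.
- by rewrite integral_kap.
- rewrite (le_trans _ hY)//; apply: ge0_le_integral => //.
  + by move=> x _; rewrite lee_fin mulr_ge0 ?kap_ge0 ?exprn_ge0 ?cabs_ge0.
  + apply/measurable_EFinP; apply: (@measurable_funM _ (mR R)); [exact: measurable_kap|exact: lmeas_cabs3].
  + by apply/measurable_EFinP; exact: lmeas_cabs3.
  + by move=> x _; rewrite lee_fin ler_piMl ?exprn_ge0 ?cabs_ge0// kap_le1.
Qed.

(** In place of Minkowski: 4 (a^3 + b^3) - (a + b)^3 = 3 (a + b) (a - b)^2 is nonnegative for
    nonnegative a and b. *)
Lemma int3B (g h : R -> R[i]) (Y Z : R) : lcmeas g -> lcmeas h -> (int3 g <= Y%:E)%E -> (int3 h <= Z%:E)%E ->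
  (int3 (fun x => (g x - h x)%R) <= (4 * (Y + Z))%:E)%E.
Proof.
move=> mg mh hY hZ; have m1 := lmeas_cabs3 mg; have m2 := lmeas_cabs3 mh.
apply: (@le_trans _ _ (\int[mu]_x (4%:E * ((cabs (g x) ^+ 3)%:E + (cabs (h x) ^+ 3)%:E)))%E).
  apply: ge0_le_integral => //.
  - by move=> x _; rewrite lee_fin exprn_ge0// cabs_ge0.
  - by apply/measurable_EFinP; apply: lmeas_cabs3; exact: cmeasB.
  - by apply: emeasurable_funM; [exact: measurable_cst|apply: emeasurable_funD; exact/measurable_EFinP].
  - move=> x _; rewrite -EFinD -EFinM lee_fin.
    apply: (le_trans (ler_cube (cabs_ge0 _) (cabsB _ _))).
    have := cabs_ge0 (g x); have := cabs_ge0 (h x).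
    move: (cabs (g x)) (cabs (h x)) => a b b0 a0.
    have : 0 <= (a + b) * (a - b) ^+ 2 by rewrite mulr_ge0 ?addr_ge0 ?sqr_ge0.
    by rewrite -subr_ge0 => h3; rewrite -subr_ge0 (_ : _ - _ = 3 * ((a + b) * (a - b) ^+ 2 - 0)); [rewrite mulr_ge0|ring].
have p0 (k : R -> R[i]) x : (0 <= (cabs (k x) ^+ 3)%:E)%E by rewrite lee_fin exprn_ge0// cabs_ge0.
rewrite ge0_integralZl_EFin//; last 2 first.
- by move=> x _; rewrite adde_ge0.
- by apply: emeasurable_funD; exact/measurable_EFinP.
rewrite ge0_integralD//; last 2 first.
- exact/measurable_EFinP.
- exact/measurable_EFinP.
rewrite EFinM EFinD; apply: lee_wpmul2l; first by rewrite lee_fin.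
by rewrite EFinD; exact: leeD.
Qed.

Variable sigma0 : R -> R[i].
Hypothesis adm : admissible_partition sigma0.
Variables s p q : R.
Hypothesis p13 : 1 <= p <= 3.
Hypothesis q1 : 1 <= q.
Hypothesis sm : summing s q.

Lemma dist_Lnorm_ge0 (f : dist R) : (0 <= dist_Lnorm p f)%E.
Proof. by apply: le_ereal_inf_tmp => _ [g _ <-]; exact: Lnorm_ge0. Qed.

Lemma modnorm_sum (f : dist R) (lam : R) : 0 < lam -> (modnorm sigma0 s p q f <= lam%:E)%E ->
  (forall k, (dist_Lnorm p (box sigma0 k f) < +oo)%E) /\
  forall l : seq int, uniq l ->
    \sum_(k <- l) bracket R k `^ (s * q) * fine (dist_Lnorm p (box sigma0 k f)) `^ q <= lam `^ q.
Proof.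
move=> lam0 h; have q0 : 0 < q by exact: lt_le_trans q1.
pose t k : \bar R := ((bracket R k `^ (s * q))%:E * dist_Lnorm p (box sigma0 k f) `^ q)%E.
have t0 k : (0 <= t k)%E by rewrite mule_ge0 ?lee_fin ?powR_ge0 ?poweR_ge0.
have E0 : (0 <= \esum_(k in [set: int]) t k)%E by apply: esum_ge0 => k _.
have hs : (\esum_(k in [set: int]) t k <= (lam `^ q)%:E)%E.
  rewrite -[leLHS]poweRe1// -(@mulVf _ q) ?gt_eqF// poweRrM -poweR_EFin.
  apply: (gt0_ler_poweR (ltW q0)) => //; first by rewrite in_itv/= poweR_ge0 leey.
  by rewrite in_itv/= lee_fin (ltW lam0) leey.
have hl (l : seq int) : uniq l -> (\sum_(k <- l) t k <= (lam `^ q)%:E)%E.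
  move=> ul; apply: le_trans hs; apply: esum_ge; exists [set` l]; first by split => //; exact: finite_seq.
  by rewrite fsbig_seq.
have fin k : (dist_Lnorm p (box sigma0 k f) < +oo)%E.
  have := hl [:: k] isT; rewrite big_seq1 /t => hk.
  have bp : 0 < bracket R k `^ (s * q) by rewrite powR_gt0// bracket_gt0.
  apply: (@lty_poweRy _ _ q); first by rewrite gt_eqF.
  rewrite ltey; apply/eqP => e; move: hk; rewrite e gt0_muley ?lte_fin//.
split=> // l ul; rewrite -lee_fin -sumEFin; apply: le_trans (hl l ul).
rewrite le_eqVlt; apply/orP; left; apply/eqP; apply: eq_bigr => k _.
rewrite EFinM -[(fine _ `^ q)%:E]poweR_EFin fineK// ge0_fin_numE//; exact: dist_Lnorm_ge0.
Qed.

Lemma cLnorm_le (g : R -> R[i]) (l : R) : 0 < l -> (cLnorm p g <= l%:E)%E ->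
  (\int[mu]_x (cabs (g x) `^ p)%:E <= (l `^ p)%:E)%E.
Proof.
have p0 : 0 < p by case/andP: p13 => p1 _; exact: lt_le_trans p1.
move=> l0 h; have := @poweR_Lnorm _ _ _ mu (fun x : R => (cabs (g x))%:E) p.
rewrite gt_eqF// => /(_ isT) e.
have -> : (\int[mu]_x (cabs (g x) `^ p)%:E = \int[mu]_x (`|(cabs (g x))%:E| `^ p))%E.
  by apply: eq_integral => x _; rewrite /= ger0_norm ?cabs_ge0.
rewrite -e -poweR_EFin; apply: (gt0_ler_poweR (ltW p0)) => //.
  by rewrite in_itv/= Lnorm_ge0 leey.
by rewrite in_itv/= lee_fin (ltW l0) leey.
Qed.

(** The L^p norm of a distribution is an infimum over representatives, so an excess has to be
    allowed. The excess lam kap(k) makes every n k positive, as the weights of [weighted_cauchy]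
    must be, is summable after the power 3/2, and scales correctly with lam. *)
Lemma choose_bands (f : dist R) (lam : R) : 0 < lam -> (modnorm sigma0 s p q f <= lam%:E)%E ->
  exists (g : int -> R -> R[i]) (n : int -> R),
    [/\ forall k, represents (box sigma0 k f) (g k), forall k, 0 < n k,
      (forall k, \int[mu]_x (cabs (g k x) `^ p)%:E <= (n k `^ p)%:E)%E &
      forall k, n k = fine (dist_Lnorm p (box sigma0 k f)) + lam * kap k%:~R].
Proof.
move=> lam0 /(modnorm_sum lam0)[fin _].
pose n k := fine (dist_Lnorm p (box sigma0 k f)) + lam * kap k%:~R.
have n0 k : 0 < n k.
  by rewrite ltr_wpDl ?mulr_gt0 ?kap_gt0// fine_ge0// dist_Lnorm_ge0.
have ex k : exists g, represents (box sigma0 k f) g /\ (cLnorm p g <= (n k)%:E)%E.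
  have : (dist_Lnorm p (box sigma0 k f) < (n k)%:E)%E.
    rewrite /n EFinD fineK; last by rewrite ge0_fin_numE// dist_Lnorm_ge0.
    by rewrite lteDl ?lte_fin ?mulr_gt0 ?kap_gt0// ge0_fin_numE// dist_Lnorm_ge0.
  by case/ereal_inf_lt => _ [g rg <-] /ltW h; exists g.
have [g hg] := choice ex.
exists g, n; split => // k; first by case: (hg k).
by apply: cLnorm_le => //; case: (hg k).
Qed.

Lemma p32D (x y : R) : 0 <= x -> 0 <= y -> p32 (x + y) <= 4 * (p32 x + p32 y).
Proof.
move=> x0 y0; have p0 : 0 <= 3 / 2 :> R by rewrite divr_ge0.
have two : p32 2 <= 4 :> R.
  rewrite -(@ler_pXn2r _ 2)// ?nnegrE ?p32_ge0// p32_sqr//; lra.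
wlog xy : x y x0 y0 / x <= y => [hw|].
  have [/hw|/ltW /hw] := leP x y; first exact.
  by rewrite addrC [p32 y + _]addrC; exact.
apply: (@le_trans _ _ (p32 (2 * y))); first by apply: p32_le; [exact: addr_ge0|lra].
rewrite p32M//; have := p32_ge0 x; have := p32_ge0 y => yp xp.
have : p32 2 * p32 y <= 4 * p32 y by rewrite ler_wpM2r.
lra.
Qed.

Lemma sum_kap (l : seq int) : uniq l -> \sum_(k <- l) kap (k%:~R : R) <= 16.
Proof.
move=> ul; have := @sum_br R 1 l ltr01 ul; rewrite invr1 => h.
have : \sum_(k <- l) kap (k%:~R : R) <= 4 * \sum_(k <- l) br R k `^ (- (1 + 1)).
  rewrite mulr_sumr; apply: ler_sum => k _.
  have b0 := br_gt0 R k.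
  rewrite powRN (_ : 1 + 1 = 2%:R) ?powR_mulrn ?(ltW b0)// ler_pdivlMr ?exprn_gt0//.
  rewrite /kap mulrC ler_pdivrMr ?ltr_wpDr ?sqr_ge0//.
  have := br_bracket R k; rewrite -(@ler_pXn2r _ 2)// ?nnegrE ?mulr_ge0 ?(ltW b0) ?(ltW (bracket_gt0 R k))//.
  rewrite exprMn /bracket sqr_sqrtr ?addr_ge0 ?sqr_ge0//; lra.
lra.
Qed.

(** The blocks are convolved twice: the first convolution puts them in L^3 by Bernstein, the second
    supplies the modulated kernels that [band_sum] sums. With T N the partial sums of the n k and L
    their limit, the partial sums of blocks are Cauchy with error CS (L - T N)^2; their limit
    represents f by [sum_box]. *)
Lemma embedding : exists2 C : R, 0 < C & forall (f : dist R) (lam : R), tempered f -> 0 < lam ->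
  (modnorm sigma0 s p q f <= lam%:E)%E ->
  exists2 g, represents f g & (int3 g <= (C * lam ^+ 3)%:E)%E.
Proof.
have [CB CB0 hB] := bernstein adm; have [CS CS0 hS] := band_sum adm; have [CM CM0 hM] := sm.
pose K := 4 * (CM + 16) : R.
have K0 : 0 < K by rewrite mulr_gt0// addr_gt0.
exists (CS * (CB * K ^+ 2)); first by rewrite mulr_gt0// mulr_gt0// exprn_gt0.
move=> f lam tf lam0 hf.
have [g0 [n0 [rg0 n00 hg0 n0E]]] := choose_bands lam0 hf.
have [fin hsum] := modnorm_sum lam0 hf.
have mg0 k : lcmeas (g0 k) by case: (rg0 k).
have ig0 k : mu.-integrable setT (EFin \o (fun x => cabs (g0 k x) * kap x)).
  by case/andP: p13 => p1 _; exact: (integrable_kap_powR p1 (mg0 k) (hg0 k)).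
pose g1 k := bandconv sigma0 k (g0 k).
have mg1 k : lcmeas (g1 k) by exact: lcmeas_bandconv.
have rg1 k : represents (box sigma0 k f) (g1 k).
  by split; [exact: mg1|move=> phi h]; exact: (box_bandconv adm (rg0 k) (ig0 k) h).
(* So that the square of n k is the Bernstein bound CB (n0 k)^3, the form in which [band_sum] takes
   its hypothesis. *)
pose n k := Num.sqrt CB * p32 (n0 k).
have np k : 0 < n k by rewrite mulr_gt0 ?sqrtr_gt0 ?p32_gt0.
have hg1 k : (int3 (g1 k) <= (n k ^+ 2)%:E)%E.
  rewrite /n exprMn sqr_sqrtr ?(ltW CB0)// p32_sqr ?(ltW (n00 k))//.
  by apply: (hB k p (n0 k)).
have ig1 k := integrable_kap_int3 (mg1 k) (hg1 k).
have rg2 k phi : schwartz phi -> box sigma0 k f phi = cintegral setT (fun y => bandconv sigma0 k (g1 k) y * phi y).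
  by move=> h; exact: (box_bandconv adm (rg1 k) (ig1 k) h).
have nsum (l : seq int) : uniq l -> \sum_(k <- l) n k <= Num.sqrt CB * (K * p32 lam).
  move=> ul; rewrite -mulr_sumr ler_wpM2l ?sqrtr_ge0//.
  have a0 k : 0 <= fine (dist_Lnorm p (box sigma0 k f)) by rewrite fine_ge0// dist_Lnorm_ge0.
  apply: (@le_trans _ _ (\sum_(k <- l) 4 * (p32 (fine (dist_Lnorm p (box sigma0 k f))) + p32 lam * kap k%:~R))).
    apply: ler_sum => k _; rewrite n0E.
    have k0 := kap_ge0 (k%:~R : R).
    rewrite (le_trans (p32D (a0 k) _)) ?mulr_ge0 ?(ltW lam0)//.
    rewrite ler_wpM2l// lerD2l p32M ?(ltW lam0)// ler_wpM2l ?p32_ge0//.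
    have kp := kap_gt0 (k%:~R : R); rewrite /p32 -[leRHS](powRr1 k0) ger_powR ?kap_le1 ?kp//; lra.
  rewrite -mulr_sumr big_split/= -mulr_sumr /K -mulrA ler_wpM2l// mulrDl lerD//.
    exact: hM.
  by rewrite mulrC ler_wpM2r ?p32_ge0// sum_kap.
(* Starting from the empty range gives G 0 = 0, so the error estimate at N = 0 is already the bound
   on the limit. *)
pose zr N := if N is N'.+1 then zint N' else [::].
have uzr N : uniq (zr N) by case: N => // N; exact: zint_uniq.
have zsub N M : (N <= M)%N -> {subset zr N <= zr M}.
  case: N M => [|N] [|M]//= NM k; rewrite !mem_zint; lia.
pose T N := \sum_(k <- zr N) n k.
have Tmono : {homo T : N M / (N <= M)%N >-> N <= M}.
  by move=> N M NM; apply: le_sum_sub => //; [exact: zsub|move=> k; exact: ltW].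
have Tb N : T N <= Num.sqrt CB * (K * p32 lam) by exact: nsum.
have Tcv : cvgn T by apply: nondecreasing_is_cvgn => //; exists (Num.sqrt CB * (K * p32 lam)) => _ [N _ <-].
have T0 N : 0 <= T N by apply: sumr_ge0 => k _; exact: ltW.
set L := limn T.
have TL N : T N <= L by exact: nondecreasing_cvgn_le.
have Lb : L <= Num.sqrt CB * (K * p32 lam) by apply: limr_le => //; exact: nearW.
pose G N y := \sum_(k <- zr N) bandconv sigma0 k (g1 k) y.
have mG N : lcmeas (G N) by apply: cmeas_sum => k; exact: lcmeas_bandconv.
pose e N := CS * (L - T N) ^+ 2.
have e0 : e @ \oo --> (0 : R).
  have -> : 0 = CS * (L - L) ^+ 2 by rewrite subrr expr0n mulr0.
  apply: cvgMr.
  apply: (@cvg_comp _ _ _ (fun N => L - T N) (fun z => z ^+ 2)); last exact: exprn_continuous.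
  by apply: cvgB => //; exact: cvg_cst.
have hG N M : (N <= M)%N -> (int3 (fun y => (G M y - G N y)%R) <= (e N)%:E)%E.
  move=> NM; pose r := [seq k <- zr M | k \notin zr N].
  have pr : perm_eq (zr M) (zr N ++ r).
    apply: uniq_perm => //.
      rewrite cat_uniq uzr filter_uniq// andbT; apply/hasPn => k; rewrite mem_filter => /andP[]//.
    move=> k; rewrite mem_cat mem_filter; case: (boolP (k \in zr N)) => //= kN.
    exact: (zsub _ _ NM).
  have dG y : G M y - G N y = \sum_(k <- r) bandconv sigma0 k (g1 k) y.
    by rewrite /G (perm_big _ pr) big_cat/= addrAC subrr add0r.
  have dT : T M - T N = \sum_(k <- r) n k by rewrite /T (perm_big _ pr) big_cat/= addrAC subrr add0r.
  have -> : (fun y => G M y - G N y) = fun y => \sum_(k <- r) bandconv sigma0 k (g1 k) y by apply/funext.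
  apply: (le_trans (hS r g1 n _ mg1 np hg1)); first by rewrite filter_uniq.
  rewrite lee_fin ler_wpM2l ?(ltW CS0)// -dT lerXn2r ?nnegrE ?subr_ge0 ?TL ?Tmono// lerD2r//; exact: TL.
have [g mg hg] := L3_complete mG e0 hG.
exists g; last first.
  have := hg 0%N; have -> : (fun x => g x - G 0%N x) = g.
    by apply/funext => x; rewrite /G big_nil subr0.
  move=> /le_trans; apply; rewrite lee_fin /e /T big_nil subr0 -mulrA ler_wpM2l ?(ltW CS0)//.
  apply: (@le_trans _ _ ((Num.sqrt CB * (K * p32 lam)) ^+ 2)).
    by rewrite lerXn2r ?nnegrE ?(le_trans (T0 0%N))// ?(le_trans (T0 0%N) (TL _))// (le_trans (le_trans (T0 0%N) (TL _)) Lb).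
  by rewrite !exprMn sqr_sqrtr ?(ltW CB0)// p32_sqr ?(ltW lam0)// mulrA.
split; first exact: mg.
move=> phi h.
have [B B0 hBk] := schwartz_kap h; have mp := schwartz_cmeas h.
have ig N := cintegrable_pair mp hBk (cmeasB mg (mG N)) (hg N).
have iG N : cintegrable setT (fun x => G N x * phi x).
  have h0 := hG 0%N N (leq0n N); apply: (cintegrable_pair mp hBk (mG N) (Y := e 0%N)).
  by move: h0; congr (_ <= _)%E; congr int3; apply/funext => x; rewrite /G big_nil subr0.
have ib k : cintegrable setT (fun y => bandconv sigma0 k (g1 k) y * phi y).
  have := hS [:: k] g1 n isT mg1 np hg1.
  rewrite (_ : (fun y => _) = bandconv sigma0 k (g1 k)); last by apply/funext => y; rewrite big_seq1.
  by apply: cintegrable_pair hBk _ => //; exact: lcmeas_bandconv.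
have igg : cintegrable setT (fun x => g x * phi x).
  have := cintegrableD measurableT (ig 0%N) (iG 0%N); congr cintegrable.
  by apply/funext => x; rewrite -mulrDl subrK.
have GE N : cintegral setT (fun x => G N.+1 x * phi x) = \sum_(k <- zint N) box sigma0 k f phi.
  under [RHS]eq_bigr do rewrite rg2//.
  rewrite -(cintegral_sum (zint N) measurableT ib); apply: eq_cintegral => x _.
  by rewrite /G mulr_suml.
have c1 := sum_box adm tf h.
have c2 : cabs (\sum_(k <- zint N) box sigma0 k f phi - dist_of g phi) @[N --> \oo] --> (0 : R).
  apply/cvgrPdist_le => eps eps0.
  have c3 : ((B * (pi + 1)) ^+ 3 * e N.+1) @[N --> \oo] --> (0 : R).
    by rewrite -[X in _ --> X](mulr0 ((B * (pi + 1)) ^+ 3)); apply: cvgMr; rewrite (cvg_shiftS e).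
  have ep : 0 < eps ^+ 3 by rewrite exprn_gt0.
  near=> N; rewrite sub0r normrN ger0_norm ?cabs_ge0//.
  rewrite -(@ler_pXn2r _ 3)// ?nnegrE ?cabs_ge0 ?(ltW eps0)// cabsBC -GE /dist_of.
  rewrite -(cintegralB measurableT igg (iG N.+1)).
  have -> : cintegral setT (fun x => g x * phi x - G N.+1 x * phi x) = cintegral setT (fun x => (g x - G N.+1 x) * phi x).
    by apply: eq_cintegral => x _; rewrite mulrBl.
  apply: (le_trans (pair_bound B0 mp hBk (cmeasB mg (mG N.+1)) (hg N.+1))).
  apply: (le_trans (ler_norm _)); rewrite -[X in `|X|]opprK normrN -[- _]sub0r; near: N.
  by move/cvgrPdist_le : c3 => /(_ _ ep).
exact: (cabs_lim_uniq c1 c2).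
Unshelve. all: by end_near.
Qed.
End Embedding.

(** * Mollification *)

Section Bump.
Variable R : realType.
Notation mu := (@lebesgue_measure R).
Notation D := (cderive (1 : R)).
Variable sigma0 : R -> R[i].
Hypothesis adm : admissible_partition sigma0.

Lemma schwartz_conj (f : R -> R[i]) : schwartz f -> schwartz (fun x => cj (f x)).
Proof.
move=> sf; apply: (@schwartz_coind _ (fun g => exists2 f, schwartz f & g = fun x => cj (f x))); last by exists f.
- move=> _ [h sh ->]; exists (fun x => cj (D h x)); first by exists (D h) => //; exact: schwartz_D.
  move=> x; have [h1 h2] := schwartz_cder x sh; split => //=.
  exact: (is_deriveN h2).
- move=> _ [h sh ->] m; have [C hC] := schwartz_bound sh m; exists C => x.
  by rewrite (_ : cabs (cj (h x)) = cabs (h x))// !cabsE/= sqrrN.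
Qed.

Lemma schwartz_slow (f : R -> R[i]) : schwartz f -> slow f.
Proof.
move=> /schwartzP[sf hf]; split=> // n; have [C hC] := hf 0%N n; exists C, 0%N => x.
by have := hC x; rewrite expr0 mul1r mulr1.
Qed.

Lemma schwartz_sigma : schwartz sigma0.
Proof. by have := shift_schwartz adm 0; congr schwartz; apply/funext => x; rewrite /shift subr0. Qed.

(** As [sigma0] is complex-valued, its squared modulus is taken: it is smooth, nonnegative and
    compactly supported, and after normalisation serves as mollifier. *)
Definition bump0 x := cabs (sigma0 x) ^+ 2.
Definition bump x := bump0 x / \int[mu]_y bump0 y.

Lemma schwartz_bump0 : schwartz (fun x => ((bump0 x)%:C)%C).
Proof.
have := schwartzM schwartz_sigma (schwartz_slow (schwartz_conj schwartz_sigma)).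
by congr schwartz; apply/funext => x; rewrite cj_mul.
Qed.

Lemma bump0_integrable : mu.-integrable setT (EFin \o bump0).
Proof. by case: (schwartz_cintegrable schwartz_bump0). Qed.

(** The lower bound c on the modulus of [sigma0] holds on a half-open interval; the closed interval
    [-1/4, 1/4] inside it has length 1/2 and gives mass at least c^2 / 2. *)
Lemma bump0_mass : 0 < \int[mu]_y bump0 y.
Proof.
have [_ _ [c c0 hc] _] := adm.
pose J : set (mR R) := `[- 4^-1, 4^-1]%classic.
have mJ : measurable J by exact: measurable_itv.
have muJ : mu J = (2^-1)%:E.
  rewrite /J lebesgue_measure_itv/= lte_fin ifT; last by lra.
  by rewrite -EFinB; congr (_%:E); field.
have i0 : 0 < c ^+ 2 / 2 by rewrite divr_gt0// exprn_gt0.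
apply: (lt_le_trans i0); rewrite -lee_fin /Rintegral fineK; last exact: (integrable_fin_num _ bump0_integrable).
apply: (@le_trans _ _ (\int[mu]_x ((c ^+ 2) * \1_J x)%:E)%E).
  under eq_integral do rewrite EFinM.
  rewrite ge0_integralZl_EFin ?exprn_ge0 ?(ltW c0)//; last first.
    by apply/measurable_EFinP; exact: measurable_indic.
  have e : (\int[mu]_y (\1_J y)%:E = (2^-1)%:E)%E.
    by rewrite (integral_indic mu measurableT mJ) setIT; exact: muJ.
  by rewrite -[X in (_ <= _ * X)%E]/(\int[mu]_y (\1_J y)%:E)%E e -EFinM.
apply: ge0_le_integral => //.
- by move=> x _; rewrite lee_fin mulr_ge0 ?exprn_ge0 ?(ltW c0).
- apply/measurable_EFinP; apply: (@measurable_funM _ (mR R)); first exact: measurable_cst.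
  exact: measurable_indic.
- by apply/measurable_EFinP; case: (schwartz_cmeas schwartz_bump0).
- move=> x _; rewrite lee_fin indicE; case: (boolP (x \in J)) => [|_]; last by rewrite mulr0 exprn_ge0 ?cabs_ge0.
  move=> /set_mem; rewrite /J/= in_itv/= => /andP[x1 x2]; rewrite mulr1 lerXn2r ?nnegrE ?cabs_ge0 ?(ltW c0)//.
  by apply: hc; apply/andP; split; lra.
Qed.

Lemma bump_ge0 x : 0 <= bump x.
Proof. by rewrite divr_ge0 ?exprn_ge0 ?cabs_ge0// ltW// bump0_mass. Qed.

Lemma schwartz_bump : schwartz (fun x => ((bump x)%:C)%C).
Proof.
have := schwartzZ (((\int[mu]_y bump0 y)^-1)%:C)%C schwartz_bump0; congr schwartz.
by apply/funext => x; rewrite -realCM mulrC.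
Qed.

Lemma bump_vanish x : 1 <= `|x| -> bump x = 0.
Proof. by move=> x1; have /= h := sigma_vanish adm 0 x1; rewrite /bump /bump0 h cabs0 expr0n mul0r. Qed.

Lemma bump_integrable : mu.-integrable setT (EFin \o bump).
Proof. by case: (schwartz_cintegrable schwartz_bump). Qed.

Lemma lmeas_bump : lmeas bump.
Proof. by case: (schwartz_cmeas schwartz_bump). Qed.

Lemma Rintegral_bump : \int[mu]_x bump x = 1.
Proof.
rewrite /bump; under eq_Rintegral do rewrite mulrC.
rewrite (RintegralZl _ measurableT bump0_integrable) mulVf//.
by rewrite gt_eqF// bump0_mass.
Qed.

Lemma integral_bump : (\int[mu]_x (bump x)%:E = 1)%E.
Proof. by rewrite -[RHS]/(1%:E) -Rintegral_bump /Rintegral fineK//; exact: (integrable_fin_num _ bump_integrable). Qed.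

Lemma bump_bounded : exists2 C, 0 < C & forall x, bump x <= C.
Proof.
have [C C0 hC] := schwartz_kap schwartz_bump; exists (C + 1); first by rewrite ltr_wpDl.
move=> x; have := hC x; rewrite cabs_real ger0_norm ?bump_ge0// => /le_trans; apply.
by rewrite ler_wpDr// ler_piMr// kap_le1.
Qed.

Lemma bump_cont : continuous bump.
Proof. by move=> x; have [/is_derive_cont h _] := schwartz_cder x schwartz_bump. Qed.
End Bump.

(** * Translations of Schwartz functions *)

Section Translate.
Variable R : realType.

(** A translation is a modulation on the Fourier side, and modulation preserves the Schwartz
    space. *)
Lemma schwartz_translate (c : R) (f : R -> R[i]) : schwartz f -> schwartz (fun x => f (x - c)).
Proof.
move=> sf; have := ifourier_schwartz (schwartz_expiM c (fourier_schwartz sf)).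
congr schwartz; apply/funext => x; rewrite -[in RHS](ifourierK sf) /ifourier; congr (_ * _).
by apply: eq_cintegral => y _; rewrite mulrA -expiD; congr (expi _ * _); ring.
Qed.

Lemma schwartz_reflect (c : R) (f : R -> R[i]) : schwartz f -> schwartz (fun x => f (c - x)).
Proof.
move=> sf; have := schwartz_translate c (schwartz_neg sf).
by congr schwartz; apply/funext => x; rewrite opprB.
Qed.
End Translate.

(** * Convolution with a real kernel *)

Section Mollify.
Variable R : realType.
Notation mu := (@lebesgue_measure R).
Implicit Types (K H : R -> R) (g : R -> R[i]).

Definition mol K g (x : R) : R[i] := cintegral setT (fun z => ((K (x - z))%:C)%C * g z).

Lemma lmeas_sub K (x : R) : lmeas K -> lmeas (fun z => K (x - z)).
Proof.
move=> mK; apply: (measurableT_comp mK).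
by apply: (@measurable_funB _ (mR R)); [exact: measurable_cst|exact: measurable_id].
Qed.

Lemma lcmeas_mol K g : lmeas K -> lcmeas g -> lcmeas (mol K g).
Proof.
move=> mK mg; apply: (cmeas_param (f := fun z => ((K (z.2 - z.1))%:C)%C * g z.1)).
apply: cmeasM; last exact: (cmeas_comp measurable_fst mg).
by apply: cmeas_real; apply: (measurableT_comp mK); exact: measurable_subr2.
Qed.

Lemma integral_sub K (x : R) : lmeas K -> (forall z, 0 <= K z) ->
  (\int[mu]_z (K (x - z))%:E = \int[mu]_z (K z)%:E)%E.
Proof.
move=> mK K0.
have m2 : lmeas (fun z => K (x - z)) by exact: lmeas_sub.
rewrite (ge0_integral_aff x ltr01) ?mul1e//=; last 2 first.
- exact/measurable_EFinP.
- by move=> z; rewrite lee_fin.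
rewrite [RHS]ge0_integral_neg; last 2 first.
- exact/measurable_EFinP.
- by move=> z; rewrite lee_fin.
by apply: eq_integral => z _; congr ((K _)%:E); ring.
Qed.

Lemma integrable_mol K g (x C : R) : 0 <= C -> lmeas K -> lcmeas g -> (forall z, `|K z| <= C * kap z) ->
  mu.-integrable setT (EFin \o (fun z => cabs (g z) * kap z)) ->
  cintegrable setT (fun z => ((K (x - z))%:C)%C * g z).
Proof.
move=> C0 mK mg hK ig.
apply: (@cintegrable_dom R setT _ (fun z => (2 * C / kap x) * (cabs (g z) * kap z)) measurableT).
- by apply: cmeasM => //; apply: cmeas_real; exact: lmeas_sub.
- move=> z _; rewrite cabsM cabs_real [leRHS]mulrCA [leLHS]mulrC ler_wpM2l ?cabs_ge0//.
  rewrite (le_trans (hK _))// (le_trans (ler_wpM2l C0 (kap_peetre z x)))//.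
  by rewrite le_eqVlt; apply/orP; left; apply/eqP; ring.
- exact: integrable_rZl.
Qed.

Lemma tonelli_kernel K (f : R -> R) : lmeas K -> (forall x, 0 <= K x) -> lmeas f -> (forall x, 0 <= f x) ->
  (\int[mu]_y \int[mu]_x (K (y - x) * f x)%:E = (\int[mu]_z (K z)%:E) * \int[mu]_x (f x)%:E)%E.
Proof.
move=> mK K0 mf f0.
have mH : measurable_fun setT (fun z : mR R * mR R => K z.2 * f z.1).
  apply: measurable_funM.
    by apply: (measurableT_comp mK); exact: measurable_snd.
  by apply: (measurableT_comp mf); exact: measurable_fst.
rewrite (tonelli_conv mH)/=; last by move=> z; rewrite mulr_ge0.
rewrite -ge0_integralZl//; last 3 first.
- exact/measurable_EFinP.
- by move=> x _; rewrite lee_fin.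
- by apply: integral_ge0 => x _; rewrite lee_fin.
apply: eq_integral => x _; under eq_integral do rewrite EFinM.
rewrite ge0_integralZr//.
- exact/measurable_EFinP.
- by move=> z _; rewrite lee_fin.
by rewrite lee_fin.
Qed.

(** Jensen for the probability density K(x - z), then Tonelli; 8 = (1 + 1)^3 is the crude constant
    of [jensen_cube] for mass 1. *)
Lemma int3_mol K g (C Y : R) : 0 <= C -> lmeas K -> (forall z, 0 <= K z) -> (forall z, K z <= C * kap z) ->
  (\int[mu]_z (K z)%:E = 1)%E -> lcmeas g -> (int3 g <= Y%:E)%E -> (int3 (mol K g) <= (8 * Y)%:E)%E.
Proof.
move=> C0 mK K0 hK K1 mg hg; have ig := integrable_kap_int3 mg hg.
have hK' z : `|K z| <= C * kap z by rewrite ger0_norm.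
have m3 := lmeas_cabs3 mg.
have mKx x := lmeas_sub x mK.
have mc : lmeas (fun x => cabs (g x)) by exact: (measurable_cabs mg).
pose I x := (\int[mu]_z (K (x - z) * cabs (g z) ^+ 3)%:E)%E.
have I0 x : (0 <= I x)%E by apply: integral_ge0 => z _; rewrite lee_fin mulr_ge0 ?exprn_ge0 ?cabs_ge0.
have mI : measurable_fun setT (I : mR R -> \bar R).
  apply: (@measurable_fun_fubini_tonelli_G _ _ _ _ _ mu (fun z : mR R * mR R => (K ((z.2 : R) - (z.1 : R)) * cabs (g z.1) ^+ 3)%:E)).
    apply/measurable_EFinP; apply: measurable_funM.
      by apply: (measurableT_comp mK); exact: measurable_subr2.
    by apply: (measurableT_comp m3); exact: measurable_fst.
  by move=> z; rewrite lee_fin mulr_ge0 ?exprn_ge0 ?cabs_ge0.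
have pt x : ((cabs (mol K g x) ^+ 3)%:E <= 8%:E * I x)%E.
  have [fy|] := boolP (I x \is a fin_num)%E; last first.
    rewrite ge0_fin_numE// -leNgt leye_eq => /eqP ->.
    by rewrite gt0_muley ?lte_fin// leey.
  have ikg : mu.-integrable setT (EFin \o (fun z => K (x - z) * cabs (g z))).
    have := integrable_cabs measurableT (integrable_mol x C0 mK mg hK' ig); congr (_.-integrable _ _).
    by apply/funext => z /=; rewrite cabsM cabs_real ger0_norm.
  rewrite -(fineK fy) -EFinM lee_fin.
  apply: (@le_trans _ _ ((\int[mu]_z (K (x - z) * cabs (g z))) ^+ 3)).
    apply: ler_cube; first exact: cabs_ge0.
    apply: cabs_cintegral_le => //.
    - by apply: cmeasM => //; exact: cmeas_real.
    - by move=> z _; rewrite cabsM cabs_real ger0_norm.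
  have -> : 8 = (1 + 1) ^+ 3 :> R by ring.
  apply: jensen_cube => //.
  - by move=> z; exact: cabs_ge0.
  - by rewrite fine_ge0.
  - by rewrite integral_sub// K1.
  - by rewrite fineK.
apply: (@le_trans _ _ (\int[mu]_x (8%:E * I x))%E).
  apply: ge0_le_integral => //.
  - by move=> x _; rewrite lee_fin exprn_ge0// cabs_ge0.
  - by apply/measurable_EFinP; apply: lmeas_cabs3; exact: lcmeas_mol.
  - by apply: emeasurable_funM => //; exact: measurable_cst.
rewrite ge0_integralZl_EFin// EFinM; apply: lee_wpmul2l; first by rewrite lee_fin.
by rewrite /I tonelli_kernel// ?K1 ?mul1e// => x; rewrite exprn_ge0// cabs_ge0.
Qed.
End Mollify.

(** * Approximation by heat kernels *)

Section HeatKernel.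
Variable R : realType.
Notation mu := (@lebesgue_measure R).
Implicit Types (K : R -> R) (g : R -> R[i]).

Definition hk (e x : R) : R := (Num.sqrt (4 * pi * e))^-1 * expR (- ((4 * e)^-1 * x ^+ 2)).

Lemma hk_ge0 e x : 0 <= hk e x.
Proof. by rewrite mulr_ge0 ?expR_ge0// invr_ge0 sqrtr_ge0. Qed.

Lemma schwartz_hk e : 0 < e -> schwartz (fun x => ((hk e x)%:C)%C).
Proof.
move=> e0; have b0 : 0 < (4 * e)^-1 by rewrite invr_gt0 mulr_gt0.
have := schwartzZ (((Num.sqrt (4 * pi * e))^-1)%:C)%C (schwartz_gauss 0 b0); congr schwartz.
by apply/funext => x; rewrite /cgauss mul0r oppr0 expi0 mulr1 -realCM.
Qed.

Lemma lmeas_hk e : 0 < e -> lmeas (hk e).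
Proof. by move=> e0; case: (schwartz_cmeas (schwartz_hk e0)). Qed.

Lemma hk_integrable e : 0 < e -> mu.-integrable setT (EFin \o hk e).
Proof. by move=> e0; case: (schwartz_cintegrable (schwartz_hk e0)). Qed.

Lemma Rintegral_hk e : 0 < e -> \int[mu]_x hk e x = 1.
Proof.
move=> e0; have b0 : 0 < (4 * e)^-1 by rewrite invr_gt0 mulr_gt0.
have s0 : 0 < Num.sqrt (4 * pi * e) by rewrite sqrtr_gt0 !mulr_gt0// pi_gt0.
have ig : mu.-integrable setT (EFin \o (fun x => expR (- ((4 * e)^-1 * x ^+ 2)))).
  have := integrable_rZl (Num.sqrt (4 * pi * e)) measurableT (hk_integrable e0).
  congr (_.-integrable _ _); apply/funext => x /=.
  by rewrite /hk mulrA mulfV ?mul1r// gt_eqF.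
rewrite (RintegralZl _ measurableT ig) Rintegral_gauss// invrK.
rewrite (_ : pi * (4 * e) = 4 * pi * e); first by rewrite mulVf// gt_eqF.
by generalize (pi : R) => P; ring.
Qed.

Lemma integral_hk e : 0 < e -> (\int[mu]_x (hk e x)%:E = 1)%E.
Proof.
by move=> e0; rewrite -[RHS]/(1%:E) -(Rintegral_hk e0) /Rintegral fineK//; exact: (integrable_fin_num _ (hk_integrable e0)).
Qed.

Lemma hk_scale e s : 0 < e -> Num.sqrt e * hk e (Num.sqrt e * s) = hk 1 s.
Proof.
move=> e0; have se : 0 < Num.sqrt e by rewrite sqrtr_gt0.
rewrite /hk mulrA; congr (_ * expR (- _)).
  rewrite mulr1 sqrtrM ?mulr_ge0 ?pi_ge0// invfM mulrC -mulrA mulVf ?gt_eqF// mulr1 //.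
by rewrite exprMn sqr_sqrtr ?(ltW e0)// mulrA; congr (_ * _); field; rewrite gt_eqF.
Qed.

Lemma cintegral_real (f : R -> R) : cintegral setT (fun x => ((f x)%:C)%C) = ((\int[mu]_x f x)%:C)%C.
Proof. by apply: cplxP => //=; rewrite Rintegral_cst// mul0r. Qed.

Lemma cintegral_mulr (c : R[i]) g : cintegrable setT g -> cintegral setT (fun x => g x * c) = cintegral setT g * c.
Proof.
move=> ig; under eq_cintegral do rewrite mulrC.
by rewrite (cintegralZ c measurableT ig) mulrC.
Qed.

(** The convolution of [hk e] with K after rescaling the heat kernel to unit width; in this form e
    can tend to 0 under the integral. *)
Definition smear K (e u : R) : R := \int[mu]_s (hk 1 s * K (u - Num.sqrt e * s)).

(** Associativity of convolution: the heat kernel is moved from g, known only to be integrable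
    against [kap], to the regular kernel K. The square of [kap] in the bound on K is what still
    leaves a product majorant after Peetre's inequality is applied to both kernels. *)
Lemma mol_hk K g (C e x : R) : 0 <= C -> lmeas K -> (forall z, `|K z| <= C * kap z ^+ 2) -> 0 < e -> lcmeas g ->
  mu.-integrable setT (EFin \o (fun z => cabs (g z) * kap z)) ->
  mol K (mol (hk e) g) x = cintegral setT (fun z => g z * ((smear K e (x - z))%:C)%C).
Proof.
move=> C0 mK hK e0 mg ig; have mh := lmeas_hk e0.
have hK1 z : `|K z| <= C * kap z.
  by rewrite (le_trans (hK z))// ler_wpM2l// expr2 ler_piMr ?kap_ge0// kap_le1.
have [B B0 hB] := schwartz_kap (schwartz_hk e0).
have hB' z : hk e z <= B * kap z by have := hB z; rewrite cabs_real ger0_norm ?hk_ge0.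
have iK z : mu.-integrable setT (EFin \o (fun y => K (x - y) * hk e (y - z))).
  apply: (@integrable_dom R _ (mR R) mu setT _ (fun y => (C * (2 / kap x) * B) * kap y) measurableT _ _ (integrable_Ckap _)).
  - apply: (@measurable_funM _ (mR R)); first exact: lmeas_sub.
    by apply: (measurableT_comp mh); apply: (@measurable_funB _ (mR R)); [exact: measurable_id|exact: measurable_cst].
  - move=> y _; rewrite normrM (ger0_norm (hk_ge0 _ _)).
    apply: (@le_trans _ _ ((C * (2 * kap y / kap x)) * B)).
      apply: ler_pM; rewrite ?normr_ge0 ?hk_ge0//.
        by rewrite (le_trans (hK1 _))// ler_wpM2l// kap_peetre.
      by rewrite (le_trans (hB' _))// ler_piMr// kap_le1.
    by rewrite le_eqVlt; apply/orP; left; apply/eqP; field; rewrite gt_eqF// kap_gt0.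
pose F (z : mR R * mR R) : R[i] := ((K (x - z.2) * hk e ((z.2 : R) - (z.1 : R)))%:C)%C * g z.1.
have FE y z : F (z, y) = ((K (x - y) * hk e (y - z))%:C)%C * g z by [].
have mF : cmeas F.
  apply: cmeasM; last exact: (cmeas_comp measurable_fst mg).
  apply: cmeas_real; apply: measurable_funM.
    by apply: (measurableT_comp (lmeas_sub x mK)); exact: measurable_snd.
  by apply: (measurableT_comp mh); exact: measurable_subr2.
pose A := C * (2 / kap x) ^+ 2 * (2 * B).
have dom z y : cabs (F (z, y)) <= (cabs (g z) * kap z) * (A * kap y).
  rewrite FE cabsM cabs_real normrM (ger0_norm (hk_ge0 _ _)) [leLHS]mulrC -mulrA ler_wpM2l ?cabs_ge0//.
  apply: (@le_trans _ _ ((C * (2 * kap y / kap x) ^+ 2) * (B * (2 * kap z / kap y)))).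
    apply: ler_pM; rewrite ?normr_ge0 ?hk_ge0//.
      have kk : 0 <= 2 * kap y / kap x by exact: le_trans (kap_ge0 _) (kap_peetre y x).
      by rewrite (le_trans (hK _))// ler_wpM2l// lerXn2r ?nnegrE ?kap_ge0// kap_peetre.
    by rewrite (le_trans (hB' _))// ler_wpM2l// kap_peetre.
  rewrite /A le_eqVlt; apply/orP; left; apply/eqP; field.
  by rewrite !gt_eqF// kap_gt0.
have FF := cfubini mF ig (integrable_Ckap A) dom.
have imol y := integrable_mol y B0 mh mg (fun z => eq_ind_r (fun w => w <= _) (hB' z) (ger0_norm (hk_ge0 e z))) ig.
clearbody F.
transitivity (cintegral setT (fun y => cintegral setT (fun z => F (z, y)))).
  apply: eq_cintegral => y _; rewrite -(cintegralZ ((K (x - y))%:C)%C measurableT (imol y)).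
  by apply: eq_cintegral => z _; rewrite FE mulrA -realCM.
rewrite -FF; apply: eq_cintegral => z _; under eq_cintegral do rewrite FE.
rewrite cintegral_mulr; last first.
  have := iK z => i1; split => //=.
  rewrite (_ : EFin \o _ = fun=> 0%E); first exact: integrable0.
  by apply/funext.
rewrite mulrC cintegral_real; apply: (congr1 (fun w : R => g z * (w%:C)%C)).
have se : 0 < Num.sqrt e by rewrite sqrtr_gt0.
rewrite (Rintegral_aff z se); last first.
  by case: (iK z) => _; have /integrableP[/measurable_EFinP] := iK z.
have iS : mu.-integrable setT (EFin \o (fun s => K (x - (Num.sqrt e * s + z)) * hk e (Num.sqrt e * s + z - z))).
  exact: (integrable_aff z se (iK z)).
rewrite -(RintegralZl _ measurableT iS); apply: eq_Rintegral => s _.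
by rewrite addrK mulrCA hk_scale// mulrC opprD [- _ - z]addrC addrA.
Qed.

Lemma smear_bound K (C : R) : 0 <= C -> lmeas K -> (forall z, `|K z| <= C * kap z) ->
  exists2 B, 0 <= B & forall e u, 0 < e <= 1 -> `|smear K e u| <= B * kap u.
Proof.
move=> C0 mK hK; have [Q Q0 hQ] := schwartz_kap2 (schwartz_hk (@ltr01 R)).
exists (2 * C * Q * pi); first by rewrite mulr_ge0 ?pi_ge0// !mulr_ge0.
move=> e u /andP[e0 e1]; have se : 0 <= Num.sqrt e by rewrite sqrtr_ge0.
have m : lmeas (fun s => hk 1 s * K (u - Num.sqrt e * s)).
  apply: (@measurable_funM _ (mR R)); first exact: lmeas_hk.
  apply: (measurableT_comp mK); apply: (@measurable_funB _ (mR R)); first exact: measurable_cst.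
  by apply: (@measurable_funM _ (mR R)); [exact: measurable_cst|exact: measurable_id].
have dom s : `|hk 1 s * K (u - Num.sqrt e * s)| <= (2 * C * Q * kap u) * kap s.
  rewrite normrM (ger0_norm (hk_ge0 _ _)).
  apply: (@le_trans _ _ ((Q * kap s ^+ 2) * (C * (2 * kap u / kap s)))); last first.
    by rewrite le_eqVlt; apply/orP; left; apply/eqP; field; rewrite gt_eqF// kap_gt0.
  apply: ler_pM; rewrite ?normr_ge0 ?hk_ge0//.
    by have := hQ s; rewrite cabs_real ger0_norm ?hk_ge0.
  rewrite (le_trans (hK _))// ler_wpM2l// kapC (le_trans (kap_peetre u _))//.
  rewrite ler_wpM2l ?mulr_ge0 ?kap_ge0// /kap invrK invrK lerD2l exprMn sqr_sqrtr ?(ltW e0)//.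
  by rewrite ler_piMl// sqr_ge0.
have ik : mu.-integrable setT (EFin \o (fun s => (2 * C * Q * kap u) * kap s)) by exact: integrable_Ckap.
rewrite /smear; apply: (@le_trans _ _ (\int[mu]_s ((2 * C * Q * kap u) * kap s))).
  have im := integrable_dom measurableT m (fun s _ => dom s) ik.
  apply: (le_trans (le_normr_Rintegral measurableT im)); apply: le_Rintegral => //.
  exact: (integrable_norm im).
rewrite (RintegralZl _ measurableT (@integrable_kap R)) Rintegral_kap.
by rewrite mulrAC.
Qed.

Lemma smear_cvg K (C u : R) (e : nat -> R) : lmeas K -> (forall z, `|K z| <= C) -> continuous K ->
  (forall n, 0 < e n) -> e @ \oo --> (0 : R) -> smear K (e n) u @[n --> \oo] --> K u.
Proof.
move=> mK hK cK e0 ec; have ih := hk_integrable (@ltr01 R).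
have -> : K u = \int[mu]_s (hk 1 s * K u).
  by rewrite (RintegralZr _ measurableT ih) Rintegral_hk// mul1r.
apply: (@Rintegral_dct R setT _ _ (fun s => C * hk 1 s)) => //.
- move=> n; apply: (@measurable_funM _ (mR R)); first exact: lmeas_hk.
  apply: (measurableT_comp mK); apply: (@measurable_funB _ (mR R)); first exact: measurable_cst.
  by apply: (@measurable_funM _ (mR R)); [exact: measurable_cst|exact: measurable_id].
- by apply: (@measurable_funM _ (mR R)); [exact: lmeas_hk|exact: measurable_cst].
- move=> s _; apply: cvgMr.
  have us : u - Num.sqrt (e n) * s @[n --> \oo] --> u - Num.sqrt 0 * s.
    apply: cvgB; first exact: cvg_cst.
    by apply: cvgMl; apply: (cvg_comp _ _ ec); exact: sqrt_continuous.
  by move: us; rewrite sqrtr0 mul0r subr0 => us; apply: (cvg_comp _ _ us); exact: cK.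
- exact: integrable_rZl.
- by move=> n s _; rewrite normrM (ger0_norm (hk_ge0 _ _)) mulrC ler_wpM2r ?hk_ge0.
Qed.

Lemma mol_hk_cvg K g (C x : R) (e : nat -> R) : 0 <= C -> lmeas K -> (forall z, `|K z| <= C * kap z ^+ 2) ->
  continuous K -> (forall n, 0 < e n <= 1) -> e @ \oo --> (0 : R) -> lcmeas g ->
  mu.-integrable setT (EFin \o (fun z => cabs (g z) * kap z)) ->
  cabs (mol K (mol (hk (e n)) g) x - mol K g x) @[n --> \oo] --> (0 : R).
Proof.
move=> C0 mK hK cK e0 ec mg ig.
have hK1 z : `|K z| <= C * kap z.
  by rewrite (le_trans (hK z))// ler_wpM2l// expr2 ler_piMr ?kap_ge0// kap_le1.
have hK2 z : `|K z| <= C by rewrite (le_trans (hK1 z))// ler_piMr// kap_le1.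
have e0' n : 0 < e n by case/andP: (e0 n).
have [B B0 hB] := smear_bound C0 mK hK1.
have mc : lmeas (fun z => cabs (g z)) by exact: (measurable_cabs mg).
have msm n : lmeas (smear K (e n)).
  apply: (measurable_param (f := fun z => hk 1 z.1 * K ((z.2 : R) - Num.sqrt (e n) * (z.1 : R)))).
  apply: measurable_funM; first by apply: (measurableT_comp (lmeas_hk ltr01)); exact: measurable_fst.
  apply: (measurableT_comp mK); apply: measurable_funB; first exact: measurable_snd.
  by apply: measurable_funM; [exact: measurable_cst|exact: measurable_fst].
under eq_fun do rewrite (mol_hk _ C0 mK hK (e0' _) mg ig).
have -> : mol K g x = cintegral setT (fun z => g z * ((K (x - z))%:C)%C).
  by apply: eq_cintegral => z _; rewrite mulrC.
apply: (@cintegral_dct R setT _ _ (fun z => B * (kap (x - z) * cabs (g z)))) => //.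
- by move=> n; apply: cmeasM => //; apply: cmeas_real; exact: lmeas_sub.
- by apply: cmeasM => //; apply: cmeas_real; exact: lmeas_sub.
- move=> z _; have sc := @smear_cvg K C (x - z) e mK hK2 cK e0' ec.
  rewrite (_ : (fun n => _) = fun n => cabs (g z) * `|smear K (e n) (x - z) - K (x - z)|); last first.
    by apply/funext => n; rewrite -mulrBr -rmorphB/= cabsM cabs_real.
  rewrite -[X in _ --> X](mulr0 (cabs (g z))); apply: cvgMr.
  by apply/norm_cvg0P/subr_cvg0.
- apply: integrable_rZl => //; apply: integrable_kap_sub_mul => // z; exact: cabs_ge0.
- move=> n z _; rewrite cabsM cabs_real mulrC mulrA ler_wpM2r ?cabs_ge0//; exact: hB.
Qed.
End HeatKernel.

(** * Lebesgue points and recovery of a function from its mollifications *)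

Section LebesguePoints.
Variable R : realType.
Notation mu := (@lebesgue_measure R).
Implicit Types (K : R -> R) (g : R -> R[i]).
Variable sigma0 : R -> R[i].
Hypothesis adm : admissible_partition sigma0.

Definition bumpr (r z : R) : R := bump sigma0 (z / r) / r.

Lemma bumpr_ge0 r z : 0 < r -> 0 <= bumpr r z.
Proof. by move=> r0; rewrite divr_ge0 ?(bump_ge0 adm)// ltW. Qed.

Lemma bumpr_vanish r z : 0 < r -> r <= `|z| -> bumpr r z = 0.
Proof.
move=> r0 rz; rewrite /bumpr (bump_vanish adm) ?mul0r//.
by rewrite normrM normfV (gtr0_norm r0) ler_pdivlMr ?mul1r.
Qed.

Lemma bumpr_cont r : continuous (bumpr r).
Proof.
move=> z; apply: cvgMl; apply: (@cvg_comp _ _ _ (fun y => y / r) (bump sigma0) _ (nbhs (z / r))).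
  by apply: cvgMl; exact: cvg_id.
exact: (bump_cont adm).
Qed.

Lemma lmeas_bumpr r : lmeas (bumpr r).
Proof. exact: continuous_measurable_fun (@bumpr_cont r). Qed.

Lemma bumpr_bounded : exists2 C, 0 < C & forall r z, 0 < r -> bumpr r z <= C / r.
Proof.
have [C C0 hC] := bump_bounded adm; exists C => // r z r0.
by rewrite /bumpr ler_wpM2r ?hC// invr_ge0 ltW.
Qed.

Lemma bumpr_kap r : 0 < r <= 1 -> exists2 C, 0 <= C & forall z, `|bumpr r z| <= C * kap z ^+ 2.
Proof.
move=> /andP[r0 r1]; have [C C0 hC] := bumpr_bounded.
have Cr : 0 <= C / r by rewrite divr_ge0// ltW.
exists (C / r * 4); first by rewrite mulr_ge0.
move=> z; rewrite ger0_norm ?bumpr_ge0//.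
have [rz|zr] := leP r `|z|; first by rewrite bumpr_vanish// mulr_ge0 ?exprn_ge0 ?kap_ge0// mulr_ge0.
rewrite (le_trans (hC r z r0))// -mulrA ler_peMr//.
have : 2^-1 <= kap z.
  rewrite /kap lef_pV2 ?posrE ?ltr_wpDr ?sqr_ge0// -[2]/(1 + 1) lerD2l -(real_normK (num_real z)).
  by rewrite expr_le1// ltW// (lt_le_trans zr).
move=> h; have : 2^-1 ^+ 2 <= kap z ^+ 2 by rewrite lerXn2r ?nnegrE ?kap_ge0.
lra.
Qed.

Lemma integral_bumpr r : 0 < r -> (\int[mu]_z (bumpr r z)%:E = 1)%E.
Proof.
move=> r0; rewrite (ge0_integral_aff 0 r0); last 2 first.
- by apply/measurable_EFinP; exact: lmeas_bumpr.
- by move=> z; rewrite lee_fin bumpr_ge0.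
have E z : (bumpr r (r * z + 0) = r^-1 * bump sigma0 z)%R.
  by rewrite /bumpr addr0 [r * z]mulrC mulfK ?gt_eqF// mulrC.
under eq_integral do rewrite E EFinM.
rewrite ge0_integralZl_EFin//; last 3 first.
- by move=> z _; rewrite lee_fin (bump_ge0 adm).
- by apply/measurable_EFinP; exact: (lmeas_bump adm).
- by rewrite invr_ge0 ltW.
by rewrite (integral_bump adm) mule1 -EFinM mulfV// gt_eqF.
Qed.

(** [bumpr r] has mass 1, is at most C / r and vanishes off a ball of radius r, so the error is
    controlled by the mean oscillation over that ball, which tends to 0 at Lebesgue points. *)
Lemma bumpr_davg : exists2 C : R, 0 <= C & forall r g x, 0 < r <= 1 -> lcmeas g ->
  mu.-integrable setT (EFin \o (fun z => cabs (g z) * kap z)) ->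
  ((cabs (mol (bumpr r) g x - g x))%:E <=
    C%:E * (davg (fun z => CRe (g z)) x r + davg (fun z => CIm (g z)) x r))%E.
Proof.
have [C C0 hC] := bumpr_bounded; exists (2 * C); first by rewrite mulr_ge0// ltW.
move=> r g x r01 mg ig; have /andP[r0 r1] := r01.
have [A A0 hA] := bumpr_kap r01.
have hA1 z : `|bumpr r z| <= A * kap z.
  by rewrite (le_trans (hA z))// ler_wpM2l// expr2 ler_piMr ?kap_ge0// kap_le1.
have mK := lmeas_bumpr r; have mKx := lmeas_sub x mK.
have iK : cintegrable setT (fun z => ((bumpr r (x - z))%:C)%C * g x).
  apply: (integrable_mol x A0 mK (g := fun=> g x) _ hA1); first exact: cmeas_cst.
  by apply: integrable_rZl => //; exact: integrable_kap.
have iKg := integrable_mol x A0 mK mg hA1 ig.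
have iB := cintegrableB measurableT iKg iK.
have E1 : mol (bumpr r) g x - g x = cintegral setT (fun z => ((bumpr r (x - z))%:C)%C * g z - ((bumpr r (x - z))%:C)%C * g x).
  rewrite (cintegralB measurableT iKg iK); congr (_ - _).
  have ibx : mu.-integrable setT (EFin \o (fun z => bumpr r (x - z))).
    apply: (@integrable_le_fin _ _ 1) => //; first by move=> z; exact: bumpr_ge0.
    by rewrite integral_sub ?integral_bumpr// => z; exact: bumpr_ge0.
  rewrite cintegral_mulr; last first.
    split => //=; rewrite (_ : EFin \o _ = fun=> 0%E); first exact: integrable0.
    by apply/funext.
  rewrite cintegral_real (_ : \int[mu]_z bumpr r (x - z) = 1) ?mul1r//.
  rewrite /Rintegral integral_sub ?integral_bumpr// => z; exact: bumpr_ge0.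
have iB' := integrable_cabs measurableT iB.
have b1 : ((cabs (mol (bumpr r) g x - g x))%:E <= \int[mu]_z (cabs (((bumpr r (x - z))%:C)%C * g z - ((bumpr r (x - z))%:C)%C * g x))%:E)%E.
  rewrite E1 -(fineK (integrable_fin_num measurableT iB')) lee_fin.
  exact: (cabs_cintegral measurableT iB).
apply: (le_trans b1); pose B : set (mR R) := ball x r.
have mB : measurable B by exact: measurable_ball.
have muB : mu B = (r *+ 2)%:E by apply: lebesgue_measure_ball; exact: ltW.
have [m1 m2] := mg.
pose hR (f : R -> R) (z : mR R) := ((fun z => `|(f z - f x)%:E|%E) \_ B) z.
have mhR (f : R -> R) : lmeas f -> measurable_fun setT (hR f : mR R -> \bar R).
  move=> mf; apply/(measurable_restrictT _ mB); apply: measurable_funTS.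
  apply/measurable_EFinP; apply: (@measurableT_comp _ _ _ _ (mR R)) => //.
  by apply: (@measurable_funB _ (mR R)) => //; exact: measurable_cst.
have hR0 f z : (0 <= hR f z)%E by rewrite /hR patchE; case: ifP.
have davgE (f : R -> R) : (davg f x r = ((r *+ 2)^-1)%:E * \int[mu]_z hR f z)%E.
  rewrite /davg /iavg muB inver mulrn_eq0/= gt_eqF//; congr (_ * _)%E.
  by rewrite integral_mkcond.
have Cr0 : 0 <= C / r by rewrite divr_ge0// ltW.
apply: (@le_trans _ _ (\int[mu]_z ((C / r)%:E * (hR (fun z => CRe (g z)) z + hR (fun z => CIm (g z)) z)))%E).
  apply: ge0_le_integral => //.
  - by move=> z _; rewrite lee_fin cabs_ge0.
  - by have /integrableP[] := iB'.
  - apply: emeasurable_funM; first exact: measurable_cst.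
    by apply: emeasurable_funD; exact: mhR.
  - move=> z _; rewrite /hR !patchE; case: (boolP (z \in B)) => [_|zB].
      rewrite -mulrBr cabsM cabs_real ger0_norm ?bumpr_ge0// !abse_EFin -EFinD -EFinM lee_fin.
      by apply: ler_pM; rewrite ?bumpr_ge0 ?cabs_ge0// ?hC// (le_trans (cabs_le _))// !CE.
    rewrite adde0 mule0 bumpr_vanish ?mul0r ?subrr ?cabs0//.
    by move: zB; rewrite notin_setE /B -ball_normE/= => /negP; rewrite -leNgt.
rewrite ge0_integralZl_EFin//; last 2 first.
- by move=> z _; rewrite adde_ge0.
- by apply: emeasurable_funD; exact: mhR.
rewrite ge0_integralD//; [|exact: mhR|exact: mhR].
rewrite !davgE -ge0_muleDr ?integral_ge0// muleA -EFinM.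
by rewrite (_ : C / r = 2 * C * (r *+ 2)^-1)//; rewrite -mulr_natl; field; rewrite gt_eqF.
Qed.

Lemma locally_integrable_kap (f : R -> R) g : lmeas f -> (forall x, `|f x| <= cabs (g x)) ->
  mu.-integrable setT (EFin \o (fun z => cabs (g z) * kap z)) -> locally_integrable setT f.
Proof.
move=> mf fg ig; split => //; first exact: openT.
move=> K _ cK; have mK : measurable (K : set (mR R)) by exact: compact_measurable.
have [M [_ hM]] := compact_bounded cK.
pose N := Num.max M 0 + 1; have KN x : K x -> `|x| <= N.
  move=> Kx; apply: hM => //; rewrite /N; apply: le_lt_trans (ltr_pwDr ltr01 (lexx _)) .
  by rewrite le_max lexx.
have N0 : 0 <= N by rewrite addr_ge0// le_max lexx orbT.
have i2 := integrable_rZl (1 + N ^+ 2) measurableT ig.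
have /integrableP[mi hi] := i2.
pose w x : R := (1 + N ^+ 2) * (cabs (g x) * kap x).
apply: le_lt_trans hi; apply: (@le_trans _ _ (\int[mu]_(x in K) `|(w x)%:E|)%E).
  apply: ge0_le_integral => //.
  - apply/measurable_EFinP; apply: measurableT_comp => //; exact: measurable_funTS.
  - by apply: measurableT_comp => //; apply: measurable_funTS; exact: mi.
  - move=> x Kx /=; rewrite lee_fin (le_trans (fg x))// (le_trans _ (ler_norm _))//.
    rewrite /w mulrCA ler_peMr ?cabs_ge0// /kap ler_pdivlMr ?ltr_wpDr ?sqr_ge0// mul1r lerD2l.
    by rewrite -(real_normK (num_real x)) lerXn2r ?nnegrE ?KN.
by apply: ge0_subset_integral => //; apply: measurableT_comp.
Qed.

Lemma cvg_cabs3 (u : nat -> R[i]) (l : R[i]) : cabs (u n - l) @[n --> \oo] --> (0 : R) ->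
  cabs (u n) ^+ 3 @[n --> \oo] --> cabs l ^+ 3.
Proof.
move=> /cabs_cvg[c1 c2].
exact: (@cvg_comp _ _ _ (fun n => cabs (u n)) (fun z : R => z ^+ 3) _ _ _ (cvg_cabsE c1 c2) (@exprn_continuous _ 3 _)).
Qed.

Lemma cvg_harmonic_right : (fun n => (n.+1%:R^-1 : R)) @ \oo --> (0 : R)^'+.
Proof.
move=> A /= hA; have h : nbhs (0 : R) (fun u : R => 0 < u -> A u) by [].
have k : \forall n \near \oo, 0 < (n.+1%:R^-1 : R) -> A n.+1%:R^-1 by exact: (@cvg_harmonic R _ h).
suff : \forall n \near \oo, A n.+1%:R^-1 by [].
by apply: filterS k => n /=; apply; rewrite invr_gt0.
Qed.

Lemma bumpr_ae g : lcmeas g -> mu.-integrable setT (EFin \o (fun z => cabs (g z) * kap z)) ->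
  {ae mu, forall x, cabs (mol (bumpr n.+1%:R^-1) g x - g x) @[n --> \oo] --> (0 : R)}.
Proof.
move=> mg ig; have [C C0 hC] := bumpr_davg; have [m1 m2] := mg.
have FF := ae_filter_ringOfSetsType mu.
have l1 := lebesgue_differentiation (locally_integrable_kap m1 (fun x => CRe_le_cabs (g x)) ig).
have l2 := lebesgue_differentiation (locally_integrable_kap m2 (fun x => CIm_le_cabs (g x)) ig).
apply: filterS2 l1 l2 => x L1 L2.
have c1 := cvg_comp _ _ cvg_harmonic_right L1; have c2 := cvg_comp _ _ cvg_harmonic_right L2.
suff : (cabs (mol (bumpr n.+1%:R^-1) g x - g x))%:E @[n --> \oo] --> (0%:E : \bar R) by move/fine_cvg.
apply: (@squeeze_cvge _ _ _ _ (cst 0%E) _ (fun n => C%:E * (davg (fun z => CRe (g z)) x n.+1%:R^-1 + davg (fun z => CIm (g z)) x n.+1%:R^-1))%E).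
- apply: nearW => n; rewrite lee_fin cabs_ge0/=; apply: hC => //.
  by rewrite invr_gt0 ltr0Sn invf_le1 ?ler1n.
- exact: cvg_cst.
- rewrite -[X in _ --> X](mule0 C%:E) -[X in (_ * X)%E](adde0 0%E).
  by apply: cvgeZl => //; apply: cvgeD.
Qed.

(** Two limits are taken. After a further convolution with a bump the heat mollifications converge
    everywhere, and the bump mollifications then converge almost everywhere by Lebesgue
    differentiation. Fatou's lemma passes the bound through both, and the bump costs the factor 8 of
    [int3_mol]. *)
Lemma mollify_int3 g (Y Y0 : R) : lcmeas g -> (int3 g <= Y0%:E)%E ->
  (forall e, 0 < e <= 1 -> (int3 (mol (hk e) g) <= Y%:E)%E) -> (int3 g <= (8 * Y)%:E)%E.
Proof.
move=> mg hg hY; have ig := integrable_kap_int3 mg hg.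
have r01 (n : nat) : 0 < (n.+1%:R : R)^-1 <= 1 by rewrite invr_gt0 ltr0Sn invf_le1 ?ler1n.
have r0 (n : nat) : 0 < (n.+1%:R : R)^-1 by rewrite invr_gt0.
have step r : 0 < r <= 1 -> (int3 (mol (bumpr r) g) <= (8 * Y)%:E)%E.
  move=> hr; have /andP[rp _] := hr; have [C C0 hC] := bumpr_kap hr.
  have hC1 z : `|bumpr r z| <= C * kap z.
    by rewrite (le_trans (hC z))// ler_wpM2l// expr2 ler_piMr ?kap_ge0// kap_le1.
  have mK := lmeas_bumpr r.
  have mm n : lcmeas (mol (bumpr r) (mol (hk (n.+1%:R^-1)) g)).
    by apply: lcmeas_mol => //; apply: lcmeas_mol => //; exact: lmeas_hk.
  apply: (@fatou_le _ (fun n x => cabs (mol (bumpr r) (mol (hk (n.+1%:R^-1)) g) x) ^+ 3)).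
  - by move=> n; apply: lmeas_cabs3.
  - by apply: lmeas_cabs3; exact: lcmeas_mol.
  - by move=> n x; rewrite exprn_ge0 ?cabs_ge0.
  - by move=> x; rewrite exprn_ge0 ?cabs_ge0.
  - apply: aeW => x.
    exact: cvg_cabs3 (mol_hk_cvg x C0 mK hC (@bumpr_cont r) r01 (@cvg_harmonic R) mg ig).
  - move=> n; apply: (int3_mol C0 mK) => //.
    + by move=> z; exact: bumpr_ge0.
    + by move=> z; rewrite (le_trans (ler_norm _)).
    + exact: integral_bumpr.
    + by apply: lcmeas_mol => //; exact: lmeas_hk.
    + exact: hY.
apply: (@fatou_le _ (fun n x => cabs (mol (bumpr n.+1%:R^-1) g x) ^+ 3)).
- by move=> n; apply: lmeas_cabs3; apply: lcmeas_mol => //; exact: lmeas_bumpr.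
- exact: lmeas_cabs3.
- by move=> n x; rewrite exprn_ge0 ?cabs_ge0.
- by move=> x; rewrite exprn_ge0 ?cabs_ge0.
- have FF := ae_filter_ringOfSetsType mu; apply: filterS (bumpr_ae mg ig) => x.
  exact: cvg_cabs3.
- by move=> n; exact: step.
Qed.

(** The heat mollification at y is the pairing with the Schwartz function hk e (y - x), so every
    mollification of the difference vanishes. *)
Lemma represents_uniq (f : dist R) g h (Y : R) : represents f g -> represents f h ->
  (int3 g <= Y%:E)%E -> (int3 h <= Y%:E)%E -> (int3 (fun x => (g x - h x)%R) <= 0)%E.
Proof.
move=> [mg rg] [mh rh] hg hh; have mB := cmeasB mg mh.
rewrite -(mule0 8%:E) -EFinM; apply: (mollify_int3 mB (int3B mg mh hg hh)) => e /andP[e0 e1].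
rewrite (_ : mol _ _ = fun=> 0); last first.
  apply/funext => y; have sk := schwartz_reflect y (schwartz_hk e0).
  have [B B0 hB] := schwartz_kap sk; have mk := schwartz_cmeas sk.
  transitivity (cintegral setT (fun x => g x * ((hk e (y - x))%:C)%C - h x * ((hk e (y - x))%:C)%C)).
    by apply: eq_cintegral => x _; rewrite mulrC mulrBl.
  rewrite (cintegralB measurableT (cintegrable_pair mk hB mg hg) (cintegrable_pair mk hB mh hh)).
  by have := rg _ sk; rewrite rh// /dist_of => ->; rewrite subrr.
rewrite /int3; under eq_integral do rewrite cabs0 expr0n.
by rewrite integral0.
Qed.
End LebesguePoints.

(** * Dispersive and energy estimates *)

Section MeanValue.
Variable R : realType.

(** Continuity in epsilon-delta form with a non-strict conclusion, the form in which the L^3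
    estimates deliver it. *)
Definition ccont (m : R -> R[i]) t := forall e, 0 < e -> exists2 d, 0 < d & forall t', `|t' - t| < d -> cabs (m t' - m t) <= e.

Lemma cont_ed (f : R -> R) t : (forall e, 0 < e -> exists2 d, 0 < d & forall t', `|t' - t| < d -> `|f t' - f t| <= e) ->
  {for t, continuous f}.
Proof.
move=> h; apply/cvgrPdist_le => e e0; have [d d0 hd] := h e e0.
near=> t'; rewrite distrC; apply: hd; rewrite distrC; near: t'.
exact: (@cvgr_dist_lt _ _ _ _ _ id t (@cvg_id _ _) d d0).
Unshelve. all: by end_near. Qed.

Lemma ccont_Re m t : ccont m t -> {for t, continuous (fun t => CRe (m t))}.
Proof.
move=> cm; apply: cont_ed => e e0; have [d d0 hd] := cm e e0; exists d => // t' /hd.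
by apply: le_trans; rewrite -CReN -CReD CRe_le_cabs.
Qed.

Lemma ccont_Im m t : ccont m t -> {for t, continuous (fun t => CIm (m t))}.
Proof.
move=> cm; apply: cont_ed => e e0; have [d d0 hd] := cm e e0; exists d => // t' /hd.
by apply: le_trans; rewrite -CImN -CImD CIm_le_cabs.
Qed.

(* Multiplying m by the phase of m b - m a reduces the statement to a monotone real function. *)
Lemma cder_mean (m m' : R -> R[i]) (be be' : R -> R) (a b : R) : a <= b ->
  (forall t, a <= t <= b -> ccont m t) -> (forall t, a <= t <= b -> {for t, continuous be}) ->
  (forall t, a < t < b -> cder m t (m' t)) -> (forall t, a < t < b -> is_derive t (1 : R) be (be' t)) ->
  (forall t, a < t < b -> cabs (m' t) <= be' t) -> cabs (m b - m a) <= be b - be a.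
Proof.
move=> ab cm cb dm db hb; set th := phase (m b - m a).
pose f t := CRe (th * m t).
have cf t : a <= t <= b -> {for t, continuous f}.
  move=> /cm ct; have [c1 c2] := (ccont_Re ct, ccont_Im ct); rewrite /f; have -> : (fun t => CRe (th * m t)) = fun t => CRe th * CRe (m t) - CIm th * CIm (m t).
    by apply/funext => s; rewrite CReM.
  by apply: cvgB; apply: cvgMr; [exact: c1|exact: c2].
have df t : a < t < b -> is_derive t (1 : R) f (CRe (th * m' t)).
  by move=> tab; case: (cderZ th (dm t tab)).
have dg t : t \in `]a, b[ -> is_derive t (1 : R) (fun t => be t - f t) (be' t - CRe (th * m' t)).
  by rewrite in_itv/= => tab; have := db t tab; have := df t tab => h1 h2; exact: is_deriveB.
have cg : {within `[a, b], continuous (fun t => be t - f t)}.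
  apply: continuous_in_subspaceT => t; rewrite inE/= in_itv/= => tab.
  by apply: cvgB; [exact: cb|exact: cf].
have [->|nab] := eqVneq a b; first by rewrite !subrr cabs0.
have ab' : a < b by rewrite lt_def eq_sym nab.
have [c cab E] := MVT ab' dg cg.
have : 0 <= (be' c - CRe (th * m' c)) * (b - a).
  rewrite mulr_ge0 ?subr_ge0//; move: cab; rewrite in_itv/= => /hb h; apply: le_trans h.
  rewrite (le_trans (ler_norm _))// (le_trans (CRe_le_cabs _))// cabsM cabs_phase mul1r//.
rewrite -E; have -> : cabs (m b - m a) = f b - f a.
  have := phaseP (m b - m a); rewrite -/th => /(congr1 (fun z : R[i] => CRe z))/= <-.
  by rewrite /f mulrBr CReD CReN.
lra.
Qed.

Lemma is_derive_o (f : R -> R) t : (forall e, 0 < e -> exists2 d, 0 < d & forall t', `|t' - t| < d -> `|f t'| <= e * `|t' - t|) ->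
  is_derive t (1 : R) f 0.
Proof.
move=> h; have f0 : f t = 0.
  have [d d0 hd] := h 1 ltr01; have := hd t; rewrite subrr normr0 mulr0 => /(_ d0).
  by rewrite normr_le0 => /eqP.
have c : (fun s => s^-1 *: (f (s *: 1 + t) - f t)) @ 0^' --> (0 : R).
  apply/cvgrPdist_le => e e0; have [d d0 hd] := h e e0.
  near=> s; rewrite sub0r normrN f0 subr0 /GRing.scale/= mulr1.
  have sn : s != 0 by near: s; exact: nbhs_dnbhs_neq.
  have sd : `|s| < d.
    near: s; apply: nbhs_dnbhs; apply/nbhs_ballP; exists d => // x.
    by rewrite -ball_normE/= sub0r normrN.
  rewrite normrM normfV ler_pdivrMl ?normr_gt0// mulrC.
  by have := hd (s + t); rewrite addrK => /(_ sd).
split; first by apply/cvg_ex; exists 0.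
exact: (cvg_lim _ c).
Unshelve. all: by end_near. Qed.

Lemma cder_o (f : R -> R[i]) t : (forall e, 0 < e -> exists2 d, 0 < d & forall t', `|t' - t| < d -> cabs (f t') <= e * `|t' - t|) ->
  cder f t 0.
Proof.
move=> h; split => /=; apply: is_derive_o => e e0; have [d d0 hd] := h e e0; exists d => // t' /hd.
  exact: le_trans (CRe_le_cabs _).
exact: le_trans (CIm_le_cabs _).
Qed.

(** The mean value theorem is applied to real and imaginary parts separately, whence the factor
    2. *)
Lemma cder_lip (m m' : R -> R[i]) (u v C t t' : R) : (forall s, u < s < v -> cder m s (m' s)) ->
  (forall s, u < s < v -> cabs (m' s) <= C) -> u < t < v -> u < t' < v -> cabs (m t' - m t) <= 2 * C * `|t' - t|.
Proof.
wlog tt : t t' / t <= t' => [hw|].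
  have [/hw|/ltW /hw h] := leP t t'; first exact.
  by move=> h1 h2 h3 h4; rewrite cabsBC distrC; exact: h.
move=> dm hm /andP[ut tv] /andP[ut' t'v].
have C0 : 0 <= C by apply: le_trans (hm t _); rewrite ?cabs_ge0 ?ut ?tv.
have inn s : s \in `[t, t'] -> u < s < v.
  by rewrite in_itv/= => /andP[h1 h2]; rewrite (lt_le_trans ut h1) (le_lt_trans h2 t'v).
have lip (f f' : R -> R) : (forall s, u < s < v -> is_derive s (1 : R) f (f' s)) ->
    (forall s, u < s < v -> `|f' s| <= C) -> `|f t' - f t| <= C * `|t' - t|.
  move=> df hf.
  have [||c /inn cc ->] := @MVT_segment R f f' t t' tt.
  - move=> x; rewrite in_itv/= => /andP[h1 h2]; apply: df; apply: inn.
    by rewrite in_itv/= !ltW.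
  - apply: continuous_in_subspaceT => x; rewrite inE/= => /inn xu.
    exact: (is_derive_cont (df x xu)).
  - by rewrite normrM ler_wpM2r ?hf.
rewrite (le_trans (cabs_le _))// !CE -mulrA mulr_natl mulr2n; apply: lerD.
- apply: (lip (fun s => CRe (m s)) (fun s => CRe (m' s))).
    by move=> s /dm[].
  by move=> s /hm; apply: le_trans; exact: CRe_le_cabs.
- apply: (lip (fun s => CIm (m s)) (fun s => CIm (m' s))).
    by move=> s /dm[].
  by move=> s /hm; apply: le_trans; exact: CIm_le_cabs.
Qed.
End MeanValue.

(** * Pairings of L^3 and L^1 functions with test functions *)

Section Pairing.
Variable R : realType.
Notation mu := (@lebesgue_measure R).
Notation D := (cderive (1 : R)).
Implicit Types (h phi : R -> R[i]).

Definition pr h phi : R[i] := cintegral setT (fun x => h x * phi x).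
Definition int1 h : \bar R := (\int[mu]_x (cabs (h x))%:E)%E.

Lemma kap_sub_kap (z x : R) : kap (z - x) <= (2 / kap z) * kap x.
Proof. by rewrite (le_trans (kap_peetre x z))// mulrAC. Qed.

Lemma kap_sub_dom phi (B z : R) : 0 <= B -> (forall x, cabs (phi x) <= B * kap (z - x)) ->
  forall x, cabs (phi x) <= (B * (2 / kap z)) * kap x.
Proof. by move=> B0 hB x; rewrite (le_trans (hB x))// -mulrA ler_wpM2l// kap_sub_kap. Qed.

Lemma pr_int phi B z h (y : R) : 0 <= B -> lcmeas phi -> (forall x, cabs (phi x) <= B * kap (z - x)) ->
  lcmeas h -> (int3 h <= (y ^+ 3)%:E)%E -> cintegrable setT (fun x => h x * phi x).
Proof. by move=> B0 mp hB mh hy; exact: (cintegrable_pair mp (kap_sub_dom B0 hB) mh hy). Qed.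

(** Jensen for the density kap(z - x), whose mass does not depend on z: the bound is uniform over
    translated test functions. *)
Lemma pr_le phi B z h (y : R) : 0 <= B -> 0 <= y -> lcmeas phi -> (forall x, cabs (phi x) <= B * kap (z - x)) ->
  lcmeas h -> (int3 h <= (y ^+ 3)%:E)%E -> cabs (pr h phi) <= B * (pi + 1) * y.
Proof.
move=> B0 y0 mp hB mh hy; have p0 : 0 <= pi :> R by exact: pi_ge0.
have ig := integrable_kap_int3 mh hy.
have mc : lmeas (fun x => cabs (h x)) by exact: (measurable_cabs mh).
have ikg := integrable_kap_sub_mul z mc (fun x => cabs_ge0 (h x)) ig.
have p1 : 0 <= pi + 1 :> R by exact: addr_ge0.
have Bp := mulr_ge0 (mulr_ge0 B0 p1) y0.
rewrite -(@ler_pXn2r _ 3)// ?nnegrE ?cabs_ge0//.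
apply: (@le_trans _ _ ((B * \int[mu]_x (kap (z - x) * cabs (h x))) ^+ 3)).
  apply: ler_cube; first exact: cabs_ge0.
  rewrite -(RintegralZl _ measurableT ikg); apply: cabs_cintegral_le => //.
  - exact: cmeasM.
  - by move=> x _; rewrite cabsM mulrA mulrC ler_wpM2r ?cabs_ge0.
  - exact: integrable_rZl.
rewrite -mulrA [leLHS]exprMn [leRHS]exprMn ler_wpM2l ?exprn_ge0// [leRHS]exprMn.
apply: jensen_cube => //.
- exact: measurable_kap_sub.
- by move=> x; exact: kap_ge0.
- by move=> x; exact: cabs_ge0.
- exact: exprn_ge0.
- by rewrite integral_kap_sub.
- rewrite (le_trans _ hy)//; apply: ge0_le_integral => //.
  + by move=> x _; rewrite lee_fin mulr_ge0 ?kap_ge0 ?exprn_ge0 ?cabs_ge0.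
  + apply/measurable_EFinP; apply: (@measurable_funM _ (mR R)); [exact: measurable_kap_sub|exact: lmeas_cabs3].
  + by apply/measurable_EFinP; exact: lmeas_cabs3.
  + by move=> x _; rewrite lee_fin ler_piMl ?exprn_ge0 ?cabs_ge0// kap_le1.
Qed.

Lemma kap0 (phi : R -> R[i]) C : (forall x, cabs (phi x) <= C * kap x) -> forall x, cabs (phi x) <= C * kap (0 - x).
Proof. by move=> h x; rewrite sub0r /kap sqrrN; exact: h. Qed.

Lemma pr_null (h phi : R -> R[i]) : lcmeas h -> (int3 h <= 0)%E -> schwartz phi -> pr h phi = 0.
Proof.
move=> mh h0 sp; have [C C0 hC] := schwartz_kap sp.
have h0' : (int3 h <= ((0 : R) ^+ 3)%:E)%E by rewrite expr0n.
have := pr_le C0 (lexx 0) (schwartz_cmeas sp) (kap0 hC) mh h0'.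
by rewrite mulr0 => k0; apply: cabs_eq0; apply/eqP; rewrite eq_le k0 cabs_ge0.
Qed.

Lemma int1_integrable h (Y : R) : lcmeas h -> (int1 h <= Y%:E)%E -> mu.-integrable setT (EFin \o (fun x => cabs (h x))).
Proof.
move=> mh hY; apply: (integrable_le_fin _ _ hY) => [|x]; last exact: cabs_ge0.
exact: (measurable_cabs mh).
Qed.

Lemma pr1_int phi S h (Y : R) : lcmeas phi -> (forall x, cabs (phi x) <= S) -> lcmeas h -> (int1 h <= Y%:E)%E ->
  cintegrable setT (fun x => h x * phi x).
Proof.
move=> mp hS mh hY; have i1 := int1_integrable mh hY.
apply: (@cintegrable_dom R setT _ (fun x => S * cabs (h x)) measurableT) => [|x _|].
- exact: cmeasM.
- by rewrite cabsM mulrC ler_wpM2r ?cabs_ge0.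
- exact: integrable_rZl.
Qed.

Lemma pr1_le phi S h (Y : R) : lcmeas phi -> (forall x, cabs (phi x) <= S) -> lcmeas h -> (int1 h <= Y%:E)%E ->
  cabs (pr h phi) <= S * Y.
Proof.
move=> mp hS mh hY; have i1 := int1_integrable mh hY.
have S0 : 0 <= S by exact: le_trans (cabs_ge0 _) (hS 0).
apply: (@le_trans _ _ (\int[mu]_x (S * cabs (h x)))).
  apply: cabs_cintegral_le => // [|x _|].
  - exact: cmeasM.
  - by rewrite cabsM mulrC ler_wpM2r ?cabs_ge0.
  - exact: integrable_rZl.
rewrite (RintegralZl _ measurableT i1) ler_wpM2l// -lee_fin /Rintegral fineK//.
exact: (integrable_fin_num _ i1).
Qed.

Lemma prB h1 h2 phi : cintegrable setT (fun x => h1 x * phi x) -> cintegrable setT (fun x => h2 x * phi x) ->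
  pr h1 phi - pr h2 phi = pr (fun x => h1 x - h2 x) phi.
Proof.
move=> i1 i2; rewrite /pr -(cintegralB measurableT i1 i2); apply: eq_cintegral => x _.
by rewrite mulrBl.
Qed.

Lemma prBr h phi1 phi2 : cintegrable setT (fun x => h x * phi1 x) -> cintegrable setT (fun x => h x * phi2 x) ->
  pr h phi1 - pr h phi2 = pr h (fun x => phi1 x - phi2 x).
Proof.
move=> i1 i2; rewrite /pr -(cintegralB measurableT i1 i2); apply: eq_cintegral => x _.
by rewrite mulrBr.
Qed.
End Pairing.

(** * Pairings in which both factors depend on time *)

Section TimePair.
Variable R : realType.
Notation mu := (@lebesgue_measure R).
Variable g : R -> R -> R[i].
Variable G : R.
Hypothesis mg : forall t, lcmeas (g t).
Hypothesis G0 : 0 <= G.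
Hypothesis hG : forall t, (int3 (g t) <= (G ^+ 3)%:E)%E.
Hypothesis cg : forall t e, 0 < e -> exists2 d, 0 < d & forall t', `|t' - t| < d ->
  (int3 (fun x => (g t' x - g t x)%R) <= (e ^+ 3)%:E)%E.

Variables (Phi Phi' : R -> R -> R[i]) (u v C z : R).
Hypothesis C0 : 0 <= C.
Hypothesis dPhi : forall s x, u < s < v -> cder (Phi ^~ x) s (Phi' s x).
Hypothesis hPhi' : forall s x, u < s < v -> cabs (Phi' s x) <= C * kap (z - x).
Hypothesis hPhi : forall s x, u < s < v -> cabs (Phi s x) <= C * kap (z - x).
Hypothesis mPhi : forall s, lcmeas (Phi s).
Hypothesis mPhi' : forall s, lcmeas (Phi' s).

Lemma Phi_lip s s' x : u < s < v -> u < s' < v -> cabs (Phi s' x - Phi s x) <= (2 * C * `|s' - s|) * kap (z - x).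
Proof.
move=> hs hs'; rewrite mulrAC -mulrA.
rewrite (le_trans (cder_lip (fun s => dPhi x (s := s)) (fun s => hPhi' x (s := s)) hs hs'))//.
by rewrite !mulrA.
Qed.

Lemma pr_lip s s' t : u < s < v -> u < s' < v ->
  cabs (pr (g t) (fun x => Phi s' x - Phi s x)) <= (2 * C * `|s' - s|) * (pi + 1) * G.
Proof.
move=> hs hs'; apply: (@pr_le _ _ _ z) => //.
- by rewrite !mulr_ge0.
- exact: cmeasB.
- by move=> x; exact: Phi_lip.
Qed.

Lemma near_uv t : u < t < v -> exists2 d, 0 < d & forall t', `|t' - t| < d -> u < t' < v.
Proof.
move=> /andP[ut tv]; exists (Num.min (t - u) (v - t)); first by rewrite lt_min !subr_gt0 ut.
by move=> t'; rewrite lt_min !ltr_norml => /andP[/andP[h1 _] /andP[_ h2]]; apply/andP; split; lra.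
Qed.

Lemma pr_cont t : u < t < v -> ccont (fun t => pr (g t) (Phi t)) t.
Proof.
move=> ht e e0; have p0 : 0 <= pi :> R by exact: pi_ge0.
have p1 : 0 < (pi + 1 : R) by rewrite ltr_wpDl.
have [d1 d10 h1] := near_uv ht.
pose e1 := e / (2 * ((C + 1) * (pi + 1))).
have C1 : 0 < C + 1 by rewrite ltr_wpDl.
have e10 : 0 < e1 by rewrite divr_gt0// !mulr_gt0.
have [d2 d20 h2] := cg t e10.
pose d3 := e / (2 * (2 * (C + 1) * (pi + 1) * (G + 1))).
have G1 : 0 < G + 1 by rewrite ltr_wpDl.
have d30 : 0 < d3 by rewrite divr_gt0// !mulr_gt0.
exists (Num.min d1 (Num.min d2 d3)); first by rewrite !lt_min d10 d20.
move=> t'; rewrite !lt_min => /and3P[/h1 ht' /h2 k2 k3].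
have iS s s' : u < s < v -> cintegrable setT (fun x => g s' x * Phi s x).
  move=> hs; apply: (pr_int C0 (mPhi s) (fun x => hPhi x hs) (mg s') (hG s')).
have -> : pr (g t') (Phi t') - pr (g t) (Phi t) =
    pr (fun x => g t' x - g t x) (Phi t') + pr (g t) (fun x => Phi t' x - Phi t x).
  by rewrite -(prB (iS _ _ ht') (iS _ _ ht')) -(prBr (iS _ _ ht') (iS _ _ ht)) addrA subrK.
rewrite (le_trans (cabsD _ _))// [leRHS](splitr e); apply: lerD.
  have hh := pr_le C0 (ltW e10) (mPhi t') (fun x => hPhi x ht') (cmeasB (mg t') (mg t)) k2.
  apply: (le_trans hh); apply: (@le_trans _ _ ((C + 1) * (pi + 1) * e1)).
    by rewrite ler_wpM2r ?(ltW e10)// ler_wpM2r ?(ltW p1)// lerDl.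
  by rewrite /e1 le_eqVlt; apply/orP; left; apply/eqP; generalize (pi : R) p1 => P P1; field; rewrite !gt_eqF.
apply: (le_trans (pr_lip t ht ht')).
apply: (@le_trans _ _ ((2 * (C + 1) * d3) * (pi + 1) * (G + 1))).
  apply: ler_pM => //; rewrite ?mulr_ge0// ?(ltW p1) ?lerDl//.
  rewrite ler_wpM2r ?(ltW p1)//; apply: ler_pM => //; rewrite ?mulr_ge0// ?(ltW k3)//.
  by rewrite ler_wpM2l// lerDl.
by rewrite /d3 le_eqVlt; apply/orP; left; apply/eqP; generalize (pi : R) p1 => P P1; field; rewrite !gt_eqF.
Qed.

Lemma cder_pair t l : u < t < v -> cder (fun s => pr (g s) (Phi t)) t l ->
  cder (fun s => pr (g s) (Phi s)) t (l + pr (g t) (Phi' t)).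
Proof.
move=> ht dl; have p0 : 0 <= pi :> R by exact: pi_ge0.
have p1 : 0 < (pi + 1 : R) by rewrite ltr_wpDl.
have iS s s' : u < s < v -> cintegrable setT (fun x => g s' x * Phi s x).
  move=> hs; apply: (pr_int C0 (mPhi s) (fun x => hPhi x hs) (mg s') (hG s')).
have d2 : cder (fun s => pr (g t) (Phi s)) t (pr (g t) (Phi' t)).
  apply: (@cder_under R (fun s x => g t x * Phi s x) (fun s x => g t x * Phi' s x)
    (fun x => (C * (2 / kap z)) * (cabs (g t x) * kap x)) u v t ht).
  - by move=> s hs; exact: iS.
  - by move=> s x hs; exact: cderZ (dPhi x hs).
  - by apply: integrable_rZl => //; exact: (integrable_kap_int3 (mg t) (hG t)).
  - move=> s x hs; rewrite cabsM [leRHS]mulrCA ler_wpM2l ?cabs_ge0//.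
    by apply: kap_sub_dom => // y; exact: hPhi'.
have d3 : cder (fun s => pr (fun x => g s x - g t x) (fun x => Phi s x - Phi t x)) t 0.
  apply: cder_o => e e0; have [d1 d10 h1] := near_uv ht.
  pose e1 := e / (2 * (C + 1) * (pi + 1)).
  have C1 : 0 < C + 1 by rewrite ltr_wpDl.
  have e10 : 0 < e1 by rewrite divr_gt0// !mulr_gt0.
  have [d2' d20 h2] := cg t e10.
  exists (Num.min d1 d2'); first by rewrite !lt_min d10 d20.
  move=> t'; rewrite !lt_min => /andP[/h1 ht' /h2 k2].
  have B0 : 0 <= 2 * C * `|t' - t| by rewrite !mulr_ge0.
  have hh := pr_le B0 (ltW e10) (cmeasB (mPhi t') (mPhi t)) (fun x => Phi_lip x ht ht') (cmeasB (mg t') (mg t)) k2.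
  apply: (le_trans hh).
  apply: (@le_trans _ _ ((2 * (C + 1) * `|t' - t|) * (pi + 1) * e1)).
    by rewrite ler_wpM2r ?(ltW e10)// ler_wpM2r ?(ltW p1)// ler_wpM2r// ler_wpM2l// lerDl.
  by rewrite /e1 le_eqVlt; apply/orP; left; apply/eqP; generalize (pi : R) p1 => P P1; field; rewrite !gt_eqF.
have dd := cderD (cderD dl d2) (cderD (cder_cst (- pr (g t) (Phi t)) t) d3).
have [d1 d10 h1] := near_uv ht.
have E : forall s, `|s - t| < d1 -> pr (g s) (Phi t) + pr (g t) (Phi s) +
   (- pr (g t) (Phi t) + pr (fun x => g s x - g t x) (fun x => Phi s x - Phi t x)) = pr (g s) (Phi s).
  move=> s /h1 hs.
  have i1 : cintegrable setT (fun x => g s x * (Phi s x - Phi t x)).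
    have := cintegrableB measurableT (iS s s hs) (iS t s ht); congr cintegrable.
    by apply/funext => x; rewrite mulrBr.
  have i2 : cintegrable setT (fun x => g t x * (Phi s x - Phi t x)).
    have := cintegrableB measurableT (iS s t hs) (iS t t ht); congr cintegrable.
    by apply/funext => x; rewrite mulrBr.
  rewrite -(prB i1 i2) -(prBr (iS s s hs) (iS t s ht)) -(prBr (iS s t hs) (iS t t ht)).
  by ring.
have {}dd : cder (fun s => pr (g s) (Phi t) + pr (g t) (Phi s) +
   (- pr (g t) (Phi t) + pr (fun x => g s x - g t x) (fun x => Phi s x - Phi t x))) t (l + pr (g t) (Phi' t)).
  by apply: (cder_ext dd) => //; rewrite addr0 addr0.
have nr : \forall s \near t, pr (g s) (Phi s) = pr (g s) (Phi t) + pr (g t) (Phi s) +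
   (- pr (g t) (Phi t) + pr (fun x => g s x - g t x) (fun x => Phi s x - Phi t x)).
  by near=> s; rewrite E//; near: s; apply: (@cvgr_distC_lt _ _ _ _ _ id t (@cvg_id _ _) d1 d10).
have [dd1 dd2] := dd; split.
- by apply: near_eq_is_derive dd1; apply: filterS nr => s ->.
- by apply: near_eq_is_derive dd2; apply: filterS nr => s ->.
Unshelve. all: by end_near. Qed.
End TimePair.

(** * The free Schroedinger evolution of a heat kernel *)

Section FreeGaussian.
Variable R : realType.
Notation mu := (@lebesgue_measure R).
Notation D := (cderive (1 : R)).
Variable eps : R.
Hypothesis eps0 : 0 < eps.

Definition r2 (s : R) : R := eps ^+ 2 + s ^+ 2.
Lemma r2_gt0 s : 0 < r2 s.
Proof. by rewrite ltr_pwDl ?sqr_ge0// exprn_gt0. Qed.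

Definition modu (s : R) : R := expR (- (4^-1 * ln (r2 s))).
(* fgauss s is the free evolution of the heat kernel hk eps: amp is the branch of
   (4 pi (eps + i s))^(-1/2) that is positive at s = 0. *)
Definition amp (s : R) : R[i] := (((Num.sqrt (4 * pi))^-1 * modu s)%:C)%C * expi (- (2^-1 * atan (s / eps))).
(** [be s] is 1 / (4 (eps + i s)) and [modu s] is the modulus of (eps + i s)^(-1/2), so [fgauss s]
    is the heat kernel at the complex time eps + i s; its derivative in s is i times the second
    space derivative [fgauss2]. *)
Definition be1 s := eps / (4 * r2 s).
Definition be2 s := - (s / (4 * r2 s)).
Definition be s : R[i] := (be1 s +i* be2 s)%C.
Definition fgauss s x : R[i] := amp s * cgauss (be1 s) (be2 s) x.
Definition fgauss2 s x : R[i] :=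
  ((-2)%:C)%C * be s * fgauss s x + (4%:C)%C * be s * be s * ((x ^+ 2)%:C)%C * fgauss s x.

Lemma is_derive_r2 s : is_derive s (1 : R) r2 (2 * s).
Proof.
have := is_deriveD (is_derive_cst (eps ^+ 2) s (1 : R)) (is_deriveX 2 (is_derive_id s (1 : R))).
move=> h; apply: (is_derive_ext h) => //.
by rewrite add0r /GRing.scale/= expr1 mulr1; ring.
Qed.

Lemma is_derive_modu s : is_derive s (1 : R) modu (- (s / (2 * r2 s)) * modu s).
Proof.
have r0 := r2_gt0 s.
have h1 := is_derive1_comp (is_derive1_ln r0) (is_derive_r2 s).
have h2 := is_deriveN (is_deriveM (is_derive_cst (4^-1 : R) s (1 : R)) h1).
have h3 := is_derive_expR_comp h2.
apply: (is_derive_ext h3) => //; rewrite /modu /GRing.scale/= mulrC; congr (_ * _).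
by field; rewrite gt_eqF.
Qed.

Lemma cder_amp s : cder amp s ((0 +i* (-2))%C * be s * amp s).
Proof.
have r0 := r2_gt0 s.
have h1 := cder_real (is_deriveM (is_derive_cst ((Num.sqrt (4 * pi))^-1 : R) s (1 : R)) (is_derive_modu s)).
have hl : is_derive s (1 : R) (fun s => s / eps) eps^-1.
  apply: (is_derive_ext (is_derive_aff eps^-1 0 s)) => //.
  by apply/funext => y; rewrite addr0 mulrC.
have ha := @is_derive1_comp R atan (fun s => s / eps) s _ _ (is_derive1_atan (s / eps)) hl.
have h2 := cder_expi (is_deriveN (is_deriveM (is_derive_cst (2^-1 : R) s (1 : R)) ha)).
apply: (cder_ext (cderM h1 h2)) => //.
rewrite /amp /= /GRing.scale/= mulr0 addr0 /be /be1 /be2.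
set c := (Num.sqrt _)^-1; set m := modu s; set e := expi _.
have -> : 2^-1 * ((1 + (s / eps) ^+ 2)^-1 / eps) + atan (s / eps) * 0 = eps / (2 * r2 s).
  have n1 : eps ^+ 2 + s ^+ 2 != 0 by rewrite gt_eqF// r0.
  have n2 : eps != 0 by rewrite gt_eqF.
  have -> : 1 + (s / eps) ^+ 2 = (eps ^+ 2 + s ^+ 2) / eps ^+ 2 by field.
  rewrite mulr0 addr0 /r2 invf_div; move: n1; set q := eps ^+ 2 + s ^+ 2 => n1.
  by field; rewrite n1 n2.
rewrite -[(cst c * modu) s]/(c * m).
by apply: cplxP; rewrite !CE/=; field; rewrite !gt_eqF.
Qed.

Lemma is_derive_inv4 s : is_derive s (1 : R) (fun s => (4 * r2 s)^-1) (- (s / (2 * r2 s ^+ 2))).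
Proof.
have r0 := r2_gt0 s.
have h1 := is_deriveM (is_derive_cst (4 : R) s (1 : R)) (is_derive_r2 s).
have n0 : (fun s => 4 * r2 s) s != 0 by rewrite mulf_neq0// gt_eqF.
have h2 := @is_deriveV R (fun s => 4 * r2 s) s _ 1 n0 h1.
apply: (is_derive_ext h2) => //; rewrite /GRing.scale/=.
by field; rewrite gt_eqF.
Qed.

Lemma cder_cgauss_s x s : cder (fun s => cgauss (be1 s) (be2 s) x) s
  ((0 +i* 4)%C * be s * be s * ((x ^+ 2)%:C)%C * cgauss (be1 s) (be2 s) x).
Proof.
have r0 := r2_gt0 s.
have hi := is_derive_inv4 s.
have h1 := is_deriveM (is_derive_cst (eps : R) s (1 : R)) hi.
have h2 := is_deriveN (is_deriveM (is_derive_id s (1 : R)) hi).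
have k1 := cder_real (is_derive_expR_comp (is_deriveN (is_deriveM h1 (is_derive_cst (x ^+ 2 : R) s (1 : R))))).
have k2 := cder_expi (is_deriveN (is_deriveM h2 (is_derive_cst (x ^+ 2 : R) s (1 : R)))).
apply: (cder_ext (cderM k1 k2)) => //.
rewrite /cgauss /be /be1 /be2 /= /GRing.scale/=.
set e1 := expR _; set e2 := expi _; move: e1 e2 => e1 e2.
have -> : - (eps / (4 * r2 s) * 0 + x ^+ 2 * (eps * - (s / (2 * r2 s ^+ 2)) + (4 * r2 s)^-1 * 0)) =
   x ^+ 2 * eps * s / (2 * r2 s ^+ 2) by field; rewrite gt_eqF.
have -> : - (- (s / (4 * r2 s)) * 0 + x ^+ 2 * - (s * - (s / (2 * r2 s ^+ 2)) + (4 * r2 s)^-1 * 1)) =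
   x ^+ 2 * (eps ^+ 2 - s ^+ 2) / (4 * r2 s ^+ 2).
  have -> : eps ^+ 2 = r2 s - s ^+ 2 by rewrite /r2 addrK.
  by field; rewrite gt_eqF.
by apply: cplxP; rewrite !CE/=; field; rewrite !gt_eqF.
Qed.

Lemma cder_fgauss_s x s : cder (fun s => fgauss s x) s ((0 +i* 1)%C * fgauss2 s x).
Proof.
apply: (cder_ext (cderM (cder_amp s) (cder_cgauss_s x s))) => //.
rewrite /fgauss2 /fgauss; move: (be s) (amp s) (cgauss _ _ _) ((x ^+ 2)%:C)%C => z a G X.
have -> : (0 +i* (-2))%C = (0 +i* 1)%C * ((-2)%:C)%C :> R[i] by apply: cplxP; rewrite !CE/=; ring.
have -> : (0 +i* 4)%C = (0 +i* 1)%C * (4%:C)%C :> R[i] by apply: cplxP; rewrite !CE/=; ring.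
ring.
Qed.

Lemma schwartz_fgauss s : schwartz (fgauss s).
Proof. by apply: schwartzZ; apply: schwartz_gauss; rewrite divr_gt0// mulr_gt0// r2_gt0. Qed.

Lemma D_fgauss s : D (fgauss s) = fun x => ((-2)%:C)%C * be s * (x%:C)%C * fgauss s x.
Proof.
apply/funext => x; apply: cderE; apply: (cder_ext (cderZ (amp s) (cder_cgauss (be1 s) (be2 s) x))) => //.
by rewrite /fgauss /be; ring.
Qed.

Lemma DD_fgauss s : D (D (fgauss s)) = fgauss2 s.
Proof.
rewrite D_fgauss; apply/funext => x; apply: cderE.
have h1 := cderZ (((-2)%:C)%C * be s) (cder_id x).
have h2 := cderZ (amp s) (cder_cgauss (be1 s) (be2 s) x).
apply: (cder_ext (cderM h1 h2)) => //.
rewrite /fgauss2 /fgauss -/(be s); move: (be s) (amp s) (cgauss _ _ _) => z a G.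
have -> : ((x ^+ 2)%:C)%C = (x%:C)%C * (x%:C)%C :> R[i] by rewrite expr2 realCM.
have -> : (4%:C)%C = ((-2)%:C)%C * ((-2)%:C)%C :> R[i] by apply: cplxP; rewrite !CE/=; ring.
ring.
Qed.

Lemma modu_ge0 s : 0 <= modu s. Proof. exact: expR_ge0. Qed.

Lemma modu_le s : modu s <= modu 0.
Proof.
rewrite /modu ler_expR lerN2 ler_wpM2l// ler_ln ?posrE ?r2_gt0//.
by rewrite /r2 lerD2l expr0n sqr_ge0.
Qed.

Lemma modu_sqr s : modu s ^+ 4 = (r2 s)^-1.
Proof.
rewrite /modu -expRM_natl -[LHS]/(expR (_)) mulrN mulrA mulfV// mul1r expRN lnK// posrE r2_gt0//.
Qed.

Lemma modu_disp s : s != 0 -> modu s <= (Num.sqrt `|s|)^-1.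
Proof.
move=> s0; have sp : 0 < Num.sqrt `|s| by rewrite sqrtr_gt0 normr_gt0.
rewrite -(@ler_pXn2r _ 4)// ?nnegrE ?modu_ge0 ?invr_ge0 ?(ltW sp)// modu_sqr exprVn lef_pV2 ?posrE ?r2_gt0 ?exprn_gt0//.
by rewrite (exprM _ 2 2) sqr_sqrtr// real_normK ?num_real// /r2 lerDr sqr_ge0.
Qed.

Lemma modu0 : modu 0 = (Num.sqrt eps)^-1.
Proof.
have sp : 0 < Num.sqrt eps by rewrite sqrtr_gt0.
apply/eqP; rewrite -(@eqrXn2 _ 4)// ?modu_ge0 ?invr_ge0 ?(ltW sp)// modu_sqr /r2 expr0n addr0 exprVn.
by rewrite (exprM _ 2 2) sqr_sqrtr// ltW.
Qed.

Lemma fgauss0 x : fgauss 0 x = ((hk eps x)%:C)%C.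
Proof.
rewrite /fgauss /amp mul0r atan0 mulr0 oppr0 expi0 mulr1 /cgauss /be2 mul0r oppr0 mul0r oppr0 expi0 mulr1 -realCM.
congr ((_%:C)%C); rewrite /hk modu0; congr (_ * expR (- (_ * _))).
  by rewrite -invfM -sqrtrM// mulr_ge0// pi_ge0.
by rewrite /be1 /r2 expr0n addr0; field; rewrite gt_eqF.
Qed.

Lemma cabs_fgauss s x : cabs (fgauss s x) = (Num.sqrt (4 * pi))^-1 * modu s * expR (- (be1 s * x ^+ 2)).
Proof.
rewrite cabsM cabs_cgauss cabsM cabs_expi mulr1 cabs_real ger0_norm//.
by rewrite mulr_ge0 ?modu_ge0// invr_ge0 sqrtr_ge0.
Qed.

Lemma sqrt4pi : 2 <= Num.sqrt (4 * pi) :> R.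
Proof.
have -> : 2 = Num.sqrt (2 ^+ 2) :> R by rewrite sqrtr_sqr ger0_norm.
by rewrite ler_sqrt ?mulr_ge0 ?pi_ge0//; have := pi_ge2 R; rewrite expr2; lra.
Qed.

(** The dispersive decay, free of eps. The factor 1/2 comes from sqrt(4 pi) >= 2 and makes the later
    time integral exactly a square root. *)
Lemma fgauss_disp s x : s != 0 -> cabs (fgauss s x) <= 2^-1 * (Num.sqrt `|s|)^-1.
Proof.
move=> s0; rewrite cabs_fgauss -[leRHS]mulr1; apply: ler_pM; rewrite ?expR_ge0//.
- by rewrite mulr_ge0 ?modu_ge0// invr_ge0 sqrtr_ge0.
- apply: ler_pM; rewrite ?modu_ge0 ?invr_ge0 ?sqrtr_ge0//; last exact: modu_disp.
  by rewrite lef_pV2 ?posrE ?sqrt4pi// (lt_le_trans _ sqrt4pi).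
- by rewrite -expR0 ler_expR oppr_le0 mulr_ge0 ?sqr_ge0// ltW// divr_gt0// mulr_gt0// r2_gt0.
Qed.

(** For |s| <= S the rate [be1 s] is at least b0, so one fixed Gaussian dominates, and
    [pow_expR_bound] absorbs the polynomial factor. The constant depends on eps, which does no harm:
    it justifies the differentiation of pairings and enters no final bound. *)
Lemma fgauss_dom (S : R) : 0 <= S -> exists2 C, 0 <= C & forall s x, `|s| <= S ->
  cabs (fgauss s x) <= C * kap x /\ cabs (fgauss2 s x) <= C * kap x.
Proof.
move=> S0; pose b0 := eps / (4 * (eps ^+ 2 + S ^+ 2)).
have q0 : 0 < eps ^+ 2 + S ^+ 2 by rewrite ltr_pwDl ?sqr_ge0// exprn_gt0.
have b00 : 0 < b0 by rewrite divr_gt0// mulr_gt0.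
have [C1 h1] := pow_expR_bound 0 b00; have [C2 h2] := pow_expR_bound 2 b00; have [C4 h4] := pow_expR_bound 4 b00.
pose E := fun x : R => expR (- (b0 * x ^+ 2)).
have E0 x : 0 <= E x by exact: expR_ge0.
pose C := C1 + 2 * C2 + C4.
have hC x : (1 + x ^+ 2) ^+ 2 * E x <= C.
  have := h1 x; have := h2 x; have := h4 x; rewrite expr0 mul1r -/(E x).
  rewrite (exprM _ 2 2) real_normK ?num_real//.
  rewrite (_ : (1 + x ^+ 2) ^+ 2 * E x = E x + 2 * (x ^+ 2 * E x) + x ^+ 2 ^+ 2 * E x); last by ring.
  rewrite /C; lra.
have C0 : 0 <= C by apply: le_trans (hC 0); rewrite mulr_ge0// exprn_ge0// addr_ge0// sqr_ge0.
have p (x : R) : 0 < 1 + x ^+ 2 by rewrite ltr_wpDr// sqr_ge0.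
have hC1 x : (1 + x ^+ 2) * E x <= C * kap x.
  by rewrite /kap ler_pdivlMr// mulrAC -expr2.
have hC0 x : E x <= C * kap x.
  by apply: le_trans (hC1 x); rewrite ler_peMl// lerDl sqr_ge0.
pose K := eps^-1; have K0 : 0 < K by rewrite invr_gt0.
have bK s : cabs (be s) <= K.
  have r0 := r2_gt0 s; rewrite (le_trans (cabs_le _))//= normrN ger0_norm; last by rewrite divr_ge0 ?ltW// mulr_gt0.
  rewrite normrM normfV (gtr0_norm (_ : 0 < 4 * r2 s)) ?mulr_gt0// -mulrDl ler_pdivrMr ?mulr_gt0//.
  rewrite /K mulrC ler_pdivlMr// /r2 -(real_normK (num_real s)).
  have := sqr_ge0 (eps - `|s|); have := sqr_ge0 eps; have := sqr_ge0 `|s|; nra.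
pose A := (Num.sqrt (4 * pi))^-1 * modu 0.
have A0 : 0 <= A by rewrite mulr_ge0 ?modu_ge0// invr_ge0 sqrtr_ge0.
have fE s x : `|s| <= S -> cabs (fgauss s x) <= A * E x.
  move=> hs; rewrite cabs_fgauss; apply: ler_pM; rewrite ?expR_ge0//.
  - by rewrite mulr_ge0 ?modu_ge0// invr_ge0 sqrtr_ge0.
  - by rewrite ler_wpM2l ?modu_le// invr_ge0 sqrtr_ge0.
  - rewrite ler_expR lerN2 ler_wpM2r ?sqr_ge0// /b0 /be1 ler_wpM2l ?(ltW eps0)//.
    rewrite lef_pV2 ?posrE ?mulr_gt0 ?r2_gt0// ler_wpM2l// /r2 lerD2l -(real_normK (num_real s)).
    by rewrite lerXn2r ?nnegrE.
pose B := A * C * (1 + 2 * K + 4 * K ^+ 2).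
have KK : 0 <= 2 * K + 4 * K ^+ 2 by rewrite addr_ge0 ?mulr_ge0 ?sqr_ge0// ltW.
have AC : 0 <= A * C by rewrite mulr_ge0.
exists B; first by rewrite /B mulr_ge0// -addrA addr_ge0.
move=> s x hs; split.
  rewrite (le_trans (fE s x hs))// (le_trans (ler_wpM2l A0 (hC0 x)))// mulrA ler_wpM2r ?kap_ge0//.
  by rewrite /B -addrA ler_peMr// lerDl.
have f0 := fE s x hs; have b := bK s; have c0 := cabs_ge0 (be s).
apply: (@le_trans _ _ ((2 * K + 4 * K ^+ 2) * ((1 + x ^+ 2) * (A * E x)))).
  rewrite /fgauss2; move: (fgauss s x) (be s) f0 b c0 => F z f0 b c0.
  rewrite (le_trans (cabsD _ _))// !cabsM !cabs_real normrN !ger0_norm ?sqr_ge0//.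
  rewrite [leRHS]mulrDl; apply: lerD.
    rewrite -mulrA -[leRHS]mulrA ler_wpM2l//; apply: ler_pM; rewrite ?cabs_ge0//.
    by apply: (le_trans f0); rewrite ler_peMl ?(mulr_ge0 A0 (E0 x))// lerDl sqr_ge0.
  have e1 : cabs z * cabs z <= K ^+ 2 by rewrite expr2; apply: ler_pM.
  have e2 : x ^+ 2 * cabs F <= (1 + x ^+ 2) * (A * E x).
    by apply: ler_pM; rewrite ?sqr_ge0 ?cabs_ge0 ?lerDr.
  rewrite (_ : 4 * cabs z * cabs z * x ^+ 2 * cabs F = (4 * (cabs z * cabs z)) * (x ^+ 2 * cabs F)); last by ring.
  apply: ler_pM => //; first by rewrite !mulr_ge0.
    by rewrite mulr_ge0 ?sqr_ge0 ?cabs_ge0.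
  by rewrite ler_wpM2l.
have -> : (2 * K + 4 * K ^+ 2) * ((1 + x ^+ 2) * (A * E x)) = (2 * K + 4 * K ^+ 2) * A * ((1 + x ^+ 2) * E x) by ring.
have KA : 0 <= (2 * K + 4 * K ^+ 2) * A by rewrite mulr_ge0.
apply: (le_trans (ler_wpM2l KA (hC1 x))); rewrite mulrA ler_wpM2r ?kap_ge0//.
have -> : B = A * C + (2 * K + 4 * K ^+ 2) * A * C by rewrite /B; ring.
by rewrite lerDr.
Qed.
End FreeGaussian.

(** * Derivatives of reflected functions *)

Section Reflect.
Variable R : realType.
Notation D := (cderive (1 : R)).

Lemma is_derive_reflect (y x : R) : is_derive x (1 : R) (fun x => y - x) (-1).
Proof.
apply: (is_derive_ext (is_derive_aff (-1) y x)) => //.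
by apply/funext => z; rewrite mulN1r addrC.
Qed.

Lemma D_reflect (phi : R -> R[i]) y : schwartz phi -> D (fun x => phi (y - x)) = fun x => - D phi (y - x).
Proof.
move=> sp; apply/funext => x; apply: cderE.
apply: (cder_ext (@cder_comp R phi (fun x => y - x) x _ _ (schwartz_cder (y - x) sp) (is_derive_reflect y x))) => //.
by apply: cplxP; rewrite !CE/=; ring.
Qed.

Lemma DD_reflect (phi : R -> R[i]) y : schwartz phi ->
  D (D (fun x => phi (y - x))) = fun x => D (D phi) (y - x).
Proof.
move=> sp; rewrite (D_reflect y sp); apply/funext => x; apply: cderE.
have := D_reflect y (schwartz_D sp) => h.
have := cderN (schwartz_cder x (schwartz_reflect y (schwartz_D sp))).
by rewrite h opprK.
Qed.
End Reflect.

(** * The localised energy identity *)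

Section LocalEnergy.
Variable R : realType.
Notation mu := (@lebesgue_measure R).
Definition dkap (x : R) : R := - (2 * x) * kap x ^+ 2.
Lemma is_derive_kap (l y : R) : is_derive y (1 : R) (fun y => kap (l * y)) (l * dkap (l * y)).
Proof.
have p : 0 < 1 + (l * y) ^+ 2 by rewrite ltr_wpDr// sqr_ge0.
have hl : is_derive y (1 : R) (fun y => l * y) l.
  by apply: (is_derive_ext (is_derive_aff l 0 y)) => //; apply/funext => z; rewrite addr0.
have h := is_deriveD (is_derive_cst (1 : R) y (1 : R)) (is_deriveX 2 hl).
have n0 : (fun y => 1 + (l * y) ^+ 2) y != 0 by rewrite gt_eqF.
have := @is_deriveV R (fun y => 1 + (l * y) ^+ 2) y _ 1 n0 h => k.
apply: (is_derive_ext k) => //.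
rewrite /dkap /kap /GRing.scale/= add0r expr1.
by field; rewrite gt_eqF.
Qed.

(** This is 2 |x| <= 1 + x^2: differentiating the weight kap(l y) costs a factor l and nothing
    more. *)
Lemma dkap_le x : `|dkap x| <= kap x.
Proof.
have k0 := kap_ge0 x.
rewrite /dkap normrM normrN (ger0_norm (sqr_ge0 _)) expr2 mulrA ler_piMl//.
rewrite /kap ler_pdivrMr ?ltr_wpDr ?sqr_ge0// mul1r normrM (ger0_norm (_ : 0 <= 2))//.
rewrite -(real_normK (num_real x)); have := sqr_ge0 (`|x| - 1).
by rewrite -subr_ge0 => h; rewrite -subr_ge0 (_ : _ - _ = (`|x| - 1) ^+ 2 - 0)//; ring.
Qed.

Lemma continuous_dkap : continuous dkap.
Proof.
move=> x; apply: cvgM.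
  by apply: cvgN; apply: cvgMr; exact: cvg_id.
by apply: (@cvg_comp _ _ _ (@kap R) (fun z => z ^+ 2) _ (nbhs (kap x))); [exact: continuous_kap|exact: exprn_continuous].
Qed.

Lemma integral_kapl (l : R) : 0 < l -> (\int[mu]_y (kap (l * y))%:E = (pi / l)%:E)%E.
Proof.
move=> l0; have := ge0_integral_aff (f := fun y => (kap y)%:E) 0 l0.
rewrite integral_kap => h.
have {}h : (pi%:E = l%:E * \int[mu]_x (kap (l * x + 0))%:E)%E.
  by apply: h; [apply/measurable_EFinP; exact: measurable_kap|move=> x; rewrite lee_fin kap_ge0].
have -> : (\int[mu]_y (kap (l * y))%:E = \int[mu]_y (kap (l * y + 0))%:E)%E.
  by apply: eq_integral => y _; rewrite addr0.
have ln : (l^-1%:E * (l%:E * \int[mu]_x (kap (l * x + 0))%:E) = \int[mu]_x (kap (l * x + 0))%:E)%E.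
  by rewrite muleA -EFinM mulVf ?gt_eqF// mul1e.
by rewrite -ln -h -EFinM mulrC.
Qed.

Lemma cIm_cj (z : R[i]) : CIm (cj z * z) = 0.
Proof. by rewrite !CE/=; ring. Qed.

Lemma is_derive_Im_cjM (f h : R -> R[i]) y f' h' : cder f y f' -> cder h y h' ->
  is_derive y (1 : R) (fun y => CIm (cj (f y) * h y)) (CIm (cj f' * h y + cj (f y) * h')).
Proof.
move=> [r1 r2] [s1 s2].
have k := is_deriveB (is_deriveM r1 s2) (is_deriveM r2 s1).
apply: (is_derive_ext k).
  by apply/funext => z; rewrite CImM /= mulNr.
by rewrite CImD !CImM /GRing.scale/=; ring.
Qed.

Lemma is_derive_Im_cj (f h : R -> R[i]) y h' : cder f y (h y) -> cder h y h' ->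
  is_derive y (1 : R) (fun y => CIm (cj (f y) * h y)) (CIm (cj (f y) * h')).
Proof.
move=> df dh; have := is_derive_Im_cjM df dh.
by move: (f y) (h y) => z x; rewrite CImD cIm_cj add0r.
Qed.

Lemma lmeas_kapl (l : R) : lmeas (fun y => kap (l * y)).
Proof.
apply: (measurableT_comp (@measurable_kap R)).
by apply: (@measurable_funM _ (mR R)); [exact: measurable_cst|exact: measurable_id].
Qed.

Lemma integrable_kapl (l : R) : 0 < l -> mu.-integrable setT (EFin \o (fun y => kap (l * y))).
Proof.
move=> l0; apply: (@integrable_le_fin _ _ (pi / l)); first exact: lmeas_kapl.
  by move=> y; exact: kap_ge0.
by rewrite integral_kapl.
Qed.

Section Dissipation.
Variables (w wy wyy wyyy f : R -> R[i]) (c : R[i]) (W0 W W2 Wf S A Y : R).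
Hypothesis dw : forall y, cder w y (wy y).
Hypothesis dwy : forall y, cder wy y (wyy y).
Hypothesis dwyy : forall y, cder wyy y (wyyy y).
Hypothesis hW0 : forall y, cabs (w y) <= W0.
Hypothesis hW : forall y, cabs (wy y) <= W.
Hypothesis hW2 : forall y, cabs (wyy y) <= W2.
Hypothesis hWf : forall y, cabs (f y) <= Wf.
Hypothesis hS : forall y, cabs (w y) <= S.
Hypothesis mw : lcmeas w.
Hypothesis mwyy : lcmeas wyy.
Hypothesis mf : lcmeas f.
Hypothesis i3 : (int3 w <= Y%:E)%E.
Hypothesis if1 : (int1 f <= A%:E)%E.
Hypothesis c1 : cabs c = 1.
Let den l y := kap (l * y) * (2 * CRe (cj (w y) * ((0 +i* 1)%C * (- wyy y + c * f y)))).

(* The energy is localised by the weight kap (l y) with l = d^3, since w is not known a priori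
   to be square integrable.  The commutator term is at most l kap |w| |wy|, and
   |w| <= d + |w|^3 / d^2 turns it into a quantity of order d. *)
Lemma dissipation (d : R) : 0 < d <= 1 ->
  \int[mu]_y den (d ^+ 3) y <= 2 * W * d * (pi + Y) + 2 * S * A.
Proof.
move=> /andP[d0 d1]; set l := d ^+ 3; have l0 : 0 < l by rewrite exprn_gt0.
have l1 : l <= 1 by rewrite exprn_ile1// ltW.
have p0 : 0 <= W0 by exact: le_trans (cabs_ge0 _) (hW0 0).
have pW : 0 <= W by exact: le_trans (cabs_ge0 _) (hW 0).
have p2 : 0 <= W2 by exact: le_trans (cabs_ge0 _) (hW2 0).
have pf : 0 <= Wf by exact: le_trans (cabs_ge0 _) (hWf 0).
have S0 : 0 <= S by exact: le_trans (cabs_ge0 _) (hS 0).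
(* The localised current Im(conj w w_y). Its derivative h' integrates to 0 and contains the
   second-derivative term of [den], which is removed by subtracting 2 h'. *)
pose h y := kap (l * y) * CIm (cj (w y) * wy y).
pose h' y := l * dkap (l * y) * CIm (cj (w y) * wy y) + kap (l * y) * CIm (cj (w y) * wyy y).
have dI y : is_derive y (1 : R) (fun y => CIm (cj (w y) * wy y)) (CIm (cj (w y) * wyy y)).
  exact: (is_derive_Im_cj (dw y) (dwy y)).
have dh y : is_derive y (1 : R) h (h' y).
  have := is_deriveM (is_derive_kap l y) (dI y) => k; apply: (is_derive_ext k) => //.
  by rewrite /h' /GRing.scale/=; ring.
have cIw y : {for y, continuous (fun y => CIm (cj (w y) * wy y))} by exact: (is_derive_cont (dI y)).
have cwyy y : {for y, continuous (fun y => CIm (cj (w y) * wyy y))}.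
  exact: (is_derive_cont (is_derive_Im_cjM (dw y) (dwyy y))).
have clin y : {for y, continuous (fun y : R => l * y)} by apply: cvgMr; exact: cvg_id.
have ckl y : {for y, continuous (fun y => kap (l * y))}.
  by apply: (@cvg_comp _ _ _ (fun y => l * y) (@kap R) _ (nbhs (l * y))); [exact: clin|exact: continuous_kap].
have cdl y : {for y, continuous (fun y => dkap (l * y))}.
  by apply: (@cvg_comp _ _ _ (fun y => l * y) dkap _ (nbhs (l * y))); [exact: clin|exact: continuous_dkap].
have ch' : continuous h'.
  move=> y; apply: cvgD; apply: cvgM; [|exact: cIw|exact: ckl|exact: cwyy].
  by apply: cvgMr; exact: cdl.
have cjw y : cabs (cj (w y)) = cabs (w y) by rewrite !cabsE/= sqrrN.
have bI y : `|CIm (cj (w y) * wy y)| <= W0 * W.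
  by rewrite (le_trans (CIm_le_cabs _))// cabsM cjw; apply: ler_pM; rewrite ?cabs_ge0 ?hW.
have bII y : `|CIm (cj (w y) * wyy y)| <= W0 * W2.
  by rewrite (le_trans (CIm_le_cabs _))// cabsM cjw; apply: ler_pM; rewrite ?cabs_ge0 ?hW0 ?hW2.
have WW : 0 <= W0 * W by rewrite mulr_ge0.
have bh' y : `|h' y| <= (W0 * W + W0 * W2) * kap (l * y).
  rewrite (le_trans (ler_normD _ _))// mulrDl; apply: lerD.
    rewrite normrM mulrC; apply: ler_pM => //.
    rewrite normrM (ger0_norm (ltW l0)); apply: le_trans (dkap_le _).
    by rewrite ler_piMl.
  by rewrite normrM (ger0_norm (kap_ge0 _)) mulrC ler_wpM2r ?kap_ge0.
have mh' : lmeas h' by exact: continuous_measurable_fun ch'.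
have ikl := integrable_kapl l0.
have ih' : mu.-integrable setT (EFin \o h').
  exact: (integrable_dom measurableT mh' (fun y _ => bh' y) (integrable_rZl _ measurableT ikl)).
have bh y : `|h y| <= (W0 * W / l ^+ 2) * kap y.
  rewrite /h normrM (ger0_norm (kap_ge0 _)) mulrC.
  apply: (@le_trans _ _ (W0 * W * (kap y / l ^+ 2))); last by rewrite mulrA mulrAC.
  apply: ler_pM; rewrite ?kap_ge0//.
  rewrite ler_pdivlMr ?exprn_gt0// /kap ler_pdivrMl ?ltr_wpDr ?sqr_ge0//.
  rewrite ler_pdivlMr ?ltr_wpDr ?sqr_ge0// mulrDr mulr1 -exprMn lerD2r.
  by rewrite exprn_ile1// ltW.
have int0 := Rintegral_derive0 dh ch' ih' bh.
have mcw : lmeas (fun y => cabs (w y)) by exact: (measurable_cabs mw).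
have iw3 := integrable_le_fin (lmeas_cabs3 mw) (fun y => exprn_ge0 3 (cabs_ge0 (w y))) i3.
have iif := int1_integrable mf if1.
have mden : lmeas (den l).
  apply: (@measurable_funM _ (mR R)); first exact: lmeas_kapl.
  apply: (@measurable_funM _ (mR R)); first exact: measurable_cst.
  have mwt : lcmeas (fun y => (0 +i* 1)%C * (- wyy y + c * f y)).
    apply: cmeasM; first exact: cmeas_cst.
    by apply: cmeasD; [exact: cmeasN|apply: cmeasM => //; exact: cmeas_cst].
  have mcj : lcmeas (fun y => cj (w y)).
    by case: mw => m1 m2; split => //=; exact: (@measurable_funN _ (mR R)).
  by case: (cmeasM mcj mwt).
have iden : mu.-integrable setT (EFin \o den l).
  apply: (@integrable_dom R _ (mR R) mu setT _ (fun y => (2 * (W0 * (W2 + Wf))) * kap (l * y)) measurableT mden _ (integrable_rZl _ measurableT ikl)) => y _.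
  rewrite /den normrM (ger0_norm (kap_ge0 _)) mulrC ler_wpM2r ?kap_ge0// normrM ger0_norm// ler_wpM2l//.
  rewrite (le_trans (CRe_le_cabs _))// cabsM cjw; apply: ler_pM; rewrite ?cabs_ge0 ?hW0//.
  rewrite cabsM cabs_i mul1r (le_trans (cabsD _ _))// cabsN cabsM c1 mul1r.
  by apply: lerD; [exact: hW2|exact: hWf].
have E1 : \int[mu]_y den l y = \int[mu]_y (den l y - 2 * h' y).
  have i2 := integrable_rZl 2 measurableT ih'.
  by rewrite (RintegralB measurableT iden i2) (RintegralZl _ measurableT ih') int0 mulr0 subr0.
(* The weight kap(l y) has mass pi / l, so the first term integrates to 2 W d pi; with l = d^3 the
   coefficient of the second is 2 W d. *)
pose U y := 2 * W * l * d * kap (l * y) + (2 * W * l / d ^+ 2) * cabs (w y) ^+ 3 + 2 * S * cabs (f y).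
have iU : mu.-integrable setT (EFin \o U).
  apply: integrable_addR => //; last exact: integrable_rZl.
  by apply: integrable_addR => //; exact: integrable_rZl.
have pU y : den l y - 2 * h' y <= U y.
  have -> : den l y - 2 * h' y = 2 * (- (l * dkap (l * y) * CIm (cj (w y) * wy y)) - kap (l * y) * CIm (c * (cj (w y) * f y))).
    rewrite /den /h'.
    have -> : CRe (cj (w y) * ((0 +i* 1)%C * (- wyy y + c * f y))) = CIm (cj (w y) * wyy y) - CIm (c * (cj (w y) * f y)).
      by rewrite !CE/=; ring.
    by ring.
  have k0 := kap_ge0 (l * y).
  have t1 : - (l * dkap (l * y) * CIm (cj (w y) * wy y)) <= l * kap (l * y) * (cabs (w y) * W).
    rewrite (le_trans (ler_norm _))// normrN normrM; apply: ler_pM => //.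
      by rewrite normrM (ger0_norm (ltW l0)) ler_wpM2l ?(ltW l0)// dkap_le.
    by rewrite (le_trans (CIm_le_cabs _))// cabsM cjw; apply: ler_pM; rewrite ?cabs_ge0.
  have t2 : - (kap (l * y) * CIm (c * (cj (w y) * f y))) <= S * cabs (f y).
    rewrite (le_trans (ler_norm _))// normrN normrM (ger0_norm k0).
    apply: (@le_trans _ _ `|CIm (c * (cj (w y) * f y))|); first by rewrite ler_piMl// kap_le1.
    by rewrite (le_trans (CIm_le_cabs _))// cabsM c1 mul1r cabsM cjw ler_wpM2r ?cabs_ge0.
  have t3 : l * kap (l * y) * (cabs (w y) * W) <= l * W * (d * kap (l * y) + cabs (w y) ^+ 3 / d ^+ 2).
    have -> : l * kap (l * y) * (cabs (w y) * W) = l * W * (kap (l * y) * cabs (w y)) by ring.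
    apply: (ler_wpM2l (mulr_ge0 (ltW l0) pW)).
    apply: (le_trans (ler_wpM2l k0 (le_add_cube (cabs_ge0 (w y)) d0))).
    have z0 : 0 <= cabs (w y) ^+ 3 / d ^+ 2 by rewrite divr_ge0// exprn_ge0 ?cabs_ge0// ltW.
    by rewrite mulrDr [kap _ * d]mulrC lerD2l ler_piMl// kap_le1.
  have -> : U y = 2 * (l * W * (d * kap (l * y) + cabs (w y) ^+ 3 / d ^+ 2) + S * cabs (f y)).
    by rewrite /U; ring.
  by rewrite ler_wpM2l// lerD// (le_trans t1).
have iL : mu.-integrable setT (EFin \o (fun y => den l y - 2 * h' y)).
  exact: (integrableB measurableT iden (integrable_rZl 2 measurableT ih')).
rewrite E1 (le_trans (le_Rintegral measurableT iL iU (fun y _ => pU y)))//.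
have i1 := integrable_rZl (2 * W * l * d) measurableT ikl.
have i2 := integrable_rZl (2 * W * l / d ^+ 2) measurableT iw3.
have i4 := integrable_rZl (2 * S) measurableT iif.
rewrite /U (RintegralD measurableT (integrable_addR measurableT i1 i2) i4) (RintegralD measurableT i1 i2).
rewrite (RintegralZl _ measurableT ikl) (RintegralZl _ measurableT iw3) (RintegralZl _ measurableT iif).
have e1 : \int[mu]_x kap (l * x) = pi / l by rewrite /Rintegral integral_kapl.
have e2 : \int[mu]_x cabs (w x) ^+ 3 <= Y.
  by rewrite -lee_fin /Rintegral fineK//; exact: (integrable_fin_num measurableT iw3).
have e3 : \int[mu]_x cabs (f x) <= A.
  by rewrite -lee_fin /Rintegral fineK//; exact: (integrable_fin_num measurableT iif).
rewrite e1; apply: lerD; last by rewrite ler_wpM2l// mulr_ge0.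
have -> : 2 * W * l * d * (pi / l) = 2 * W * d * pi.
  by generalize (pi : R) => P; field; rewrite gt_eqF.
have -> : 2 * W * l / d ^+ 2 = 2 * W * d by rewrite /l; field; rewrite gt_eqF.
have q0 : 0 <= 2 * W * d by apply: mulr_ge0 (ltW d0); exact: mulr_ge0.
by rewrite [leRHS]mulrDr lerD2l; apply: (ler_wpM2l q0).
Qed.
End Dissipation.
End LocalEnergy.

(** * Dispersive bound, energy bound and vanishing *)

Section Evolution.
Variables (R : realType) (sigma0 : R -> R[i]).
Hypothesis adm : admissible_partition sigma0.
Notation mu := (@lebesgue_measure R).
Notation D := (cderive (1 : R)).
Variables (g F : R -> R -> R[i]) (T G : R) (c : R[i]).
Hypothesis mg : forall t, lcmeas (g t).
Hypothesis G0 : 0 <= G.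
Hypothesis hG : forall t, (int3 (g t) <= (G ^+ 3)%:E)%E.
Hypothesis cg : forall t e, 0 < e -> exists2 d, 0 < d & forall t', `|t' - t| < d ->
  (int3 (fun x => (g t' x - g t x)%R) <= (e ^+ 3)%:E)%E.
Hypothesis mF : forall t, lcmeas (F t).
Hypothesis c1 : cabs c = 1.
Hypothesis Hd : forall phi, schwartz phi -> forall t, 0 < t < T ->
  cder (fun s => pr (g s) phi) t ((0 +i* 1)%C * (- pr (g t) (D (D phi)) + c * pr (F t) phi)).

(** The pairing m of g with the free Gaussian that becomes [hk eps] at time t0 vanishes at time a.
    In m' the two second-derivative terms cancel, leaving i c times the pairing of F, of modulus at
    most A / (2 sqrt(t0 - t)), which is integrable up to t0. *)
Lemma dispersive (a t0 A eps y : R) : 0 <= a -> a <= t0 -> t0 <= T -> 0 < eps -> 0 <= A ->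
  (forall phi, schwartz phi -> pr (g a) phi = 0) ->
  (forall t, a <= t <= t0 -> (int1 (F t) <= A%:E)%E) ->
  cabs (pr (g t0) (fun x => ((hk eps (y - x))%:C)%C)) <= A * Num.sqrt (t0 - a).
Proof.
move=> a0 at0 t0T eps0 A0 ha hA.
have T0 : 0 <= T by exact: le_trans (le_trans a0 at0) t0T.
have S0 : 0 <= T + 1 by rewrite addr_ge0.
have [C C0 hC] := fgauss_dom eps0 S0.
pose Phi t x := fgauss eps (t - t0) (y - x).
pose Phi' t x := (0 +i* 1)%C * fgauss2 eps (t - t0) (y - x).
(* An open window containing [a, t0], because the product rule and the continuity of pairings are
   stated on open intervals. *)
pose u := t0 - (T + 1); pose v := t0 + (T + 1).
have uv s : u < s < v -> `|s - t0| <= T + 1.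
  by rewrite /u /v => /andP[h1 h2]; rewrite ler_norml; apply/andP; split; lra.
have tuv t : a <= t <= t0 -> u < t < v by move=> /andP[h1 h2]; rewrite /u /v; apply/andP; split; lra.
have sP t : schwartz (Phi t) by apply: schwartz_reflect; exact: schwartz_fgauss.
have sP2 t : schwartz (fun x => fgauss2 eps (t - t0) (y - x)).
  by apply: schwartz_reflect; rewrite -DD_fgauss//; do 2 apply: schwartz_D; exact: schwartz_fgauss.
have mP t := schwartz_cmeas (sP t).
have mP' t : lcmeas (Phi' t) by apply: schwartz_cmeas; exact: schwartzZ.
have dP s x : u < s < v -> cder (Phi ^~ x) s (Phi' s x).
  move=> _; have hd : is_derive s (1 : R) (fun s => s - t0) 1.
    apply: (is_derive_ext (is_derive_aff 1 (- t0) s)) => //.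
    by apply/funext => z; rewrite mul1r.
  apply: (cder_ext (@cder_comp R (fun s => fgauss eps s (y - x)) (fun s => s - t0) s _ _ (cder_fgauss_s eps0 (y - x) (s - t0)) hd)) => //.
  by rewrite mul1r.
have hP s x : u < s < v -> cabs (Phi s x) <= C * kap (y - x).
  by move=> /uv hs; case: (hC _ (y - x) hs).
have hP' s x : u < s < v -> cabs (Phi' s x) <= C * kap (y - x).
  by move=> /uv hs; rewrite cabsM cabs_i mul1r; case: (hC _ (y - x) hs).
have DDP t : D (D (Phi t)) = fun x => fgauss2 eps (t - t0) (y - x).
  by rewrite (DD_reflect y (schwartz_fgauss eps0 (t - t0))) DD_fgauss.
pose m t := pr (g t) (Phi t).
pose m' t := (0 +i* 1)%C * (- pr (g t) (D (D (Phi t))) + c * pr (F t) (Phi t)) + pr (g t) (Phi' t).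
have dm t : a < t < t0 -> cder m t (m' t).
  move=> /andP[h1 h2]; rewrite /m /m'; apply: (cder_pair mg hG cg C0 dP hP' hP mP).
    by apply: tuv; rewrite !ltW.
  by apply: Hd => //; apply/andP; split; [exact: le_lt_trans h1|exact: lt_le_trans t0T].
have m'E t : u < t < v -> m' t = (0 +i* 1)%C * (c * pr (F t) (Phi t)).
  move=> ht; rewrite /m' DDP.
  have -> : pr (g t) (Phi' t) = (0 +i* 1)%C * pr (g t) (fun x => fgauss2 eps (t - t0) (y - x)).
    rewrite /pr -cintegralZ//.
      by apply: eq_cintegral => x _; rewrite /Phi'; ring.
    apply: (@pr_int _ _ C y _ _ C0 (schwartz_cmeas (sP2 t)) _ (mg t) (hG t)) => x.
    by case: (hC _ (y - x) (uv t ht)).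
  by rewrite mulrDr mulrN addrAC addNr add0r.
have hm' t : a < t < t0 -> cabs (m' t) <= A * (2 * Num.sqrt (t0 - t))^-1.
  move=> /andP[h1 h2]; have tin : a <= t <= t0 by rewrite !ltW.
  rewrite (m'E _ (tuv _ tin)) cabsM cabs_i mul1r cabsM c1 mul1r [leRHS]mulrC invfM.
  apply: (pr1_le (mP t) _ (mF t) (hA t tin)) => x.
  have st : t - t0 != 0 by rewrite subr_eq0 lt_eqF.
  have -> : t0 - t = `|t - t0| by rewrite ler0_norm ?opprB// subr_le0 ltW.
  exact: (fgauss_disp eps0 (y - x) st).
(* A primitive of the bound on m'. It need not be differentiable at t0, which is why [cder_mean]
   asks for derivatives only in the open interval. *)
pose be t := - (A * Num.sqrt (t0 - t)).
have dbe t : a < t < t0 -> is_derive t (1 : R) be (A * (2 * Num.sqrt (t0 - t))^-1).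
  move=> /andP[h1 h2]; have p : 0 < t0 - t by rewrite subr_gt0.
  have h := @is_derive1_comp R Num.sqrt (fun x => t0 - x) t _ _ (is_derive1_sqrt p) (is_derive_reflect t0 t).
  have := is_deriveN (is_deriveM (is_derive_cst (A : R) t (1 : R)) h).
  move=> k; apply: (is_derive_ext k) => //.
  by rewrite /GRing.scale/=; ring.
have cbe t : a <= t <= t0 -> {for t, continuous be}.
  move=> _; apply: cvgN; apply: cvgMr; apply: (@cvg_comp _ _ _ (fun t => t0 - t) Num.sqrt _ (nbhs (t0 - t))); last exact: sqrt_continuous.
  by apply: cvgB; [exact: cvg_cst|exact: cvg_id].
have cm t : a <= t <= t0 -> ccont m t.
  by move=> /tuv; apply: (pr_cont mg G0 hG cg C0 dP hP' hP mP).
have := cder_mean at0 cm cbe dm dbe hm'.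
rewrite /m (ha _ (sP a)) subr0 /be subrr sqrtr0 mulr0 oppr0 add0r opprK.
apply: le_trans; rewrite le_eqVlt; apply/orP; left; apply/eqP; congr cabs.
by apply: eq_cintegral => x _; rewrite /Phi subrr fgauss0.
Qed.

Definition cv (phi h : R -> R[i]) (y : R) : R[i] := pr h (fun x => phi (y - x)).

Lemma lcmeas_reflect (phi : R -> R[i]) (y : R) : lcmeas phi -> lcmeas (fun x => phi (y - x)).
Proof.
move=> mp; apply: (cmeas_comp _ mp).
by apply: (@measurable_funB _ (mR R)); [exact: measurable_cst|exact: measurable_id].
Qed.

Lemma lcmeas_cv (phi h : R -> R[i]) : lcmeas phi -> lcmeas h -> lcmeas (cv phi h).
Proof.
move=> mp mh; apply: (cmeas_param (f := fun z => h z.1 * phi (z.2 - z.1))).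
apply: cmeasM; first exact: (cmeas_comp measurable_fst mh).
have := cmeas_comp (@measurable_subr2 R) (mp : @cmeas _ (mR R) _ phi); exact.
Qed.

Lemma cv_cder phi h Y y : schwartz phi -> lcmeas h -> (int3 h <= (Y ^+ 3)%:E)%E ->
  cder (cv phi h) y (cv (D phi) h y).
Proof.
move=> sp mh hY; have [C C0 hC] := schwartz_kap sp; have [C' C'0 hC'] := schwartz_kap (schwartz_D sp).
(* Bounds Peetre's factor 2 / kap t for all t within distance 1 of y. *)
pose Q := 2 * (1 + (`|y| + 1) ^+ 2).
have Q0 : 0 <= Q by rewrite mulr_ge0// addr_ge0// sqr_ge0.
apply: (@cder_under R (fun y x => h x * phi (y - x)) (fun y x => h x * D phi (y - x))
    (fun x => (C' * Q) * (cabs (h x) * kap x)) (y - 1) (y + 1) y).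
- by apply/andP; split; lra.
- move=> t _; apply: (pr_int C0 (lcmeas_reflect t (schwartz_cmeas sp)) (fun x => hC (t - x)) mh hY).
- move=> t x _; apply: cderZ.
  have hd : is_derive t (1 : R) (fun t => t - x) 1.
    apply: (is_derive_ext (is_derive_aff 1 (- x) t)) => //.
    by apply/funext => z; rewrite mul1r.
  apply: (cder_ext (@cder_comp R phi (fun t => t - x) t _ _ (schwartz_cder (t - x) sp) hd)) => //.
  by rewrite mul1r.
- by apply: integrable_rZl => //; exact: (integrable_kap_int3 mh hY).
- move=> t x /andP[h1 h2]; rewrite cabsM [leRHS]mulrCA ler_wpM2l ?cabs_ge0//.
  rewrite (le_trans (hC' _))// -mulrA ler_wpM2l// (le_trans (kap_sub_kap t x))// ler_wpM2r ?kap_ge0//.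
  rewrite /Q /kap invrK ler_wpM2l// lerD2l -(real_normK (num_real t)) lerXn2r ?nnegrE ?addr_ge0//.
  have := ler_normD (t - y) y; rewrite subrK => k; rewrite (le_trans k)// addrC lerD2l ler_norml; apply/andP; split; lra.
Qed.

Lemma cv_hk eps h y : cv (fun x => ((hk eps x)%:C)%C) h y = mol (hk eps) h y.
Proof. by apply: eq_cintegral => x _; rewrite mulrC. Qed.

Lemma int1_cv eps h (Y : R) : 0 < eps -> lcmeas h -> (int1 h <= Y%:E)%E ->
  (int1 (cv (fun x => ((hk eps x)%:C)%C) h) <= Y%:E)%E.
Proof.
move=> e0 mh hY; have mk := lmeas_hk e0; have mc : lmeas (fun x => cabs (h x)) by exact: (measurable_cabs mh).
have i1 := int1_integrable mh hY.
have [C C0 hC] := schwartz_kap (schwartz_hk e0).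
have ik y : mu.-integrable setT (EFin \o (fun x => hk eps (y - x) * cabs (h x))).
  apply: (@integrable_dom R _ (mR R) mu setT _ (fun x => C * cabs (h x)) measurableT _ _ (integrable_rZl _ measurableT i1)).
  - by apply: (@measurable_funM _ (mR R)) => //; exact: lmeas_sub.
  - move=> x _; rewrite ger0_norm ?mulr_ge0 ?hk_ge0 ?cabs_ge0// ler_wpM2r ?cabs_ge0//.
    have := hC (y - x); rewrite cabs_real ger0_norm ?hk_ge0// => /le_trans; apply.
    by rewrite ler_piMr// kap_le1.
apply: (@le_trans _ _ (\int[mu]_y \int[mu]_x (hk eps (y - x) * cabs (h x))%:E)%E); last first.
  by rewrite tonelli_kernel// ?integral_hk ?mul1e// => x; [exact: hk_ge0|exact: cabs_ge0].
apply: ge0_le_integral => //.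
- by move=> y _; rewrite lee_fin cabs_ge0.
- apply/measurable_EFinP; apply: measurable_cabs; apply: lcmeas_cv => //; exact: cmeas_real.
- apply: (@measurable_fun_fubini_tonelli_G _ _ _ _ _ mu (fun z : mR R * mR R => (hk eps ((z.2 : R) - (z.1 : R)) * cabs (h z.1))%:E)).
    apply/measurable_EFinP; apply: measurable_funM.
      by apply: (measurableT_comp mk); exact: measurable_subr2.
    by apply: (measurableT_comp mc); exact: measurable_fst.
  by move=> z; rewrite lee_fin mulr_ge0 ?hk_ge0 ?cabs_ge0.
- move=> y _; rewrite -(fineK (integrable_fin_num measurableT (ik y))) lee_fin.
  apply: cabs_cintegral_le => // [|x _].
  - by apply: cmeasM => //; apply: cmeas_real; exact: lmeas_sub.
  - by rewrite cabsM cabs_real ger0_norm ?hk_ge0// mulrC.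
Qed.

Section Energy.
Variables (a t0 A S eps : R).
Hypothesis a0 : 0 <= a.
Hypothesis at0 : a <= t0.
Hypothesis t0T : t0 <= T.
Hypothesis eps0 : 0 < eps.
Hypothesis A0 : 0 <= A.
Hypothesis ha : forall phi, schwartz phi -> pr (g a) phi = 0.
Hypothesis hA : forall t, a <= t <= t0 -> (int1 (F t) <= A%:E)%E.

Let hkc : R -> R[i] := fun x => ((hk eps x)%:C)%C.
Let sk : schwartz hkc. Proof. exact: schwartz_hk. Qed.
Let w t y := cv hkc (g t) y.
Let wy t y := cv (D hkc) (g t) y.
Let wyy t y := cv (D (D hkc)) (g t) y.
Let f t y := cv hkc (F t) y.
(** The time derivative of w, obtained by testing the equation with the reflected heat kernel. *)
Let wt t y := (0 +i* 1)%C * (- wyy t y + c * f t y).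
Hypothesis hS : forall t y, a <= t <= t0 -> cabs (w t y) <= S.

Lemma cv_unif (phi : R -> R[i]) : schwartz phi -> exists2 W, 0 <= W & forall t y, cabs (cv phi (g t) y) <= W.
Proof.
move=> sp; have [C C0 hC] := schwartz_kap sp; exists (C * (pi + 1) * G).
  by rewrite mulr_ge0// mulr_ge0// addr_ge0// pi_ge0.
by move=> t y; apply: (pr_le C0 G0 (lcmeas_reflect y (schwartz_cmeas sp)) (fun x => hC (y - x)) (mg t) (hG t)).
Qed.

Lemma w_lip t : exists2 C, 0 <= C & forall e, 0 < e -> exists2 d, 0 < d & forall t' y, `|t' - t| < d ->
  cabs (w t' y - w t y) <= C * e.
Proof.
have [C C0 hC] := schwartz_kap sk; exists (C * (pi + 1)).
  by rewrite mulr_ge0// addr_ge0// pi_ge0.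
move=> e e0; have [d d0 hd] := cg t e0; exists d => // t' y /hd k.
have mk := lcmeas_reflect y (schwartz_cmeas sk).
have ik s := pr_int C0 mk (fun x => hC (y - x)) (mg s) (hG s).
rewrite /w /cv (prB (ik t') (ik t)).
exact: (pr_le C0 (ltW e0) mk (fun x => hC (y - x)) (cmeasB (mg t') (mg t)) k).
Qed.

Lemma f_unif : exists2 W, 0 <= W & forall t y, a <= t <= t0 -> cabs (f t y) <= W.
Proof.
have [C C0 hC] := schwartz_kap sk; exists (C * A); first exact: mulr_ge0.
move=> t y ht; apply: (pr1_le (lcmeas_reflect y (schwartz_cmeas sk)) _ (mF t) (hA ht)) => x.
by rewrite (le_trans (hC _))// ler_piMr// kap_le1.
Qed.

Lemma wt_cder t y : a < t < t0 -> cder (w ^~ y) t (wt t y).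
Proof.
move=> /andP[h1 h2]; have := Hd (schwartz_reflect y sk); rewrite (DD_reflect y sk); apply.
by apply/andP; split; [exact: le_lt_trans h1|exact: lt_le_trans t0T].
Qed.

(** The weight makes the energy finite for a function w that is only known to be bounded and in
    L^3. *)
Definition en (l t : R) := \int[mu]_y (kap (l * y) * cabs (w t y) ^+ 2).

Lemma lcmeas_w t : lcmeas (w t).
Proof. by apply: lcmeas_cv; [exact: schwartz_cmeas|exact: mg]. Qed.

Lemma en_int (l t : R) : 0 < l -> mu.-integrable setT (EFin \o (fun y => kap (l * y) * cabs (w t y) ^+ 2)).
Proof.
move=> l0; have [W W0 hW] := cv_unif sk.
apply: (@integrable_dom R _ (mR R) mu setT _ (fun y => W ^+ 2 * kap (l * y)) measurableT _ _ (integrable_rZl _ measurableT (integrable_kapl l0))).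
- apply: (@measurable_funM _ (mR R)); first exact: lmeas_kapl.
  by apply: (@measurable_funX _ (mR R)); apply: measurable_cabs; exact: lcmeas_w.
- move=> y _; rewrite (ger0_norm (mulr_ge0 (kap_ge0 _) (sqr_ge0 _))) [leLHS]mulrC ler_wpM2r ?kap_ge0//.
  by rewrite lerXn2r ?nnegrE ?cabs_ge0 ?hW.
Qed.

Let den l t y := kap (l * y) * (2 * CRe (cj (w t y) * wt t y)).

Lemma en_derive (l t : R) : 0 < l -> a < t < t0 -> is_derive t (1 : R) (en l) (\int[mu]_y den l t y).
Proof.
move=> l0 ht; have [W W0 hW] := cv_unif sk.
have [W2 W20 hW2] := cv_unif (schwartz_D (schwartz_D sk)); have [Wf Wf0 hWf] := f_unif.
apply: (@is_derive_under R (fun t y => kap (l * y) * cabs (w t y) ^+ 2) (den l)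
   (fun y => (2 * (W * (W2 + Wf))) * kap (l * y)) a t0 t ht).
- by move=> s _; exact: en_int.
- move=> s y hs; have [d1 d2] := wt_cder y hs.
  have k := is_deriveD (is_deriveX 2 d1) (is_deriveX 2 d2).
  have := is_deriveM (is_derive_cst (kap (l * y) : R) s (1 : R)) k.
  move=> h; apply: (is_derive_ext h).
    by apply/funext => x; rewrite sqr_cabs.
  by rewrite /den /GRing.scale/= !expr1 !CE/=; ring.
- by apply: integrable_rZl => //; exact: integrable_kapl.
- move=> s y hs; have hs' : a <= s <= t0 by move: hs => /andP[h1 h2]; rewrite !ltW.
  rewrite /den normrM (ger0_norm (kap_ge0 _)) mulrC ler_wpM2r ?kap_ge0// normrM ger0_norm// ler_wpM2l//.
  rewrite (le_trans (CRe_le_cabs _))// cabsM; apply: ler_pM; rewrite ?cabs_ge0//.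
    by rewrite (_ : cabs (cj _) = cabs (w s y)) ?hW// !cabsE/= sqrrN.
  rewrite /wt cabsM cabs_i mul1r (le_trans (cabsD _ _))// cabsN cabsM c1 mul1r.
  by apply: lerD; [exact: hW2|exact: hWf].
Qed.

Lemma en_bound (d t : R) W : 0 < d <= 1 -> a < t < t0 -> (forall t y, cabs (wy t y) <= W) ->
  \int[mu]_y den (d ^+ 3) t y <= 2 * W * d * (pi + 8 * G ^+ 3) + 2 * S * A.
Proof.
move=> hd ht hW1.
have ht' : a <= t <= t0 by move: ht => /andP[h1 h2]; rewrite !ltW.
have [W' W'0 hW] := cv_unif sk.
have [W2 W20 hW2] := cv_unif (schwartz_D (schwartz_D sk)); have [Wf Wf0 hWf] := f_unif.
have sk2 := schwartz_D sk; have sk3 := schwartz_D sk2.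
have mF' : lcmeas (f t) by apply: lcmeas_cv; [exact: schwartz_cmeas|exact: mF].
have mwyy : lcmeas (wyy t) by apply: lcmeas_cv; [exact: (schwartz_cmeas sk3)|exact: mg].
have i3 : (int3 (w t) <= (8 * G ^+ 3)%:E)%E.
  have [C C0 hC] := schwartz_kap sk.
  have -> : w t = mol (hk eps) (g t) by apply/funext => y; rewrite /w cv_hk.
  apply: (int3_mol C0 (lmeas_hk eps0)) => //.
  - by move=> z; exact: hk_ge0.
  - by move=> z; have := hC z; rewrite cabs_real ger0_norm ?hk_ge0.
  - exact: integral_hk.
have if1 := int1_cv eps0 (mF t) (hA ht').
exact: (dissipation (fun y => cv_cder y sk (mg t) (hG t)) (fun y => cv_cder y sk2 (mg t) (hG t))
  (fun y => cv_cder y sk3 (mg t) (hG t)) (hW t) (hW1 t) (hW2 t) (fun y => hWf t y ht') (fun y => hS y ht')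
  (lcmeas_w t) mwyy mF' i3 if1 c1 hd).
Qed.
Lemma en_cont (l t : R) : 0 < l -> {for t, continuous (en l)}.
Proof.
move=> l0; have [W W0 hW] := cv_unif sk; have [C C0 hC] := w_lip t.
pose K := (2 * W + 1) * (C + 1) * (pi / l).
have pl : 0 < pi / l by rewrite divr_gt0// pi_gt0.
have K0 : 0 < K by rewrite mulr_gt0// mulr_gt0// ltr_wpDl// mulr_ge0.
apply: cont_ed => e e0; have [d d0 hd] := hC _ (divr_gt0 e0 K0); exists d => // t' ht'.
rewrite /en -(RintegralB measurableT (en_int t' l0) (en_int t l0)).
have iD := integrableB measurableT (en_int t' l0) (en_int t l0).
have q : (2 * W + 1) * (C + 1) * (e / K) * (pi / l) = e.
  by rewrite /K; move: (pi / l) pl => x px; field; rewrite !gt_eqF// ltr_wpDl// mulr_ge0.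
rewrite (le_trans (le_normr_Rintegral measurableT iD))//.
have ikl := integrable_kapl l0.
have b y : `|kap (l * y) * cabs (w t' y) ^+ 2 - kap (l * y) * cabs (w t y) ^+ 2| <= (2 * W + 1) * (C + 1) * (e / K) * kap (l * y).
  rewrite -mulrBr normrM (ger0_norm (kap_ge0 _)) [leLHS]mulrC ler_wpM2r ?kap_ge0// subr_sqr normrM mulrC.
  have h1 : `|cabs (w t' y) + cabs (w t y)| <= 2 * W + 1.
    by rewrite ger0_norm ?addr_ge0 ?cabs_ge0// (le_trans (lerD (hW t' y) (hW t y)))//; lra.
  have h2 : `|cabs (w t' y) - cabs (w t y)| <= (C + 1) * (e / K).
    rewrite (le_trans (le_trans (cabs_dist _ _) (hd t' y ht')))// ler_wpM2r ?lerDl//.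
    by rewrite ltW// divr_gt0.
  by rewrite -mulrA; apply: ler_pM.
have iU := integrable_rZl ((2 * W + 1) * (C + 1) * (e / K)) measurableT ikl.
rewrite (le_trans (le_Rintegral measurableT (integrable_norm iD) iU (fun y _ => b y)))//.
rewrite (RintegralZl _ measurableT ikl) (_ : \int[mu]_x kap (l * x) = pi / l) ?q//.
by rewrite /Rintegral integral_kapl.
Qed.

(** The energy starts from 0 at time a because every pairing with [g a] does; the mean value theorem
    then integrates [en_bound]. *)
Lemma en_le (d : R) W : 0 < d <= 1 -> (forall t y, cabs (wy t y) <= W) ->
  en (d ^+ 3) t0 <= (2 * W * d * (pi + 8 * G ^+ 3) + 2 * S * A) * (t0 - a).
Proof.
move=> hd hW1; have l0 : 0 < d ^+ 3 by case/andP: hd => d0 _; rewrite exprn_gt0.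
have wa y : w a y = 0 by apply: ha; exact: schwartz_reflect.
have ea : en (d ^+ 3) a = 0.
  rewrite /en /Rintegral (eq_integral (cst 0%E)) ?integral0// => y _.
  by rewrite wa cabs0 expr0n mulr0.
move: at0; rewrite le_eqVlt => /predU1P[<-|ab]; first by rewrite ea subrr mulr0.
have dE s : s \in `]a, t0[ -> is_derive s (1 : R) (en (d ^+ 3)) (\int[mu]_y den (d ^+ 3) s y).
  by rewrite in_itv/= => hs; exact: en_derive.
have cE : {within `[a, t0], continuous (en (d ^+ 3))}.
  by apply: continuous_subspaceT => s; exact: en_cont.
have [s hs] := MVT ab dE cE.
rewrite ea subr0 => ->; rewrite ler_wpM2r ?subr_ge0//.
by apply: en_bound => //; move: hs; rewrite in_itv.
Qed.

(** The localisation is removed along d_n tending to 0: the weight tends to 1 pointwise, Fatou's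
    lemma applies, and the commutator error Q d_n stays below the given e. The constant Q depends on
    the mollification and disappears in this limit. *)
Lemma energy : (\int[mu]_y (cabs (w t0 y) ^+ 2)%:E <= (2 * S * A * (t0 - a))%:E)%E.
Proof.
have [W W0 hW] := cv_unif (schwartz_D sk).
apply/lee_addgt0Pr => e e0.
have p8 : 0 < pi + 8 * G ^+ 3 by rewrite ltr_wpDr ?pi_gt0// mulr_ge0// exprn_ge0.
have h0 : 0 <= t0 - a by rewrite subr_ge0.
pose Q := 2 * W * (pi + 8 * G ^+ 3) * (t0 - a).
have Q0 : 0 <= Q by rewrite /Q mulr_ge0// mulr_ge0 ?(ltW p8)// mulr_ge0.
pose d0 := Num.min 1 (e / (Q + 1)).
have Q1 : 0 < Q + 1 by rewrite ltr_wpDl.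
have d00 : 0 < d0 by rewrite /d0 lt_min ltr01 divr_gt0.
have d01 : d0 <= 1 by rewrite /d0 ge_min lexx.
have d0e : Q * d0 <= e.
  apply: (@le_trans _ _ ((Q + 1) * (e / (Q + 1)))); last by rewrite mulrCA mulfV ?mulr1// gt_eqF.
  by apply: ler_pM; rewrite ?(ltW d00)// ?lerDl// /d0 ge_min lexx orbT.
pose d_ n := d0 / n.+1%:R.
have dn0 n : 0 < d_ n by rewrite divr_gt0.
have dn1 n : d_ n <= d0 by rewrite /d_ ler_pdivrMr// ler_peMr ?(ltW d00)// ler1n.
apply: (@fatou_le R (fun n y => kap (d_ n ^+ 3 * y) * cabs (w t0 y) ^+ 2) (fun y => cabs (w t0 y) ^+ 2)).
- move=> n; apply: (@measurable_funM _ (mR R)); first exact: lmeas_kapl.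
  by apply: (@measurable_funX _ (mR R)); apply: measurable_cabs; exact: lcmeas_w.
- by apply: (@measurable_funX _ (mR R)); apply: measurable_cabs; exact: lcmeas_w.
- by move=> n y; rewrite mulr_ge0 ?kap_ge0// sqr_ge0.
- by move=> y; rewrite sqr_ge0.
- apply: aeW => y /=; rewrite -[X in _ --> X]mul1r; apply: cvgMl.
  have cd : d_ n @[n --> \oo] --> (0 : R).
    have k : (fun n => d0 * @harmonic R n) @ \oo --> d0 * 0 by apply: cvgM; [exact: cvg_cst|exact: cvg_harmonic].
    by rewrite mulr0 in k; exact: k.
  have -> : 1 = kap ((0 : R) ^+ 3 * y) by rewrite expr0n mul0r /kap expr0n addr0 invr1.
  apply: (@cvg_comp _ _ _ (fun n => d_ n ^+ 3 * y) (@kap R) _ (nbhs (0 ^+ 3 * y))); last exact: continuous_kap.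
  apply: cvgMl; apply: (@cvg_comp _ _ _ d_ (fun x => x ^+ 3) _ (nbhs (0 : R))); [exact: cd|exact: exprn_continuous].
- move=> n; have l0 : 0 < d_ n ^+ 3 by rewrite exprn_gt0.
  rewrite -(fineK (integrable_fin_num measurableT (en_int t0 l0))) -EFinD lee_fin.
  have hd : 0 < d_ n <= 1 by rewrite dn0 (le_trans (dn1 n)).
  apply: (le_trans (en_le hd hW)).
  have -> : (2 * W * d_ n * (pi + 8 * G ^+ 3) + 2 * S * A) * (t0 - a) = 2 * S * A * (t0 - a) + Q * d_ n.
    by rewrite /Q; ring.
  rewrite lerD2l; apply: le_trans d0e; exact: (ler_wpM2l Q0).
Qed.

Lemma int3_w : (int3 (w t0) <= (S * (2 * S * A * (t0 - a)))%:E)%E.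
Proof.
have tt : a <= t0 <= t0 by rewrite lexx at0.
have S0 : 0 <= S by exact: le_trans (cabs_ge0 _) (hS 0 tt).
have mw : lmeas (fun y => cabs (w t0 y)) by apply: measurable_cabs; exact: lcmeas_w.
apply: (@le_trans _ _ (S%:E * \int[mu]_y (cabs (w t0 y) ^+ 2)%:E)%E); last first.
  by rewrite EFinM; apply: lee_wpmul2l; [rewrite lee_fin|exact: energy].
rewrite -ge0_integralZl_EFin//; last 2 first.
- by move=> y _; rewrite lee_fin sqr_ge0.
- by apply/measurable_EFinP; exact: (@measurable_funX _ (mR R)).
apply: ge0_le_integral => //.
- by move=> y _; rewrite lee_fin exprn_ge0 ?cabs_ge0.
- by apply/measurable_EFinP; exact: (@measurable_funX _ (mR R)).
- by apply/measurable_EFinP; apply: (@measurable_funM _ (mR R)); [exact: measurable_cst|exact: (@measurable_funX _ (mR R))].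
- by move=> y _; rewrite -EFinM lee_fin exprS ler_wpM2r ?sqr_ge0// hS.
Qed.
End Energy.

Lemma short_int3 (a t0 A : R) : 0 <= a -> a <= t0 -> t0 <= T -> 0 <= A ->
  (forall phi, schwartz phi -> pr (g a) phi = 0) ->
  (forall t, a <= t <= t0 -> (int1 (F t) <= A%:E)%E) ->
  (int3 (g t0) <= (16 * A ^+ 3 * (t0 - a) ^+ 2)%:E)%E.
Proof.
move=> a0 at0 t0T A0 ha hA; have h0 : 0 <= t0 - a by rewrite subr_ge0.
pose Y := A * Num.sqrt (t0 - a) * (2 * (A * Num.sqrt (t0 - a)) * A * (t0 - a)).
have -> : 16 * A ^+ 3 * (t0 - a) ^+ 2 = 8 * Y.
  have -> : 8 * Y = 16 * A ^+ 3 * (t0 - a) * Num.sqrt (t0 - a) ^+ 2 by rewrite /Y; ring.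
  by rewrite sqr_sqrtr//; ring.
apply: (mollify_int3 adm (mg t0) (hG t0)) => e /andP[e0 e1].
have -> : mol (hk e) (g t0) = cv (fun x => ((hk e x)%:C)%C) (g t0) by apply/funext => y; rewrite cv_hk.
apply: (int3_w a0 at0 t0T e0 A0 ha hA) => t y /andP[h1 h2].
have h3 s : a <= s <= t -> (int1 (F s) <= A%:E)%E.
  by move=> /andP[h3 h4]; apply: hA; rewrite h3 (le_trans h4).
apply: (le_trans (dispersive y a0 h1 (le_trans h2 t0T) e0 A0 ha h3)).
by rewrite ler_wpM2l// ler_sqrt ?lerB// subr_ge0 (le_trans h1).
Qed.

Variable A0 : R.
Hypothesis A00 : 0 <= A0.
Hypothesis hF : forall t (y : R), 0 <= y -> (int3 (g t) <= (y ^+ 3)%:E)%E -> (int1 (F t) <= (A0 * y)%:E)%E.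

(** As [int3] is a cube, halving the norm requires the factor 1/8 in the smallness condition on h.
    The bounds G / 2^n then hold for every n. *)
Lemma short_zero (a h : R) : 0 <= a -> a + h <= T -> 0 <= h -> 16 * A0 ^+ 3 * h ^+ 2 <= 8^-1 ->
  (forall phi, schwartz phi -> pr (g a) phi = 0) ->
  forall t, a <= t <= a + h -> (int3 (g t) <= 0)%E.
Proof.
move=> a0 ahT h0 hh ha.
have st n : forall t, a <= t <= a + h -> (int3 (g t) <= ((G / 2 ^+ n) ^+ 3)%:E)%E.
  elim: n => [t _|n IH t /andP[h1 h2]]; first by rewrite expr0 divr1.
  have q0 : 0 <= G / 2 ^+ n by rewrite divr_ge0.
  have := @short_int3 a t (A0 * (G / 2 ^+ n)) a0 h1 (le_trans h2 ahT) (mulr_ge0 A00 q0) ha.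
  have hA s : a <= s <= t -> (int1 (F s) <= (A0 * (G / 2 ^+ n))%:E)%E.
    by move=> /andP[h3 h4]; apply: hF => //; apply: IH; rewrite h3 (le_trans h4).
  move=> /(_ hA) /le_trans; apply; rewrite lee_fin.
  have -> : (G / 2 ^+ n.+1) ^+ 3 = 8^-1 * (G / 2 ^+ n) ^+ 3.
    have z0 : (2 : R) ^+ n != 0 by rewrite expf_neq0.
    by rewrite [2 ^+ n.+1]exprS; move: (2 ^+ n) z0 => z z0; field.
  rewrite exprMn; have -> : 16 * (A0 ^+ 3 * (G / 2 ^+ n) ^+ 3) * (t - a) ^+ 2 = 16 * A0 ^+ 3 * (t - a) ^+ 2 * (G / 2 ^+ n) ^+ 3 by ring.
  rewrite ler_wpM2r ?exprn_ge0//; apply: le_trans hh.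
  rewrite ler_wpM2l ?mulr_ge0 ?exprn_ge0// lerXn2r ?nnegrE ?subr_ge0//.
  by rewrite lerBlDl.
move=> t ht; have := st 0%N t ht; case E : (int3 (g t)) (int3_ge0 (g t)) => [r||]//; rewrite !lee_fin => r0 _.
rewrite leNgt; apply/negP => rp.
(* Since n <= 8^n, such an n contradicts r <= G^3 / 8^n. *)
have [n hn] : exists n : nat, G ^+ 3 / r < n%:R.
  by exists (Num.truncn (G ^+ 3 / r)).+1; exact: truncnS_gt.
have := st n t ht; rewrite E lee_fin => k.
have n8 : (n%:R : R) <= 8 ^+ n by rewrite -natrX ler_nat; exact: ltnW (ltn_expl n _).
have p8 : 0 < (8 : R) ^+ n by rewrite exprn_gt0.
have {}k : r <= G ^+ 3 / 8 ^+ n.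
  by apply: (le_trans k); rewrite expr_div_n -exprM mulnC exprM (_ : (2 : R) ^+ 3 = 8)//; ring.
move: k; rewrite ler_pdivlMr// leNgt => /negP; apply; rewrite mulrC -ltr_pdivrMr//.
exact: lt_le_trans hn n8.
Qed.

(** With X <= N and h = T / N one has 16 A0^3 h^2 = X / (8 N^2) <= 1/8. Each step hands on to the
    next, as initial condition, the vanishing of all pairings, which [pr_null] derives from the
    vanishing of [int3]. *)
Lemma evolution_zero : 0 <= T -> (forall phi, schwartz phi -> pr (g 0) phi = 0) ->
  forall t, 0 <= t <= T -> (int3 (g t) <= 0)%E.
Proof.
move=> T0 h0.
pose X := 128 * A0 ^+ 3 * T ^+ 2.
have X0 : 0 <= X by rewrite /X !mulr_ge0 ?exprn_ge0 ?sqr_ge0.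
pose N := (Num.truncn X).+1.
have hN : X <= N%:R by rewrite ltW// /N truncnS_gt.
have Np : 0 < N%:R :> R by rewrite ltr0n.
pose h := T / N%:R; have hp : 0 <= h by rewrite divr_ge0.
have hh : 16 * A0 ^+ 3 * h ^+ 2 <= 8^-1.
  have -> : 16 * A0 ^+ 3 * h ^+ 2 = 8^-1 * (X / N%:R ^+ 2).
    by rewrite /h /X; field; rewrite gt_eqF.
  rewrite ler_piMr// ler_pdivrMr ?exprn_gt0// mul1r (le_trans hN)// expr2 ler_peMr ?(ltW Np)// ler1n.
  by [].
have st k : (k <= N)%N -> forall t, 0 <= t <= k%:R * h -> (int3 (g t) <= 0)%E.
  elim: k => [_ t|k IH kN t /andP[t0 tk]].
    rewrite mul0r => ht; apply: (@short_zero 0 0 _ _ _ _ h0 t); rewrite ?addr0//.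
    by rewrite expr0n mulr0.
  case: (leP t (k%:R * h)) => ht; first by apply: IH; [exact: ltnW|rewrite t0].
  have kh : 0 <= k%:R * h by rewrite mulr_ge0.
  apply: (@short_zero (k%:R * h) h kh _ hp hh _ t).
  - have NT : N%:R * h = T by rewrite /h mulrC divfK// gt_eqF.
    by rewrite -NT -[X in _ + X <= _]mul1r -mulrDl ler_wpM2r// natr1 ler_nat.
  - by move=> phi; apply: pr_null (mg _) _; apply: IH; [exact: ltnW|rewrite kh/=].
  - by rewrite (ltW ht) (le_trans tk)// -natr1 mulrDl mul1r.
move=> t /andP[t0 tT]; apply: (st N (leqnn N)); rewrite t0/= (le_trans tT)//.
by rewrite /h mulrC divfK// gt_eqF.
Qed.
End Evolution.

(** * Weak solutions as paths in L^3 *)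

Section Cubic.
Variable R : realType.
Notation mu := (@lebesgue_measure R).
Implicit Types a b : R -> R[i].

Definition cube (z : R[i]) : R[i] := ((cabs z ^+ 2)%:C)%C * z.

Lemma lcmeas_cube a : lcmeas a -> lcmeas (fun x => cube (a x)).
Proof.
move=> ma; apply: cmeasM => //; apply: cmeas_real.
by apply: (@measurable_funX _ (mR R)); exact: measurable_cabs.
Qed.

Lemma cabs_cube z : cabs (cube z) = cabs z ^+ 3.
Proof. by rewrite cabsM cabs_real ger0_norm ?sqr_ge0// -exprSr. Qed.

Lemma cube_diff (z w : R[i]) : cabs (cube z - cube w) <= 2 * (cabs z ^+ 2 + cabs w ^+ 2) * cabs (z - w).
Proof.
have -> : cube z - cube w = ((cabs z ^+ 2)%:C)%C * (z - w) + ((cabs z ^+ 2 - cabs w ^+ 2)%:C)%C * w.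
  by rewrite /cube; move: (cabs z ^+ 2) (cabs w ^+ 2) => x y; apply: cplxP; rewrite !CE/=; ring.
rewrite (le_trans (cabsD _ _))// !cabsM !cabs_real (ger0_norm (sqr_ge0 _)) subr_sqr normrM.
have h := cabs_dist z w.
have z0 := cabs_ge0 z; have w0 := cabs_ge0 w; have d0 := cabs_ge0 (z - w).
rewrite (ger0_norm (addr_ge0 z0 w0)).
apply: (@le_trans _ _ (cabs z ^+ 2 * cabs (z - w) + cabs (z - w) * (cabs z + cabs w) * cabs w)).
  by rewrite lerD2l ler_wpM2r// ler_wpM2r// addr_ge0.
have k : 0 <= cabs (z - w) * (cabs z - cabs w) ^+ 2 by rewrite mulr_ge0// sqr_ge0.
have k2 : 0 <= cabs (z - w) * cabs z ^+ 2 by rewrite mulr_ge0// sqr_ge0.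
have k3 : 0 <= cabs (z - w) * cabs w ^+ 2 by rewrite mulr_ge0// sqr_ge0.
rewrite -subr_ge0; move: k k2 k3; nra.
Qed.

(* Unlike Young's inequality this weights the two cubes so that integrating it with y = |g|_3 gives
   a bound linear in y. *)
Lemma mixed_young (x d y : R) : 0 <= x -> 0 <= d -> 0 < y -> x ^+ 2 * d <= x ^+ 3 * y + d ^+ 3 / y ^+ 2.
Proof.
move=> x0 d0 y0; have p : 0 <= x ^+ 3 * y by rewrite mulr_ge0 ?exprn_ge0// ltW.
have p2 : 0 <= d ^+ 3 / y ^+ 2 by rewrite divr_ge0 ?exprn_ge0// ltW.
case: (leP d (x * y)) => h.
  apply: (@le_trans _ _ (x ^+ 3 * y)); last by rewrite lerDl.
  by rewrite [x ^+ 3]exprSr -mulrA ler_wpM2l// sqr_ge0.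
apply: (@le_trans _ _ (d ^+ 3 / y ^+ 2)); last by rewrite lerDr.
rewrite ler_pdivlMr ?exprn_gt0// mulrAC -exprMn [d ^+ 3]exprSr ler_wpM2r//.
by rewrite lerXn2r ?nnegrE// ?(ltW h)// mulr_ge0// ltW.
Qed.

Lemma int1_cube a b (Y y : R) : lcmeas a -> lcmeas b -> (int3 a <= Y%:E)%E -> (int3 b <= Y%:E)%E ->
  0 <= y -> (int3 (fun x => (a x - b x)%R) <= (y ^+ 3)%:E)%E ->
  (int1 (fun x => (cube (a x) - cube (b x))%R) <= (4 * (Y + 1) * y)%:E)%E.
Proof.
move=> ma mb hA hB y0 hD; have mD := cmeasB ma mb.
have Y0 : 0 <= Y by rewrite -lee_fin; apply: le_trans hA; exact: int3_ge0.
have p4 : 0 < 4 * (Y + 1) by rewrite mulr_gt0// ltr_wpDl.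
(* [mixed_young] needs a positive parameter while y may be 0. The excess of z over y is chosen so
   that 4 (Y + 1) z is the target plus exactly e. *)
apply/lee_addgt0Pr => e e0; set z := y + e / (4 * (Y + 1)).
have e' : 0 < e / (4 * (Y + 1)) by rewrite divr_gt0.
have z0 : 0 < z by rewrite ltr_wpDl.
have ia := integrable_le_fin (lmeas_cabs3 ma) (fun x => exprn_ge0 3 (cabs_ge0 (a x))) hA.
have ib := integrable_le_fin (lmeas_cabs3 mb) (fun x => exprn_ge0 3 (cabs_ge0 (b x))) hB.
have id := integrable_le_fin (lmeas_cabs3 mD) (fun x => exprn_ge0 3 (cabs_ge0 (a x - b x))) hD.
have i1 := integrable_addR measurableT ia ib.
have i2 := integrable_rZl (2 * z) measurableT i1.
have i3 := integrable_rZl (4 / z ^+ 2) measurableT id.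
have i4 := integrable_addR measurableT i2 i3.
have mC : lmeas (fun x => cabs (cube (a x) - cube (b x))).
  by apply: measurable_cabs; apply: cmeasB; exact: lcmeas_cube.
have dom x : cabs (cube (a x) - cube (b x)) <= 2 * z * (cabs (a x) ^+ 3 + cabs (b x) ^+ 3) + 4 / z ^+ 2 * cabs (a x - b x) ^+ 3.
  rewrite (le_trans (cube_diff _ _))//.
  have k1 := mixed_young (cabs_ge0 (a x)) (cabs_ge0 (a x - b x)) z0.
  have k2 := mixed_young (cabs_ge0 (b x)) (cabs_ge0 (a x - b x)) z0.
  have -> : 2 * z * (cabs (a x) ^+ 3 + cabs (b x) ^+ 3) + 4 / z ^+ 2 * cabs (a x - b x) ^+ 3 =
    2 * ((cabs (a x) ^+ 3 * z + cabs (a x - b x) ^+ 3 / z ^+ 2) + (cabs (b x) ^+ 3 * z + cabs (a x - b x) ^+ 3 / z ^+ 2)).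
    by field; rewrite gt_eqF.
  by rewrite -mulrA ler_wpM2l// mulrDl; apply: lerD.
have ic : mu.-integrable setT (EFin \o (fun x => cabs (cube (a x) - cube (b x)))).
  apply: (@integrable_dom R _ (mR R) mu setT _ _ measurableT mC _ i4) => x _.
  by rewrite ger0_norm ?cabs_ge0 ?dom.
have -> : int1 (fun x => cube (a x) - cube (b x)) = (\int[mu]_x cabs (cube (a x) - cube (b x)))%:E.
  by rewrite /Rintegral fineK//; exact: (integrable_fin_num measurableT ic).
rewrite -EFinD lee_fin (le_trans (le_Rintegral measurableT ic i4 (fun x _ => dom x)))//.
rewrite (RintegralD measurableT i2 i3) (RintegralZl _ measurableT i1) (RintegralD measurableT ia ib) (RintegralZl _ measurableT id).
have ea : \int[mu]_x cabs (a x) ^+ 3 <= Y.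
  by rewrite -lee_fin /Rintegral fineK//; exact: (integrable_fin_num measurableT ia).
have eb : \int[mu]_x cabs (b x) ^+ 3 <= Y.
  by rewrite -lee_fin /Rintegral fineK//; exact: (integrable_fin_num measurableT ib).
have ed : \int[mu]_x cabs (a x - b x) ^+ 3 <= y ^+ 3.
  by rewrite -lee_fin /Rintegral fineK//; exact: (integrable_fin_num measurableT id).
apply: (@le_trans _ _ (2 * z * (Y + Y) + 4 / z ^+ 2 * y ^+ 3)).
  by apply: lerD; [rewrite ler_wpM2l ?lerD// mulr_ge0// ltW|rewrite ler_wpM2l// divr_ge0// ltW// exprn_gt0].
have k : 4 / z ^+ 2 * y ^+ 3 <= 4 * z.
  rewrite -mulrA ler_wpM2l// mulrC ler_pdivrMr ?exprn_gt0// -exprS.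
  by apply: ler_cube => //; rewrite lerDl ltW.
have -> : 4 * (Y + 1) * y + e = 4 * (Y + 1) * z by rewrite /z; field; rewrite !gt_eqF// ltr_wpDl.
have -> : 4 * (Y + 1) * z = 2 * z * (Y + Y) + 4 * z by ring.
by rewrite lerD2l.
Qed.

Lemma cLnorm3E (g : R -> R[i]) : (int3 g = cLnorm 3 g `^ 3)%E.
Proof.
rewrite /cLnorm poweR_Lnorm//; apply: eq_integral => x _.
by rewrite /= ger0_norm ?cabs_ge0// powR_mulrn ?cabs_ge0.
Qed.

Lemma cLnorm3P (g : R -> R[i]) : (cLnorm 3 g < +oo)%E <-> (int3 g < +oo)%E.
Proof.
rewrite cLnorm3E; split; first exact: poweR_lty.
exact: lty_poweRy.
Qed.

Lemma int3_fin (g : R -> R[i]) : (int3 g < +oo)%E -> exists2 Y, 0 <= Y & (int3 g <= Y%:E)%E.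
Proof.
move=> h; exists (fine (int3 g)); first by rewrite fine_ge0// int3_ge0.
by rewrite fineK// ge0_fin_numE// int3_ge0.
Qed.

Lemma tempered_sub (f g : dist R) : tempered f -> tempered g -> tempered (f \- g).
Proof.
move=> [f1 f2] [g1 g2]; split=> [a phi psi sp sq|phi_ sp cv] /=.
  by rewrite f1// g1//; ring.
have h : (fun j => cabs (f (phi_ j)) + cabs (g (phi_ j))) @ \oo --> (0 : R) + 0.
  by apply: cvgD; [exact: f2|exact: g2].
rewrite addr0 in h.
apply: (@squeeze_cvgr _ _ _ _ (fun=> 0) (fun j => cabs (f (phi_ j)) + cabs (g (phi_ j)))) => //; last exact: cvg_cst.
by apply: nearW => j; rewrite cabs_ge0/= cabsB.
Qed.
End Cubic.

(** * L^3 densities of a path in the modulation space *)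

Section Densities.
Variables (R : realType) (sigma0 : R -> R[i]).
Hypothesis adm : admissible_partition sigma0.
Variables s p q : R.
Hypothesis p13 : 1 <= p <= 3.
Hypothesis q1 : 1 <= q.
Hypothesis sm : summing s q.

(** Two L^3 representatives differ by a function of zero norm, and h = g - (g - h); the factor 4 is
    that of [int3B]. *)
Lemma represents_le (f : dist R) g h (Y Z : R) : represents f g -> represents f h ->
  (int3 g <= Y%:E)%E -> (int3 h <= Z%:E)%E -> (int3 h <= (4 * Y)%:E)%E.
Proof.
move=> rg rh hg hh; pose W := Num.max Y Z.
have hg' : (int3 g <= W%:E)%E by apply: (le_trans hg); rewrite lee_fin /W le_max lexx.
have hh' : (int3 h <= W%:E)%E by apply: (le_trans hh); rewrite lee_fin /W le_max lexx orbT.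
have h0 := represents_uniq adm rg rh hg' hh'; case: (rg) (rh) => mg _ [mh _].
have := int3B mg (cmeasB mg mh) hg h0; rewrite addr0.
by congr (_ <= _)%E; congr int3; apply/funext => x; rewrite opprB addrC subrK.
Qed.

Lemma density_spec (f : dist R) g (Y : R) : represents f g -> (int3 g <= Y%:E)%E ->
  represents f (L3_density f) /\ (int3 (L3_density f) <= (4 * Y)%:E)%E.
Proof.
move=> rg hg.
have [rf /cLnorm3P hf] : represents f (L3_density f) /\ (cLnorm 3 (L3_density f) < +oo)%E.
  have := @xgetPex _ (fun=> 0) [set g | represents f g /\ (cLnorm 3 g < +oo)%E]; apply.
  by exists g; split => //; apply/cLnorm3P; exact: le_lt_trans hg (ltey _).
have [Z _ hZ] := int3_fin hf.
by split => //; exact: represents_le rg rf hg hZ.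
Qed.

(** The second clause serves differences: the difference of the densities at two times need not be
    the chosen density of the difference, but it is another representative and obeys the same
    bound. *)
Lemma density_bound : exists2 C : R, 0 < C & forall (f : dist R) (lam : R), tempered f -> 0 < lam ->
  (modnorm sigma0 s p q f <= lam%:E)%E ->
  (represents f (L3_density f) /\ (int3 (L3_density f) <= (C * lam ^+ 3)%:E)%E) /\
  forall h Z, represents f h -> (int3 h <= Z%:E)%E -> (int3 h <= (C * lam ^+ 3)%:E)%E.
Proof.
have [C C0 hC] := embedding adm p13 q1 sm; exists (4 * C); first by rewrite mulr_gt0.
move=> f lam tf l0 hf; have [g rg hg] := hC f lam tf l0 hf; rewrite -mulrA.
split; first exact: density_spec rg hg.
by move=> h Z rh hh; exact: represents_le rg rh hg hh.
Qed.

Section Path.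
Variables (T : R) (u : R -> dist R).
Hypothesis T0 : 0 < T.
Hypothesis hu : Cmod sigma0 s p q T u.

(* Clamping the time extends the path continuously to the whole line. *)
Definition clamp (t : R) := Num.max 0 (Num.min t T).
Lemma clamp_in t : 0 <= clamp t <= T.
Proof. by rewrite /clamp le_max lexx/= ge_max (ltW T0)/= ge_min lexx orbT. Qed.
Lemma clamp_id t : 0 <= t <= T -> clamp t = t.
Proof. by move=> /andP[t0 tT]; rewrite /clamp (min_idPl tT) (max_idPr t0). Qed.
Lemma clamp_lip t t' : `|clamp t' - clamp t| <= `|t' - t|.
Proof.
have k1 := ler_norm (t' - t); have := ler_norm (- (t' - t)); rewrite normrN => k2.
rewrite /clamp ler_norml; have TT := ltW T0.
have [h1|h1] := leP t' T; have [h2|h2] := leP t T.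
- by have [h3|h3] := leP 0 t'; have [h4|h4] := leP 0 t; apply/andP; split; lra.
- by rewrite (max_idPr TT); have [h3|h3] := leP 0 t'; apply/andP; split; lra.
- by rewrite (max_idPr TT); have [h3|h3] := leP 0 t; apply/andP; split; lra.
- by apply/andP; split; lra.
Qed.

Lemma modulation_fin t : exists2 lam : R, 0 < lam & (modnorm sigma0 s p q (u (clamp t)) <= lam%:E)%E.
Proof.
have [|[_ h] _] := hu (t := clamp t); first by rewrite in_itv/= clamp_in.
case E : (modnorm _ _ _ _ _) h => [r||]// _; last by exists 1; rewrite ?leNye.
by exists (Num.max r 1); rewrite ?lt_max ?ltr01 ?orbT// lee_fin le_max lexx.
Qed.

Lemma path_tempered t : tempered (u (clamp t)).
Proof. by have [|[h _] _] := hu (t := clamp t); first by rewrite in_itv/= clamp_in. Qed.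

Definition density t : R -> R[i] := L3_density (u (clamp t)).

Lemma path_rep t : represents (u (clamp t)) (density t) /\ exists2 Y : R, 0 <= Y & (int3 (density t) <= Y%:E)%E.
Proof.
have [C C0 hC] := density_bound; have [lam l0 hl] := modulation_fin t.
have [[rp h] _] := hC _ _ (path_tempered t) l0 hl; split => //.
by exists (C * lam ^+ 3); rewrite // mulr_ge0// ?exprn_ge0// ltW.
Qed.

Lemma path_meas t : lcmeas (density t).
Proof. by have [[]] := path_rep t. Qed.

Lemma path_cont t e : 0 < e -> exists2 d, 0 < d & forall t', `|t' - t| < d ->
  (int3 (fun x => (density t' x - density t x)%R) <= (e ^+ 3)%:E)%E.
Proof.
move=> e0; have [C C0 hC] := density_bound.
have C1 : 0 < C + 1 by rewrite ltr_wpDl// ltW.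
(* Then C lam^3 <= e^3, because C <= (C + 1)^3. *)
pose lam := e / (C + 1); have l0 : 0 < lam by rewrite divr_gt0.
have [|_ cv] := hu (t := clamp t); first by rewrite in_itv/= clamp_in.
have nl : nbhs 0%E [set x : \bar R | (x < lam%:E)%E].
  by apply: open_nbhs_nbhs; split; [exact: open_ereal_lt_ereal|rewrite /= lte_fin].
have /nbhs_ballP[d /= d0 hd] := cv _ nl.
exists d => // t' ht'.
have ct : ball (clamp t) d (clamp t').
  by rewrite -ball_normE/= distrC; apply: le_lt_trans ht'; exact: clamp_lip.
have hm : (modnorm sigma0 s p q (u (clamp t') \- u (clamp t))%R <= lam%:E)%E.
  by apply/ltW/(hd _ ct); rewrite /= in_itv/= clamp_in.
have [[mg rg] [Y Y0 hY]] := path_rep t; have [[mg' rg'] [Y' Y'0 hY']] := path_rep t'.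
have rd : represents (u (clamp t') \- u (clamp t)) (fun x => density t' x - density t x).
  split; first exact: cmeasB.
  move=> phi sp /=; rewrite (rg _ sp) (rg' _ sp); have [B B0 hB] := schwartz_kap sp.
  apply: prB; first exact: (cintegrable_pair (schwartz_cmeas sp) hB mg' hY').
  exact: (cintegrable_pair (schwartz_cmeas sp) hB mg hY).
have [_ h] := hC _ _ (tempered_sub (path_tempered t') (path_tempered t)) l0 hm.
apply: (le_trans (h _ _ rd (int3B mg' mg hY' hY))); rewrite lee_fin /lam exprMn mulrCA ler_piMr ?exprn_ge0 ?(ltW e0)//.
rewrite exprVn ler_pdivrMr ?exprn_gt0// mul1r (@le_trans _ _ (C + 1)) ?lerDl//.
by rewrite exprS ler_peMr ?(ltW C1)// exprn_ege1// lerDr ltW.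
Qed.

(** Continuity in L^3 gives local boundedness, and compactness of [0, T] a common bound; clamping
    extends it to all times. *)
Lemma path_bound : exists2 Y : R, 0 <= Y & forall t, (int3 (density t) <= Y%:E)%E.
Proof.
have K : compact `[0, T] by exact: segment_compact.
have nc := (compact_near_coveringP _).1 K.
(* The bound M plays the part of the parameter tending to +oo: near-covering compactness exchanges
   its quantifier with that over t. *)
have [|M [Mr hM]] := nc R (pinfty_nbhs R) (fun M t => (int3 (density t) <= M%:E)%E) _ _.
  move=> t _; have [_ [Y Y0 hY]] := path_rep t; have [d d0 hd] := path_cont t ltr01.
  exists (ball t d, [set M : R | 4 * (Y + 1) <= M]) => /=.
    split; first exact: nbhsx_ballx.
    by exists (4 * (Y + 1)); split; [exact: num_real|move=> x; exact: ltW].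
  move=> [t' M] [/= ht' hM]; have ht : `|t' - t| < d by move: ht'; rewrite -ball_normE/= distrC.
  have mg := path_meas t; have mg' := path_meas t'.
  have h1 : (int3 (fun x => (density t x - density t' x)%R) <= 1%:E)%E.
    have := hd _ ht; rewrite expr1n; congr (_ <= _)%E; apply: eq_integral => x _.
    by rewrite cabsBC.
  have := int3B mg (cmeasB mg mg') hY h1.
  rewrite (_ : (fun x => density t x - (density t x - density t' x)) = density t'); last first.
    by apply/funext => x; rewrite opprB addrC subrK.
  by move=> /le_trans; apply; rewrite lee_fin.
exists (Num.max 0 (M + 1)); first by rewrite le_max lexx.
move=> t; have -> : density t = density (clamp t) by rewrite /density (clamp_id (clamp_in t)).
have := hM (M + 1); rewrite ltrDl ltr01 => /(_ isT (clamp t)).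
rewrite /= in_itv/= clamp_in => /(_ isT) /le_trans; apply.
by rewrite lee_fin le_max lexx orbT.
Qed.
End Path.
End Densities.

(** * Tensor products as test functions *)

Section Tensor.
Variable R : realType.
Notation D := (cderive (1 : R)).
Implicit Types (f : R * R -> R[i]) (th phi : R -> R[i]).

(** Reduces directional derivatives on the plane to one-variable calculus along a line. *)
Lemma is_derive_line (V : normedModType R) (f : V -> R) (z v : V) (d : R) :
  is_derive (0 : R) (1 : R) (fun s => f (s *: v + z)) d -> is_derive z v f d.
Proof.
move=> [h1 h2].
have e : (fun h : R => h^-1 *: ((f \o pseudometric_normed_Zmodule.shift z) (h *: v) - f z)) =
    (fun h : R => h^-1 *: (((fun s : R => f (s *: v + z)) \o pseudometric_normed_Zmodule.shift 0) (h *: (1 : R)) - f (0 *: v + z))).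
  by apply/funext => h /=; rewrite scale0r add0r /GRing.scale/= mulr1 addr0.
split; first by move: h1; rewrite /derivable e.
by move: h2; rewrite /derive e.
Qed.

Definition cdir f (z v : R * R) (l : R[i]) := is_derive z v (fun y => CRe (f y)) (CRe l) /\
  is_derive z v (fun y => CIm (f y)) (CIm l).

Lemma cdirE f z v l : cdir f z v l -> cderive v f z = l.
Proof. by move=> [[_ e1] [_ e2]]; rewrite /cderive e1 e2; case: l {e1 e2}. Qed.

Definition tens th phi (z : R * R) : R[i] := th z.1 * phi z.2.

Lemma cdir_tens th phi (z v : R * R) a b : cder th z.1 a -> cder phi z.2 b ->
  cdir (tens th phi) z v ((v.1%:C)%C * a * phi z.2 + th z.1 * ((v.2%:C)%C * b)).
Proof.
move=> ha hb.
have d1 : is_derive (0 : R) (1 : R) (fun s : R => s * v.1 + z.1) v.1.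
  by apply: (is_derive_ext (is_derive_aff v.1 z.1 0)) => //; apply/funext => s; rewrite mulrC.
have d2 : is_derive (0 : R) (1 : R) (fun s : R => s * v.2 + z.2) v.2.
  by apply: (is_derive_ext (is_derive_aff v.2 z.2 0)) => //; apply/funext => s; rewrite mulrC.
have h1 : cder th (0 * v.1 + z.1) a by rewrite mul0r add0r.
have h2 : cder phi (0 * v.2 + z.2) b by rewrite mul0r add0r.
have := cderM (@cder_comp R th (fun s => s * v.1 + z.1) 0 _ _ h1 d1) (@cder_comp R phi (fun s => s * v.2 + z.2) 0 _ _ h2 d2).
rewrite !mul0r !add0r => -[k1 k2].
by split; apply: is_derive_line.
Qed.

Lemma cdirD f g z v a b : cdir f z v a -> cdir g z v b -> cdir (fun y => f y + g y) z v (a + b).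
Proof.
move=> [f1 f2] [g1 g2]; split; rewrite ?CReD ?CImD.
  have := is_deriveD f1 g1; congr (is_derive _ _ _ _).
  by apply/funext => y; rewrite CReD.
have := is_deriveD f2 g2; congr (is_derive _ _ _ _).
by apply/funext => y; rewrite CImD.
Qed.

(** Finite sums of tensor products of Schwartz functions are closed under every directional
    derivative, so continuity of the members already gives smoothness on the plane. *)
Inductive tspan : (R * R -> R[i]) -> Prop :=
| tspan1 th phi : schwartz th -> schwartz phi -> tspan (tens th phi)
| tspan2 f g : tspan f -> tspan g -> tspan (fun z => f z + g z).

Lemma tspan_dir f v : tspan f -> exists2 f', tspan f' & forall z, cdir f z v (f' z).
Proof.
elim=> [th phi st sp|g h _ [g' sg hg] _ [h' sh hh]].
  exists (fun z => tens (fun t => (v.1%:C)%C * D th t) phi z + tens th (fun x => (v.2%:C)%C * D phi x) z).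
    by apply: tspan2; apply: tspan1 => //; apply: schwartzZ; exact: schwartz_D.
  by move=> z; apply: cdir_tens; exact: schwartz_cder.
exists (fun z => g' z + h' z); first exact: tspan2.
by move=> z; exact: cdirD.
Qed.

Lemma tspan_cont f z : tspan f -> {for z, continuous (fun y => CRe (f y))} /\ {for z, continuous (fun y => CIm (f y))}.
Proof.
have part (h : R -> R) (pj : R * R -> R) (x : R) : {for x, continuous h} -> pj z = x -> {for z, continuous pj} ->
    {for z, continuous (fun y => h (pj y))}.
  by move=> ch e cp; apply: (@continuous_comp _ _ _ pj h z cp); rewrite e.
have c1 : {for z, continuous (fun y : R * R => y.1)} by exact: cvg_fst.
have c2 : {for z, continuous (fun y : R * R => y.2)} by exact: cvg_snd.
elim=> [th phi st sp|g h _ [g1 g2] _ [h1 h2]].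
  have [t1 t2] := schwartz_cder z.1 st; have [p1 p2] := schwartz_cder z.2 sp.
  have a1 := part _ _ _ (is_derive_cont t1) erefl c1; have a2 := part _ _ _ (is_derive_cont t2) erefl c1.
  have b1 := part _ _ _ (is_derive_cont p1) erefl c2; have b2 := part _ _ _ (is_derive_cont p2) erefl c2.
  rewrite /tens; split.
    have -> : (fun y : R * R => CRe (th y.1 * phi y.2)) = (fun y => CRe (th y.1) * CRe (phi y.2) - CIm (th y.1) * CIm (phi y.2)).
      by apply/funext => y; rewrite CReM.
    by apply: cvgB; apply: cvgM.
  have -> : (fun y : R * R => CIm (th y.1 * phi y.2)) = (fun y => CRe (th y.1) * CIm (phi y.2) + CIm (th y.1) * CRe (phi y.2)).
    by apply/funext => y; rewrite CImM.
  by apply: cvgD; apply: cvgM.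
split.
  have -> : (fun y => CRe (g y + h y)) = (fun y => CRe (g y) + CRe (h y)) by apply/funext => y; rewrite CReD.
  exact: cvgD.
have -> : (fun y => CIm (g y + h y)) = (fun y => CIm (g y) + CIm (h y)) by apply/funext => y; rewrite CImD.
exact: cvgD.
Qed.

Lemma tspan_smooth f : tspan f -> smooth_on setT f.
Proof.
move=> sf vs z _ /=.
have sh : tspan (foldr (@cderive R (R * R)%type) f vs).
  elim: vs => //= v vs /(tspan_dir v)[f' sf' h'].
  by have -> : cderive v (foldr (@cderive R (R * R)%type) f vs) = f' by apply/funext => y; exact: cdirE.
have [c1 c2] := tspan_cont z sh.
by split => // v; have [f' _ h'] := tspan_dir v sh; have [[d1 _] [d2 _]] := h' z.
Qed.

Lemma dt_tens th phi (z : R * R) : schwartz th -> schwartz phi -> dt (tens th phi) z = D th z.1 * phi z.2.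
Proof.
move=> st sp; have := cdirE (cdir_tens (1, 0) (schwartz_cder z.1 st) (schwartz_cder z.2 sp)).
by rewrite /dt => -> /=; rewrite mul1r mul0r mulr0 addr0.
Qed.

Lemma dx_tens th phi : schwartz th -> schwartz phi -> dx (tens th phi) = tens th (D phi).
Proof.
move=> st sp; apply/funext => z; have := cdirE (cdir_tens (0, 1) (schwartz_cder z.1 st) (schwartz_cder z.2 sp)).
by rewrite /dx => -> /=; rewrite !mul0r add0r mul1r.
Qed.

Lemma test_tens (T a b N : R) th phi : schwartz th -> schwartz phi -> 0 < a -> b < T ->
  (forall t, ~~ (a <= t <= b) -> th t = 0) -> (forall x, ~~ (- N <= x <= N) -> phi x = 0) ->
  test_function T (tens th phi).
Proof.
move=> st sp a0 bT ht hx.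
have K : compact (`[a, b] `*` `[- N, N] : set (R * R)) by apply: compact_setX; exact: segment_compact.
have cK : closed (`[a, b] `*` `[- N, N] : set (R * R)) by apply: compact_closed K; exact: norm_hausdorff.
have sub : csupp (tens th phi) `<=` `[a, b] `*` `[- N, N].
  rewrite [X in _ `<=` X](proj1 (closure_id _) cK); apply: closure_subset => z /=.
  rewrite /tens !in_itv/= => /eqP h; split; apply/negP => /negP k; apply: h.
    by rewrite ht// mul0r.
  by rewrite hx// mulr0.
split.
- by apply: tspan_smooth; exact: tspan1.
- by apply: (subclosed_compact _ K sub); exact: closed_closure.
- move=> z /sub[/=]; rewrite !in_itv/= => /andP[h1 h2] _.
  by rewrite (lt_le_trans a0 h1) (le_lt_trans h2 bT).
Qed.
End Tensor.

(** * Scaling and primitives of Schwartz functions *)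

Section SchwartzMore.
Variable R : realType.
Notation D := (cderive (1 : R)).

Lemma schwartz_scale (l : R) (f : R -> R[i]) : 0 < l -> schwartz f -> schwartz (fun x => f (l * x)).
Proof.
move=> l0 sf; pose P (h : R -> R[i]) := exists c f, schwartz f /\ h = fun x => c * f (l * x).
apply: (@schwartz_coind R P); last by exists 1, f; split => //; apply/funext => x; rewrite mul1r.
- move=> h [c [k [sk ->]]]; exists (fun x => (c * (l%:C)%C) * D k (l * x)).
    by exists (c * (l%:C)%C), (D k); split => //; exact: schwartz_D.
  move=> x; have hl : is_derive x (1 : R) (fun x => l * x) l.
    by apply: (is_derive_ext (is_derive_aff l 0 x)) => //; apply/funext => z; rewrite addr0.
  apply: (cder_ext (cderZ c (@cder_comp R k (fun x => l * x) x _ _ (schwartz_cder (l * x) sk) hl))) => //.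
  by rewrite mulrA.
- move=> h [c [k [sk ->]]] m; have [C hC] := schwartz_bound sk m.
  exists (cabs c * (l^-1 ^+ m * C)) => x; rewrite cabsM mulrCA ler_wpM2l ?cabs_ge0//.
  have -> : `|x| ^+ m * cabs (k (l * x)) = l^-1 ^+ m * (`|l * x| ^+ m * cabs (k (l * x))).
    by rewrite mulrA -exprMn normrM (gtr0_norm l0) mulKf// gt_eqF.
  by rewrite ler_wpM2l ?hC// exprn_ge0// invr_ge0 ltW.
Qed.

(** The derivatives of positive order are those of psi, so only the decay of th itself has to be
    supplied. *)
Lemma schwartz_prim (th psi : R -> R[i]) : schwartz psi -> (forall x, cder th x (psi x)) ->
  (forall m, exists C, forall x, `|x| ^+ m * cabs (th x) <= C) -> schwartz th.
Proof.
move=> sp h b; have e : D th = psi by apply/funext => x; exact: cderE.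
have [sm hb] := (schwartzP _).1 sp.
apply/schwartzP; split.
  by case=> [|n] x; [exists (psi x); exact: h|rewrite iterSr e; exact: sm].
by move=> m [|n]; [exact: b|rewrite iterSr e; exact: hb].
Qed.

Lemma cintegral_vanish (A : set R) (f : R -> R[i]) : (forall x, ~ A x -> f x = 0) ->
  cintegral A f = cintegral setT f.
Proof.
move=> h; rewrite /cintegral; congr (_ +i* _)%C.
  rewrite Rintegral_mkcond; apply: eq_Rintegral => x _; rewrite patchE.
  by case: ifPn => //; rewrite notin_setE => /h ->.
rewrite Rintegral_mkcond; apply: eq_Rintegral => x _; rewrite patchE.
by case: ifPn => //; rewrite notin_setE => /h ->.
Qed.

Lemma ccont_cmeas (m : R -> R[i]) : (forall t, ccont m t) -> lcmeas m.
Proof.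
move=> cm; split.
  by apply: continuous_measurable_fun => t; exact: ccont_Re.
by apply: continuous_measurable_fun => t; exact: ccont_Im.
Qed.
End SchwartzMore.

(** * From the weak equation to increments in time *)

Section Step.
Variables (R : realType) (sigma0 : R -> R[i]).
Hypothesis adm : admissible_partition sigma0.
Notation mu := (@lebesgue_measure R).
Notation D := (cderive (1 : R)).
Notation bump := (bump sigma0).
Notation bumpr := (bumpr sigma0).

(** A smooth step, equal to 0 to the left of -1 and to 1 to the right of 1. *)
Definition ramp (y : R) : R := \int[mu]_(x in `]-oo, y]) bump x.

Lemma is_derive_ramp y : is_derive y (1 : R) ramp (bump y).
Proof.
have ib : mu.-integrable `]-oo, (y + 1)] (EFin \o bump).
  by apply: integrableS (bump_integrable adm).
have [d e] := @continuous_FTC1 R bump -oo%O y (y + 1) (ltr_pwDr ltr01 (lexx y)) ib (ltNyr y) (@bump_cont _ _ adm y).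
by rewrite derive1E in e; exact: (DeriveDef d e).
Qed.

Lemma ramp_le y : y <= -1 -> ramp y = 0.
Proof.
move=> h; rewrite /ramp /Rintegral (eq_integral (cst 0%E)) ?integral0// => x.
rewrite inE/= in_itv/= => hx; rewrite (bump_vanish adm)//.
by rewrite lerNr in h; rewrite (le_trans h)// -normrN (le_trans _ (ler_norm _))// lerN2.
Qed.

Lemma ramp_ge y : 1 <= y -> ramp y = 1.
Proof.
move=> h; rewrite -(Rintegral_bump adm) /ramp Rintegral_mkcond; apply: eq_Rintegral => x _.
rewrite patchE; case: ifPn => //; rewrite notin_setE/= in_itv/= => /negP; rewrite -ltNge => hx.
by rewrite (bump_vanish adm)// (le_trans _ (ler_norm _))// (le_trans h)// ltW.
Qed.

Lemma ramp_ge0 y : 0 <= ramp y.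
Proof. by apply: Rintegral_ge0 => x _; exact: bump_ge0. Qed.

Lemma ramp_le1 y : ramp y <= 1.
Proof.
rewrite -(Rintegral_bump adm) /ramp Rintegral_mkcond.
have mb : lmeas (bump \_ `]-oo, y]).
  by apply/(measurable_restrictT _ _).1 => //; apply: measurable_funTS; exact: (lmeas_bump adm).
have le x : (bump \_ `]-oo, y]) x <= bump x.
  by rewrite patchE; case: ifP => // _; exact: bump_ge0.
apply: le_Rintegral => //; last exact: bump_integrable.
apply: (@integrable_dom R _ (mR R) mu setT _ _ measurableT mb _ (bump_integrable adm)) => x _.
rewrite ger0_norm ?le// patchE; case: ifP => // _; exact: bump_ge0.
Qed.

(* Centring the ramps at t + de rather than t makes hat t1 t2 de converge to the indicator of
   ]t1, t2] at every point as de tends to 0+. *)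
Definition hat (t1 t2 de s : R) : R := ramp ((s - (t1 + de)) / de) - ramp ((s - (t2 + de)) / de).

Lemma is_derive_hat t1 t2 de s :
  is_derive s (1 : R) (hat t1 t2 de) (bumpr de (s - (t1 + de)) - bumpr de (s - (t2 + de))).
Proof.
have k c : is_derive s (1 : R) (fun s => ramp ((s - c) / de)) (bumpr de (s - c)).
  have hl : is_derive s (1 : R) (fun s => (s - c) / de) de^-1.
    apply: (is_derive_ext (is_derive_aff de^-1 (- c / de) s)) => //.
    by apply/funext => z; rewrite mulrBl mulNr mulrC.
  apply: (is_derive_ext (@is_derive1_comp R ramp (fun s => (s - c) / de) s _ _ (is_derive_ramp _) hl)) => //.
exact: is_deriveB (k _) (k _).
Qed.

Lemma hat_vanish t1 t2 de s : 0 < de -> t1 <= t2 -> ~~ (t1 <= s <= t2 + 2 * de) -> hat t1 t2 de s = 0.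
Proof.
move=> d0 t12; rewrite negb_and -!ltNge => /orP[h|h]; rewrite /hat.
  by rewrite !ramp_le ?subrr// ler_pdivrMr//; lra.
by rewrite !ramp_ge ?subrr// ler_pdivlMr//; lra.
Qed.

Lemma hat_le1 t1 t2 de s : `|hat t1 t2 de s| <= 1.
Proof.
rewrite /hat ler_norml; have := ramp_ge0 ((s - (t1 + de)) / de); have := ramp_le1 ((s - (t1 + de)) / de).
have := ramp_ge0 ((s - (t2 + de)) / de); have := ramp_le1 ((s - (t2 + de)) / de) => *; apply/andP; split; lra.
Qed.

Lemma schwartz_bumpr c de : 0 < de -> schwartz (fun s => ((bumpr de (s - c))%:C)%C).
Proof.
move=> d0; have d1 : 0 < de^-1 by rewrite invr_gt0.
have := schwartzZ ((de^-1)%:C)%C (schwartz_translate c (schwartz_scale d1 (schwartz_bump adm))).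
congr schwartz; apply/funext => s; rewrite -realCM /bumpr; congr ((_%:C)%C).
by rewrite mulrC [de^-1 * (s - c)]mulrC.
Qed.

Lemma cder_hat t1 t2 de s : cder (fun s => ((hat t1 t2 de s)%:C)%C) s
  (((bumpr de (s - (t1 + de)))%:C)%C - ((bumpr de (s - (t2 + de)))%:C)%C).
Proof.
apply: (cder_ext (cder_real (is_derive_hat t1 t2 de s))) => //.
by apply: cplxP; rewrite !CE/= ?subr0.
Qed.

Lemma schwartz_hat t1 t2 de : 0 < de -> t1 <= t2 -> schwartz (fun s => ((hat t1 t2 de s)%:C)%C).
Proof.
move=> d0 t12.
apply: (schwartz_prim (schwartzB (schwartz_bumpr (t1 + de) d0) (schwartz_bumpr (t2 + de) d0)) (cder_hat t1 t2 de)).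
move=> m; pose N := `|t1| + `|t2| + 2 * de.
have N0 : 0 <= N by rewrite /N !addr_ge0// mulr_ge0// ltW.
exists (N ^+ m) => s; rewrite cabs_real.
case: (boolP (t1 <= s <= t2 + 2 * de)) => [|h]; last by rewrite (hat_vanish d0 t12 h) normr0 mulr0 exprn_ge0.
move=> /andP[h1 h2]; rewrite -[leRHS]mulr1; apply: ler_pM; rewrite ?exprn_ge0 ?hat_le1//.
apply: lerXn2r; rewrite ?nnegrE//.
have a1 := ler_norm (- t1); have a2 := ler_norm t2; have a3 := normr_ge0 t1; have a4 := normr_ge0 t2.
by move: a1; rewrite normrN => a1; rewrite ler_norml /N; apply/andP; split; lra.
Qed.

Lemma bumpr_avg (m : R -> R[i]) t de w : 0 < de -> (forall t, ccont m t) ->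
  (forall s, `|s - t| <= 2 * de -> cabs (m s - m t) <= w) ->
  cintegrable setT (fun s => ((bumpr de (s - (t + de)))%:C)%C * m s) /\
  cabs (cintegral setT (fun s => ((bumpr de (s - (t + de)))%:C)%C * m s) - m t) <= w.
Proof.
move=> d0 cm hw; have mm := ccont_cmeas cm.
have w0 : 0 <= w by apply: le_trans (cabs_ge0 _) (hw t _); rewrite subrr normr0 mulr_ge0// ltW.
pose b s := bumpr de (s - (t + de)).
have b0 s : 0 <= b s by exact: bumpr_ge0.
have mb : lmeas b.
  apply: (measurableT_comp (lmeas_bumpr adm de)).
  by apply: (@measurable_funB _ (mR R)); [exact: measurable_id|exact: measurable_cst].
have I1 : (\int[mu]_s (b s)%:E = 1)%E.
  have := ge0_integral_aff (f := fun z => (bumpr de z)%:E) (- (t + de)) ltr01.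
  rewrite (integral_bumpr adm d0) mul1e => ->.
  - by apply: eq_integral => s _; rewrite mul1r.
  - by apply/measurable_EFinP; exact: lmeas_bumpr.
  - by move=> z; rewrite lee_fin bumpr_ge0.
have ib : mu.-integrable setT (EFin \o b).
  by apply: (integrable_le_fin mb b0 (Y := 1)); rewrite I1.
have Ib : \int[mu]_s b s = 1 by rewrite /Rintegral I1.
have bv s : 2 * de < `|s - t| -> b s = 0.
  move=> h; rewrite /b bumpr_vanish//; have := ler_normD (s - (t + de)) de.
  by rewrite (gtr0_norm d0) (_ : s - (t + de) + de = s - t); [move: h; lra|ring].
have cmr : lcmeas (fun s => ((b s)%:C)%C) by exact: cmeas_real.
have i1 : cintegrable setT (fun s => ((b s)%:C)%C * m s).
  apply: (@cintegrable_dom R setT _ (fun s => (w + cabs (m t)) * b s) measurableT (cmeasM cmr mm)); last exact: integrable_rZl.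
  move=> s _; rewrite cabsM cabs_real ger0_norm// mulrC.
  have [h|h] := leP `|s - t| (2 * de); last by rewrite bv// !mulr0.
  rewrite ler_wpM2r// -[m s](subrK (m t)) (le_trans (cabsD _ _))// lerD2r; exact: hw.
have i2 : cintegrable setT (fun s => ((b s)%:C)%C * m t).
  apply: (@cintegrable_dom R setT _ (fun s => cabs (m t) * b s) measurableT); last exact: integrable_rZl.
    by apply: cmeasM => //; exact: cmeas_cst.
  by move=> s _; rewrite cabsM cabs_real ger0_norm// mulrC.
split=> //.
have -> : m t = cintegral setT (fun s => ((b s)%:C)%C * m t).
  rewrite (@cintegral_mulr R (m t) (fun s => ((b s)%:C)%C)) ?cintegral_real ?Ib ?mul1r//.
  split; first exact: ib.
  by apply: (integrable_le_fin (f := fun=> 0) (Y := 0)) => //; rewrite integral0.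
rewrite -(cintegralB measurableT i1 i2).
apply: (@le_trans _ _ (\int[mu]_s (w * b s))); last by rewrite (RintegralZl _ measurableT ib) Ib mulr1.
apply: cabs_cintegral_le => //; last exact: integrable_rZl.
  by apply: cmeasB; apply: cmeasM => //; exact: cmeas_cst.
move=> s _; rewrite -mulrBr cabsM cabs_real ger0_norm// mulrC.
have [h|h] := leP `|s - t| (2 * de); last by rewrite bv// !mulr0.
by rewrite ler_wpM2r// hw.
Qed.

Section DuBoisReymond.
Variables (T M : R) (m k : R -> R[i]).
Hypothesis cm : forall t, ccont m t.
Hypothesis ck : forall t, ccont k t.
Hypothesis mM : forall t, cabs (m t) <= M.
Hypothesis kM : forall t, cabs (k t) <= M.
Hypothesis weak : forall (th : R -> R[i]) a b, schwartz th -> 0 < a -> b < T ->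
  (forall t, ~~ (a <= t <= b) -> th t = 0) ->
  cintegral `]0, T[ (fun t => D th t * m t) + cintegral `]0, T[ (fun t => th t * k t) = 0.

Lemma hat_cvg t1 t2 (de : nat -> R) s : (forall n, 0 < de n) -> t1 <= t2 -> de n @[n --> \oo] --> (0 : R) ->
  cabs (((hat t1 t2 (de n) s)%:C)%C * k s - (fun s => if (t1 < s <= t2) then k s else 0) s) @[n --> \oo] --> (0 : R).
Proof.
move=> d0 t12 dc.
have ev (x : R) : 0 < x -> \forall n \near \oo, de n < x.
  move=> x0; move/cvgrPdist_lt : (dc) => /(_ _ x0); apply: filterS => n.
  by rewrite sub0r normrN (gtr0_norm (d0 n)).
suff H : \forall n \near \oo, cabs (((hat t1 t2 (de n) s)%:C)%C * k s - (if (t1 < s <= t2) then k s else 0)) = 0.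
  exact: cvg_near_cst H.
have [h1|h1] := leP s t1.
  apply: nearW => n; rewrite /hat !ramp_le ?subrr ?mul0r ?subrr ?cabs0//.
    by rewrite ler_pdivrMr//; have := d0 n; lra.
  by rewrite ler_pdivrMr//; have := d0 n; lra.
have [h2|h2] := leP s t2.
  have p : 0 < (s - t1) / 2 by rewrite divr_gt0// subr_gt0.
  near=> n.
  have h : de n < (s - t1) / 2 by near: n; exact: ev.
  rewrite /hat ramp_ge ?ramp_le ?subr0 ?mul1r ?subrr ?cabs0//.
    by rewrite ler_pdivrMr//; have := d0 n; lra.
  by rewrite ler_pdivlMr//; have := d0 n; lra.
have p : 0 < (s - t2) / 2 by rewrite divr_gt0// subr_gt0.
near=> n.
have h : de n < (s - t2) / 2 by near: n; exact: ev.
rewrite /hat !ramp_ge ?subrr ?mul0r ?subrr ?cabs0//.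
  by rewrite ler_pdivlMr//; have := d0 n; lra.
by rewrite ler_pdivlMr//; have := d0 n; lra.
Unshelve. all: by end_near. Qed.

(* Testing with hat t1 t2 de: its derivative is an approximate Dirac mass at t1 minus one at t2. *)
Lemma weak_ftc t1 t2 : 0 < t1 -> t1 <= t2 -> t2 < T -> m t2 - m t1 = cintegral `]t1, t2] k.
Proof.
move=> t10 t12 t2T; have mk := ccont_cmeas ck.
(* Keeps the supports of the test functions and of their derivatives inside ]0, T[. *)
pose d0 := Num.min ((T - t2) / 4) (t1 / 2).
have d00 : 0 < d0 by rewrite /d0 lt_min !divr_gt0// subr_gt0.
have d0T : 2 * d0 < T - t2.
  have : d0 <= (T - t2) / 4 by rewrite /d0 ge_min lexx.
  by have : 0 < T - t2 by [rewrite subr_gt0]; lra.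
pose de n : R := d0 * n.+1%:R^-1.
have de0 n : 0 < de n by rewrite mulr_gt0.
have ded n : de n <= d0 by rewrite /de ler_piMr ?(ltW d00)// invf_le1// ler1n.
have dec : de n @[n --> \oo] --> (0 : R).
  have c : (fun n => d0 * @harmonic R n) @ \oo --> d0 * 0 by apply: cvgM; [exact: cvg_cst|exact: cvg_harmonic].
  by rewrite mulr0 in c; exact: c.
pose K : R -> R[i] := fun s => if t1 < s <= t2 then k s else 0.
have mD : measurable (`]0, T[ : set R) by exact: measurable_itv.
have M0 : 0 <= M by exact: le_trans (cabs_ge0 _) (kM 0).
have mK : lcmeas K.
  have -> : K = fun s => ((@indic (mR R) R `]t1, t2] s)%:C)%C * k s.
    apply/funext => s; rewrite /K indicE; have [h|h] := boolP (t1 < s <= t2).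
      by rewrite (mem_set (_ : `]t1, t2]%classic s)) ?mul1r//= in_itv.
    by rewrite memNset ?mul0r//= in_itv/=; exact/negP.
  by apply: cmeasM => //; apply: cmeas_real; exact: measurable_indic.
have KE : cintegral `]0, T[ K = cintegral `]t1, t2] k.
  rewrite cintegral_vanish; last first.
    move=> s; rewrite /= in_itv/= /K => /negP; case: ifP => // /andP[h1 h2].
    by rewrite (lt_trans t10 h1)/= (le_lt_trans h2 t2T).
  rewrite -(@cintegral_vanish R `]t1, t2]); last first.
    by move=> s; rewrite /= in_itv/= /K => /negP/negbTE ->.
  by apply: eq_cintegral => s; rewrite inE/= in_itv/= /K => ->.
have ih : mu.-integrable `]0, T[ (EFin \o (fun _ : R => M)).
  apply: (@measurable_bounded_integrable _ _ _ mu) => //.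
  - have : (lebesgue_measure (`]0%R, T[ : set R) < +oo)%E by rewrite lebesgue_measure_itv/=; case: ifP => // _; exact: ltry.
    by [].
  - by exists `|M|; split; [exact: num_real|move=> x hx y _; exact: ltW].
have dct := @cintegral_dct R `]0, T[ (fun n s => ((hat t1 t2 (de n) s)%:C)%C * k s) K (fun=> M) mD.
have mf n : lcmeas (fun s => ((hat t1 t2 (de n) s)%:C)%C * k s).
  by apply: cmeasM => //; exact: (schwartz_cmeas (schwartz_hat (de0 n) t12)).
have {}dct := dct mf mK (fun s _ => hat_cvg s de0 t12 dec) ih _.
have hb n (x : R) : `]0, T[%classic x -> cabs (((hat t1 t2 (de n) x)%:C)%C * k x) <= M.
  move=> _; rewrite cabsM cabs_real -[leRHS]mul1r; apply: ler_pM; rewrite ?cabs_ge0 ?hat_le1//.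
have {}dct := dct hb; rewrite KE in dct.
have W n : cintegral setT (fun s => ((bumpr (de n) (s - (t1 + de n)))%:C)%C * m s)
   - cintegral setT (fun s => ((bumpr (de n) (s - (t2 + de n)))%:C)%C * m s)
   + cintegral `]0, T[ (fun s => ((hat t1 t2 (de n) s)%:C)%C * k s) = 0.
  have s1 := schwartz_hat (de0 n) t12.
  have h := @weak _ t1 (t2 + 2 * de n) s1 t10.
  rewrite -{}h; last 2 first.
  - by have := ded n; lra.
  - by move=> t ht; rewrite hat_vanish.
  congr (_ + _).
  have hw t t' : `|t' - t| <= 2 * de n -> cabs (m t' - m t) <= M + M.
    by move=> _; rewrite (le_trans (cabsB _ _))// lerD.
  have [i1 _] := bumpr_avg (de0 n) cm (hw t1); have [i2 _] := bumpr_avg (de0 n) cm (hw t2).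
  rewrite -(cintegralB measurableT i1 i2) -(@cintegral_vanish R `]0, T[).
    by apply: eq_cintegral => x _; rewrite (cderE (cder_hat t1 t2 (de n) x)) mulrBl.
  move=> x; rewrite /= in_itv/= => hx; rewrite -mulrBl.
  have d1 := de0 n; have d2 := ded n.
  have [h|h] := leP x 0.
    rewrite !bumpr_vanish ?subrr ?mul0r//; rewrite ler0_norm; lra.
  have [h'|h'] := leP T x; last by case: hx; rewrite h h'.
  by rewrite !bumpr_vanish ?subrr ?mul0r//; rewrite ger0_norm; lra.
apply/eqP; rewrite -subr_eq0; apply/eqP/cabs_eq0/eqP; rewrite eq_le cabs_ge0 andbT.
apply/ler_addgt0Pr => e e0; rewrite add0r.
have e3 : 0 < e / 3 by rewrite divr_gt0.
have [r1 r10 h1] := cm t1 e3; have [r2 r20 h2] := cm t2 e3.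
have ev (x : R) : 0 < x -> \forall n \near \oo, de n < x.
  move=> x0; move/cvgrPdist_lt : (dec) => /(_ _ x0); apply: filterS => n.
  by rewrite sub0r normrN (gtr0_norm (de0 n)).
have evd : \forall n \near \oo, cabs (cintegral `]0, T[ (fun s => ((hat t1 t2 (de n) s)%:C)%C * k s) - cintegral `]t1, t2] k) < e / 3.
  move/cvgrPdist_lt : dct => /(_ _ e3); apply: filterS => n.
  by rewrite sub0r normrN ger0_norm ?cabs_ge0.
have [n [[n1 n2] n3]] : exists n, (de n < r1 / 2 /\ de n < r2 / 2) /\
    cabs (cintegral `]0, T[ (fun s => ((hat t1 t2 (de n) s)%:C)%C * k s) - cintegral `]t1, t2] k) < e / 3.
  have q1 : 0 < r1 / 2 by rewrite divr_gt0.
  have q2 : 0 < r2 / 2 by rewrite divr_gt0.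
  have [n hn] := filter_ex (filterI (filterI (ev _ q1) (ev _ q2)) evd).
  by exists n.
have w1 t' : `|t' - t1| <= 2 * de n -> cabs (m t' - m t1) <= e / 3 by move=> h; apply: h1; lra.
have w2 t' : `|t' - t2| <= 2 * de n -> cabs (m t' - m t2) <= e / 3 by move=> h; apply: h2; lra.
have [_ a1] := bumpr_avg (de0 n) cm w1; have [_ a2] := bumpr_avg (de0 n) cm w2.
move: (W n) a1 a2 n3; set A1 := cintegral setT _; set A2 := cintegral setT _; set B := cintegral _ _; set L := cintegral _ k.
move=> WE a1 a2 n3.
have -> : m t2 - m t1 - L = - (A2 - m t2) + (A1 - m t1) + (B - L).
  have -> : B = A2 - A1 by apply/eqP; rewrite -subr_eq0 -WE; apply/eqP; ring.
  ring.
rewrite (le_trans (cabsD _ _))// (_ : e = e / 3 + e / 3 + e / 3); last by field.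
by apply: lerD (ltW n3); rewrite (le_trans (cabsD _ _))// cabsN lerD.
Qed.

(** The increment form of the statement that k is the derivative of m. The comparison value ka is
    arbitrary, which allows m and k to belong to an approximate test function and ka to the exact
    one. *)
Lemma weak_bound t1 t2 (ka : R[i]) (eta : R) : 0 < t1 -> t1 <= t2 -> t2 < T ->
  (forall s, t1 < s <= t2 -> cabs (k s - ka) <= eta) ->
  cabs (m t2 - m t1 - ((t2 - t1)%:C)%C * ka) <= eta * (t2 - t1).
Proof.
move=> t10 t12 t2T h; rewrite weak_ftc//.
have mD : measurable (`]t1, t2] : set R) by exact: measurable_itv.
have len : fine (mu (`]t1, t2] : set R)) = t2 - t1.
  rewrite lebesgue_measure_itv/= lte_fin; case: ltP => // h'.
  by have -> : t2 = t1 by [apply/eqP; rewrite eq_le h' t12]; rewrite subrr.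
have ic c : mu.-integrable `]t1, t2] (EFin \o (fun _ : R => c)).
  apply: (@measurable_bounded_integrable _ _ _ mu) => //.
  - have : (lebesgue_measure (`]t1, t2] : set R) < +oo)%E by rewrite lebesgue_measure_itv/=; case: ifP => // _; exact: ltry.
    by [].
  - by exists `|c|; split; [exact: num_real|move=> x hx y _; exact: ltW].
have ck' : cintegrable `]t1, t2] k by apply: (cintegrable_dom mD (ccont_cmeas ck) (fun x _ => kM x) (ic M)).
have cka : cintegrable `]t1, t2] (fun=> ka) by split; exact: ic.
have -> : ((t2 - t1)%:C)%C * ka = cintegral `]t1, t2] (fun=> ka).
  rewrite /cintegral !Rintegral_cst// len.
  by apply: cplxP; rewrite !CE/= mul0r ?subr0 ?addr0 mulrC.
rewrite -(cintegralB mD ck' cka).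
apply: (@le_trans _ _ (\int[mu]_(x in `]t1, t2]) eta)); last by rewrite Rintegral_cst// len.
apply: (cabs_cintegral_le mD _ _ (ic eta)); last by move=> x; rewrite /= in_itv/=; exact: h.
by apply: cmeasB; [exact: ccont_cmeas|exact: cmeas_cst].
Qed.
End DuBoisReymond.
End Step.

(** * Approximation of Schwartz functions with compact support *)

Section Approx.
Variables (R : realType) (sigma0 : R -> R[i]).
Hypothesis adm : admissible_partition sigma0.
Notation D := (cderive (1 : R)).

Lemma cutoff_vanish N (x : R) : N%:R + 1 <= `|x| -> cutoff sigma0 N x = 0.
Proof.
move=> h; rewrite /cutoff big_seq big1// => k; rewrite mem_zint => kN.
have := @sigma_vanish _ _ adm 0 (x - k%:~R); apply.
have kR : `|k%:~R| <= N%:R :> R by rewrite -intr_norm -[N%:R]/((N%:Z)%:~R) ler_int.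
by have := lerB_normD x (- k%:~R); rewrite normrN; lra.
Qed.

(** The equation may be tested only with compact support, whereas heat kernels and free Gaussians
    have none. The cutoff error and its second derivative are O(1 / (N + 1)), also after
    multiplication by x^2, which gives the bound by e times [kap]. *)
Lemma compact_approx (phi : R -> R[i]) (e : R) : schwartz phi -> 0 < e ->
  exists psi N, [/\ schwartz psi, (forall x, ~~ (- N <= x <= N) -> psi x = 0),
    (forall x, cabs (psi x - phi x) <= e * kap x) &
    (forall x, cabs (D (D psi) x - D (D phi) x) <= e * kap x)].
Proof.
move=> sp e0; have esc := escaping_cutoff adm.
have [C0 C00 h0] := escaping_decay esc sp 0 0; have [C2 C20 h2] := escaping_decay esc sp 0 2.
have [B0 B00 k0] := escaping_decay esc sp 2 0; have [B2 B20 k2] := escaping_decay esc sp 2 2.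
pose S := C0 + C2 + B0 + B2.
have S0 : 0 <= S by rewrite /S !addr_ge0.
pose N := Num.truncn (S / e).
have hN : S / N.+1%:R <= e.
  by rewrite ler_pdivrMr// mulrC -ler_pdivrMr// ltW// truncnS_gt.
have le1 C : C <= S -> C / N.+1%:R <= S / N.+1%:R by move=> h; rewrite ler_wpM2r// invr_ge0.
pose eta x := phi x * (cutoff sigma0 N x - 1).
have seta : schwartz eta by exact: schwartzM sp (escaping_slow N esc).
pose psi x := phi x * cutoff sigma0 N x.
have E : psi = fun x => eta x + phi x by apply/funext => x; rewrite /psi /eta; ring.
have kb (z : R[i]) x A B : A + B <= S -> cabs z <= A / N.+1%:R -> `|x| ^+ 2 * cabs z <= B / N.+1%:R -> cabs z <= e * kap x.
  move=> AB hA hB; rewrite /kap ler_pdivlMr; last by rewrite ltr_wpDr// sqr_ge0.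
  apply: le_trans hN; apply: le_trans (le1 _ AB); rewrite mulrDr mulr1 mulrDl; apply: lerD => //.
  by rewrite mulrC -(real_normK (num_real x)).
exists psi, (N%:R + 1); split.
- by rewrite E; exact: schwartzD.
- move=> x h; rewrite /psi cutoff_vanish ?mulr0// leNgt; apply: contraNN h => h.
  by rewrite -ler_norml ltW.
- move=> x; rewrite E addrK; apply: (kb _ _ C0 C2); rewrite /S; first lra.
    by have := h0 N x; rewrite expr0 mul1r.
  exact: h2.
- have E2 : D (D psi) = fun x => D (D eta) x + D (D phi) x.
    by rewrite E; exact: (iterD_add 2 (schwartz_csmooth seta) (schwartz_csmooth sp)).
  move=> x; rewrite E2 addrK; apply: (kb _ _ B0 B2); rewrite /S; first lra.
    by have := k0 N x; rewrite expr0 mul1r.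
  exact: k2.
Qed.
End Approx.

(** * Differentiability of the pairings of a solution *)

Section Solution.
Variables (R : realType) (sigma0 : R -> R[i]).
Hypothesis adm : admissible_partition sigma0.
Variables s p q : R.
Hypothesis p13 : 1 <= p <= 3.
Hypothesis q1 : 1 <= q.
Hypothesis sm : summing s q.
Notation mu := (@lebesgue_measure R).
Notation D := (cderive (1 : R)).
Variables (b : bool) (T : R) (u0 : dist R) (u : R -> dist R).
Hypothesis T0 : 0 < T.
Hypothesis hu : Cmod sigma0 s p q T u.
Hypothesis hn : nls_solution b T u0 u.

Let U := density T u.
Let mU t : lcmeas (U t). Proof. exact: (path_meas adm p13 q1 sm T0 hu). Qed.
Let cU := path_cont adm p13 q1 sm T0 hu.
Let c : R[i] := (-1) ^+ b.
Let c1 : cabs c = 1. Proof. by rewrite cabsX cabsN cabs1 expr1n. Qed.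

Lemma path_pair t phi : 0 <= t <= T -> schwartz phi -> u t phi = pr (U t) phi.
Proof. by move=> ht sp; have [[_ h] _] := path_rep adm p13 q1 sm T0 hu t; have := h _ sp; rewrite clamp_id. Qed.

Let n3 t x := cube (U t x).
Let mn t : lcmeas (n3 t). Proof. exact: lcmeas_cube. Qed.

Lemma int1_n3 t : int1 (n3 t) = int3 (U t).
Proof. by apply: eq_integral => x _; rewrite cabs_cube. Qed.

Lemma frac_le (C Q e : R) : 0 <= C -> 0 < Q -> 0 <= e -> C * (Q * (e / ((C + 1) * Q))) <= e.
Proof.
move=> C0 Q0 e0; have C1 : 0 < C + 1 by rewrite ltr_wpDl.
have -> : C * (Q * (e / ((C + 1) * Q))) = e * (C / (C + 1)) by field; rewrite !gt_eqF.
by rewrite ler_piMr// ler_pdivrMr// mul1r lerDl.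
Qed.

Section Bounds.
Variables (Y : R).
Hypothesis Y0 : 0 <= Y.
Hypothesis hY : forall t, (int3 (U t) <= Y%:E)%E.

Let G := 1 + Y.
Let G0 : 0 <= G. Proof. by rewrite addr_ge0. Qed.
Let hG t : (int3 (U t) <= (G ^+ 3)%:E)%E.
Proof.
apply: (le_trans (hY t)); rewrite lee_fin (@le_trans _ _ G) ?lerDr//.
by rewrite -[leLHS]expr1 ler_weXn2l// lerDl.
Qed.

Let h1 t : (int1 (n3 t) <= Y%:E)%E. Proof. by rewrite int1_n3. Qed.

(** One constant for two kinds of pairing: that of [U t], bounded through L^3, and that of its cubic
    term, bounded through L^1. *)
Definition pair_const := (pi + 1) * G + Y.
Lemma pair_const_ge0 : 0 <= pair_const.
Proof. by rewrite /pair_const addr_ge0// mulr_ge0// addr_ge0// pi_ge0. Qed.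

Lemma pr_small t chi e : 0 <= e -> lcmeas chi -> (forall x, cabs (chi x) <= e * kap x) -> cabs (pr (U t) chi) <= e * pair_const.
Proof.
move=> e0 mc h; rewrite (le_trans (pr_le e0 G0 mc (kap0 h) (mU t) (hG t)))// /pair_const [leRHS]mulrDr mulrA lerDl.
exact: mulr_ge0.
Qed.

Lemma pr_small3 t chi e : 0 <= e -> lcmeas chi -> (forall x, cabs (chi x) <= e * kap x) -> cabs (pr (n3 t) chi) <= e * pair_const.
Proof.
move=> e0 mc h; have h' x : cabs (chi x) <= e by rewrite (le_trans (h x))// ler_piMr// kap_le1.
by rewrite (le_trans (pr1_le mc h' (mn t) (h1 t)))// ler_wpM2l// /pair_const lerDr mulr_ge0// addr_ge0// pi_ge0.
Qed.

Lemma pr_path_int t phi : schwartz phi -> cintegrable setT (fun x => U t x * phi x).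
Proof. by move=> sp; have [C C0 hC] := schwartz_kap sp; exact: (pr_int C0 (schwartz_cmeas sp) (kap0 hC) (mU t) (hG t)). Qed.

Lemma pr_path_cont phi t : schwartz phi -> ccont (fun t => pr (U t) phi) t.
Proof.
move=> sp e e0; have [C C0 hC] := schwartz_kap sp; have mp := schwartz_cmeas sp.
have C1 : 0 < (C + 1) * (pi + 1) by rewrite mulr_gt0 ?ltr_wpDl ?pi_ge0.
have [d d0 hd] := cU t (divr_gt0 e0 C1); exists d => // t' /hd k.
rewrite (prB (pr_path_int t' sp) (pr_path_int t sp)).
have e' : 0 <= e / ((C + 1) * (pi + 1)) by rewrite divr_ge0// ltW.
rewrite (le_trans (pr_le C0 e' mp (kap0 hC) (cmeasB (mU t') (mU t)) k))//.
have p1 : 0 < pi + 1 :> R by rewrite ltr_wpDl ?pi_ge0.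
by rewrite -mulrA; exact: frac_le C0 p1 (ltW e0).
Qed.

Lemma n3_int t phi : schwartz phi -> cintegrable setT (fun x => n3 t x * phi x).
Proof.
move=> sp; have [C C0 hC] := schwartz_kap sp.
have h' x : cabs (phi x) <= C by rewrite (le_trans (hC x))// ler_piMr// kap_le1.
exact: (pr1_int (schwartz_cmeas sp) h' (mn t) (h1 t)).
Qed.

Lemma pr_n3_cont phi t : schwartz phi -> ccont (fun t => pr (n3 t) phi) t.
Proof.
move=> sp e e0; have [C C0 hC] := schwartz_kap sp; have mp := schwartz_cmeas sp.
have h' x : cabs (phi x) <= C by rewrite (le_trans (hC x))// ler_piMr// kap_le1.
have C1 : 0 < (C + 1) * (4 * (Y + 1)) by rewrite !mulr_gt0 ?ltr_wpDl.
have [d d0 hd] := cU t (divr_gt0 e0 C1); exists d => // t' /hd k.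
rewrite (prB (n3_int t' sp) (n3_int t sp)).
have e' : 0 <= e / ((C + 1) * (4 * (Y + 1))) by rewrite divr_ge0// ltW.
have k1 := int1_cube (mU t') (mU t) (hY t') (hY t) e' k.
rewrite (le_trans (pr1_le mp h' (cmeasB (mn t') (mn t)) k1))//.
have p4 : 0 < 4 * (Y + 1) by rewrite mulr_gt0// ltr_wpDl.
exact: frac_le C0 p4 (ltW e0).
Qed.

(** The time derivative of the pairing with phi that the equation prescribes once it is solved for
    u_t. *)
Definition rhs phi t := (0 +i* 1)%C * (- pr (U t) (D (D phi)) + c * pr (n3 t) phi).

Lemma ccontN m t : ccont m t -> ccont (fun t => - m t : R[i]) t.
Proof. by move=> h e e0; have [d d0 hd] := h e e0; exists d => // t' /hd; rewrite -opprD cabsN. Qed.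
Lemma ccontD m m' t : ccont m t -> ccont m' t -> ccont (fun t => m t + m' t : R[i]) t.
Proof.
move=> h h' e e0; have e2 : 0 < e / 2 by rewrite divr_gt0.
have [d d0 hd] := h _ e2; have [d' d'0 hd'] := h' _ e2; exists (Num.min d d').
  by rewrite lt_min d0.
move=> t'; rewrite lt_min => /andP[/hd k /hd' k'].
by rewrite opprD addrACA (le_trans (cabsD _ _))// [leRHS]splitr lerD.
Qed.
Lemma ccontZ (z : R[i]) m t : cabs z = 1 -> ccont m t -> ccont (fun t => z * m t : R[i]) t.
Proof. by move=> z1 h e e0; have [d d0 hd] := h e e0; exists d => // t' /hd; rewrite -mulrBr cabsM z1 mul1r. Qed.

Lemma rhs_alg (z z' A A' B B' : R[i]) :
  z * (- A + z' * B) - z * (- A' + z' * B') = z * (- (A - A') + z' * (B - B')).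
Proof. ring. Qed.

Lemma cabs_tri (x y z : R[i]) : cabs (x - z) <= cabs (x - y) + cabs (y - z).
Proof. by rewrite -[x - z](subrKA y) cabsD. Qed.

Lemma rhs_cont phi t : schwartz phi -> ccont (rhs phi) t.
Proof.
move=> sp; apply: ccontZ; first exact: cabs_i.
apply: ccontD; first by apply: ccontN; apply: pr_path_cont; do 2 apply: schwartz_D.
by apply: ccontZ c1 _; exact: pr_n3_cont.
Qed.

Lemma pr_path_bound phi : schwartz phi -> exists2 M, 0 <= M & forall t, cabs (pr (U t) phi) <= M /\ cabs (pr (n3 t) phi) <= M.
Proof.
move=> sp; have [C C0 hC] := schwartz_kap sp; have mp := schwartz_cmeas sp.
exists (C * pair_const); first by rewrite mulr_ge0// pair_const_ge0.
by move=> t; split; [exact: pr_small|exact: pr_small3].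
Qed.

Lemma rhs_diff phi psi t e : 0 <= e -> schwartz phi -> schwartz psi ->
  (forall x, cabs (psi x - phi x) <= e * kap x) ->
  (forall x, cabs (D (D psi) x - D (D phi) x) <= e * kap x) ->
  cabs (rhs psi t - rhs phi t) <= 2 * (e * pair_const).
Proof.
move=> e0 sp sq k1 k2; have sp2 := schwartz_D (schwartz_D sp); have sq2 := schwartz_D (schwartz_D sq).
rewrite [rhs psi t - _](rhs_alg (0 +i* 1)%C c (pr (U t) (D (D psi))) (pr (U t) (D (D phi))) (pr (n3 t) psi) (pr (n3 t) phi)).
rewrite (prBr (pr_path_int t sq2) (pr_path_int t sp2)) (prBr (n3_int t sq) (n3_int t sp)).
rewrite cabsM cabs_i mul1r (le_trans (cabsD _ _))// cabsN cabsM c1 mul1r [leRHS](_ : _ = e * pair_const + e * pair_const); last by ring.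
apply: lerD; [apply: pr_small|apply: pr_small3] => //; apply: schwartz_cmeas; exact: schwartzB.
Qed.

(** The equation is tested with the product of th(t) and phi(x) and multiplied by i, which brings it
    to the form that [weak_ftc] expects. *)
Lemma weak_identity (th phi : R -> R[i]) a0 b0 N : schwartz th -> schwartz phi -> 0 < a0 -> b0 < T ->
  (forall t, ~~ (a0 <= t <= b0) -> th t = 0) -> (forall x, ~~ (- N <= x <= N) -> phi x = 0) ->
  cintegral `]0, T[ (fun t => D th t * pr (U t) phi) + cintegral `]0, T[ (fun t => th t * rhs phi t) = 0.
Proof.
move=> st sp a00 b0T ht hx; have test := test_tens st sp a00 b0T ht hx.
have sp1 := schwartz_D sp; have sp2 := schwartz_D sp1.
have [_ h] := hn; have := h _ test; rewrite (dx_tens st sp) (dx_tens st sp1).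
have prZ t z phi' : schwartz phi' -> pr (U t) (fun x => z * phi' x) = z * pr (U t) phi'.
  move=> sp'; rewrite /pr -(cintegralZ z measurableT (pr_path_int t sp')).
  by apply: eq_cintegral => x _; ring.
have E1 : pairing T u (dt (tens th phi)) = cintegral `]0, T[ (fun t => D th t * pr (U t) phi).
  apply: eq_cintegral => t; rewrite inE/= in_itv/= => /andP[t0 tT].
  rewrite -(prZ t _ _ sp) -path_pair ?(ltW t0) ?(ltW tT)//; last exact: schwartzZ.
  by congr (u t); apply/funext => x; rewrite (dt_tens _ st sp).
have E2 : pairing T u (tens th (D (D phi))) = cintegral `]0, T[ (fun t => th t * pr (U t) (D (D phi))).
  apply: eq_cintegral => t; rewrite inE/= in_itv/= => /andP[t0 tT].
  by rewrite -(prZ t _ _ sp2) -path_pair ?(ltW t0) ?(ltW tT)//; exact: schwartzZ.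
have E3 : pairing T (fun t => cubic (u t)) (tens th phi) = cintegral `]0, T[ (fun t => th t * pr (n3 t) phi).
  apply: eq_cintegral => t; rewrite inE/= in_itv/= => /andP[t0 tT].
  rewrite /pr -(cintegralZ (th t) measurableT (n3_int t sp)); apply: eq_cintegral => x _.
  by rewrite /n3 /U /density clamp_id ?(ltW t0) ?(ltW tT)// /tens /= /cube; ring.
rewrite E1 E2 E3 => {}h.
have mD : measurable (`]0, T[ : set R) by exact: measurable_itv.
have [CT CT0 hCT] := schwartz_kap st.
have ic z : mu.-integrable `]0, T[ (EFin \o (fun _ : R => z)).
  apply: (@measurable_bounded_integrable _ _ _ mu) => //.
  - have : (lebesgue_measure (`]0%R, T[ : set R) < +oo)%E by rewrite lebesgue_measure_itv/=; case: ifP => // _; exact: ltry.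
    by [].
  - by exists `|z|; split; [exact: num_real|move=> x hx' y _; exact: ltW].
have ib (m : R -> R[i]) M : (forall t, ccont m t) -> 0 <= M -> (forall t, cabs (m t) <= M) -> cintegrable `]0, T[ (fun t => th t * m t).
  move=> cm M0 hM; apply: (@cintegrable_dom R _ _ (fun=> CT * M) mD _ _ (ic _)).
    by apply: cmeasM; [exact: schwartz_cmeas|exact: ccont_cmeas].
  move=> t _; rewrite cabsM; apply: ler_pM; rewrite ?cabs_ge0//.
  by rewrite (le_trans (hCT t))// ler_piMr// kap_le1.
have [M1 M10 hM1] := pr_path_bound sp; have [M2 M20 hM2] := pr_path_bound sp2.
have i2 := ib _ _ (fun t => pr_path_cont t sp2) M20 (fun t => proj1 (hM2 t)).
have i3 := ib _ _ (fun t => pr_n3_cont t sp) M10 (fun t => proj2 (hM1 t)).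
have -> : cintegral `]0, T[ (fun t => th t * rhs phi t) =
    (0 +i* 1)%C * (- cintegral `]0, T[ (fun t => th t * pr (U t) (D (D phi))) + c * cintegral `]0, T[ (fun t => th t * pr (n3 t) phi)).
  rewrite -(cintegralZ c mD i3) -[- cintegral _ _]mulN1r -(cintegralZ (-1) mD i2).
  rewrite -(cintegralD mD (cintegrableZ (-1) mD i2) (cintegrableZ c mD i3)).
  rewrite -(cintegralZ _ mD (cintegrableD mD (cintegrableZ (-1) mD i2) (cintegrableZ c mD i3))).
  by apply: eq_cintegral => t _; rewrite /rhs; ring.
move: h; rewrite -/c; move: (cintegral _ _) (cintegral _ _) (cintegral _ _) => C B A h.
(* The left side is i times the tested equation, up to a multiple of 1 + i^2. *)
have -> : A + (0 +i* 1)%C * (- B + c * C) = (0 +i* 1)%C * (- ((0 +i* 1)%C * A) - B + c * C) + (1 + (0 +i* 1)%C * (0 +i* 1)%C) * A by ring.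
rewrite h mulr0 add0r; have -> : 1 + (0 +i* 1)%C * (0 +i* 1)%C = 0 :> R[i] by apply: cplxP; rewrite !CE/=; ring.
by rewrite mul0r.
Qed.

(** Stated as an estimate because estimates survive approximation: replacing phi by a compactly
    supported psi changes the pairings and [rhs] by at most a multiple of z, which is chosen so
    small that the total error stays below e. *)
Lemma path_incr phi t1 t2 ka eta : schwartz phi -> 0 < t1 -> t1 <= t2 -> t2 < T ->
  (forall r, t1 < r <= t2 -> cabs (rhs phi r - ka) <= eta) ->
  cabs (pr (U t2) phi - pr (U t1) phi - ((t2 - t1)%:C)%C * ka) <= eta * (t2 - t1).
Proof.
move=> sp t10 t12 t2T hk; apply/ler_addgt0Pr => e e0.
have K0 := pair_const_ge0; have t210 : 0 <= t2 - t1 by rewrite subr_ge0.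
have q0 : 0 < 2 * (pair_const + 1) * (t2 - t1 + 1) by rewrite !mulr_gt0 ?ltr_wpDl.
pose z := e / (2 * (pair_const + 1) * (t2 - t1 + 1)); have z0 : 0 < z by rewrite divr_gt0.
have [psi [N [sq hN k1 k2]]] := compact_approx adm sp z0.
have [M1 M10 hM1] := pr_path_bound sq; have [M2 M20 hM2] := pr_path_bound (schwartz_D (schwartz_D sq)).
have mM t : cabs (pr (U t) psi) <= M1 + M2 by rewrite (le_trans (proj1 (hM1 t)))// lerDl.
have kM t : cabs (rhs psi t) <= M1 + M2.
  rewrite /rhs cabsM cabs_i mul1r (le_trans (cabsD _ _))// cabsN cabsM c1 mul1r addrC.
  by apply: lerD; [exact: (proj2 (hM1 t))|exact: (proj1 (hM2 t))].
have W (th : R -> R[i]) a0 b0 : schwartz th -> 0 < a0 -> b0 < T -> (forall t, ~~ (a0 <= t <= b0) -> th t = 0) ->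
  cintegral `]0, T[ (fun t => D th t * pr (U t) psi) + cintegral `]0, T[ (fun t => th t * rhs psi t) = 0.
  by move=> st h3 h4 h5; apply: (weak_identity st sq h3 h4 h5 hN).
have hk' r : t1 < r <= t2 -> cabs (rhs psi r - ka) <= eta + 2 * (z * pair_const).
  move=> hr; apply: (le_trans (cabs_tri _ (rhs phi r) _)); rewrite addrC.
  by apply: lerD; [exact: hk|apply: rhs_diff => //; exact: ltW].
have := weak_bound adm (fun t => pr_path_cont t sq) (fun t => rhs_cont t sq) mM kM W t10 t12 t2T hk'.
have df t : cabs (pr (U t) psi - pr (U t) phi) <= z * pair_const.
  rewrite (prBr (pr_path_int t sq) (pr_path_int t sp)); apply: pr_small => //; first exact: ltW.
  by apply: schwartz_cmeas; exact: schwartzB.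
move: (df t1) (df t2); move: (pr (U t1) psi) (pr (U t1) phi) (pr (U t2) psi) (pr (U t2) phi) => a a' b' b'' d1 d2 h.
rewrite (_ : b'' - a' - _ = (b' - a - ((t2 - t1)%:C)%C * ka) + ((a - a') - (b' - b''))); last by ring.
rewrite (le_trans (cabsD _ _))// (le_trans (lerD h (le_trans (cabsB _ _) (lerD d1 d2))))//.
rewrite mulrDl -addrA lerD2l.
have -> : 2 * (z * pair_const) * (t2 - t1) + (z * pair_const + z * pair_const) = z * (2 * pair_const * (t2 - t1 + 1)) by ring.
rewrite /z mulrAC ler_pdivrMr//; apply: (ler_wpM2l (ltW e0)).
by apply: ler_wpM2r; [rewrite addr_ge0|rewrite ler_wpM2l// lerDl].
Qed.

(** Continuity of [rhs phi] at t turns the increment estimate into o(|t' - t|). For t' before t the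
    increment is taken from t' to t, still compared with the value at t. *)
Lemma path_cder phi t : schwartz phi -> 0 < t < T -> cder (fun t => pr (U t) phi) t (rhs phi t).
Proof.
move=> sp /andP[t0 tT].
suff k : cder (fun r => pr (U r) phi - pr (U t) phi - ((r - t)%:C)%C * rhs phi t) t 0.
  have hl : is_derive t (1 : R) (fun r => r - t) 1.
    apply: (is_derive_ext (is_derive_aff 1 (- t) t)) => //.
    by apply/funext => z; rewrite mul1r.
  have k2 := cderD (cderD k (cderM (cder_real hl) (cder_cst (rhs phi t) t))) (cder_cst (pr (U t) phi) t).
  apply: (cder_ext k2); first by apply/funext => r; ring.
  by rewrite subrr mulr0 add0r !addr0 mul1r.
apply: cder_o => e e0; have [d d0 hd] := rhs_cont t sp e0.
pose d' := Num.min d (Num.min t (T - t)).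
exists d'; first by rewrite /d' !lt_min d0 t0 subr_gt0.
move=> t'; rewrite /d' !lt_min => /andP[td /andP[tt tT']].
have [h|h] := leP t t'.
  rewrite ger0_norm ?subr_ge0//; apply: path_incr => //.
    by move: tT'; rewrite ger0_norm ?subr_ge0//; lra.
  move=> r /andP[h3 h4]; apply: hd; apply: le_lt_trans td.
  by rewrite !ger0_norm ?subr_ge0 ?(ltW h3)// lerD2r.
have -> : cabs (pr (U t') phi - pr (U t) phi - ((t' - t)%:C)%C * rhs phi t) =
    cabs (pr (U t) phi - pr (U t') phi - ((t - t')%:C)%C * rhs phi t).
  rewrite -cabsN; congr cabs.
  have -> : ((t - t')%:C)%C = - ((t' - t)%:C)%C :> R[i] by apply: cplxP; rewrite !CE/=; ring.
  ring.
rewrite ler0_norm ?subr_le0 ?(ltW h)// opprB; apply: path_incr => //.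
- by move: tt; rewrite ler0_norm ?subr_le0 ?(ltW h)//; lra.
- exact: ltW.
- move=> r /andP[h3 h4]; apply: hd; apply: le_lt_trans td.
  by rewrite !ler0_norm ?subr_le0 ?(ltW h)//; lra.
Qed.
End Bounds.
End Solution.

(** * Uniqueness in the modulation space *)

Section Uniqueness.
Variables (R : realType) (sigma0 : R -> R[i]).
Hypothesis adm : admissible_partition sigma0.
Variables s p q : R.
Hypothesis p13 : 1 <= p <= 3.
Hypothesis q1 : 1 <= q.
Hypothesis sm : summing s q.
Notation D := (cderive (1 : R)).

(** By linearity of the pairings, the difference g of the densities evolves with source the
    difference F of the cubes, and [int1_cube] with the common bound Y supplies the estimate of F by
    g on which [evolution_zero] rests. *)
Lemma solution_unique (b : bool) (T : R) (u0 : dist R) (u v : R -> dist R) : 0 < T ->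
  Cmod sigma0 s p q T u -> nls_solution b T u0 u -> Cmod sigma0 s p q T v -> nls_solution b T u0 v ->
  forall t, 0 <= t <= T -> dist_eq (v t) (u t).
Proof.
move=> T0 hu nu hv nv.
pose U := density T u; pose V := density T v.
have mU t : lcmeas (U t) := path_meas adm p13 q1 sm T0 hu t.
have mV t : lcmeas (V t) := path_meas adm p13 q1 sm T0 hv t.
have [Yu Yu0 hYu] := path_bound adm p13 q1 sm T0 hu.
have [Yv Yv0 hYv] := path_bound adm p13 q1 sm T0 hv.
pose Y := Yu + Yv; have Y0 : 0 <= Y by rewrite addr_ge0.
have hU t : (int3 (U t) <= Y%:E)%E by rewrite (le_trans (hYu t))// lee_fin lerDl.
have hV t : (int3 (V t) <= Y%:E)%E by rewrite (le_trans (hYv t))// lee_fin lerDr.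
pose g t x := U t x - V t x; pose F t x := cube (U t x) - cube (V t x).
have mg t : lcmeas (g t) by exact: cmeasB.
have mF t : lcmeas (F t) by apply: cmeasB; exact: lcmeas_cube.
(* [int3B] gives 4 (Y + Y) = 8 Y, and 1 + 8 Y, being at least 1, is at most its own cube. *)
pose G := 1 + 8 * Y; have Y8 : 0 <= 8 * Y by rewrite mulr_ge0.
have G0 : 0 <= G by rewrite addr_ge0.
have hG t : (int3 (g t) <= (G ^+ 3)%:E)%E.
  apply: (le_trans (int3B (mU t) (mV t) (hU t) (hV t))); rewrite lee_fin (@le_trans _ _ G)//.
    by rewrite /G; lra.
  by rewrite -[leLHS]expr1 ler_weXn2l// lerDl.
have cg t e : 0 < e -> exists2 d, 0 < d & forall t', `|t' - t| < d ->
    (int3 (fun x => (g t' x - g t x)%R) <= (e ^+ 3)%:E)%E.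
  (* Halving e is enough, because 4 ((e / 2)^3 + (e / 2)^3) = e^3. *)
  move=> e0; have e2 : 0 < e / 2 by rewrite divr_gt0.
  have [d d0 hd] := path_cont adm p13 q1 sm T0 hu t e2; have [d' d'0 hd'] := path_cont adm p13 q1 sm T0 hv t e2.
  exists (Num.min d d'); first by rewrite lt_min d0.
  move=> t'; rewrite lt_min => /andP[/hd k /hd' k'].
  have := int3B (cmeasB (mU t') (mU t)) (cmeasB (mV t') (mV t)) k k'.
  rewrite (_ : 4 * _ = e ^+ 3); last by field.
  by congr (_ <= _)%E; congr int3; apply/funext => x; rewrite /g; ring.
have c1 : cabs ((-1) ^+ b : R[i]) = 1 by rewrite cabsX cabsN cabs1 expr1n.
have dU := path_cder adm p13 q1 sm T0 hu nu Yu0 hYu; have dV := path_cder adm p13 q1 sm T0 hv nv Yv0 hYv.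
have iU := pr_path_int adm p13 q1 sm T0 hu Yu0 hYu; have iV := pr_path_int adm p13 q1 sm T0 hv Yv0 hYv.
have jU := n3_int adm p13 q1 sm T0 hu hYu; have jV := n3_int adm p13 q1 sm T0 hv hYv.
have Hd phi : schwartz phi -> forall t, 0 < t < T ->
    cder (fun r => pr (g r) phi) t ((0 +i* 1)%C * (- pr (g t) (D (D phi)) + (-1) ^+ b * pr (F t) phi)).
  move=> sp t ht; have k := cderD (dU phi t sp ht) (cderN (dV phi t sp ht)).
  apply: (cder_ext k).
    by apply/funext => r; rewrite (prB (iU r _ sp) (iV r _ sp)).
  have sp2 := schwartz_D (schwartz_D sp).
  rewrite -(prB (iU t _ sp2) (iV t _ sp2)) -(prB (jU t _ sp) (jV t _ sp)); exact: rhs_alg.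
have p4 : 0 <= 4 * (Y + 1) by rewrite mulr_ge0// addr_ge0.
have hF t (y : R) : 0 <= y -> (int3 (g t) <= (y ^+ 3)%:E)%E -> (int1 (F t) <= (4 * (Y + 1) * y)%:E)%E.
  by move=> y0; exact: int1_cube.
have pU := path_pair adm p13 q1 sm T0 hu; have pV := path_pair adm p13 q1 sm T0 hv.
have init phi : schwartz phi -> pr (g 0) phi = 0.
  move=> sp; have t0 : 0 <= (0 : R) <= T by rewrite lexx ltW.
  rewrite -(prB (iU 0 _ sp) (iV 0 _ sp)) -(pU _ _ t0 sp) -(pV _ _ t0 sp).
  by rewrite (proj1 nu _ sp) (proj1 nv _ sp) subrr.
move=> t ht phi sp.
have z := pr_null (mg t) (evolution_zero adm mg G0 hG cg mF c1 Hd p4 hF (ltW T0) init ht) sp.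
rewrite (pU _ _ ht sp) (pV _ _ ht sp); apply/eqP; rewrite eq_sym -subr_eq0; apply/eqP.
by rewrite (prB (iU t _ sp) (iV t _ sp)).
Qed.
End Uniqueness.

Theorem theorem6 (R : realType) (sigma0 : R -> R[i]) (b : bool)
    (s p q T : R) (u0 : dist R) (u : R -> dist R) :
  admissible_partition sigma0 ->
  [\/ [/\ 0 <= s, 2 <= p <= 3 & 1 <= q <= 3 / 2],
      [/\ 2 / 3 - q^-1 < s, 2 <= p <= 3 & 3 / 2 < q <= 18 / 11] |
      [/\ 2 / 3 - q^-1 < s,
          2 <= p < 10 * conj_exp q / (conj_exp q + 6) & 18 / 11 < q <= 2]] ->
  0 < T ->
  modulation sigma0 s p q u0 ->
  constructed_solution sigma0 b s p q T u0 u ->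
  forall v : R -> dist R,
    Cmod sigma0 s p q T v ->
    nls_solution b T u0 v ->
    forall t, t \in `[0, T] -> dist_eq (v t) (u t).
Proof.
move=> adm /exponents[p13 q1 sm] T0 _ [hu nu _] v hv nv t; rewrite in_itv/=.
exact: (solution_unique adm p13 q1 sm T0 hu nu hv nv).
Qed.
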